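(* Let $\mathcal A$ be a unital $C^*$-algebra, $k\in\mathcal A$ positive and invertible, $\rho\in\mathcal A$, and let $a,b,m$ be positive integers. Put $d_m=a+b-2+(m-2)/2$ and let $\mathbf y(\rho)=k^{-1}\rho k$. Let $C$ be the imaginary axis oriented from $-i\infty$ to $i\infty$. Then $$\int_0^\infty \Big(\frac{1}{2\pi i}\int_C e^{-\lambda}(kr^2-\lambda)^{-a}\,\rho\,(kr^2-\lambda)^{-b}\,d\lambda\Big) r^{2d_m+1}\,dr = k^{-(d_m+1)}\Big[\frac{\Gamma(d_m+1)}{2\,\Gamma(a+b)}\;{}_2F_1\big(d_m+1,b;a+b;1-\mathbf y\big)\Big](\rho).$$
   Context: ${}_2F_1(\alpha,\beta;\gamma;z)$ is the Gauss hypergeometric function; for $\gamma>\beta>0$ and $z\in\mathbb C\setminus[1,\infty)$, $${}_2F_1(\alpha,\beta;\gamma;z)=\frac{\Gamma(\gamma)}{\Gamma(\beta)\Gamma(\gamma-\beta)}\int_0^1(1-t)^{\gamma-\beta-1}t^{\beta-1}(1-zt)^{-\alpha}dt.$$ The modular operator $\mathbf y:\mathcal A\to\mathcal A$, $\mathbf y(\rho)=k^{-1}\rho k$, is a bounded operator with spectrum in $(0,\infty)$, and $f(\mathbf y)$ for $f(y)={}_2F_1(\cdot,\cdot;\cdot;1-y)$ (holomorphic on $\mathbb C\setminus(-\infty,0]$) is defined by holomorphic functional calculus. *)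

(* Defs.v *)
From Stdlib Require Import Reals Lra List.
From Stdlib Require Import FunctionalExtensionality ProofIrrelevance.
From Stdlib Require Import PropExtensionality ClassicalEpsilon.
From Coquelicot Require Import Coquelicot.
Import ListNotations.

Open Scope R_scope.

(** Coquelicot integrates functions from [R] into an [R]-normed module, whereas
    the spaces below are [C]-normed modules. [realify V] has the same carrier,
    addition, norm and uniform structure as [V]. *)

Section Realify.

Context (V : CompleteNormedModule C_AbsRing).

Definition realify_scal (r : R) (x : V) : V := scal (RtoC r : C_AbsRing) x.

Lemma realify_scal_ax1 (x y : R_Ring) (u : V) :
  realify_scal x (realify_scal y u) = realify_scal (mult x y) u.
Proof.
unfold realify_scal.
etransitivity; [exact (scal_assoc (K := C_Ring) (RtoC x) (RtoC y) u) |].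
f_equal; symmetry; exact (RtoC_mult x y).
Qed.

Lemma realify_scal_ax2 (u : V) : realify_scal (one : R_Ring) u = u.
Proof. exact (scal_one (K := C_Ring) u). Qed.

Lemma realify_scal_ax3 (x : R_Ring) (u v : V) :
  realify_scal x (plus u v) = plus (realify_scal x u) (realify_scal x v).
Proof. exact (scal_distr_l (K := C_Ring) _ u v). Qed.

Lemma realify_scal_ax4 (x y : R_Ring) (u : V) :
  realify_scal (plus x y) u = plus (realify_scal x u) (realify_scal y u).
Proof.
unfold realify_scal.
etransitivity; [| exact (scal_distr_r (K := C_Ring) (RtoC x) (RtoC y) u)].
f_equal; exact (RtoC_plus x y).
Qed.

Definition realify_ModuleSpace_mixin :=
  ModuleSpace.Mixin R_Ring V realify_scal
    realify_scal_ax1 realify_scal_ax2 realify_scal_ax3 realify_scal_ax4.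

Definition realify_NormedModuleAux : NormedModuleAux R_AbsRing :=
  NormedModuleAux.Pack R_AbsRing V
    (NormedModuleAux.Class R_AbsRing V
      (ModuleSpace.Class R_Ring V (AbelianGroup.class V)
         realify_ModuleSpace_mixin)
      (UniformSpace.class V)) V.

Lemma realify_norm_ax2 (l : R_AbsRing) (x : realify_NormedModuleAux) :
  norm (V := V) (scal l x) <= abs l * norm (V := V) x.
Proof.
change (abs l) with (Rabs l); rewrite <- Cmod_R.
exact (norm_scal (K := C_AbsRing) (V := V) (RtoC l) x).
Qed.

Definition realify_NormedModule_mixin :=
  NormedModule.Mixin R_AbsRing realify_NormedModuleAux
    (norm (V := V)) (norm_factor (V := V))
    (norm_triangle (V := V)) realify_norm_ax2
    (norm_compat1 (V := V)) (norm_compat2 (V := V)) (norm_eq_zero (V := V)).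

Definition realify : CompleteNormedModule R_AbsRing :=
  CompleteNormedModule.Pack R_AbsRing V
    (CompleteNormedModule.Class R_AbsRing V
      (NormedModule.Class R_AbsRing V
         (NormedModuleAux.class R_AbsRing realify_NormedModuleAux)
         realify_NormedModule_mixin)
      (CompleteNormedModule.mixin _ _ (CompleteNormedModule.class _ V))) V.

End Realify.

Record BanachAlgebra : Type := {
  ba_space :> CompleteNormedModule C_AbsRing;
  amult : ba_space -> ba_space -> ba_space;
  aone : ba_space;
  amult_assoc : forall x y z, amult x (amult y z) = amult (amult x y) z;
  amult_one_l : forall x, amult aone x = x;
  amult_one_r : forall x, amult x aone = x;
  amult_plus_l : forall x y z,
    amult (plus x y) z = plus (amult x z) (amult y z);
  amult_plus_r : forall x y z,
    amult x (plus y z) = plus (amult x y) (amult x z);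
  amult_scal_l : forall (c : C) x y, amult (scal c x) y = scal c (amult x y);
  amult_scal_r : forall (c : C) x y, amult x (scal c y) = scal c (amult x y);
  amult_norm : forall x y, norm (amult x y) <= norm x * norm y
}.

Arguments amult {_} _ _.
Arguments aone {_}.

Record CStarAlgebra : Type := {
  cs_algebra :> BanachAlgebra;
  star : cs_algebra -> cs_algebra;
  star_involutive : forall x, star (star x) = x;
  star_plus : forall x y, star (plus x y) = plus (star x) (star y);
  star_scal : forall (c : C) x, star (scal c x) = scal (Cconj c) (star x);
  star_mult : forall x y, star (amult x y) = amult (star y) (star x);
  star_norm : forall x, norm (amult (star x) x) = norm x * norm x
}.

Arguments star {_} _.

Section Algebra.

Context {B : BanachAlgebra}.

Definition inverse_of (x y : B) : Prop := amult x y = aone /\ amult y x = aone.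

Definition invertible (x : B) : Prop := exists y, inverse_of x y.

(** The inverse of [x] when [x] is invertible, unspecified otherwise. *)
Definition ainv (x : B) : B := iota (inverse_of x).

Fixpoint apow (x : B) (n : nat) : B :=
  match n with
  | O => aone
  | S n => amult x (apow x n)
  end.

Definition spectrum (x : B) (z : C) : Prop :=
  ~ invertible (minus (scal z aone) x).

End Algebra.

Definition cs_positive {A : CStarAlgebra} (x : A) : Prop :=
  star x = x /\ forall z, spectrum x z -> Im z = 0 /\ 0 <= Re z.

Section BoundedOperators.

Context (V : CompleteNormedModule C_AbsRing).

(** [is_linear] of Coquelicot includes boundedness. *)
Definition Bop : Type := {f : V -> V | is_linear f}.

Definition bop_fun (f : Bop) : V -> V := proj1_sig f.

Coercion bop_fun : Bop >-> Funclass.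

Definition opnorm (f : V -> V) : R :=
  real (Lub_Rbar (fun r => exists x : V, norm x <= 1 /\ r = norm (f x))).

Lemma Bop_ext (f g : Bop) : (forall x, f x = g x) -> f = g.
Proof.
destruct f as [f Hf], g as [g Hg]; simpl; intros H.
assert (E : f = g) by (apply functional_extensionality; exact H).
subst g; f_equal; apply proof_irrelevance.
Qed.

Lemma norm_scal_C (c : C) (x : V) : norm (scal c x) <= Cmod c * norm x.
Proof. exact (norm_scal (K := C_AbsRing) c x). Qed.

Lemma scal_assoc_C (c d : C) (x : V) : scal c (scal d x) = scal (Cmult c d) x.
Proof. exact (scal_assoc (K := C_Ring) c d x). Qed.

Lemma scal_opp_one_C (x : V) : scal (RtoC (-1) : C_AbsRing) x = opp x.
Proof.
etransitivity; [| exact (scal_opp_one (K := C_Ring) (V := V) x)].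
f_equal; apply injective_projections; simpl; unfold opp; simpl; ring.
Qed.

Lemma minus_trans_C (y x z : V) :
  minus x z = plus (minus x y) (minus y z).
Proof. exact (minus_trans (G := V) y x z). Qed.

Lemma opp_minus_C (x y : V) : opp (minus x y) = minus y x.
Proof. exact (opp_minus (G := V) x y). Qed.

Lemma plus_opp_r_C (x : V) : plus x (opp x) = zero.
Proof. exact (plus_opp_r (G := V) x). Qed.

Lemma plus_opp_l_C (x : V) : plus (opp x) x = zero.
Proof. exact (plus_opp_l (G := V) x). Qed.

Lemma opp_plus_C (x y : V) : opp (plus x y) = plus (opp x) (opp y).
Proof. exact (opp_plus (G := V) x y). Qed.

Lemma scal_minus_C (c : C) (x y : V) :
  scal c (minus x y) = minus (scal c x) (scal c y).
Proof. exact (scal_minus_distr_l (K := C_Ring) (V := V) c x y). Qed.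

Lemma norm_ge_0_C (x : V) : 0 <= norm x.
Proof. exact (norm_ge_0 x). Qed.

Lemma norm_triangle_C (x y : V) : norm (plus x y) <= norm x + norm y.
Proof. exact (norm_triangle x y). Qed.

Lemma norm_opp_C (x : V) : norm (opp x) = norm x.
Proof. exact (norm_opp x). Qed.

Lemma norm_eq_zero_C (x : V) : norm x = 0 -> x = zero.
Proof. exact (norm_eq_zero x). Qed.

Lemma norm_zero_C : norm (zero : V) = 0.
Proof. exact (norm_zero (V := V)). Qed.

Lemma linear_zero (f : Bop) : f zero = zero.
Proof.
destruct f as [f Hf]; simpl.
transitivity (f (scal (RtoC 0 : C_AbsRing) zero)).
- f_equal; symmetry; exact (scal_zero_l (K := C_Ring) (zero : V)).
- rewrite (linear_scal f Hf); exact (scal_zero_l (K := C_Ring) (f zero)).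
Qed.

Lemma opnorm_is_lub (f : Bop) :
  is_lub_Rbar (fun r => exists x : V, norm x <= 1 /\ r = norm (f x))
    (Finite (opnorm f)).
Proof.
unfold opnorm.
set (E := fun r => exists x : V, norm x <= 1 /\ r = norm (f x)).
assert (HL := Lub_Rbar_correct E).
destruct (linear_norm _ (proj2_sig f)) as [M [HM H]].
assert (H1 : Rbar_le (Lub_Rbar E) M).
{ apply HL; intros r [x [Hx ->]]; simpl.
  apply Rle_trans with (1 := H x).
  rewrite <- (Rmult_1_r M) at 2.
  apply Rmult_le_compat_l; [lra | exact Hx]. }
assert (H2 : Rbar_le 0 (Lub_Rbar E)).
{ apply HL; exists zero; split.
  - rewrite norm_zero_C; lra.
  - rewrite linear_zero, norm_zero_C; reflexivity. }
destruct (Lub_Rbar E) as [l | |]; simpl in *; [exact HL | easy | easy].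
Qed.

Lemma opnorm_ge_0 (f : Bop) : 0 <= opnorm f.
Proof.
destruct (opnorm_is_lub f) as [H _].
apply (H 0); exists zero; split.
- rewrite norm_zero_C; lra.
- rewrite linear_zero, norm_zero_C; reflexivity.
Qed.

Lemma opnorm_bound (f : Bop) (x : V) : norm (f x) <= opnorm f * norm x.
Proof.
destruct (Req_dec (norm x) 0) as [H0 | H0].
- rewrite H0, Rmult_0_r, (norm_eq_zero_C x H0), linear_zero; right.
  exact norm_zero_C.
- assert (Hp : 0 < norm x) by (generalize (norm_ge_0_C x); lra).
  set (u := scal (RtoC (/ norm x) : C_AbsRing) x : V).
  assert (Hu : norm u <= 1).
  { apply Rle_trans with (1 := norm_scal_C _ _).
    rewrite Cmod_R, Rabs_pos_eq by (left; apply Rinv_0_lt_compat, Hp).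
    rewrite Rinv_l; lra. }
  assert (Hfu : norm (f u) <= opnorm f).
  { apply (proj1 (opnorm_is_lub f)); exists u; split; [exact Hu | easy]. }
  assert (Hx : f x = scal (RtoC (norm x) : C_AbsRing) (f u)).
  { unfold u; unfold bop_fun.
    rewrite (linear_scal _ (proj2_sig f)), scal_assoc_C.
    rewrite <- RtoC_mult, Rinv_r by exact H0.
    symmetry; exact (scal_one (K := C_Ring) (proj1_sig f x)). }
  rewrite Hx.
  apply Rle_trans with (1 := norm_scal_C _ _).
  rewrite Cmod_R, Rabs_pos_eq by lra.
  rewrite Rmult_comm; apply Rmult_le_compat_r; lra.
Qed.

Lemma opnorm_le (f : Bop) (M : R) :
  0 <= M -> (forall x, norm (f x) <= M * norm x) -> opnorm f <= M.
Proof.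
intros HM H.
apply (proj2 (opnorm_is_lub f) (Finite M)).
intros r [x [Hx ->]]; simpl.
apply Rle_trans with (1 := H x).
rewrite <- (Rmult_1_r M) at 2; apply Rmult_le_compat_l; assumption.
Qed.

Lemma mk_linear (f : V -> V) (M : R) :
  (forall x y, f (plus x y) = plus (f x) (f y)) ->
  (forall (c : C) x, f (scal c x) = scal c (f x)) ->
  (forall x, norm (f x) <= M * norm x) -> is_linear f.
Proof.
intros H1 H2 H3; split; [exact H1 | exact H2 |].
exists (Rmax M 1); split.
- apply Rlt_le_trans with (2 := Rmax_r M 1); lra.
- intros x; apply Rle_trans with (1 := H3 x).
  apply Rmult_le_compat_r; [apply norm_ge_0_C | apply Rmax_l].
Qed.

Lemma bop_plus_linear (f g : Bop) : is_linear (fun x => plus (f x) (g x)).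
Proof.
apply (mk_linear _ (opnorm f + opnorm g)).
- intros x y; unfold bop_fun.
  rewrite (linear_plus _ (proj2_sig f)), (linear_plus _ (proj2_sig g)).
  rewrite <- !plus_assoc; f_equal.
  rewrite !plus_assoc; f_equal; apply plus_comm.
- intros c x; unfold bop_fun.
  rewrite (linear_scal _ (proj2_sig f)), (linear_scal _ (proj2_sig g)).
  symmetry; exact (scal_distr_l (K := C_Ring) c _ _).
- intros x; apply Rle_trans with (1 := norm_triangle_C _ _).
  rewrite Rmult_plus_distr_r.
  apply Rplus_le_compat; apply opnorm_bound.
Qed.

Lemma bop_scal_linear (c : C) (f : Bop) : is_linear (fun x => scal c (f x)).
Proof.
apply (mk_linear _ (Cmod c * opnorm f)).
- intros x y; unfold bop_fun; rewrite (linear_plus _ (proj2_sig f)).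
  exact (scal_distr_l (K := C_Ring) c _ _).
- intros d x; unfold bop_fun; rewrite (linear_scal _ (proj2_sig f)).
  rewrite !scal_assoc_C; f_equal; apply Cmult_comm.
- intros x; apply Rle_trans with (1 := norm_scal_C _ _).
  rewrite Rmult_assoc.
  apply Rmult_le_compat_l; [apply Cmod_ge_0 | apply opnorm_bound].
Qed.

Lemma bop_zero_linear : is_linear (fun _ : V => zero : V).
Proof.
apply (mk_linear _ 0).
- intros _ _; symmetry; apply plus_zero_l.
- intros c _; symmetry; exact (scal_zero_r (K := C_Ring) c).
- intros x; rewrite norm_zero_C; lra.
Qed.

Lemma bop_one_linear : is_linear (fun x : V => x).
Proof. apply (mk_linear _ 1); [easy | easy | intros x; lra]. Qed.

Lemma bop_comp_linear (f g : Bop) : is_linear (fun x => f (g x)).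
Proof.
apply (mk_linear _ (opnorm f * opnorm g)).
- intros x y; unfold bop_fun.
  rewrite (linear_plus _ (proj2_sig g)); apply (linear_plus _ (proj2_sig f)).
- intros c x; unfold bop_fun.
  rewrite (linear_scal _ (proj2_sig g)); apply (linear_scal _ (proj2_sig f)).
- intros x; apply Rle_trans with (1 := opnorm_bound f _).
  rewrite Rmult_assoc.
  apply Rmult_le_compat_l; [apply opnorm_ge_0 | apply opnorm_bound].
Qed.

Definition bop_plus (f g : Bop) : Bop := exist _ _ (bop_plus_linear f g).
Definition bop_scal (c : C) (f : Bop) : Bop := exist _ _ (bop_scal_linear c f).
Definition bop_zero : Bop := exist _ _ bop_zero_linear.
Definition bop_one : Bop := exist _ _ bop_one_linear.
Definition bop_comp (f g : Bop) : Bop := exist _ _ (bop_comp_linear f g).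
Definition bop_opp (f : Bop) : Bop := bop_scal (RtoC (-1)) f.

Lemma bop_plus_opp (f : Bop) : bop_plus f (bop_opp f) = bop_zero.
Proof.
apply Bop_ext; intros x; simpl.
transitivity (plus (f x) (opp (f x))); [f_equal | exact (plus_opp_r (G := V) (f x))].
apply scal_opp_one_C.
Qed.

Definition Bop_AbelianMonoid_mixin : AbelianMonoid.mixin_of Bop.
Proof.
apply (AbelianMonoid.Mixin Bop bop_plus bop_zero).
- intros f g; apply Bop_ext; intros x; apply plus_comm.
- intros f g h; apply Bop_ext; intros x; apply plus_assoc.
- intros f; apply Bop_ext; intros x; apply plus_zero_r.
Defined.

Definition Bop_AbelianGroup_mixin :
  AbelianGroup.mixin_of (AbelianMonoid.Pack Bop Bop_AbelianMonoid_mixin Bop) :=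
  AbelianGroup.Mixin (AbelianMonoid.Pack Bop Bop_AbelianMonoid_mixin Bop)
    bop_opp bop_plus_opp.

Definition Bop_AbelianGroup_class : AbelianGroup.class_of Bop :=
  AbelianGroup.Class Bop Bop_AbelianMonoid_mixin Bop_AbelianGroup_mixin.

Definition Bop_ModuleSpace_mixin :
  ModuleSpace.mixin_of C_Ring (AbelianGroup.Pack Bop Bop_AbelianGroup_class Bop).
Proof.
apply (ModuleSpace.Mixin C_Ring
         (AbelianGroup.Pack Bop Bop_AbelianGroup_class Bop) bop_scal).
- intros c d f; apply Bop_ext; intros x; apply scal_assoc_C.
- intros f; apply Bop_ext; intros x.
  exact (scal_one (K := C_Ring) (V := V) (bop_fun f x)).
- intros c f g; apply Bop_ext; intros x.
  exact (scal_distr_l (K := C_Ring) (V := V) c (bop_fun f x) (bop_fun g x)).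
- intros c d f; apply Bop_ext; intros x.
  exact (scal_distr_r (K := C_Ring) (V := V) c d (bop_fun f x)).
Defined.

Lemma opnorm_plus (f g : Bop) : opnorm (bop_plus f g) <= opnorm f + opnorm g.
Proof.
apply opnorm_le.
- generalize (opnorm_ge_0 f) (opnorm_ge_0 g); lra.
- intros x; apply Rle_trans with (1 := norm_triangle_C _ _).
  rewrite Rmult_plus_distr_r; apply Rplus_le_compat; apply opnorm_bound.
Qed.

Lemma opnorm_scal (c : C) (f : Bop) : opnorm (bop_scal c f) <= Cmod c * opnorm f.
Proof.
apply opnorm_le.
- apply Rmult_le_pos; [apply Cmod_ge_0 | apply opnorm_ge_0].
- intros x; apply Rle_trans with (1 := norm_scal_C _ _).
  rewrite Rmult_assoc.
  apply Rmult_le_compat_l; [apply Cmod_ge_0 | apply opnorm_bound].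
Qed.

Lemma opnorm_comp (f g : Bop) : opnorm (bop_comp f g) <= opnorm f * opnorm g.
Proof.
apply opnorm_le.
- apply Rmult_le_pos; apply opnorm_ge_0.
- intros x; apply Rle_trans with (1 := opnorm_bound f _).
  rewrite Rmult_assoc.
  apply Rmult_le_compat_l; [apply opnorm_ge_0 | apply opnorm_bound].
Qed.

Lemma opnorm_zero : opnorm bop_zero = 0.
Proof.
apply Rle_antisym; [| apply opnorm_ge_0].
apply opnorm_le; [lra |]; intros x; simpl; rewrite norm_zero_C; lra.
Qed.

Lemma opnorm_eq_zero (f : Bop) : opnorm f = 0 -> f = bop_zero.
Proof.
intros H; apply Bop_ext; intros x; apply norm_eq_zero_C.
apply Rle_antisym; [| apply norm_ge_0_C].
generalize (opnorm_bound f x); rewrite H; lra.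
Qed.

Definition bop_minus (f g : Bop) : Bop := bop_plus f (bop_opp g).

Lemma bop_minus_fun (f g : Bop) (x : V) : bop_minus f g x = minus (f x) (g x).
Proof.
simpl; unfold minus; f_equal; apply scal_opp_one_C.
Qed.

Definition bop_ball (f : Bop) (e : R) (g : Bop) : Prop :=
  opnorm (bop_minus g f) < e.

Lemma opnorm_minus_sym (f g : Bop) :
  opnorm (bop_minus f g) <= opnorm (bop_minus g f).
Proof.
apply opnorm_le; [apply opnorm_ge_0 |]; intros x.
rewrite bop_minus_fun, <- norm_opp_C, opp_minus_C, <- bop_minus_fun.
apply opnorm_bound.
Qed.

Lemma opnorm_minus_triangle (f g h : Bop) :
  opnorm (bop_minus h f) <= opnorm (bop_minus g f) + opnorm (bop_minus h g).
Proof.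
assert (E : bop_minus h f = bop_plus (bop_minus g f) (bop_minus h g)).
{ apply Bop_ext; intros x; rewrite bop_minus_fun.
  change (bop_plus (bop_minus g f) (bop_minus h g) x)
    with (plus (bop_minus g f x) (bop_minus h g x)).
  rewrite !bop_minus_fun, plus_comm; apply minus_trans_C. }
rewrite E; apply opnorm_plus.
Qed.

Definition Bop_UniformSpace_mixin : UniformSpace.mixin_of Bop.
Proof.
apply (UniformSpace.Mixin Bop bop_zero bop_ball).
- intros f e; unfold bop_ball, bop_minus.
  rewrite bop_plus_opp, opnorm_zero; apply cond_pos.
- intros f g e H.
  apply Rle_lt_trans with (1 := opnorm_minus_sym _ _); exact H.
- intros f g h d e H1 H2.
  apply Rle_lt_trans with (1 := opnorm_minus_triangle f g h).
  apply Rplus_lt_compat; assumption.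
Defined.

Definition Bop_NormedModuleAux : NormedModuleAux C_AbsRing :=
  NormedModuleAux.Pack C_AbsRing Bop
    (NormedModuleAux.Class C_AbsRing Bop
       (ModuleSpace.Class C_Ring Bop Bop_AbelianGroup_class
          Bop_ModuleSpace_mixin)
       Bop_UniformSpace_mixin) Bop.

Definition Bop_NormedModule_mixin :
  NormedModule.mixin_of C_AbsRing Bop_NormedModuleAux.
Proof.
apply (NormedModule.Mixin C_AbsRing Bop_NormedModuleAux
         (fun f : Bop => opnorm f) 1).
- exact opnorm_plus.
- exact opnorm_scal.
- intros f g e H; exact H.
- intros f g e H; rewrite Rmult_1_l; exact H.
- exact opnorm_eq_zero.
Defined.

Definition Bop_UniformSpace : UniformSpace :=
  UniformSpace.Pack Bop Bop_UniformSpace_mixin Bop.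

Lemma Bop_complete (F : (Bop_UniformSpace -> Prop) -> Prop) :
  ProperFilter F -> cauchy F ->
  exists L : Bop, forall eps : posreal, F (bop_ball L eps).
Proof.
intros PF CF.
pose (G := fun x : V => filtermap (fun f : Bop => f x) F).
assert (PG : forall x, ProperFilter (G x)).
{ intros x; apply filtermap_proper_filter, PF. }
assert (near : forall (f g : Bop) (e : R) (x : V),
           bop_ball f e g -> norm (minus (g x) (f x)) <= e * norm x).
{ intros f g e x H; rewrite <- bop_minus_fun.
  apply Rle_trans with (1 := opnorm_bound _ _).
  apply Rmult_le_compat_r; [apply norm_ge_0_C | left; exact H]. }
assert (CG : forall x, cauchy (G x)).
{ intros x eps.
  assert (Hd : 0 < eps / (norm x + 1)).
  { apply Rdiv_lt_0_compat; [apply cond_pos | generalize (norm_ge_0_C x); lra]. }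
  destruct (CF (mkposreal _ Hd)) as [f Hf]; change Bop in f.
  exists (f x); unfold G, filtermap; revert Hf; apply filter_imp; intros g Hg; change Bop in g.
  apply (norm_compat1 (V := V)).
  apply Rle_lt_trans with (1 := near f g _ x Hg); simpl.
  assert (H0 := norm_ge_0_C x).
  apply Rlt_le_trans with (eps / (norm x + 1) * (norm x + 1)).
  - apply Rmult_lt_compat_l; [exact Hd | lra].
  - right; field; lra. }
pose (L := fun x : V => lim (G x) : V).
assert (HL : forall (x : V) (eps : posreal),
           F (fun g : Bop => norm (minus (g x) (L x)) < eps)).
{ intros x eps.
  assert (Hd : 0 < eps / norm_factor (V := V)).
  { apply Rdiv_lt_0_compat; [apply cond_pos | apply norm_factor_gt_0]. }
  generalize (complete_cauchy (G x) (PG x) (CG x) (mkposreal _ Hd)).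
  unfold G at 1, filtermap; apply filter_imp; intros g Hg; change Bop in g.
  generalize (norm_compat2 (V := V) _ _ _ Hg); simpl; intros H.
  replace (pos eps) with (norm_factor (V := V) * (eps / norm_factor (V := V))).
  - exact H.
  - field; apply Rgt_not_eq, norm_factor_gt_0. }
assert (small : forall (u : V) (M : R),
           0 <= M -> (forall e : posreal, norm u <= M * e) -> u = zero).
{ intros u M HM H; apply norm_eq_zero_C.
  apply Rle_antisym; [| apply norm_ge_0_C].
  apply Rnot_lt_le; intros Hu.
  assert (Hd : 0 < norm u / (M + 1)) by (apply Rdiv_lt_0_compat; lra).
  generalize (H (mkposreal _ Hd)); simpl; intros H1.
  assert (M * (norm u / (M + 1)) < norm u); [| lra].
  apply Rlt_le_trans with ((M + 1) * (norm u / (M + 1))).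
  - apply Rmult_lt_compat_r; lra.
  - right; field; lra. }
assert (eq_of_minus : forall u v : V, minus u v = zero -> u = v).
{ intros u v H; apply (plus_reg_r (G := V) (opp v)); rewrite plus_opp_r_C; exact H. }
assert (Lplus : forall x y, L (plus x y) = plus (L x) (L y)).
{ intros x y; apply eq_of_minus, (small _ 3); [lra |]; intros e.
  destruct (filter_ex _ (filter_and _ _ (HL (plus x y) e)
             (filter_and _ _ (HL x e) (HL y e)))) as [g [H1 [H2 H3]]]; change Bop in g.
  assert (E : minus (L (plus x y)) (plus (L x) (L y)) =
    plus (opp (minus (g (plus x y)) (L (plus x y))))
      (plus (minus (g x) (L x)) (minus (g y) (L y)))).
  { unfold bop_fun; rewrite (linear_plus _ (proj2_sig g)).
    rewrite opp_minus_C.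
    assert (E2 : plus (minus (proj1_sig g x) (L x))
                   (minus (proj1_sig g y) (L y)) =
      minus (plus (proj1_sig g x) (proj1_sig g y)) (plus (L x) (L y))).
    { unfold minus; rewrite opp_plus_C, <- !plus_assoc; f_equal.
      rewrite !plus_assoc; f_equal; apply plus_comm. }
    rewrite E2; apply minus_trans_C. }
  rewrite E.
  apply Rle_trans with (1 := norm_triangle_C _ _); rewrite norm_opp_C.
  apply Rle_trans with (e + (e + e)); [| lra].
  apply Rplus_le_compat; [left; exact H1 |].
  apply Rle_trans with (1 := norm_triangle_C _ _).
  apply Rplus_le_compat; left; assumption. }
assert (Lscal : forall (c : C) x, L (scal c x) = scal c (L x)).
{ intros c x; apply eq_of_minus, (small _ (1 + Cmod c)).
  { generalize (Cmod_ge_0 c); lra. }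
  intros e.
  destruct (filter_ex _ (filter_and _ _ (HL (scal c x) e) (HL x e)))
    as [g [H1 H2]]; change Bop in g.
  assert (E : minus (L (scal c x)) (scal c (L x)) =
    plus (opp (minus (g (scal c x)) (L (scal c x))))
      (scal c (minus (g x) (L x)))).
  { unfold bop_fun; rewrite (linear_scal _ (proj2_sig g)).
    rewrite opp_minus_C, scal_minus_C; apply minus_trans_C. }
  rewrite E.
  apply Rle_trans with (1 := norm_triangle_C _ _); rewrite norm_opp_C.
  apply Rle_trans with (e + Cmod c * e); [| right; ring].
  apply Rplus_le_compat; [left; exact H1 |].
  apply Rle_trans with (1 := norm_scal_C _ _).
  apply Rmult_le_compat_l; [apply Cmod_ge_0 | left; exact H2]. }
assert (Lnear : forall (f : Bop) (d : R) (x : V), F (bop_ball f d) ->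
           norm (minus (L x) (f x)) <= d * norm x).
{ intros f d x Hf; apply le_epsilon; intros e He.
  destruct (filter_ex _ (filter_and _ _ Hf (HL x (mkposreal e He))))
    as [g [H1 H2]]; change Bop in g; simpl in H2.
  rewrite (minus_trans_C (g x)), plus_comm.
  apply Rle_trans with (1 := norm_triangle_C _ _).
  apply Rplus_le_compat; [exact (near f g d x H1) |].
  rewrite <- norm_opp_C, opp_minus_C; left; exact H2. }
assert (Llin : is_linear L).
{ destruct (CF (mkposreal 1 Rlt_0_1)) as [f Hf]; change Bop in f.
  apply (mk_linear _ (1 + opnorm f)); [exact Lplus | exact Lscal |].
  intros x.
  replace (L x) with (plus (minus (L x) (f x)) (f x)).
  - apply Rle_trans with (1 := norm_triangle_C _ _).
    rewrite Rmult_plus_distr_r; apply Rplus_le_compat.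
    + exact (Lnear f 1 x Hf).
    + apply opnorm_bound.
  - unfold minus; rewrite <- plus_assoc, plus_opp_l_C; apply plus_zero_r. }
exists (exist _ L Llin); intros eps.
assert (He : 0 < eps / 2) by (generalize (cond_pos eps); lra).
destruct (CF (mkposreal _ He)) as [f Hf]; change Bop in f.
generalize Hf; apply filter_imp; intros g Hg; change Bop in g.
apply Rle_lt_trans with (1 := opnorm_minus_triangle _ f g).
assert (opnorm (bop_minus f (exist _ L Llin)) <= eps / 2).
{ apply Rle_trans with (1 := opnorm_minus_sym _ _).
  apply opnorm_le; [lra |]; intros x; rewrite bop_minus_fun.
  exact (Lnear f _ x Hf). }
replace (pos eps) with (eps / 2 + eps / 2) by lra.
apply Rplus_le_lt_compat; [assumption | exact Hg].
Qed.

Definition bop_lim (F : (Bop -> Prop) -> Prop) : Bop :=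
  epsilon (inhabits bop_zero)
    (fun L => forall eps : posreal, F (bop_ball L eps)).

Definition Bop_CompleteSpace_mixin : CompleteSpace.mixin_of Bop_UniformSpace.
Proof.
apply (CompleteSpace.Mixin Bop_UniformSpace bop_lim).
- intros F PF CF; exact (epsilon_spec _ _ (Bop_complete F PF CF)).
- intros F1 F2 H1 H2.
  assert (E : F1 = F2).
  { apply functional_extensionality; intros P.
    apply propositional_extensionality; split; [apply H2 | apply H1]. }
  rewrite E; apply close_refl.
Defined.

Definition Bop_CompleteNormedModule : CompleteNormedModule C_AbsRing :=
  CompleteNormedModule.Pack C_AbsRing Bop
    (CompleteNormedModule.Class C_AbsRing Bop
       (NormedModule.Class C_AbsRing Bop
          (NormedModuleAux.class C_AbsRing Bop_NormedModuleAux)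
          Bop_NormedModule_mixin)
       Bop_CompleteSpace_mixin) Bop.

Definition Bop_BanachAlgebra : BanachAlgebra.
Proof.
apply (Build_BanachAlgebra Bop_CompleteNormedModule bop_comp bop_one).
- intros f g h; apply Bop_ext; reflexivity.
- intros f; apply Bop_ext; reflexivity.
- intros f; apply Bop_ext; reflexivity.
- intros f g h; apply Bop_ext; reflexivity.
- intros f g h; apply Bop_ext; intros x.
  exact (linear_plus _ (proj2_sig f)
           (bop_fun g x) (bop_fun h x)).
- intros c f g; apply Bop_ext; reflexivity.
- intros c f g; apply Bop_ext; intros x.
  exact (linear_scal _ (proj2_sig f) c (bop_fun g x)).
- exact opnorm_comp.
Defined.

End BoundedOperators.

Arguments bop_fun {V} _ _.

(** A closed C^1 curve parametrised by [[0, 1]]. The velocity may vanish, so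
    closed piecewise C^1 curves are covered after reparametrisation. *)
Record loop : Type := {
  path : R -> C;
  velocity : R -> C;
  path_derive : forall t, 0 <= t <= 1 ->
    is_derive (V := C_R_NormedModule) path t (velocity t);
  velocity_continuous : forall t, 0 <= t <= 1 ->
    continuous (U := C_R_NormedModule) velocity t;
  path_closed : path 0 = path 1
}.

(** A contour is a finite formal sum of loops; a loop may be repeated. *)
Definition contour : Type := list loop.

Definition contour_in (G : contour) (D : C -> Prop) : Prop :=
  forall g, In g G -> forall t, 0 <= t <= 1 -> D (path g t).

Definition is_contour_int {V : CompleteNormedModule C_AbsRing}
    (G : contour) (f : C -> V) (I : V) : Prop :=
  is_RInt (V := realify V)
    (fun t => fold_right plus zero
       (map (fun g => scal (velocity g t : C_AbsRing) (f (path g t))) G))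
    0 1 I.

Definition two_pi_i : C := (2 * PI * Ci)%C.

Definition has_index (G : contour) (w n : C) : Prop :=
  is_contour_int (V := C_CompleteNormedModule) G
    (fun z => (/ two_pi_i * / (z - w))%C) n.

(** [G] surrounds the set [K] in the open set [U]. *)
Definition surrounds (G : contour) (K U : C -> Prop) : Prop :=
  contour_in G (fun z => U z /\ ~ K z) /\
  (forall w, K w -> has_index G w 1) /\
  (forall w, ~ U w -> has_index G w 0).

(** [holo_calc U f x v]: the function [f] is holomorphic on the open
    neighbourhood [U] of the spectrum of [x], and [v] is [f(x)], the value of
    [(1 / 2 i pi) \int_G f(z) (z - x)^-1 dz] for the contours [G] surrounding the
    spectrum of [x] in [U]. *)
Definition holo_calc {B : BanachAlgebra} (U : C -> Prop) (f : C -> C)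
    (x v : B) : Prop :=
  open (T := C_UniformSpace) U /\
  (forall z, U z -> ex_derive (K := C_AbsRing) (V := C_NormedModule) f z) /\
  (forall z, spectrum x z -> U z) /\
  (exists G, surrounds G (spectrum x) U) /\
  (forall G, surrounds G (spectrum x) U ->
     is_contour_int G
       (fun z => scal (/ two_pi_i * f z)%C (ainv (minus (scal z aone) x))) v).

Definition Cexp (z : C) : C := (exp (Re z) * cos (Im z), exp (Re z) * sin (Im z)).

Definition slit_plane (z : C) : Prop := ~ (Im z = 0 /\ Re z <= 0).

(** The principal argument, with values in [(-pi, pi)], on the slit plane, by
    [tan (arg z / 2) = Im z / (|z| + Re z)]. *)
Definition Carg (z : C) : R := 2 * atan (Im z / (Cmod z + Re z)).

Definition Clog (z : C) : C := (ln (Cmod z), Carg z).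

(** The principal branch of [z^s], for [z] in the slit plane. *)
Definition Crpow (z : C) (s : R) : C := Cexp (s * Clog z).

(** Euler's integral, for [0 < x]. *)
Definition Gamma (x : R) : R :=
  RInt_gen (V := R_CompleteNormedModule)
    (fun t => Rpower t (x - 1) * exp (- t)) (at_right 0) (Rbar_locally p_infty).

(** Euler's integral, for [0 < beta < gamma] and [z] outside [[1, oo)]. *)
Definition hyp2F1 (alpha beta gamma : R) (z : C) : C :=
  (Gamma gamma / (Gamma beta * Gamma (gamma - beta)) *
   RInt_gen (V := C_R_CompleteNormedModule)
     (fun t => Rpower (1 - t) (gamma - beta - 1) * Rpower t (beta - 1) *
               Crpow (1 - z * t) (- alpha))
     (at_right 0) (at_left 1))%C.

Section Modular.

Context {A : BanachAlgebra}.

Lemma modular_linear (k : A) :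
  is_linear (fun rho : A => amult (ainv k) (amult rho k)).
Proof.
apply (mk_linear _ _ (norm (ainv k) * norm k)).
- intros x y; rewrite amult_plus_l; apply amult_plus_r.
- intros c x; rewrite amult_scal_l; apply amult_scal_r.
- intros x; apply Rle_trans with (1 := amult_norm _ _ _).
  rewrite Rmult_assoc; apply Rmult_le_compat_l; [apply norm_ge_0_C |].
  rewrite Rmult_comm; exact (amult_norm _ _ _).
Qed.

Definition modular (k : A) : Bop_BanachAlgebra A :=
  exist _ _ (modular_linear k).

(** [J] is [(1 / 2 i pi) \int e^-l (k r^2 - l)^-a rho (k r^2 - l)^-b dl] along
    [l = i s], with [s] increasing over the real line. *)
Definition is_vertical_int (k rho : A) (a b : nat) (r : R) (J : A) : Prop :=
  is_RInt_gen (V := realify A)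
    (fun s : R =>
       let l := (Ci * s)%C in
       let res := ainv (minus (scal (RtoC (r ^ 2)) k) (scal l aone)) in
       scal (/ two_pi_i * Cexp (- l) * Ci)%C
         (amult (apow res a) (amult rho (apow res b))))
    (Rbar_locally m_infty) (Rbar_locally p_infty) J.

End Modular.

Definition d_m (a b m : nat) : R := INR a + INR b - 2 + (INR m - 2) / 2.

(* Main.v *)
(* Write [s = d + 1] and let [E(u) = exp(-u k)], which decays exponentially.  Closing the
   vertical contour to the right, the contour integral of [e^(-l v) (x - l)^-n] is
   [v^(n-1)/(n-1)! e^(-v x)], so the convolution rule gives, with [x = k r^2],
     J(r) = int_0^1 (1-t)^(a-1)/(a-1)! t^(b-1)/(b-1)! E((1-t) r^2) rho E(t r^2) dt.
   Let [L] and [R] be left and right multiplication by [k]; they commute and [R = L y].  Then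
   [int_0^oo r^(2s-1) E((1-t) r^2) rho E(t r^2) dr] is [Gamma(s)/2 (L ((1-t) + t y))^(-s) rho].
   This is shown without computing powers of [L ((1-t) + t y)]: the derivative in [t] of
   [((1-t) + t y)^s] times the integral truncated at [M] is a boundary term at [r = M], hence
   negligible.  Integrating over [t] gives Euler's integral for the hypergeometric function. *)

Require Import Defs.
From Stdlib Require Import Reals Lra Lia List Factorial ClassicalEpsilon.
From Coquelicot Require Import Coquelicot.
Import ListNotations.

Open Scope R_scope.
Set Bullet Behavior "Strict Subproofs".

(** * Linear identities in normed modules *)

(** [holo_calc] asks for one value over every contour that surrounds the spectrum. Independence of
    the contour and multiplicativity of powers come from a single device: along a contour the powers
    [((1 - c) + c x)^s] form a path that starts from 1 at [c = 0] and solves a linear differential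
    equation in [c], so identities between powers follow from vanishing derivatives. Winding numbers
    enter through one normalisation, that the resolvent integrates to [2 pi i]; it is obtained from
    an entire extension, in the manner of Dixon's proof of Cauchy's theorem. The comparison of
    radial integrals along the path is made twice: with [(L, R, y)], and with [(1, k, k)], which
    turns the integral of [r^N E(r^2)] into [Gamma(s)/2 k^(-s)]. That the spectrum of [y] stays away
    from the closed negative ray is also read off exponentials: [tau L + R] is inverted by
    integrating [exp(-u (tau L + R))], with bounds uniform in [tau >= 0]. Since [2 d + 1] is a
    natural number [N], the radial weight is a plain power. *)

Notation CNM := (CompleteNormedModule C_AbsRing).

(** Transparent wrappers with fixed head symbols. [plus], [scal] and [norm] appear through varying
    canonical structures, whereas rewriting and the reification behind [vmod] need one syntactic
    form. *)
Definition vadd {V : CNM} (x y : V) : V := plus x y.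
Definition vneg {V : CNM} (x : V) : V := opp x.
Definition vsub {V : CNM} (x y : V) : V := minus x y.
Definition vzero {V : CNM} : V := zero.
Definition vsc {V : CNM} (c : C) (x : V) : V := scal (c : C_AbsRing) x.
Definition nrm {V : CNM} (x : V) : R := norm x.

Notation "x [+] y" := (vadd x y) (at level 50, left associativity).
Notation "x [-] y" := (vsub x y) (at level 50, left associativity).
Notation "c [*] x" := (vsc c x) (at level 40, left associativity).
Notation "x [o] y" := (amult x y) (at level 40, left associativity).

Section Vector.
Context {V : CNM}.
Implicit Types x y z : V.

Lemma vadd_comm x y : x [+] y = y [+] x.
Proof. exact (plus_comm (G := V) x y). Qed.
Lemma vadd_assoc x y z : x [+] (y [+] z) = x [+] y [+] z.
Proof. exact (plus_assoc (G := V) x y z). Qed.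
Lemma vadd_0_l x : vzero [+] x = x.
Proof. exact (plus_zero_l (G := V) x). Qed.
Lemma vadd_0_r x : x [+] vzero = x.
Proof. exact (plus_zero_r (G := V) x). Qed.
Lemma vsc_assoc c d x : c [*] (d [*] x) = (c * d)%C [*] x.
Proof. exact (scal_assoc (K := C_Ring) c d x). Qed.
Lemma vsc_1 x : 1%C [*] x = x.
Proof. exact (scal_one (K := C_Ring) x). Qed.
Lemma vsc_0 x : 0%C [*] x = vzero.
Proof. exact (scal_zero_l (K := C_Ring) x). Qed.
Lemma vsc_vzero c : c [*] (vzero : V) = vzero.
Proof. exact (scal_zero_r (K := C_Ring) c). Qed.
Lemma vsc_add_r c x y : c [*] (x [+] y) = c [*] x [+] c [*] y.
Proof. exact (scal_distr_l (K := C_Ring) c x y). Qed.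
Lemma vsc_add_l c d x : (c + d)%C [*] x = c [*] x [+] d [*] x.
Proof. exact (scal_distr_r (K := C_Ring) c d x). Qed.
Lemma vneg_sc x : vneg x = (-(1))%C [*] x.
Proof. symmetry; exact (scal_opp_one (K := C_Ring) (V := V) x). Qed.
Lemma vsub_add x y : x [-] y = x [+] vneg y.
Proof. reflexivity. Qed.

Lemma nrm_ge0 x : 0 <= nrm x.
Proof. exact (norm_ge_0 x). Qed.
Lemma nrm_add x y : nrm (x [+] y) <= nrm x + nrm y.
Proof. exact (norm_triangle x y). Qed.
Lemma nrm_neg x : nrm (vneg x) = nrm x.
Proof. exact (norm_opp x). Qed.
Lemma nrm_sc_le c x : nrm (c [*] x) <= Cmod c * nrm x.
Proof. exact (norm_scal (K := C_AbsRing) c x). Qed.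
Lemma nrm_0 : nrm (vzero : V) = 0.
Proof. exact (norm_zero (V := V)). Qed.
Lemma nrm_eq0 x : nrm x = 0 -> x = vzero.
Proof. exact (norm_eq_zero x). Qed.
Lemma nrm_sub x y : nrm (x [-] y) <= nrm x + nrm y.
Proof. rewrite vsub_add, <- (nrm_neg y); apply nrm_add. Qed.

End Vector.

(* [vmod] proves a linear identity between vectors by comparing the coefficients of each
   atom on both sides; [vmod0] leaves these scalar equations as goals. *)
Inductive mexp : Type :=
  | MA (n : nat) | M0 | MP (a b : mexp) | MN (a : mexp) | MM (a b : mexp)
  | MS (c : C) (a : mexp).

Fixpoint meval {V : CNM} (env : list V) (e : mexp) : V :=
  match e with
  | MA n => nth n env vzero
  | M0 => vzero
  | MP a b => meval env a [+] meval env b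
  | MN a => vneg (meval env a)
  | MM a b => meval env a [-] meval env b
  | MS c a => c [*] meval env a
  end.

Fixpoint mcoef (i : nat) (e : mexp) : C :=
  match e with
  | MA n => if Nat.eqb i n then 1%C else 0%C
  | M0 => 0%C
  | MP a b => (mcoef i a + mcoef i b)%C
  | MN a => (- mcoef i a)%C
  | MM a b => (mcoef i a - mcoef i b)%C
  | MS c a => (c * mcoef i a)%C
  end.

Fixpoint mlin {V : CNM} (env : list V) (f : nat -> C) : V :=
  match env with
  | nil => vzero
  | x :: env => f O [*] x [+] mlin env (fun i => f (S i))
  end.

Section Reflect.
Context {V : CNM}.

Lemma mlin_ext (env : list V) : forall f g,
  (forall i, (i < length env)%nat -> f i = g i) -> mlin env f = mlin env g.
Proof.
induction env as [| x env IH]; simpl; intros f g H; [reflexivity |].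
rewrite (H O) by lia; f_equal; apply IH; intros i Hi; apply H; lia.
Qed.

Lemma vadd_swap (x y z t : V) : x [+] y [+] (z [+] t) = x [+] z [+] (y [+] t).
Proof.
rewrite <- !vadd_assoc; f_equal; rewrite !vadd_assoc; f_equal; apply vadd_comm.
Qed.

Lemma mlin_add (env : list V) : forall f g,
  mlin env (fun i => f i + g i)%C = mlin env f [+] mlin env g.
Proof.
induction env as [| x env IH]; simpl; intros f g; [symmetry; apply vadd_0_l |].
rewrite (IH (fun i => f (S i)) (fun i => g (S i))), vsc_add_l; apply vadd_swap.
Qed.

Lemma mlin_sc (env : list V) c : forall f,
  mlin env (fun i => c * f i)%C = c [*] mlin env f.
Proof.
induction env as [| x env IH]; simpl; intros f; [symmetry; apply vsc_vzero |].
rewrite (IH (fun i => f (S i))), vsc_add_r, vsc_assoc; reflexivity.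
Qed.

Lemma mlin_0 (env : list V) : mlin env (fun _ => 0%C) = vzero.
Proof.
induction env as [| x env IH]; simpl; [reflexivity |].
rewrite vsc_0, IH; apply vadd_0_l.
Qed.

Lemma mlin_atom (env : list V) : forall n,
  mlin env (fun i => if Nat.eqb i n then 1%C else 0%C) = nth n env vzero.
Proof.
induction env as [| x env IH]; intros [| n]; simpl; try reflexivity.
- rewrite vsc_1, mlin_0; apply vadd_0_r.
- rewrite vsc_0, vadd_0_l; apply IH.
Qed.

Lemma meval_lin (env : list V) e : meval env e = mlin env (fun i => mcoef i e).
Proof.
induction e as [n | | a IHa b IHb | a IHa | a IHa b IHb | c a IHa]; simpl.
- symmetry; apply mlin_atom.
- symmetry; apply mlin_0.
- rewrite mlin_add, IHa, IHb; reflexivity.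
- rewrite IHa, vneg_sc, <- mlin_sc; apply mlin_ext; intros; ring.
- rewrite vsub_add, vneg_sc, IHa, IHb, <- mlin_sc, <- mlin_add.
  apply mlin_ext; intros; ring.
- rewrite IHa, mlin_sc; reflexivity.
Qed.

Fixpoint mall (n : nat) (P : nat -> Prop) : Prop :=
  match n with O => True | S n => P n /\ mall n P end.

Lemma meval_eq (env : list V) e1 e2 :
  mall (length env) (fun i => mcoef i e1 = mcoef i e2) ->
  meval env e1 = meval env e2.
Proof.
intros H; rewrite !meval_lin; apply mlin_ext; intros i Hi.
revert H Hi; generalize (length env); intros n.
induction n as [| n IH]; simpl; [lia |]; intros [H1 H2] Hi.
destruct (Nat.eq_dec i n) as [-> |]; [exact H1 | apply IH; [exact H2 | lia]].
Qed.

End Reflect.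

Ltac mem_idx x l :=
  match l with
  | ?y :: ?l' => match constr:(tt) with
      (* Wrapping [constr_eq] in a [match] runs it as a test while the enclosing function still
         returns a term; its failure selects the next branch. *)
      | _ => let _ := match constr:(tt) with _ => constr_eq x y end in constr:(Some O)
      | _ => let r := mem_idx x l' in
             match r with Some ?n => constr:(Some (S n)) | None => constr:(@None nat) end
      end
  | _ => constr:(@None nat)
  end.

Ltac madd x l :=
  let r := mem_idx x l in
  match r with
  | Some _ => l
  | None => match l with
      | context [@nil ?T] => let l' := eval cbv [app] in (app l (@cons T x (@nil T))) in l'
      end
  end.

Ltac matoms e l :=
  lazymatch e with
  | vadd ?a ?b => let l := matoms a l in matoms b l
  | vsub ?a ?b => let l := matoms a l in matoms b l
  | vneg ?a => matoms a l
  | vsc _ ?a => matoms a l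
  | vzero => l
  | _ => madd e l
  end.

Ltac mreify e l :=
  lazymatch e with
  | vadd ?a ?b => let a := mreify a l in let b := mreify b l in constr:(MP a b)
  | vsub ?a ?b => let a := mreify a l in let b := mreify b l in constr:(MM a b)
  | vneg ?a => let a := mreify a l in constr:(MN a)
  | vsc ?c ?a => let a := mreify a l in constr:(MS c a)
  | vzero => constr:(M0)
  | _ => let r := mem_idx e l in match r with Some ?n => constr:(MA n) end
  end.

Ltac vmod0 :=
  lazymatch goal with
  | |- @eq ?T ?a ?b =>
      let l := matoms a (@nil T) in
      let l := matoms b l in
      let ea := mreify a l in
      let eb := mreify b l in
      refine (@meval_eq _ l ea eb _); cbn [length mall mcoef Nat.eqb]; repeat split
  end.
Ltac vmod := vmod0; try ring.

(** * Continuity and derivatives *)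

Notation CS := C_CompleteNormedModule.

Lemma nrm_C (z : C) : nrm (V := CS) z = Cmod z.
Proof. reflexivity. Qed.

(** Continuity measured by the norm instead of the balls of the uniform structure; the two differ by
    [norm_factor], which is absorbed once and for all below. *)
Definition vcont {T : UniformSpace} {V : CNM} (f : T -> V) (x : T) : Prop :=
  forall eps, 0 < eps -> locally x (fun y => nrm (f y [-] f x) < eps).

Lemma vcont_continuous {T : UniformSpace} {V : CNM} (f : T -> V) (x : T) :
  vcont f x <-> continuous (U := V) f x.
Proof.
split.
- intros H; apply filterlim_locally; intros eps.
  generalize (H eps (cond_pos eps)); apply filter_imp; intros y Hy.
  apply (norm_compat1 (V := V)); exact Hy.
- intros H eps Heps.
  assert (Hd : 0 < eps / norm_factor (V := V)).
  { apply Rdiv_lt_0_compat; [exact Heps | apply norm_factor_gt_0]. }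
  generalize (proj1 (filterlim_locally _ _) H (mkposreal _ Hd)).
  apply filter_imp; intros y Hy.
  generalize (norm_compat2 (V := V) _ _ _ Hy); simpl; intros H1.
  replace eps with (norm_factor (V := V) * (eps / norm_factor (V := V))).
  + exact H1.
  + field; apply Rgt_not_eq, norm_factor_gt_0.
Qed.

(** Scalar multiplication and the product of the algebra are both instances, so that each product
    rule has a single proof. *)
Record bilin {U V W : CNM} (b : U -> V -> W) : Prop := {
  bil_add_l : forall x y z, b (x [+] y) z = b x z [+] b y z;
  bil_add_r : forall x y z, b x (y [+] z) = b x y [+] b x z;
  bil_sc_l : forall c x y, b (c [*] x) y = c [*] b x y;
  bil_sc_r : forall c x y, b x (c [*] y) = c [*] b x y;
  bil_bound : exists M, 0 < M /\ forall x y, nrm (b x y) <= M * nrm x * nrm y }.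

Record linmap {U V : CNM} (f : U -> V) : Prop := {
  lin_add : forall x y, f (x [+] y) = f x [+] f y;
  lin_sc : forall c x, f (c [*] x) = c [*] f x;
  lin_bound : exists M, 0 < M /\ forall x, nrm (f x) <= M * nrm x }.

Lemma lin_neg {U V : CNM} {f : U -> V} : linmap f -> forall x, f (vneg x) = vneg (f x).
Proof. intros H x; rewrite !vneg_sc; apply (lin_sc _ H). Qed.
Lemma lin_sub {U V : CNM} {f : U -> V} : linmap f -> forall x y, f (x [-] y) = f x [-] f y.
Proof. intros H x y; rewrite !vsub_add, (lin_add _ H), (lin_neg H); reflexivity. Qed.
Lemma lin_0 {U V : CNM} {f : U -> V} : linmap f -> f vzero = vzero.
Proof. intros H; rewrite <- (vsc_0 vzero), (lin_sc _ H), vsc_0; reflexivity. Qed.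

Lemma bilin_lin_l {U V W : CNM} {b : U -> V -> W} : bilin b -> forall y, linmap (fun x => b x y).
Proof.
intros [H1 _ H3 _ [M [HM H5]]] y; split; auto.
exists (M * nrm y + 1); split.
- generalize (Rmult_le_pos M (nrm y)) (nrm_ge0 y); nra.
- intros x; apply Rle_trans with (1 := H5 x y); generalize (nrm_ge0 x); nra.
Qed.
Lemma bilin_lin_r {U V W : CNM} {b : U -> V -> W} : bilin b -> forall x, linmap (fun y => b x y).
Proof.
intros [_ H2 _ H4 [M [HM H5]]] x; split; auto.
exists (M * nrm x + 1); split.
- generalize (nrm_ge0 x); nra.
- intros y; apply Rle_trans with (1 := H5 x y); generalize (nrm_ge0 y); nra.
Qed.

Lemma vsc_bilin {V : CNM} : bilin (U := CS) (V := V) (W := V) (fun c x => c [*] x).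
Proof.
split.
- intros; apply vsc_add_l.
- intros; apply vsc_add_r.
- intros c x y; symmetry; exact (vsc_assoc c x y).
- intros c x y; rewrite !vsc_assoc; f_equal; apply Cmult_comm.
- exists 1; split; [lra |]; intros; rewrite Rmult_1_l; apply nrm_sc_le.
Qed.

Lemma amult_bilin {B : BanachAlgebra} : bilin (U := B) (V := B) (W := B) amult.
Proof.
split.
- apply amult_plus_l.
- apply amult_plus_r.
- apply amult_scal_l.
- intros; apply amult_scal_r.
- exists 1; split; [lra |]; intros; rewrite Rmult_1_l; apply amult_norm.
Qed.

Lemma sc_linmap {V : CNM} (c : C) : linmap (fun x : V => c [*] x).
Proof. exact (bilin_lin_r vsc_bilin c). Qed.
Lemma scl_linmap {V : CNM} (x : V) : linmap (U := CS) (fun c => c [*] x).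
Proof. exact (bilin_lin_l vsc_bilin x). Qed.
Lemma mul_l_linmap {B : BanachAlgebra} (a : B) : linmap (fun x : B => a [o] x).
Proof. exact (bilin_lin_r amult_bilin a). Qed.
Lemma mul_r_linmap {B : BanachAlgebra} (a : B) : linmap (fun x : B => x [o] a).
Proof. exact (bilin_lin_l amult_bilin a). Qed.

Section Continuity.
Context {T : UniformSpace}.

Lemma loc_and (x : T) (P Q : T -> Prop) :
  locally x P -> locally x Q -> locally x (fun y => P y /\ Q y).
Proof. apply filter_and. Qed.

Lemma vcont_const {V : CNM} (c : V) (x : T) : vcont (fun _ => c) x.
Proof.
intros eps H; apply filter_forall; intros _.
replace (c [-] c) with (vzero : V) by vmod; rewrite nrm_0; exact H.
Qed.

Lemma vcont_lin {U V : CNM} {b : U -> V} (Hb : linmap b) (f : T -> U) (x : T) :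
  vcont f x -> vcont (fun t => b (f t)) x.
Proof.
intros H eps He; destruct (lin_bound _ Hb) as [M [HM Hn]].
generalize (H (eps / M) (Rdiv_lt_0_compat _ _ He HM)); apply filter_imp; intros y Hy.
rewrite <- (lin_sub Hb); apply Rle_lt_trans with (1 := Hn _).
replace eps with (M * (eps / M)) by (field; lra); apply Rmult_lt_compat_l; lra.
Qed.

Lemma vcont_add {V : CNM} (f g : T -> V) (x : T) :
  vcont f x -> vcont g x -> vcont (fun t => f t [+] g t) x.
Proof.
intros Hf Hg eps He.
generalize (loc_and _ _ _ (Hf (eps / 2) ltac:(lra)) (Hg (eps / 2) ltac:(lra))).
apply filter_imp; intros y [H1 H2].
replace (f y [+] g y [-] (f x [+] g x)) with ((f y [-] f x) [+] (g y [-] g x)) by vmod.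
apply Rle_lt_trans with (1 := nrm_add _ _); lra.
Qed.

Lemma vcont_neg {V : CNM} (f : T -> V) (x : T) : vcont f x -> vcont (fun t => vneg (f t)) x.
Proof.
intros Hf eps He; generalize (Hf eps He); apply filter_imp; intros y H1.
replace (vneg (f y) [-] vneg (f x)) with (vneg (f y [-] f x)) by vmod.
rewrite nrm_neg; exact H1.
Qed.

Lemma vcont_sub {V : CNM} (f g : T -> V) (x : T) :
  vcont f x -> vcont g x -> vcont (fun t => f t [-] g t) x.
Proof. intros Hf Hg; apply vcont_add; [exact Hf | apply vcont_neg, Hg]. Qed.

Lemma vcont_bilin {U V W : CNM} {b : U -> V -> W} (Hb : bilin b) (f : T -> U) (g : T -> V) x :
  vcont f x -> vcont g x -> vcont (fun t => b (f t) (g t)) x.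
Proof.
intros Hf Hg eps He; destruct (bil_bound _ Hb) as [M [HM Hn]].
pose (F := nrm (f x)); pose (G := nrm (g x)).
assert (HF : 0 <= F) by apply nrm_ge0; assert (HG : 0 <= G) by apply nrm_ge0.
assert (HD : 0 < M * (F + G + 1)) by nra.
(* As [e <= 1], the three terms of the expansion below are at most [M e], [M e G] and [M e F]. *)
pose (e := Rmin 1 (eps / (M * (F + G + 1)))).
assert (E1 : e <= 1) by apply Rmin_l.
assert (E2 : e * (M * (F + G + 1)) <= eps).
{ apply Rle_trans with (eps / (M * (F + G + 1)) * (M * (F + G + 1))).
  - apply Rmult_le_compat_r; [lra | apply Rmin_r].
  - right; field; nra. }
assert (E0 : 0 < e) by (apply Rmin_glb_lt; [lra | apply Rdiv_lt_0_compat; assumption]).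
generalize (loc_and _ _ _ (Hf e E0) (Hg e E0)); apply filter_imp; intros y [H1 H2].
replace (b (f y) (g y) [-] b (f x) (g x)) with
  (b (f y [-] f x) (g y [-] g x) [+] b (f y [-] f x) (g x) [+] b (f x) (g y [-] g x)).
2:{ rewrite !(lin_sub (bilin_lin_l Hb _)), !(lin_sub (bilin_lin_r Hb _)); vmod. }
apply Rle_lt_trans with (1 := nrm_add _ _).
assert (K1 := nrm_add (b (f y [-] f x) (g y [-] g x)) (b (f y [-] f x) (g x))).
assert (K2 := Hn (f y [-] f x) (g y [-] g x)).
assert (K3 := Hn (f y [-] f x) (g x)). assert (K4 := Hn (f x) (g y [-] g x)).
fold G in K3; fold F in K4.
set (p := nrm (f y [-] f x)) in *; set (q := nrm (g y [-] g x)) in *.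
assert (0 <= p) by apply nrm_ge0; assert (0 <= q) by apply nrm_ge0.
assert (M * p * q <= M * p * 1) by (apply Rmult_le_compat_l; nra).
assert (M * p < M * e) by (apply Rmult_lt_compat_l; lra).
assert (M * p * G <= M * e * G) by (apply Rmult_le_compat_r; nra).
assert (M * F * q <= M * F * e) by (apply Rmult_le_compat_l; nra).
nra.
Qed.

Lemma vcont_sc {V : CNM} (c : T -> C) (f : T -> V) x :
  vcont (V := CS) c x -> vcont f x -> vcont (fun t => c t [*] f t) x.
Proof. exact (vcont_bilin vsc_bilin c f x). Qed.

Lemma vcont_mul {B : BanachAlgebra} (f g : T -> B) x :
  vcont f x -> vcont g x -> vcont (fun t => f t [o] g t) x.
Proof. exact (vcont_bilin amult_bilin f g x). Qed.

Lemma vcont_Cplus (f g : T -> C) x :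
  vcont (V := CS) f x -> vcont (V := CS) g x -> vcont (V := CS) (fun t => f t + g t)%C x.
Proof. exact (vcont_add (V := CS) f g x). Qed.
Lemma vcont_Cminus (f g : T -> C) x :
  vcont (V := CS) f x -> vcont (V := CS) g x -> vcont (V := CS) (fun t => f t - g t)%C x.
Proof. exact (vcont_sub (V := CS) f g x). Qed.
Lemma vcont_Copp (f : T -> C) x : vcont (V := CS) f x -> vcont (V := CS) (fun t => - f t)%C x.
Proof. exact (vcont_neg (V := CS) f x). Qed.
Lemma vcont_Cmult (f g : T -> C) x :
  vcont (V := CS) f x -> vcont (V := CS) g x -> vcont (V := CS) (fun t => f t * g t)%C x.
Proof. exact (vcont_sc (V := CS) f g x). Qed.

Lemma vcont_Rfun (f : T -> R) x :
  continuous f x -> vcont (V := CS) (fun t => RtoC (f t)) x.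
Proof.
intros H eps He.
generalize (proj1 (filterlim_locally _ _) H (mkposreal _ He)); apply filter_imp; intros y Hy.
change (Cmod (RtoC (f y) - RtoC (f x))%C < eps).
rewrite <- RtoC_minus, Cmod_R; exact Hy.
Qed.

Lemma vcont_comp {V : CNM} {S : UniformSpace} (g : T -> S) (f : S -> V) x :
  continuous g x -> vcont f (g x) -> vcont (fun t => f (g t)) x.
Proof.
intros Hg Hf; apply vcont_continuous, continuous_comp; [exact Hg |].
apply vcont_continuous, Hf.
Qed.

Lemma vcont_compC {V : CNM} (g : T -> C) (f : C_UniformSpace -> V) x :
  vcont (V := CS) g x -> vcont f (g x) -> vcont (fun t => f (g t)) x.
Proof.
intros Hg Hf; apply (vcont_comp (S := C_UniformSpace) g); [| exact Hf].
apply (vcont_continuous (V := CS)), Hg.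
Qed.

Lemma vcont_ext_loc {V : CNM} (f g : T -> V) x :
  locally x (fun y => f y = g y) -> vcont f x -> vcont g x.
Proof.
intros He Hf; apply vcont_continuous.
apply (continuous_ext_loc (U := V) g f x); [exact He |]; apply vcont_continuous, Hf.
Qed.

Lemma vcont_ext {V : CNM} (f g : T -> V) x :
  (forall y, f y = g y) -> vcont f x -> vcont g x.
Proof. intros H; apply vcont_ext_loc, filter_forall, H. Qed.

Lemma vcont_nrm {V : CNM} (f : T -> V) x : vcont f x -> continuous (fun t => nrm (f t)) x.
Proof.
intros H; apply (continuous_comp (V := V) f (fun v : V => norm v)).
- apply vcont_continuous, H.
- exact (filterlim_norm (V := V) (f x)).
Qed.

Lemma vcont_id_C (z : C) : vcont (T := C_UniformSpace) (V := CS) (fun w => w) z.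
Proof. apply (vcont_continuous (V := CS)), continuous_id. Qed.

End Continuity.

Lemma locally_Cmod (z : C) (P : C -> Prop) :
  locally (T := C_UniformSpace) z P <->
  exists d, 0 < d /\ forall w, Cmod (w - z) < d -> P w.
Proof.
rewrite locally_C; split.
- intros [d Hd]; exists d; split; [apply cond_pos |]; intros w Hw; apply Hd, Hw.
- intros [d [H0 Hd]]; exists (mkposreal d H0); intros w Hw; apply Hd, Hw.
Qed.

Lemma locally_Rabs (t : R) (P : R -> Prop) :
  locally t P <-> exists d, 0 < d /\ forall s, Rabs (s - t) < d -> P s.
Proof.
split.
- intros [d Hd]; exists d; split; [apply cond_pos |]; intros w Hw; apply Hd, Hw.
- intros [d [H0 Hd]]; exists (mkposreal d H0); intros w Hw; apply Hd, Hw.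
Qed.

Section Deriv.
Context {P : Type} (io : P -> C).

(** The map [io] places the parameter in the complex plane: the inclusion of the reals gives real
    derivatives, the identity complex ones, and both share the rules of calculus. *)
Definition der {V : CNM} (f : P -> V) (p : P) (l : V) : Prop :=
  forall eps, 0 < eps -> exists d, 0 < d /\ forall q, Cmod (io q - io p) < d ->
    nrm (f q [-] f p [-] (io q - io p)%C [*] l) <= eps * Cmod (io q - io p).

Lemma der_const {V : CNM} (c : V) p : der (fun _ => c) p vzero.
Proof.
intros eps He; exists 1; split; [lra |]; intros q _.
replace (c [-] c [-] (io q - io p)%C [*] vzero) with (vzero : V) by vmod.
rewrite nrm_0; apply Rmult_le_pos; [lra | apply Cmod_ge_0].
Qed.

Lemma der_io p : der (V := CS) io p (RtoC 1).
Proof.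
intros eps He; exists 1; split; [lra |]; intros q _.
replace (vsub (V := CS) (vsub (V := CS) (io q) (io p)) (vsc (V := CS) (io q - io p)%C (RtoC 1))) with (vzero : CS).
- rewrite nrm_0; apply Rmult_le_pos; [lra | apply Cmod_ge_0].
- change (RtoC 0 = (io q - io p - (io q - io p) * 1)%C); ring.
Qed.

Lemma der_eq {V : CNM} (f : P -> V) p l l' : der f p l -> l = l' -> der f p l'.
Proof. intros H <-; exact H. Qed.

Lemma der_ext {V : CNM} (f g : P -> V) p l : (forall q, f q = g q) -> der f p l -> der g p l.
Proof.
intros E H eps He; destruct (H eps He) as [d [Hd H1]]; exists d; split; [exact Hd |].
intros q Hq; rewrite <- !E; auto.
Qed.

Lemma der_ext_loc {V : CNM} (f g : P -> V) p l :
  (exists d, 0 < d /\ forall q, Cmod (io q - io p) < d -> f q = g q) -> der f p l -> der g p l.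
Proof.
intros [d' [Hd' E]] H eps He; destruct (H eps He) as [d [Hd H1]]; exists (Rmin d d'); split.
- apply Rmin_glb_lt; assumption.
- intros q Hq; rewrite <- !E; [apply H1 | |].
  + apply Rlt_le_trans with (1 := Hq), Rmin_l.
  + replace (io p - io p)%C with (RtoC 0) by ring; rewrite Cmod_0; exact Hd'.
  + apply Rlt_le_trans with (1 := Hq), Rmin_r.
Qed.

Lemma der_add {V : CNM} (f g : P -> V) p l m :
  der f p l -> der g p m -> der (fun q => f q [+] g q) p (l [+] m).
Proof.
intros Hf Hg eps He.
destruct (Hf (eps / 2) ltac:(lra)) as [d1 [D1 H1]].
destruct (Hg (eps / 2) ltac:(lra)) as [d2 [D2 H2]].
exists (Rmin d1 d2); split; [apply Rmin_glb_lt; assumption |]; intros q Hq.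
specialize (H1 q (Rlt_le_trans _ _ _ Hq (Rmin_l _ _))).
specialize (H2 q (Rlt_le_trans _ _ _ Hq (Rmin_r _ _))).
match goal with |- nrm ?e <= _ => replace e with
  ((f q [-] f p [-] (io q - io p)%C [*] l) [+] (g q [-] g p [-] (io q - io p)%C [*] m)) by vmod end.
apply Rle_trans with (1 := nrm_add _ _); lra.
Qed.

Lemma der_lin {U V : CNM} {b : U -> V} (Hb : linmap b) (f : P -> U) p l :
  der f p l -> der (fun q => b (f q)) p (b l).
Proof.
intros Hf eps He; destruct (lin_bound _ Hb) as [M [HM Hn]].
destruct (Hf (eps / M) (Rdiv_lt_0_compat _ _ He HM)) as [d [D H]].
exists d; split; [exact D |]; intros q Hq; specialize (H q Hq).
rewrite <- (lin_sc _ Hb), <- !(lin_sub Hb).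
apply Rle_trans with (1 := Hn _).
replace (eps * Cmod (io q - io p)) with (M * (eps / M * Cmod (io q - io p))) by (field; lra).
apply Rmult_le_compat_l; lra.
Qed.

Lemma der_lipschitz {V : CNM} (f : P -> V) p l : der f p l ->
  exists d, 0 < d /\ forall q, Cmod (io q - io p) < d ->
    nrm (f q [-] f p) <= (nrm l + 1) * Cmod (io q - io p).
Proof.
intros H; destruct (H 1 Rlt_0_1) as [d [D H1]]; exists d; split; [exact D |].
intros q Hq; specialize (H1 q Hq).
replace (f q [-] f p) with ((f q [-] f p [-] (io q - io p)%C [*] l) [+] (io q - io p)%C [*] l) by vmod.
apply Rle_trans with (1 := nrm_add _ _).
generalize (nrm_sc_le (io q - io p)%C l); lra.
Qed.

Lemma der_bilin {U V W : CNM} {b : U -> V -> W} (Hb : bilin b) (f : P -> U) (g : P -> V) p l m :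
  der f p l -> der g p m -> der (fun q => b (f q) (g q)) p (b l (g p) [+] b (f p) m).
Proof.
intros Hf Hg eps He; destruct (bil_bound _ Hb) as [M [HM Hn]].
destruct (der_lipschitz _ _ _ Hf) as [d1 [D1 L1]].
destruct (der_lipschitz _ _ _ Hg) as [d2 [D2 L2]].
destruct (der_lin (bilin_lin_l Hb (g p)) _ _ _ Hf (eps / 3) ltac:(lra)) as [d3 [D3 L3]].
destruct (der_lin (bilin_lin_r Hb (f p)) _ _ _ Hg (eps / 3) ltac:(lra)) as [d4 [D4 L4]].
pose (K := M * (nrm l + 1) * (nrm m + 1)).
assert (HK : 0 < K).
{ unfold K; generalize (nrm_ge0 l) (nrm_ge0 m); intros.
  apply Rmult_lt_0_compat; [apply Rmult_lt_0_compat |]; lra. }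
(* The product of the two increments is at most [K n^2], hence at most [eps / 3 * n] once
   [n < d5]. *)
pose (d5 := eps / 3 / K).
assert (D5 : 0 < d5) by (apply Rdiv_lt_0_compat; lra).
exists (Rmin (Rmin d1 d2) (Rmin d5 (Rmin d3 d4))); split.
{ repeat apply Rmin_glb_lt; assumption. }
intros q Hq.
assert (Q1 := Rlt_le_trans _ _ _ Hq (Rmin_l _ _)).
assert (Q2 := Rlt_le_trans _ _ _ Hq (Rmin_r _ _)).
specialize (L1 q (Rlt_le_trans _ _ _ Q1 (Rmin_l _ _))).
specialize (L2 q (Rlt_le_trans _ _ _ Q1 (Rmin_r _ _))).
assert (Q5 := Rlt_le_trans _ _ _ Q2 (Rmin_l _ _)).
assert (Q6 := Rlt_le_trans _ _ _ Q2 (Rmin_r _ _)).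
specialize (L3 q (Rlt_le_trans _ _ _ Q6 (Rmin_l _ _))).
specialize (L4 q (Rlt_le_trans _ _ _ Q6 (Rmin_r _ _))).
assert (K2 := Hn (f q [-] f p) (g q [-] g p)).
simpl in L3, L4.
set (h := (io q - io p)%C) in *; set (n := Cmod h) in *.
assert (Hn0 : 0 <= n) by apply Cmod_ge_0.
match goal with |- nrm ?e <= _ => replace e with
  (b (f q [-] f p) (g q [-] g p) [+]
   (b (f q) (g p) [-] b (f p) (g p) [-] h [*] b l (g p)) [+]
   (b (f p) (g q) [-] b (f p) (g p) [-] h [*] b (f p) m)) end.
2:{ rewrite !(lin_sub (bilin_lin_l Hb _)), !(lin_sub (bilin_lin_r Hb _)); vmod. }
apply Rle_trans with (1 := nrm_add _ _).
eapply Rle_trans; [apply Rplus_le_compat_r, nrm_add |].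
assert (nrm (b (f q [-] f p) (g q [-] g p)) <= eps / 3 * n); [| lra].
apply Rle_trans with (1 := K2).
apply Rle_trans with (K * n * n).
- unfold K; replace (M * (nrm l + 1) * (nrm m + 1) * n * n) with
    (M * ((nrm l + 1) * n) * ((nrm m + 1) * n)) by ring.
  apply Rmult_le_compat; [| apply nrm_ge0 | | exact L2].
  + apply Rmult_le_pos; [lra | apply nrm_ge0].
  + apply Rmult_le_compat_l; lra.
- apply Rmult_le_compat_r; [exact Hn0 |].
  replace (eps / 3) with (K * d5) by (unfold d5; field; lra).
  apply Rmult_le_compat_l; lra.
Qed.

Lemma der_sub {V : CNM} (f g : P -> V) p l m :
  der f p l -> der g p m -> der (fun q => f q [-] g q) p (l [-] m).
Proof.
intros Hf Hg; rewrite vsub_add, vneg_sc.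
apply der_ext with (fun q => f q [+] (-(1))%C [*] g q).
- intros; rewrite vsub_add, vneg_sc; reflexivity.
- apply der_add; [exact Hf |]; exact (der_lin (sc_linmap _) g p m Hg).
Qed.

Lemma der_sc {V : CNM} (c : P -> C) (f : P -> V) p (c' : C) f' :
  der (V := CS) c p c' -> der f p f' ->
  der (fun q => c q [*] f q) p (c' [*] f p [+] c p [*] f').
Proof. exact (der_bilin vsc_bilin c f p c' f'). Qed.

Lemma der_mul {B : BanachAlgebra} (f g : P -> B) p f' g' :
  der f p f' -> der g p g' ->
  der (fun q => f q [o] g q) p (f' [o] g p [+] f p [o] g').
Proof. exact (der_bilin amult_bilin f g p f' g'). Qed.

Lemma der_chain {V : CNM} (g : P -> C) (f : C -> V) p (g' : C) f' :
  der (V := CS) g p g' ->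
  (forall eps, 0 < eps -> exists d, 0 < d /\ forall w, Cmod (w - g p) < d ->
    nrm (f w [-] f (g p) [-] (w - g p)%C [*] f') <= eps * Cmod (w - g p)) ->
  der (fun q => f (g q)) p (g' [*] f').
Proof.
intros Hg Hf eps He.
destruct (der_lipschitz _ _ _ Hg) as [d1 [D1 L1]].
pose (K := nrm (V := CS) g' + 1).
assert (HK : 0 < K) by (unfold K; generalize (nrm_ge0 (V := CS) g'); lra).
destruct (der_lin (scl_linmap f') _ _ _ Hg (eps / 2) ltac:(lra)) as [d2 [D2 L2]].
destruct (Hf (eps / 2 / K) ltac:(apply Rdiv_lt_0_compat; lra)) as [d3 [D3 L3]].
exists (Rmin (d3 / K) (Rmin d1 d2)); split.
{ repeat apply Rmin_glb_lt; try assumption; apply Rdiv_lt_0_compat; lra. }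
intros q Hq.
assert (Q1 := Rlt_le_trans _ _ _ Hq (Rmin_l _ _)).
assert (Q2 := Rlt_le_trans _ _ _ Hq (Rmin_r _ _)).
specialize (L1 q (Rlt_le_trans _ _ _ Q2 (Rmin_l _ _))).
specialize (L2 q (Rlt_le_trans _ _ _ Q2 (Rmin_r _ _))).
change (nrm (V := CS) (vsub (V := CS) (g q) (g p))) with (Cmod (g q - g p)) in L1.
fold K in L1.
set (h := (io q - io p)%C) in *; set (n := Cmod h) in *.
assert (Hn0 : 0 <= n) by apply Cmod_ge_0.
assert (Hs : Cmod (g q - g p) < d3).
{ apply Rle_lt_trans with (1 := L1).
  replace d3 with (K * (d3 / K)) by (field; lra); apply Rmult_lt_compat_l; lra. }
specialize (L3 _ Hs).
match goal with |- nrm ?e <= _ => replace e with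
  ((f (g q) [-] f (g p) [-] (g q - g p)%C [*] f') [+]
   (g q [*] f' [-] g p [*] f' [-] h [*] (g' [*] f'))) end.
2:{ vmod. }
apply Rle_trans with (1 := nrm_add _ _).
assert (eps / 2 / K * Cmod (g q - g p) <= eps / 2 * n); [| lra].
apply Rle_trans with (eps / 2 / K * (K * n)).
- apply Rmult_le_compat_l; [left; apply Rdiv_lt_0_compat; lra | exact L1].
- right; field; lra.
Qed.

End Deriv.

Definition cder {V : CNM} (f : C -> V) (z : C) (l : V) := der (fun w => w) f z l.
Definition rder {V : CNM} (f : R -> V) (t : R) (l : V) := der RtoC f t l.

Lemma cder_vcont {V : CNM} (f : C -> V) z l : cder f z l -> vcont (T := C_UniformSpace) f z.
Proof.
intros H eps He; destruct (der_lipschitz _ _ _ _ H) as [d [D H1]].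
apply locally_Cmod.
assert (HK : 0 < nrm l + 1) by (generalize (nrm_ge0 l); lra).
exists (Rmin d (eps / (nrm l + 1))); split.
{ apply Rmin_glb_lt; [exact D | apply Rdiv_lt_0_compat; assumption]. }
intros w Hw; apply Rle_lt_trans with (1 := H1 w (Rlt_le_trans _ _ _ Hw (Rmin_l _ _))).
replace eps with ((nrm l + 1) * (eps / (nrm l + 1))) by (field; lra).
apply Rmult_lt_compat_l; [exact HK | apply Rlt_le_trans with (1 := Hw), Rmin_r].
Qed.

Lemma rder_vcont {V : CNM} (f : R -> V) t l : rder f t l -> vcont f t.
Proof.
intros H eps He; destruct (der_lipschitz _ _ _ _ H) as [d [D H1]].
apply locally_Rabs.
assert (HK : 0 < nrm l + 1) by (generalize (nrm_ge0 l); lra).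
exists (Rmin d (eps / (nrm l + 1))); split.
{ apply Rmin_glb_lt; [exact D | apply Rdiv_lt_0_compat; assumption]. }
intros w Hw; rewrite <- Cmod_R, RtoC_minus in Hw.
apply Rle_lt_trans with (1 := H1 w (Rlt_le_trans _ _ _ Hw (Rmin_l _ _))).
replace eps with ((nrm l + 1) * (eps / (nrm l + 1))) by (field; lra).
apply Rmult_lt_compat_l; [exact HK | apply Rlt_le_trans with (1 := Hw), Rmin_r].
Qed.

Lemma cder_chain {V : CNM} {P : Type} (io : P -> C) (g : P -> C) (f : C -> V) p (g' : C) f' :
  der io (V := CS) g p g' -> cder f (g p) f' -> der io (fun q => f (g q)) p (g' [*] f').
Proof. intros Hg Hf; apply der_chain; assumption. Qed.

Lemma rder_is_derive {V : CNM} (f : R -> V) t l :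
  rder f t l <-> is_derive (K := R_AbsRing) (V := realify V) f t l.
Proof.
split.
- intros H; split; [apply (is_linear_scal_l (K := R_AbsRing) (V := realify V)) |].
  intros x Hx; rewrite <- (is_filter_lim_locally_unique _ _ Hx); clear x Hx.
  intros eps; destruct (H eps (cond_pos eps)) as [d [D H1]].
  exists (mkposreal d D); intros s Hs.
  assert (Hs' : Cmod (s - t) < d) by (rewrite <- RtoC_minus, Cmod_R; exact Hs).
  specialize (H1 s Hs'); rewrite <- RtoC_minus, Cmod_R in H1; exact H1.
- intros [_ H] eps He; specialize (H t (fun P H => H) (mkposreal _ He)).
  destruct H as [d H]; exists d; split; [apply cond_pos |]; intros s Hs.
  rewrite <- RtoC_minus, Cmod_R; rewrite <- RtoC_minus, Cmod_R in Hs.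
  exact (H s Hs).
Qed.

Lemma cder_is_derive {V : CNM} (f : C -> V) z l :
  cder f z l <-> is_derive (K := C_AbsRing) (V := V) f z l.
Proof.
split.
- intros H; split; [apply (is_linear_scal_l (K := C_AbsRing) (V := V)) |].
  intros x Hx; rewrite <- (is_filter_lim_locally_unique _ _ Hx); clear x Hx.
  intros eps; destruct (H eps (cond_pos eps)) as [d [D H1]].
  exists (mkposreal d D); intros s Hs; exact (H1 s Hs).
- intros [_ H] eps He; specialize (H z (fun P H => H) (mkposreal _ He)).
  destruct H as [d H]; exists d; split; [apply cond_pos |]; intros s Hs; exact (H s Hs).
Qed.

(** * Integrals of vector-valued functions *)

Definition conton {V : CNM} (f : R -> V) (a b : R) : Prop :=
  forall t, a <= t <= b -> vcont f t.
Definition is_vint {V : CNM} (f : R -> V) (a b : R) (I : V) : Prop :=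
  is_RInt (V := realify V) f a b I.
Definition vint {V : CNM} (f : R -> V) (a b : R) : V := RInt (V := realify V) f a b.

Section Integral.
Context {V : CNM}.
Implicit Types f g : R -> V.

Lemma conton_sub f a b c d : a <= c -> d <= b -> conton f a b -> conton f c d.
Proof. intros H1 H2 H t Ht; apply H; lra. Qed.

Lemma vint_correct f a b : a <= b -> conton f a b -> is_vint f a b (vint f a b).
Proof.
intros Hab H; apply (RInt_correct (V := realify V)), (ex_RInt_continuous (V := realify V)).
intros z; rewrite Rmin_left, Rmax_right by exact Hab; intros Hz.
apply (vcont_continuous (V := V)), H, Hz.
Qed.

Lemma vint_unique f a b I : is_vint f a b I -> vint f a b = I.
Proof. exact (is_RInt_unique (V := realify V) f a b I). Qed.

Lemma is_vint_ext f g a b I : a <= b -> (forall t, a <= t <= b -> f t = g t) ->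
  is_vint f a b I -> is_vint g a b I.
Proof.
intros Hab H; apply (is_RInt_ext (V := realify V)).
intros x; rewrite Rmin_left, Rmax_right by exact Hab; intros Hx; apply H; lra.
Qed.

Lemma vint_ext f g a b : a <= b -> (forall t, a <= t <= b -> f t = g t) ->
  vint f a b = vint g a b.
Proof.
intros Hab H; apply (RInt_ext (V := realify V)).
intros x; rewrite Rmin_left, Rmax_right by exact Hab; intros Hx; apply H; lra.
Qed.

Lemma is_vint_point f a : is_vint f a a vzero.
Proof. exact (is_RInt_point (V := realify V) f a). Qed.

Lemma is_vint_add f g a b I J : is_vint f a b I -> is_vint g a b J ->
  is_vint (fun t => f t [+] g t) a b (I [+] J).
Proof. exact (is_RInt_plus (V := realify V) f g a b I J). Qed.

Lemma is_vint_sub f g a b I J : is_vint f a b I -> is_vint g a b J ->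
  is_vint (fun t => f t [-] g t) a b (I [-] J).
Proof. exact (is_RInt_minus (V := realify V) f g a b I J). Qed.

Lemma is_vint_chasles f a b c I J : is_vint f a b I -> is_vint f b c J ->
  is_vint f a c (I [+] J).
Proof. exact (is_RInt_Chasles (V := realify V) f a b c I J). Qed.

Lemma vint_chasles f a b c : a <= b -> b <= c -> conton f a c ->
  vint f a b [+] vint f b c = vint f a c.
Proof.
intros H1 H2 H; symmetry; apply vint_unique, is_vint_chasles with b;
  apply vint_correct; try assumption; eapply conton_sub; try exact H; lra.
Qed.

Lemma is_vint_bound f a b I M : a <= b -> (forall t, a <= t <= b -> nrm (f t) <= M) ->
  is_vint f a b I -> nrm I <= (b - a) * M.
Proof. exact (norm_RInt_le_const (V := realify V) f a b I M). Qed.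

Lemma vint_bound f a b M : a <= b -> conton f a b -> (forall t, a <= t <= b -> nrm (f t) <= M) ->
  nrm (vint f a b) <= (b - a) * M.
Proof. intros H1 H2 H3; exact (is_vint_bound f a b _ M H1 H3 (vint_correct f a b H1 H2)). Qed.

Lemma vint_add f g a b : a <= b -> conton f a b -> conton g a b ->
  vint (fun t => f t [+] g t) a b = vint f a b [+] vint g a b.
Proof. intros; apply vint_unique, is_vint_add; apply vint_correct; assumption. Qed.

Lemma vint_sub f g a b : a <= b -> conton f a b -> conton g a b ->
  vint (fun t => f t [-] g t) a b = vint f a b [-] vint g a b.
Proof. intros; apply vint_unique, is_vint_sub; apply vint_correct; assumption. Qed.

Lemma is_vint_ftc (F f : R -> V) a b : a <= b ->
  (forall t, a <= t <= b -> rder F t (f t)) -> conton f a b ->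
  is_vint f a b (F b [-] F a).
Proof.
intros Hab HF Hf; apply (is_RInt_derive (V := realify V)).
- intros x; rewrite Rmin_left, Rmax_right by exact Hab; intros Hx.
  apply (rder_is_derive (V := V)), HF, Hx.
- intros x; rewrite Rmin_left, Rmax_right by exact Hab; intros Hx.
  apply (vcont_continuous (V := V)), Hf, Hx.
Qed.

Lemma is_vint_0 a b : a <= b -> is_vint (fun _ => vzero : V) a b vzero.
Proof.
intros Hab; assert (H : is_vint (fun _ => vzero : V) a b (vzero [-] vzero)).
{ apply (is_vint_ftc (fun _ => vzero)); [exact Hab | intros; apply der_const |].
  intros t _; apply vcont_const. }
replace (vzero [-] vzero) with (vzero : V) in H by vmod; exact H.
Qed.

Lemma is_vint_const01 (c : V) : is_vint (fun _ => c) 0 1 c.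
Proof.
assert (H : is_vint (fun _ => c) 0 1 (1%R [*] c [-] 0%R [*] c)).
{ apply (is_vint_ftc (fun t => t [*] c)); [lra | | intros t _; apply vcont_const].
  intros t _; apply der_eq with (2 := vsc_1 c).
  exact (der_lin _ (scl_linmap c) _ _ _ (der_io RtoC t)). }
replace (1%R [*] c [-] 0%R [*] c) with c in H by vmod; exact H.
Qed.

Lemma rder_vint f a t : (forall u, vcont f u) -> rder (fun u => vint f a u) t (f t).
Proof.
intros H; apply rder_is_derive.
apply (is_derive_RInt (V := realify V) f _ a t).
- apply filter_forall; intros u.
  apply (RInt_correct (V := realify V)), (ex_RInt_continuous (V := realify V)).
  intros z _; apply (vcont_continuous (V := V)), H.
- apply (vcont_continuous (V := V)), H.
Qed.

(** Integrate the derivative of [F t - t l]. This mean value inequality turns closeness of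
    derivatives into the uniform control of difference quotients that differentiation under an
    integral requires. *)
Lemma mvt01 (F F' : R -> V) l eps :
  (forall t, 0 <= t <= 1 -> rder F t (F' t)) -> conton F' 0 1 ->
  (forall t, 0 <= t <= 1 -> nrm (F' t [-] l) <= eps) ->
  nrm (F 1 [-] F 0 [-] l) <= eps.
Proof.
intros HF Hc Hb.
assert (H0 : rder (fun t => t [*] l) 0 l) by
  (apply der_eq with (2 := vsc_1 l); exact (der_lin _ (scl_linmap l) _ _ _ (der_io RtoC 0))).
assert (H : is_vint (fun t => F' t [-] l) 0 1 (F 1 [-] 1%C [*] l [-] (F 0 [-] 0%C [*] l))).
{ apply (is_vint_ftc (fun t => F t [-] t [*] l)); [lra | |].
  - intros t Ht; apply der_sub; [apply HF, Ht |].
    apply der_eq with (2 := vsc_1 l); exact (der_lin _ (scl_linmap l) _ _ _ (der_io RtoC t)).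
  - intros t Ht; apply vcont_sub; [apply Hc, Ht | apply vcont_const]. }
assert (H1 := is_vint_bound _ 0 1 _ eps Rle_0_1 Hb H).
replace (F 1 [-] F 0 [-] l) with (F 1 [-] 1%C [*] l [-] (F 0 [-] 0%C [*] l)) by vmod.
lra.
Qed.

End Integral.

(** A linear map commutes with each Riemann sum, and its continuity carries the identity to the
    limit. *)
Lemma is_vint_lin {U V : CNM} {b : U -> V} (Hb : linmap b) (f : R -> U) x y I :
  is_vint f x y I -> is_vint (fun t => b (f t)) x y (b I).
Proof.
intros H.
assert (HR : forall ptd, Riemann_sum (V := realify V) (fun t => b (f t)) ptd =
                         b (Riemann_sum (V := realify U) f ptd)).
{ intros ptd; symmetry.
  apply SF_cons_ind with (s := ptd); clear ptd.
  - intros x0; exact (lin_0 Hb).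
  - intros h s IH; rewrite !Riemann_sum_cons, <- IH.
    etransitivity; [exact (lin_add _ Hb _ _) |].
    apply (f_equal2 (vadd (V := V))); [exact (lin_sc _ Hb _ _) | reflexivity]. }
unfold is_vint, is_RInt.
apply filterlim_ext with (fun ptd =>
  b (scal (V := realify U) (sign (y - x)) (Riemann_sum (V := realify U) f ptd))).
- intros ptd; etransitivity; [exact (lin_sc _ Hb (RtoC (sign (y - x))) _) |].
  rewrite HR; reflexivity.
- eapply filterlim_comp; [exact H |].
  apply (vcont_continuous (T := U) (V := V) b).
  exact (vcont_lin Hb (fun u : U => u) I (proj2 (vcont_continuous (T := U) _ _) (continuous_id (U := U) I))).
Qed.

Lemma vint_lin {U V : CNM} {b : U -> V} (Hb : linmap b) (f : R -> U) x y :
  x <= y -> conton f x y -> vint (fun t => b (f t)) x y = b (vint f x y).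
Proof. intros H1 H2; apply vint_unique, (is_vint_lin Hb), vint_correct; assumption. Qed.

(** * Integrals depending on a parameter *)

Section Parametric.
Context {P : UniformSpace} {V : CNM}.

Definition jcont (g : R -> P -> V) (t : R) (p : P) : Prop :=
  vcont (T := prod_UniformSpace R_UniformSpace P) (fun tp => g (fst tp) (snd tp)) (t, p).

Lemma jcont_l (g : R -> P -> V) t p : jcont g t p -> vcont (fun u => g u p) t.
Proof.
intros H; apply (vcont_comp (S := prod_UniformSpace R_UniformSpace P) (fun u => (u, p))
  (fun tp => g (fst tp) (snd tp)) t); [| exact H].
intros Q [e He]; exists e; intros y Hy; apply He; split; [exact Hy | apply ball_center].
Qed.

Lemma jcont_r (g : R -> P -> V) t p : jcont g t p -> vcont (fun q => g t q) p.
Proof.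
intros H; apply (vcont_comp (S := prod_UniformSpace R_UniformSpace P) (fun q => (t, q))
  (fun tp => g (fst tp) (snd tp)) p); [| exact H].
intros Q [e He]; exists e; intros y Hy; apply He; split; [apply ball_center | exact Hy].
Qed.

Lemma jcont_fst (f : R -> V) t p : vcont f t -> jcont (fun u _ => f u) t p.
Proof.
intros H; apply (vcont_comp (T := prod_UniformSpace R_UniformSpace P) (S := R_UniformSpace)
  (fun tp => fst tp) f (t, p)); [apply continuous_fst | exact H].
Qed.

Lemma jcont_snd (f : P -> V) t p : vcont f p -> jcont (fun _ q => f q) t p.
Proof.
intros H; apply (vcont_comp (T := prod_UniformSpace R_UniformSpace P) (S := P)
  (fun tp => snd tp) f (t, p)); [apply continuous_snd | exact H].
Qed.

(** Joint continuity at the points [(u, p0)] defines a gauge on [[a, b]]; compactness bounds it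
    below on suitable centres. Both [g t p] and [g t p0] are compared with [g u p0] for a centre [u]
    near [t]. *)
Lemma tube (g : R -> P -> V) a b p0 :
  (forall t, a <= t <= b -> jcont g t p0) ->
  forall eps, 0 < eps -> locally p0 (fun p => forall t, a <= t <= b ->
    nrm (g t p [-] g t p0) < eps).
Proof.
intros H eps He.
assert (K : forall t, exists d : posreal, a <= t <= b -> forall s p, Rabs (s - t) < d ->
  ball p0 d p -> nrm (g s p [-] g t p0) < eps / 2).
{ intros t; destruct (classic (a <= t <= b)) as [Ht | Ht].
  - destruct (H t Ht (eps / 2) ltac:(lra)) as [d Hd].
    exists d; intros _ s p Hs Hp; apply (Hd (s, p)); split; assumption.
  - exists (mkposreal 1 Rlt_0_1); tauto. }
pose (delta := fun t => proj1_sig (constructive_indefinite_description _ (K t))).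
destruct (compactness_value_1d a b delta) as [d Hd].
exists d; intros p Hp t Ht; apply NNPP; intros Hn; apply (Hd t Ht).
intros [u [Hu [H1 H2]]]; apply Hn.
unfold delta in H1, H2.
destruct (constructive_indefinite_description _ (K u)) as [e Ke]; simpl in *.
assert (A1 := Ke Hu t p H1 (ball_le _ _ _ H2 _ Hp)).
assert (A2 := Ke Hu t p0 H1 (ball_center _ _)).
replace (g t p [-] g t p0) with ((g t p [-] g u p0) [-] (g t p0 [-] g u p0)) by vmod.
apply Rle_lt_trans with (1 := nrm_sub _ _); lra.
Qed.

Lemma vcont_vint (g : R -> P -> V) a b p0 : a <= b ->
  (forall t, a <= t <= b -> jcont g t p0) ->
  locally p0 (fun p => conton (fun t => g t p) a b) ->
  vcont (fun p => vint (fun t => g t p) a b) p0.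
Proof.
intros Hab H Hn eps He.
assert (Hd : 0 < eps / (2 * (b - a + 1))) by (apply Rdiv_lt_0_compat; lra).
generalize (loc_and _ _ _ Hn (tube g a b p0 H _ Hd)); apply filter_imp; intros p [H1 H2].
rewrite <- vint_sub.
- apply Rle_lt_trans with ((b - a) * (eps / (2 * (b - a + 1)))).
  + apply vint_bound; [exact Hab | | intros t Ht; left; apply H2, Ht].
    intros t Ht; apply vcont_sub; [apply H1, Ht | apply jcont_l, H, Ht].
  + apply Rle_lt_trans with ((b - a + 1) * (eps / (2 * (b - a + 1)))).
    * apply Rmult_le_compat_r; lra.
    * replace ((b - a + 1) * (eps / (2 * (b - a + 1)))) with (eps / 2) by (field; lra); lra.
- exact Hab.
- exact H1.
- intros t Ht; apply jcont_l, H, Ht.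
Qed.

End Parametric.

(** The difference quotients are assumed uniform in [t]. Dividing [eps] by [b - a + 1] instead of
    [b - a] covers an interval reduced to a point. *)
Lemma der_vint {P : Type} (io : P -> C) {V : CNM} (g : R -> P -> V) (g' : R -> V) a b p :
  a <= b ->
  (exists d, 0 < d /\ forall q, Cmod (io q - io p) < d -> conton (fun t => g t q) a b) ->
  conton g' a b ->
  (forall eps, 0 < eps -> exists d, 0 < d /\ forall q t, Cmod (io q - io p) < d -> a <= t <= b ->
    nrm (g t q [-] g t p [-] (io q - io p)%C [*] g' t) <= eps * Cmod (io q - io p)) ->
  der io (fun q => vint (fun t => g t q) a b) p (vint g' a b).
Proof.
intros Hab [d1 [D1 H1]] H2 H3 eps He.
destruct (H3 (eps / (b - a + 1)) ltac:(apply Rdiv_lt_0_compat; lra)) as [d2 [D2 H4]].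
exists (Rmin d1 d2); split; [apply Rmin_glb_lt; assumption |]; intros q Hq.
assert (C1 := H1 q (Rlt_le_trans _ _ _ Hq (Rmin_l _ _))).
assert (C2 : conton (fun t => g t p) a b).
{ apply H1; replace (io p - io p)%C with (RtoC 0) by ring; rewrite Cmod_0; exact D1. }
rewrite <- vint_sub by assumption.
rewrite <- (vint_lin (sc_linmap (io q - io p)%C)) by assumption.
assert (C3 : conton (fun t => (io q - io p)%C [*] g' t) a b).
{ intros t Ht; apply (vcont_lin (sc_linmap _)), H2, Ht. }
rewrite <- vint_sub.
- assert (Hn := Cmod_ge_0 (io q - io p)).
  apply Rle_trans with ((b - a) * (eps / (b - a + 1) * Cmod (io q - io p))).
  + apply vint_bound; [exact Hab | |].
    * intros t Ht; apply vcont_sub; [apply vcont_sub | apply C3, Ht]; [apply C1, Ht | apply C2, Ht].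
    * intros t Ht; apply H4; [| exact Ht]; apply Rlt_le_trans with (1 := Hq), Rmin_r.
  + rewrite <- Rmult_assoc; apply Rmult_le_compat_r; [exact Hn |].
    apply Rle_trans with ((b - a + 1) * (eps / (b - a + 1))).
    * apply Rmult_le_compat_r; [left; apply Rdiv_lt_0_compat; lra | lra].
    * right; field; lra.
- exact Hab.
- intros t Ht; apply vcont_sub; [apply C1, Ht | apply C2, Ht].
- exact C3.
Qed.

Lemma Cmod_scaled (s : R) (h : C) : 0 <= s <= 1 -> Cmod (s * h) <= Cmod h.
Proof.
intros Hs; rewrite Cmod_mult, Cmod_R, Rabs_pos_eq by lra.
generalize (Cmod_ge_0 h); nra.
Qed.

(** The mean value inequality along the segment from [p] to [q] reduces the uniform difference
    quotient to the closeness of [g'] at neighbouring parameters, which [tube] supplies. *)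
Lemma rder_vint_param {V : CNM} (g g' : R -> R -> V) a b (p : R) : a <= b ->
  locally p (fun q => conton (fun t => g t q) a b /\
    forall t, a <= t <= b -> rder (g t) q (g' t q) /\ vcont (g' t) q) ->
  (forall t, a <= t <= b -> jcont (P := R_UniformSpace) g' t p) ->
  rder (fun q => vint (fun t => g t q) a b) p (vint (fun t => g' t p) a b).
Proof.
intros Hab Hn Hj; apply der_vint.
- exact Hab.
- destruct (proj1 (locally_Rabs _ _) Hn) as [d [D H]]; exists d; split; [exact D |].
  intros q Hq; rewrite <- RtoC_minus, Cmod_R in Hq; apply H, Hq.
- intros t Ht; exact (jcont_l (P := R_UniformSpace) _ _ _ (Hj t Ht)).
- intros eps He.
  destruct (proj1 (locally_Rabs _ _) (loc_and _ _ _ Hn (tube _ a b p Hj eps He))) as [d [D H]].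
  exists d; split; [exact D |]; intros q t Hq Ht.
  set (h := (q - p)%C).
  assert (Hs : forall s, 0 <= s <= 1 -> Rabs (p + s * (q - p) - p) < d).
  { intros s Hs; apply Rle_lt_trans with (2 := Hq).
    replace (p + s * (q - p) - p) with (s * (q - p)) by ring.
    rewrite <- RtoC_minus, Cmod_R, Rabs_mult, (Rabs_pos_eq s) by lra.
    generalize (Rabs_pos (q - p)); nra. }
  replace (g t q) with (g t (p + 1 * (q - p))) by (f_equal; ring).
  replace (g t p) with (g t (p + 0 * (q - p))) by (f_equal; ring).
  apply (mvt01 (fun s => g t (p + s * (q - p))) (fun s => h [*] g' t (p + s * (q - p)))).
  + intros s Hs1; specialize (Hs s Hs1); destruct (H _ Hs) as [[_ H1] _].
    destruct (H1 t Ht) as [H2 _].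
    intros e0 He0.
    (* The affine reparametrisation scales increments by [|q - p|], and tolerances are divided by
       it, so the degenerate segment is set apart. *)
    destruct (Req_dec q p) as [Eqp | Nqp].
    { exists 1; split; [lra |]; intros r _.
      replace (g t (p + r * (q - p)) [-] g t (p + s * (q - p)) [-] (r - s)%C [*] (h [*] g' t (p + s * (q - p))))
        with (vzero : V).
      - rewrite nrm_0; apply Rmult_le_pos; [lra | apply Cmod_ge_0].
      - rewrite Eqp; unfold h; rewrite Eqp.
        replace (p + r * (p - p)) with (p + s * (p - p)) by ring; vmod. }
    assert (Hp : 0 < Rabs (q - p)) by (apply Rabs_pos_lt; lra).
    destruct (H2 (e0 / Rabs (q - p)) ltac:(apply Rdiv_lt_0_compat; lra)) as [d2 [D2 H3]].
    exists (d2 / Rabs (q - p)); split; [apply Rdiv_lt_0_compat; lra |].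
    intros r Hr; specialize (H3 (p + r * (q - p))).
    assert (E : (RtoC (p + r * (q - p)) - RtoC (p + s * (q - p)) = (r - s) * h)%C).
    { unfold h; rewrite !RtoC_plus, !RtoC_mult, RtoC_minus; ring. }
    rewrite E in H3; rewrite Cmod_mult in H3.
    assert (Eh : Cmod h = Rabs (q - p)) by (unfold h; rewrite <- RtoC_minus, Cmod_R; reflexivity).
    rewrite Eh in H3; rewrite vsc_assoc.
    eapply Rle_trans; [apply H3 |].
    * replace d2 with (d2 / Rabs (q - p) * Rabs (q - p)) by (field; lra).
      apply Rmult_lt_compat_r; assumption.
    * right; field; lra.
  + intros s Hs1; specialize (Hs s Hs1); destruct (H _ Hs) as [[_ H1] _].
    destruct (H1 t Ht) as [_ H2].
    apply (vcont_lin (sc_linmap h)).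
    apply (vcont_comp (S := R_UniformSpace) (fun s => p + s * (q - p)) (g' t)); [| exact H2].
    apply (continuous_plus (V := R_NormedModule)); [apply continuous_const |].
    apply (continuous_scal_l (K := R_AbsRing) (V := R_NormedModule)), continuous_id.
  + intros s Hs1; specialize (Hs s Hs1); destruct (H _ Hs) as [_ H2].
    replace (h [*] g' t (p + s * (q - p)) [-] h [*] g' t p) with
      (h [*] (g' t (p + s * (q - p)) [-] g' t p)) by vmod.
    eapply Rle_trans; [apply nrm_sc_le |]; rewrite Rmult_comm.
    apply Rmult_le_compat_r; [apply Cmod_ge_0 | left; apply H2, Ht].
Qed.

Lemma cder_vint_param {V : CNM} (g g' : R -> C -> V) a b (p : C) : a <= b ->
  locally (T := C_UniformSpace) p (fun q => conton (fun t => g t q) a b /\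
    forall t, a <= t <= b -> cder (g t) q (g' t q) /\ vcont (T := C_UniformSpace) (g' t) q) ->
  (forall t, a <= t <= b -> jcont (P := C_UniformSpace) g' t p) ->
  cder (fun q => vint (fun t => g t q) a b) p (vint (fun t => g' t p) a b).
Proof.
intros Hab Hn Hj; apply der_vint.
- exact Hab.
- destruct (proj1 (locally_Cmod _ _) Hn) as [d [D H]]; exists d; split; [exact D |].
  intros q Hq; apply H, Hq.
- intros t Ht; exact (jcont_l (P := C_UniformSpace) _ _ _ (Hj t Ht)).
- intros eps He.
  destruct (proj1 (locally_Cmod _ _) (loc_and _ _ _ Hn (tube _ a b p Hj eps He))) as [d [D H]].
  exists d; split; [exact D |]; intros q t Hq Ht.
  set (h := (q - p)%C).
  assert (Hs : forall s, 0 <= s <= 1 -> Cmod (p + s * h - p) < d).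
  { intros s Hs; apply Rle_lt_trans with (2 := Hq).
    replace (p + s * h - p)%C with (s * h)%C by ring.
    apply Cmod_scaled, Hs. }
  assert (Hdg : forall s, rder (V := CS) (fun s => p + s * h)%C s h).
  { intros s; apply der_eq with (vadd (V := CS) vzero (vsc (V := CS) h (RtoC 1))).
    - apply der_ext with (fun s => vadd (V := CS) p (vsc (V := CS) h (RtoC s))).
      + intros r; change ((p + h * r)%C = (p + r * h)%C); ring.
      + apply der_add; [apply der_const |].
        exact (der_lin _ (sc_linmap h) _ _ _ (der_io RtoC s)).
    - change ((0 + h * 1)%C = h); ring. }
  replace (g t q) with (g t (p + 1%R * h)%C) by (f_equal; unfold h; ring).
  replace (g t p) with (g t (p + 0%R * h)%C) by (f_equal; ring).
  apply (mvt01 (fun s => g t (p + s * h)%C) (fun s => h [*] g' t (p + s * h)%C)).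
  + intros s Hs1; specialize (Hs s Hs1); destruct (H _ Hs) as [[_ H1] _].
    apply (cder_chain RtoC (fun s => p + s * h)%C (g t) s h _ (Hdg s)), (H1 t Ht).
  + intros s Hs1; specialize (Hs s Hs1); destruct (H _ Hs) as [[_ H1] _].
    destruct (H1 t Ht) as [_ H2].
    apply (vcont_lin (sc_linmap h)).
    apply (vcont_compC (T := R_UniformSpace) (fun s : R => p + s * h)%C (g' t)); [| exact H2].
    apply rder_vcont with h, Hdg.
  + intros s Hs1; specialize (Hs s Hs1); destruct (H _ Hs) as [_ H2].
    replace (h [*] g' t (p + s * h)%C [-] h [*] g' t p) with
      (h [*] (g' t (p + s * h)%C [-] g' t p)) by vmod.
    eapply Rle_trans; [apply nrm_sc_le |]; rewrite Rmult_comm.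
    apply Rmult_le_compat_r; [apply Cmod_ge_0 | left; apply H2, Ht].
Qed.

(** * Banach algebras and resolvents *)

Definition clamp (a b u : R) : R := Rmax a (Rmin b u).

Lemma clamp_in a b u : a <= b -> a <= clamp a b u <= b.
Proof. intros H; unfold clamp, Rmax, Rmin; repeat destruct Rle_dec; lra. Qed.

Lemma clamp_id a b u : a <= u <= b -> clamp a b u = u.
Proof. intros H; unfold clamp, Rmax, Rmin; repeat destruct Rle_dec; lra. Qed.

Lemma continuous_clamp a b u : continuous (clamp a b) u.
Proof.
apply filterlim_locally; intros e; exists e; intros v Hv.
apply Rle_lt_trans with (2 := Hv).
change (Rabs (clamp a b v - clamp a b u) <= Rabs (v - u)).
unfold clamp, Rmax, Rmin; repeat destruct Rle_dec; unfold Rabs; repeat destruct Rcase_abs; lra.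
Qed.

Lemma jcont_swap {V : CNM} (f : R -> R -> V) u v :
  jcont (P := R_UniformSpace) f u v -> jcont (P := R_UniformSpace) (fun v u => f u v) v u.
Proof.
intros H.
apply (vcont_comp (T := prod_UniformSpace R_UniformSpace R_UniformSpace)
  (S := prod_UniformSpace R_UniformSpace R_UniformSpace) (fun tp => (snd tp, fst tp))
  (fun tp => f (fst tp) (snd tp)) (v, u)); [| exact H].
intros Q [e He]; exists e; intros y [H1 H2]; apply He; split; [exact H2 | exact H1].
Qed.

Lemma jcont_clamp {V : CNM} (f : R -> R -> V) a b c d u v :
  jcont (P := R_UniformSpace) f (clamp a b u) (clamp c d v) ->
  jcont (P := R_UniformSpace) (fun u v => f (clamp a b u) (clamp c d v)) u v.
Proof.
intros H.
apply (vcont_comp (T := prod_UniformSpace R_UniformSpace R_UniformSpace)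
  (S := prod_UniformSpace R_UniformSpace R_UniformSpace)
  (fun tp => (clamp a b (fst tp), clamp c d (snd tp)))
  (fun tp => f (fst tp) (snd tp)) (u, v)); [| exact H].
intros Q [e He].
destruct (proj1 (filterlim_locally _ _) (continuous_clamp a b u) e) as [e1 H1].
destruct (proj1 (filterlim_locally _ _) (continuous_clamp c d v) e) as [e2 H2].
assert (Hm : 0 < Rmin e1 e2) by (apply Rmin_glb_lt; apply cond_pos).
exists (mkposreal _ Hm); intros y [Y1 Y2]; apply He; split.
- apply H1; eapply ball_le; [| exact Y1]; apply Rmin_l.
- apply H2; eapply ball_le; [| exact Y2]; apply Rmin_r.
Qed.

Section Fubini.
Context {V : CNM}.

(** As functions of the upper limit [q] of the [u]-integral, both sides have derivative the integral
    of [f q v] over [v], and both vanish at [q = a]. *)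
Lemma fubini_global (f : R -> R -> V) a b c d : a <= b -> c <= d ->
  (forall u v, jcont (P := R_UniformSpace) f u v) ->
  vint (fun u => vint (fun v => f u v) c d) a b = vint (fun v => vint (fun u => f u v) a b) c d.
Proof.
intros Hab Hcd H.
assert (Hs : forall u v, jcont (P := R_UniformSpace) (fun v u => f u v) v u)
  by (intros; apply jcont_swap, H).
assert (C1 : forall u v, vcont (fun u => f u v) u) by (intros; exact (jcont_l _ _ _ (H u v))).
assert (C2 : forall u v, vcont (fun v => f u v) v) by (intros; exact (jcont_r _ _ _ (H u v))).
assert (HG : is_vint (fun u => vint (fun v => f u v) c d) a b
  (vint (fun v => vint (fun u => f u v) a b) c d [-] vint (fun v => vint (fun u => f u v) a a) c d)).
{ apply (is_vint_ftc (fun q => vint (fun v => vint (fun u => f u v) a q) c d)); [exact Hab | |].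
  - intros q Hq; apply (rder_vint_param (fun v q => vint (fun u => f u v) a q) (fun v q => f q v)).
    + exact Hcd.
    + apply filter_forall; intros p; split.
      (* The derivative at [q = a] is two-sided, so upper limits below [a] occur and lead to a
         reversed integral. *)
      * intros v Hv; destruct (Rle_dec a p) as [Hp | Hp].
        -- apply (vcont_vint (P := R_UniformSpace) f a p v Hp); [intros; apply H |].
           apply filter_forall; intros v' u Hu; apply C1.
        -- apply vcont_ext with (fun v => vneg (vint (fun u => f u v) p a)).
           { intros v'; apply (opp_RInt_swap (V := realify V)).
             apply (ex_RInt_continuous (V := realify V)); intros z _.
             apply (vcont_continuous (V := V)), C1. }
           apply vcont_neg.
           apply (vcont_vint (P := R_UniformSpace) f p a v ltac:(lra)); [intros; apply H |].
           apply filter_forall; intros v' u Hu; apply C1.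
      * intros v Hv; split; [| apply C1].
        apply (rder_vint (fun u => f u v) a p); intros; apply C1.
    + intros v Hv; apply Hs.
  - intros u Hu; apply (vcont_vint (P := R_UniformSpace) (fun v u => f u v) c d u Hcd).
    + intros v Hv; apply Hs.
    + apply filter_forall; intros u' v Hv; apply C2. }
rewrite (vint_unique _ _ _ _ HG).
rewrite (vint_ext (fun v => vint (fun u => f u v) a a) (fun _ => vzero) c d Hcd).
2:{ intros v Hv; apply vint_unique, is_vint_point. }
assert (E0 : vint (fun _ : R => (vzero : V)) c d = vzero) by apply vint_unique, is_vint_0, Hcd.
rewrite E0; vmod.
Qed.

Lemma fubini (f : R -> R -> V) a b c d : a <= b -> c <= d ->
  (forall u v, a <= u <= b -> c <= v <= d -> jcont (P := R_UniformSpace) f u v) ->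
  vint (fun u => vint (fun v => f u v) c d) a b = vint (fun v => vint (fun u => f u v) a b) c d.
Proof.
intros Hab Hcd H.
(* Retracting the plane onto the rectangle gives an integrand that is jointly continuous everywhere
   and unchanged on the rectangle. *)
pose (g := fun u v => f (clamp a b u) (clamp c d v)).
transitivity (vint (fun u => vint (fun v => g u v) c d) a b).
- apply vint_ext; [exact Hab |]; intros u Hu; apply vint_ext; [exact Hcd |]; intros v Hv.
  unfold g; rewrite !clamp_id by assumption; reflexivity.
- rewrite fubini_global.
  + apply vint_ext; [exact Hcd |]; intros v Hv; apply vint_ext; [exact Hab |]; intros u Hu.
    unfold g; rewrite !clamp_id by assumption; reflexivity.
  + exact Hab.
  + exact Hcd.
  + intros u v; apply jcont_clamp, H; apply clamp_in; assumption.
Qed.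

Lemma conton_vint (f : R -> R -> V) a b c d : a <= b ->
  (forall u v, a <= u <= b -> c <= v <= d -> jcont (P := R_UniformSpace) f u v) ->
  c <= d ->
  conton (fun v => vint (fun u => f u (clamp c d v)) a b) c d.
Proof.
intros Hab H Hcd v Hv.
assert (HJ : forall u v, a <= u <= b ->
  jcont (P := R_UniformSpace) (fun u v => f u (clamp c d v)) u v).
{ intros u w Hu.
  apply (vcont_comp (T := prod_UniformSpace R_UniformSpace R_UniformSpace)
    (S := prod_UniformSpace R_UniformSpace R_UniformSpace)
    (fun tp => (fst tp, clamp c d (snd tp))) (fun tp => f (fst tp) (snd tp)) (u, w)).
  - intros Q [e He].
    destruct (proj1 (filterlim_locally _ _) (continuous_clamp c d w) e) as [e2 H2].
    assert (Hm : 0 < Rmin e e2) by (apply Rmin_glb_lt; apply cond_pos).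
    exists (mkposreal _ Hm); intros y [Y1 Y2]; apply He; split.
    + eapply ball_le; [| exact Y1]; apply Rmin_l.
    + apply H2; eapply ball_le; [| exact Y2]; apply Rmin_r.
  - apply H; [exact Hu | apply clamp_in, Hcd]. }
apply (vcont_vint (P := R_UniformSpace) (fun u v => f u (clamp c d v)) a b v Hab).
- intros u Hu; apply HJ, Hu.
- apply filter_forall; intros v' u Hu; exact (jcont_l _ _ _ (HJ u v' Hu)).
Qed.

End Fubini.

Section Algebra.
Context {B : BanachAlgebra}.
Implicit Types x y z : B.

Lemma amulA x y z : (x [o] y) [o] z = x [o] (y [o] z).
Proof. symmetry; apply amult_assoc. Qed.
Lemma amul_add_l x y z : (x [+] y) [o] z = x [o] z [+] y [o] z.
Proof. apply amult_plus_l. Qed.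
Lemma amul_add_r x y z : x [o] (y [+] z) = x [o] y [+] x [o] z.
Proof. apply amult_plus_r. Qed.
Lemma amul_sc_l c x y : (c [*] x) [o] y = c [*] (x [o] y).
Proof. apply amult_scal_l. Qed.
Lemma amul_sc_r c x y : x [o] (c [*] y) = c [*] (x [o] y).
Proof. apply amult_scal_r. Qed.
Lemma amul_neg_l x y : (vneg x) [o] y = vneg (x [o] y).
Proof. rewrite !vneg_sc; apply amul_sc_l. Qed.
Lemma amul_neg_r x y : x [o] (vneg y) = vneg (x [o] y).
Proof. rewrite !vneg_sc; apply amul_sc_r. Qed.
Lemma amul_sub_l x y z : (x [-] y) [o] z = x [o] z [-] y [o] z.
Proof. rewrite !vsub_add, amul_add_l, amul_neg_l; reflexivity. Qed.
Lemma amul_sub_r x y z : x [o] (y [-] z) = x [o] y [-] x [o] z.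
Proof. rewrite !vsub_add, amul_add_r, amul_neg_r; reflexivity. Qed.
Lemma amul_0_l x : vzero [o] x = vzero.
Proof. rewrite <- (vsc_0 vzero) at 1; rewrite amul_sc_l; apply vsc_0. Qed.
Lemma amul_0_r x : x [o] vzero = vzero.
Proof. rewrite <- (vsc_0 vzero) at 1; rewrite amul_sc_r; apply vsc_0. Qed.
Lemma amul_1_l x : aone [o] x = x.
Proof. apply amult_one_l. Qed.
Lemma amul_1_r x : x [o] aone = x.
Proof. apply amult_one_r. Qed.
Lemma nrm_mul x y : nrm (x [o] y) <= nrm x * nrm y.
Proof. apply amult_norm. Qed.
End Algebra.

Ltac aexp := rewrite ?amulA, ?amul_add_l, ?amul_add_r, ?amul_sub_l, ?amul_sub_r, ?amul_neg_l,
  ?amul_neg_r, ?amul_sc_l, ?amul_sc_r, ?amul_0_l, ?amul_0_r, ?amul_1_l, ?amul_1_r.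
Ltac alg := repeat (progress aexp); vmod.

(** * Inverses and the Neumann series *)

Section Invertible.
Context {B : BanachAlgebra}.
Implicit Types x y z : B.

Lemma inverse_unique x y z : inverse_of x y -> inverse_of x z -> y = z.
Proof.
intros [H1 H2] [H3 H4].
rewrite <- (amul_1_r y), <- H3, <- amulA, H2; apply amul_1_l.
Qed.

Lemma inverse_left_right x y z : y [o] x = aone -> x [o] z = aone -> y = z /\ inverse_of x z.
Proof.
intros H1 H2.
assert (E : y = z) by (rewrite <- (amul_1_r y), <- H2, <- amulA, H1; apply amul_1_l).
split; [exact E |]; split; [exact H2 |]; change (z [o] x = aone); rewrite <- E; exact H1.
Qed.

Lemma ainv_spec x : invertible x -> inverse_of x (ainv x).
Proof.
intros [y Hy]; apply (iota_correct (inverse_of x)); exists y; split; [exact Hy |].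
intros z Hz; apply inverse_unique with x; assumption.
Qed.

Lemma ainv_eq x y : inverse_of x y -> ainv x = y.
Proof.
intros H; apply inverse_unique with x; [| exact H]; apply ainv_spec; exists y; exact H.
Qed.

Lemma inverse_mul x x' y y' : inverse_of x x' -> inverse_of y y' ->
  inverse_of (x [o] y) (y' [o] x').
Proof.
intros [H1 H2] [H3 H4]; split; change amult with (fun a b : B => a [o] b) in *; simpl in *.
- rewrite amulA, <- (amulA y), H3, amul_1_l; exact H1.
- rewrite amulA, <- (amulA x'), H2, amul_1_l; exact H4.
Qed.

Lemma inverse_comm x y a : inverse_of x y -> a [o] x = x [o] a -> a [o] y = y [o] a.
Proof.
intros [H1 H2] H.
rewrite <- (amul_1_l (a [o] y)), <- H2, amulA, <- (amulA x), <- H, amulA, H1.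
rewrite amul_1_r; reflexivity.
Qed.

Lemma nrm_apow x n : nrm (apow x n) <= (nrm x) ^ n * nrm (aone : B).
Proof.
induction n as [| n IH]; simpl; [lra |].
apply Rle_trans with (1 := nrm_mul _ _); rewrite Rmult_assoc.
apply Rmult_le_compat_l; [apply nrm_ge0 | exact IH].
Qed.

Lemma apow_comm x n : apow x n [o] x = x [o] apow x n.
Proof.
induction n as [| n IH]; simpl; [rewrite amul_1_l, amul_1_r; reflexivity |].
change (amult x (apow x n)) with (x [o] apow x n); rewrite amulA, IH; reflexivity.
Qed.

(** The partial sums of the geometric series, multiplied by [1 - x] on either side, telescope to
    [1 - x^(n+1)], and the power tends to zero. *)
Lemma neumann x : nrm x < 1 -> exists y, inverse_of (aone [-] x) y.
Proof.
intros Hx.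
assert (Hs : ex_series (K := C_AbsRing) (V := B) (apow x)).
{ apply (ex_series_le (K := C_AbsRing) (V := B) _ (fun n => (nrm x) ^ n * nrm (aone : B))).
  - intros n; apply nrm_apow.
  - apply (ex_series_scal_r (nrm (aone : B))), ex_series_geom.
    rewrite Rabs_pos_eq by apply nrm_ge0; exact Hx. }
destruct Hs as [S HS]; exists S.
pose (s := fun n => sum_n (G := B) (apow x) n : B).
assert (HSl : forall n, (aone [-] x) [o] s n = aone [-] apow x (Datatypes.S n)).
{ induction n as [| n IH].
  - unfold s; rewrite sum_O; simpl; change (amult x aone) with (x [o] aone); alg.
  - unfold s; rewrite sum_Sn.
    change ((aone [-] x) [o] (s n [+] apow x (Datatypes.S n)) = aone [-] (x [o] apow x (Datatypes.S n))).
    rewrite amul_add_r, IH; alg. }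
assert (HSr : forall n, s n [o] (aone [-] x) = aone [-] apow x (Datatypes.S n)).
{ induction n as [| n IH].
  - unfold s; rewrite sum_O; simpl; change (amult x aone) with (x [o] aone); alg.
  - unfold s; rewrite sum_Sn.
    change ((s n [+] apow x (Datatypes.S n)) [o] (aone [-] x) = aone [-] (x [o] apow x (Datatypes.S n))).
    rewrite amul_add_l, IH, amul_sub_r, amul_1_r, apow_comm; vmod. }
assert (Hc : forall eps, 0 < eps -> exists n, nrm (S [-] s n) < eps /\ nrm (apow x (Datatypes.S n)) < eps).
{ intros eps He.
  assert (He2 : 0 < eps / norm_factor (V := B)).
  { apply Rdiv_lt_0_compat; [exact He | apply norm_factor_gt_0]. }
  destruct (proj1 (filterlim_locally _ _) HS (mkposreal _ He2)) as [N1 HN1].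
  assert (H1 : 0 <= nrm (aone : B)) by apply nrm_ge0.
  destruct (pow_lt_1_zero (nrm x) ltac:(rewrite Rabs_pos_eq by apply nrm_ge0; exact Hx)
    (eps / (nrm (aone : B) + 1)) ltac:(apply Rdiv_lt_0_compat; lra)) as [N2 HN2].
  exists (max N1 N2); split.
  - generalize (norm_compat2 (V := B) _ _ _ (HN1 (max N1 N2) ltac:(lia))); simpl.
    intros H; rewrite <- nrm_neg.
    replace eps with (norm_factor (V := B) * (eps / norm_factor (V := B))).
    2:{ field; apply Rgt_not_eq, norm_factor_gt_0. }
    replace (vneg (S [-] s (max N1 N2))) with (s (max N1 N2) [-] S) by vmod; exact H.
  - apply Rle_lt_trans with (1 := nrm_apow _ _).
    specialize (HN2 (Datatypes.S (max N1 N2)) ltac:(lia)).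
    rewrite Rabs_pos_eq in HN2 by (apply pow_le, nrm_ge0).
    apply Rle_lt_trans with (nrm x ^ Datatypes.S (max N1 N2) * (nrm (aone : B) + 1)).
    + apply Rmult_le_compat_l; [apply pow_le, nrm_ge0 | lra].
    + replace eps with (eps / (nrm (aone : B) + 1) * (nrm (aone : B) + 1)) by (field; lra).
      apply Rmult_lt_compat_r; lra. }
assert (Hz : forall u : B, (forall eps, 0 < eps -> nrm u <= (nrm (aone [-] x) + 1) * eps) -> u = vzero).
{ intros u Hu; apply nrm_eq0, Rle_antisym; [| apply nrm_ge0].
  apply Rnot_lt_le; intros Hp.
  assert (HK : 0 < nrm (aone [-] x) + 1) by (generalize (nrm_ge0 (aone [-] x)); lra).
  specialize (Hu (nrm u / 2 / (nrm (aone [-] x) + 1)) ltac:(apply Rdiv_lt_0_compat; lra)).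
  replace ((nrm (aone [-] x) + 1) * (nrm u / 2 / (nrm (aone [-] x) + 1))) with (nrm u / 2) in Hu
    by (field; lra); lra. }
assert (He : forall u v : B, u [-] v = vzero -> u = v).
{ intros u v H; replace u with ((u [-] v) [+] v) by vmod; rewrite H; apply vadd_0_l. }
split; apply He, Hz; intros eps Hp; destruct (Hc eps Hp) as [n [N1 N2]].
- change (amult (aone [-] x) S) with ((aone [-] x) [o] S).
  replace ((aone [-] x) [o] S [-] aone) with ((aone [-] x) [o] (S [-] s n) [-] apow x (Datatypes.S n)).
  + apply Rle_trans with (1 := nrm_sub _ _).
    assert (K := nrm_mul (aone [-] x) (S [-] s n)).
    assert (nrm (aone [-] x) * nrm (S [-] s n) <= nrm (aone [-] x) * eps).
    { apply Rmult_le_compat_l; [apply nrm_ge0 | lra]. }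
    lra.
  + rewrite amul_sub_r, HSl; vmod.
- change (amult S (aone [-] x)) with (S [o] (aone [-] x)).
  replace (S [o] (aone [-] x) [-] aone) with ((S [-] s n) [o] (aone [-] x) [-] apow x (Datatypes.S n)).
  + apply Rle_trans with (1 := nrm_sub _ _).
    assert (K := nrm_mul (S [-] s n) (aone [-] x)).
    assert (nrm (S [-] s n) * nrm (aone [-] x) <= eps * nrm (aone [-] x)).
    { apply Rmult_le_compat_r; [apply nrm_ge0 | lra]. }
    lra.
  + rewrite amul_sub_l, HSr; vmod.
Qed.

End Invertible.

(** * Resolvent identity, openness of the resolvent set, decay at infinity *)

Section Resolvent.
Context {B : BanachAlgebra} (x : B).

Definition res (z : C) : B := ainv (minus (scal (z : C_AbsRing) aone) x).

Definition regular (z : C) : Prop := invertible (z [*] aone [-] x).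

Lemma regular_spectrum z : regular z <-> ~ spectrum x z.
Proof. split; [intros H K; exact (K H) | intros H; apply NNPP; exact H]. Qed.

Lemma res_spec z : regular z -> inverse_of (z [*] aone [-] x) (res z).
Proof. exact (ainv_spec _). Qed.

Lemma res_r z : regular z -> x [o] res z = z [*] res z [-] aone.
Proof.
intros H; destruct (res_spec z H) as [H1 _].
change ((z [*] aone [-] x) [o] res z = aone) in H1; rewrite <- H1; alg.
Qed.

Lemma res_l z : regular z -> res z [o] x = z [*] res z [-] aone.
Proof.
intros H; destruct (res_spec z H) as [_ H1].
change (res z [o] (z [*] aone [-] x) = aone) in H1; rewrite <- H1; alg.
Qed.

Lemma res_comm z a : regular z -> a [o] x = x [o] a -> a [o] res z = res z [o] a.
Proof.
intros H Ha; apply (inverse_comm _ _ a (res_spec z H)).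
repeat (progress aexp); rewrite Ha; reflexivity.
Qed.

(** Sandwich [(z - x) - (w - x)] between [res w] and [res z]: the first resolvent identity. *)
Lemma res_eq z w : regular z -> regular w ->
  res w [-] res z = (z - w)%C [*] (res w [o] res z).
Proof.
intros Hz Hw.
assert (E1 : res w [o] ((z [*] aone [-] x) [o] res z) = res w).
{ destruct (res_spec z Hz) as [H1 _].
  change ((z [*] aone [-] x) [o] res z = aone) in H1; rewrite H1; apply amul_1_r. }
assert (E2 : (res w [o] (w [*] aone [-] x)) [o] res z = res z).
{ destruct (res_spec w Hw) as [_ H1].
  change (res w [o] (w [*] aone [-] x) = aone) in H1; rewrite H1; apply amul_1_l. }
transitivity (res w [o] ((z [*] aone [-] x) [o] res z) [-] (res w [o] (w [*] aone [-] x)) [o] res z).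
- rewrite E1, E2; reflexivity.
- alg.
Qed.

(** One has [w - x = (z - x) (1 - (z - w) res z)], and the Neumann series inverts the second factor.
    For the bound, the resolvent identity expresses [res w] by [res z] and a term of at most half
    its own norm. *)
Lemma regular_near z : regular z ->
  forall w, Cmod (w - z) * nrm (res z) <= / 2 -> regular w /\ nrm (res w) <= 2 * nrm (res z).
Proof.
intros Hz w Hw.
assert (Hr : regular w).
{ destruct (neumann ((z - w)%C [*] res z)) as [y Hy].
  { apply Rle_lt_trans with (1 := nrm_sc_le _ _).
    replace (z - w)%C with (- (w - z))%C by ring; rewrite Cmod_opp; lra. }
  exists (y [o] res z).
  replace (w [*] aone [-] x) with ((z [*] aone [-] x) [o] (aone [-] (z - w)%C [*] res z)).
  - apply inverse_mul; [apply res_spec, Hz | exact Hy].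
  - rewrite amul_sub_r, amul_1_r, amul_sc_r.
    destruct (res_spec z Hz) as [H1 _].
    change ((z [*] aone [-] x) [o] res z = aone) in H1; rewrite H1; vmod. }
split; [exact Hr |].
assert (E := res_eq z w Hz Hr).
assert (E2 : res w = res z [+] (z - w)%C [*] (res w [o] res z)).
{ rewrite <- E; vmod. }
assert (H1 : nrm (res w) <= nrm (res z) + Cmod (w - z) * (nrm (res w) * nrm (res z))).
{ rewrite E2 at 1; apply Rle_trans with (1 := nrm_add _ _).
  apply Rplus_le_compat_l, Rle_trans with (1 := nrm_sc_le _ _).
  replace (z - w)%C with (- (w - z))%C by ring; rewrite Cmod_opp.
  apply Rmult_le_compat_l; [apply Cmod_ge_0 | apply nrm_mul]. }
assert (H0 := nrm_ge0 (res w)).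
assert (Cmod (w - z) * nrm (res z) * nrm (res w) <= / 2 * nrm (res w)) by
  (apply Rmult_le_compat_r; assumption).
lra.
Qed.

Lemma regular_open z : regular z -> exists d, 0 < d /\ forall w, Cmod (w - z) < d -> regular w.
Proof.
intros Hz; assert (H0 := nrm_ge0 (res z)).
exists (/ 2 / (nrm (res z) + 1)); split; [apply Rdiv_lt_0_compat; lra |].
intros w Hw; apply (regular_near z Hz w).
apply Rle_trans with (/ 2 / (nrm (res z) + 1) * (nrm (res z) + 1)).
- apply Rmult_le_compat; [apply Cmod_ge_0 | | |]; lra.
- right; field; lra.
Qed.

Lemma cder_res z : regular z -> cder res z (vneg (res z [o] res z)).
Proof.
intros Hz eps He; assert (H0 := nrm_ge0 (res z)).
set (n := nrm (res z)) in *.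
pose (K := 2 * (n + 1) * (n + 1) * (n + 1)).
assert (HK : 0 < K) by (unfold K; repeat apply Rmult_lt_0_compat; lra).
exists (Rmin (/ 2 / (n + 1)) (eps / K)); split.
{ apply Rmin_glb_lt; apply Rdiv_lt_0_compat; lra. }
intros w Hw.
assert (W1 := Rlt_le_trans _ _ _ Hw (Rmin_l _ _)).
assert (W2 := Rlt_le_trans _ _ _ Hw (Rmin_r _ _)).
assert (Hn : Cmod (w - z) * nrm (res z) <= / 2).
{ apply Rle_trans with (/ 2 / (n + 1) * (n + 1)).
  - apply Rmult_le_compat; [apply Cmod_ge_0 | | |]; fold n; lra.
  - right; field; lra. }
destruct (regular_near z Hz w Hn) as [Hr Hb]; fold n in Hb.
assert (E := res_eq z w Hz Hr).
(* Two applications of the resolvent identity make the remainder exactly quadratic in [w - z]; [K]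
   bounds the remaining product of three resolvents. *)
replace (res w [-] res z [-] (w - z)%C [*] vneg (res z [o] res z)) with
  (((w - z) * (w - z))%C [*] ((res w [o] res z) [o] res z)).
2:{ rewrite E.
    assert (E2 : res w = res z [+] (z - w)%C [*] (res w [o] res z)) by (rewrite <- E; vmod).
    assert (E3 : (res w [o] res z) = (res z [o] res z) [+] (z - w)%C [*] ((res w [o] res z) [o] res z)).
    { rewrite E2 at 1; rewrite amul_add_l, amul_sc_l; reflexivity. }
    rewrite E3 at 2; vmod. }
apply Rle_trans with (1 := nrm_sc_le _ _); rewrite Cmod_mult.
assert (Hc := Cmod_ge_0 (w - z)).
assert (HM : nrm ((res w [o] res z) [o] res z) <= K).
{ apply Rle_trans with (1 := nrm_mul _ _).
  apply Rle_trans with (nrm (res w) * n * n).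
  - apply Rmult_le_compat_r; [exact H0 | apply nrm_mul].
  - assert (nrm (res w) <= 2 * (n + 1)) by lra.
    assert (0 <= nrm (res w)) by apply nrm_ge0.
    unfold K; apply Rmult_le_compat; try lra; [nra |].
    apply Rmult_le_compat; lra. }
apply Rle_trans with (Cmod (w - z) * Cmod (w - z) * K).
{ apply Rmult_le_compat_l; [nra | exact HM]. }
rewrite (Rmult_comm eps), Rmult_assoc; apply Rmult_le_compat_l; [exact Hc |].
replace eps with (eps / K * K) by (field; lra); apply Rmult_le_compat_r; lra.
Qed.

Lemma vcont_res z : regular z -> vcont (T := C_UniformSpace) res z.
Proof. intros Hz; exact (cder_vcont _ _ _ (cder_res z Hz)). Qed.

(** The factor [1 - x / z] is inverted by the Neumann series. In [res z = (x res z + 1) / z] the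
    condition [2 |x| <= |z|] lets the left side absorb the first term. *)
Lemma regular_large z : nrm x < Cmod z -> regular z /\
  (2 * nrm x <= Cmod z -> 0 < Cmod z -> nrm (res z) <= 2 * nrm (aone : B) / Cmod z).
Proof.
intros Hz; assert (H0 := nrm_ge0 x).
assert (Nz : z <> 0%C) by (apply Cmod_gt_0; lra).
assert (Hr : regular z).
{ destruct (neumann ((/ z)%C [*] x)) as [y Hy].
  { apply Rle_lt_trans with (1 := nrm_sc_le _ _); rewrite Cmod_inv by exact Nz.
    replace 1 with (/ Cmod z * Cmod z) by (field; lra).
    apply Rmult_lt_compat_l; [apply Rinv_0_lt_compat; lra | exact Hz]. }
  exists ((/ z)%C [*] y); destruct Hy as [H1 H2].
  change ((aone [-] (/ z)%C [*] x) [o] y = aone) in H1.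
  change (y [o] (aone [-] (/ z)%C [*] x) = aone) in H2.
  split.
  - change ((z [*] aone [-] x) [o] ((/ z)%C [*] y) = aone).
    transitivity ((aone [-] (/ z)%C [*] x) [o] y); [| exact H1].
    repeat (progress aexp); vmod0; field; exact Nz.
  - change (((/ z)%C [*] y) [o] (z [*] aone [-] x) = aone).
    transitivity (y [o] (aone [-] (/ z)%C [*] x)); [| exact H2].
    repeat (progress aexp); vmod0; field; exact Nz. }
split; [exact Hr |]; intros H2 Hp.
assert (E := res_r z Hr).
assert (E2 : res z = (/ z)%C [*] (x [o] res z [+] aone)).
{ rewrite E; vmod0; field; exact Nz. }
assert (K : nrm (res z) <= / Cmod z * (nrm x * nrm (res z) + nrm (aone : B))).
{ rewrite E2 at 1; apply Rle_trans with (1 := nrm_sc_le _ _); rewrite Cmod_inv by exact Nz.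
  apply Rmult_le_compat_l; [left; apply Rinv_0_lt_compat; lra |].
  apply Rle_trans with (1 := nrm_add _ _); apply Rplus_le_compat_r, nrm_mul. }
assert (H3 := nrm_ge0 (res z)).
assert (K2 : Cmod z * nrm (res z) <= nrm x * nrm (res z) + nrm (aone : B)).
{ replace (nrm x * nrm (res z) + nrm (aone : B)) with
    (Cmod z * (/ Cmod z * (nrm x * nrm (res z) + nrm (aone : B)))) by (field; lra).
  apply Rmult_le_compat_l; lra. }
apply Rmult_le_reg_l with (Cmod z); [exact Hp |].
replace (Cmod z * (2 * nrm (aone : B) / Cmod z)) with (2 * nrm (aone : B)) by (field; lra).
nra.
Qed.

End Resolvent.

(** * The exponential and powers in the slit plane *)

(** The scalars as a Banach algebra: there the resolvent of [w] is [1 / (z - w)], so its derivative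
    is a case of [cder_res]. *)
Definition C_algebra : BanachAlgebra.
Proof.
apply (Build_BanachAlgebra CS Cmult (RtoC 1)).
- exact Cmult_assoc.
- exact Cmult_1_l.
- exact Cmult_1_r.
- exact Cmult_plus_distr_r.
- exact Cmult_plus_distr_l.
- intros c x y; symmetry; exact (Cmult_assoc c x y).
- intros c x y; change ((x * (c * y))%C = (c * (x * y))%C); ring.
- intros x y; right; exact (Cmod_mult x y).
Defined.

Lemma C_inverse (z w : C) : z <> w ->
  inverse_of (B := C_algebra) (vsub (V := C_algebra) (vsc (V := C_algebra) z (RtoC 1)) w) (/ (z - w))%C.
Proof.
intros H; assert (N : (z - w)%C <> 0%C).
{ intros E; apply H; replace z with (z - w + w)%C by ring; rewrite E; ring. }
split; [change ((z * 1 - w) * / (z - w) = 1)%C | change (/ (z - w) * (z * 1 - w) = 1)%C];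
  field; exact N.
Qed.

Lemma Cminus_neq0 (z w : C) : z <> w -> (z - w)%C <> 0%C.
Proof.
intros H E; apply H; replace z with (z - w + w)%C by ring; rewrite E; ring.
Qed.

Lemma C_regular (z w : C) : z <> w -> regular (B := C_algebra) w z.
Proof. intros H; eexists; exact (C_inverse z w H). Qed.

Lemma C_res (z w : C) : z <> w -> res (B := C_algebra) w z = (/ (z - w))%C.
Proof. intros H; apply (ainv_eq (B := C_algebra)); exact (C_inverse z w H). Qed.

Lemma cder_inv_sub (w z : C) : z <> w ->
  cder (V := CS) (fun z => / (z - w))%C z (- (/ (z - w) * / (z - w)))%C.
Proof.
intros H.
apply der_eq with (- (res (B := C_algebra) w z * res (B := C_algebra) w z))%C.
- apply der_ext_loc with (res (B := C_algebra) w); [| exact (cder_res (B := C_algebra) w z (C_regular z w H))].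
  exists (Cmod (z - w)); split; [apply Cmod_gt_0, Cminus_neq0, H |].
  intros q Hq; apply C_res; intros ->.
  replace (w - z)%C with (- (z - w))%C in Hq by ring; rewrite Cmod_opp in Hq; lra.
- rewrite C_res by exact H; reflexivity.
Qed.

Lemma cder_inv (z : C) : z <> 0%C -> cder (V := CS) Cinv z (- (/ z * / z))%C.
Proof.
intros H; apply der_ext with (fun z => / (z - 0))%C.
- intros q; f_equal; ring.
- replace (/ z)%C with (/ (z - 0))%C by (f_equal; ring); apply cder_inv_sub, H.
Qed.

Lemma vcont_inv {T : UniformSpace} (f : T -> C) (x : T) : f x <> 0%C -> vcont (V := CS) f x ->
  vcont (V := CS) (fun t => / f t)%C x.
Proof.
intros H Hf; apply (vcont_compC (V := CS) f Cinv); [exact Hf |].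
exact (cder_vcont _ _ _ (cder_inv _ H)).
Qed.

Lemma C_pair (u v : R) : (u, v) = (u + Ci * v)%C.
Proof. apply injective_projections; simpl; ring. Qed.

Lemma vcont_pair {T : UniformSpace} (u v : T -> R) (x : T) : continuous u x -> continuous v x ->
  vcont (V := CS) (fun t => (u t, v t)) x.
Proof.
intros Hu Hv; apply vcont_ext with (fun t => u t + Ci * v t)%C.
- intros t; symmetry; apply C_pair.
- apply vcont_Cplus; [apply vcont_Rfun, Hu |].
  apply vcont_Cmult; [apply vcont_const | apply vcont_Rfun, Hv].
Qed.

Lemma rder_R (r : R -> R) t r' : is_derive r t r' -> rder (V := CS) (fun t => RtoC (r t)) t (RtoC r').
Proof.
intros [_ H] eps He; specialize (H t (fun P H => H) (mkposreal _ He)).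
destruct H as [d H]; exists d; split; [apply cond_pos |]; intros s Hs.
rewrite <- RtoC_minus, Cmod_R in Hs; specialize (H s Hs).
change (Cmod (r s - r t - (s - t) * r')%C <= eps * Cmod (s - t)%C).
rewrite <- !RtoC_minus, <- RtoC_mult, <- RtoC_minus, !Cmod_R; exact H.
Qed.

Lemma rder_pair (u v : R -> R) t u' v' : is_derive u t u' -> is_derive v t v' ->
  rder (V := CS) (fun t => (u t, v t)) t (u', v').
Proof.
intros Hu Hv; refine (der_eq RtoC (V := CS) _ _ _ _ _ (eq_sym (C_pair u' v'))).
apply der_ext with (fun t => u t + Ci * v t)%C; [intros; symmetry; apply C_pair |].
apply (der_add RtoC (V := CS)); [apply rder_R, Hu |].
exact (der_lin RtoC (sc_linmap (V := CS) Ci) _ _ _ (rder_R _ _ _ Hv)).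
Qed.

Lemma continuous_Re (z : C) : continuous (T := C_UniformSpace) Re z.
Proof. destruct z as [x y]; exact (continuous_fst (U := R_UniformSpace) (V := R_UniformSpace) x y). Qed.
Lemma continuous_Im (z : C) : continuous (T := C_UniformSpace) Im z.
Proof. destruct z as [x y]; exact (continuous_snd (U := R_UniformSpace) (V := R_UniformSpace) x y). Qed.
Lemma continuous_Cmod (z : C) : continuous (T := C_UniformSpace) Cmod z.
Proof. exact (vcont_nrm (V := CS) (fun w => w) z (vcont_id_C z)). Qed.

Lemma Cexp_plus (z w : C) : Cexp (z + w) = (Cexp z * Cexp w)%C.
Proof.
unfold Cexp; destruct z as [x y], w as [u v]; simpl.
rewrite exp_plus, cos_plus, sin_plus; apply injective_projections; simpl; ring.
Qed.

Lemma Cexp_0 : Cexp 0 = 1%C.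
Proof. unfold Cexp; simpl; rewrite exp_0, cos_0, sin_0; apply injective_projections; simpl; ring. Qed.

Lemma Cexp_neg (z : C) : (Cexp z * Cexp (- z))%C = 1%C.
Proof. rewrite <- Cexp_plus, <- Cexp_0; f_equal; ring. Qed.

Lemma Cexp_neq0 (z : C) : Cexp z <> 0%C.
Proof.
intros E; assert (H := Cexp_neg z); rewrite E in H.
apply R1_neq_R0; rewrite Cmult_0_l in H; injection H; auto.
Qed.

Lemma Cmod_Cexp (z : C) : Cmod (Cexp z) = exp (Re z).
Proof.
unfold Cmod, Cexp; simpl.
replace (_ + _) with (exp (Re z) * exp (Re z) * (Rsqr (sin (Im z)) + Rsqr (cos (Im z)))) by (unfold Rsqr; ring).
rewrite sin2_cos2, Rmult_1_r; apply sqrt_square; left; apply exp_pos.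
Qed.

Lemma vcont_Cexp0 (z : C) : vcont (T := C_UniformSpace) (V := CS) Cexp z.
Proof.
assert (E : continuous (T := C_UniformSpace) (fun z => exp (Re z)) z).
{ apply (continuous_comp (U := C_UniformSpace) Re exp); [apply continuous_Re |].
  apply continuous_exp. }
apply vcont_pair; apply (continuous_mult (K := R_AbsRing)); try exact E.
- apply (continuous_comp (U := C_UniformSpace) Im cos); [apply continuous_Im | apply continuous_cos].
- apply (continuous_comp (U := C_UniformSpace) Im sin); [apply continuous_Im | apply continuous_sin].
Qed.

Lemma rder_Cexp_line (h : C) t : rder (V := CS) (fun t => Cexp (t * h)) t (h * Cexp (t * h))%C.
Proof.
apply der_ext with (fun t => (exp (t * Re h) * cos (t * Im h), exp (t * Re h) * sin (t * Im h))).
{ intros s; unfold Cexp; simpl; f_equal; f_equal; f_equal; unfold Re, Im; ring. }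
eapply der_eq.
- apply rder_pair; auto_derive; auto; reflexivity.
- unfold Cexp; apply injective_projections; simpl.
  + replace (t * fst h - 0 * snd h) with (t * Re h) by (unfold Re; ring).
    replace (t * snd h + 0 * fst h) with (t * Im h) by (unfold Im; ring).
    unfold Re, Im; ring.
  + replace (t * fst h - 0 * snd h) with (t * Re h) by (unfold Re; ring).
    replace (t * snd h + 0 * fst h) with (t * Im h) by (unfold Im; ring).
    unfold Re, Im; ring.
Qed.

(** Along the segment [t h] the real derivative is [h exp(t h)], which differs from [h] by at most
    [eps |h|] by continuity at 0; the mean value inequality concludes. *)
Lemma Cexp_taylor eps : 0 < eps -> exists d, 0 < d /\ forall h, Cmod h < d ->
  Cmod (Cexp h - 1 - h) <= eps * Cmod h.
Proof.
intros He.
destruct (proj1 (locally_Cmod _ _) (vcont_Cexp0 0 eps He)) as [d [D H]].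
exists d; split; [exact D |]; intros h Hh.
assert (E1 : Cexp (1%R * h) = Cexp h) by (f_equal; ring).
assert (E0 : Cexp (0%R * h) = 1%C) by (rewrite <- Cexp_0; f_equal; ring).
rewrite <- E0, <- E1.
apply (mvt01 (V := CS) (fun t => Cexp (t * h)) (fun t => h * Cexp (t * h))%C h (eps * Cmod h)).
- intros t Ht; apply rder_Cexp_line.
- intros t Ht; apply vcont_Cmult; [apply vcont_const |].
  exact (rder_vcont _ _ _ (rder_Cexp_line h t)).
- intros t Ht.
  change (Cmod (h * Cexp (t * h) - h) <= eps * Cmod h).
  replace (h * Cexp (t * h) - h)%C with (h * (Cexp (t * h) - 1))%C by ring.
  rewrite Cmod_mult, Rmult_comm; apply Rmult_le_compat_r; [apply Cmod_ge_0 |].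
  assert (Ht2 : Cmod (t * h - 0) < d).
  { replace (t * h - 0)%C with (t * h)%C by ring.
    apply Rle_lt_trans with (2 := Hh), Cmod_scaled, Ht. }
  specialize (H _ Ht2); rewrite Cexp_0 in H; left; exact H.
Qed.

Lemma cder_Cexp (z : C) : cder (V := CS) Cexp z (Cexp z).
Proof.
intros eps He.
assert (Hm : 0 < Cmod (Cexp z)) by apply Cmod_gt_0, Cexp_neq0.
destruct (Cexp_taylor (eps / Cmod (Cexp z))) as [d [D H]]; [apply Rdiv_lt_0_compat; assumption |].
exists d; split; [exact D |]; intros w Hw; specialize (H _ Hw).
change (Cmod (Cexp w - Cexp z - (w - z) * Cexp z) <= eps * Cmod (w - z)).
replace (Cexp w) with (Cexp z * Cexp (w - z))%C by (rewrite <- Cexp_plus; f_equal; ring).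
replace (Cexp z * Cexp (w - z) - Cexp z - (w - z) * Cexp z)%C with
  (Cexp z * (Cexp (w - z) - 1 - (w - z)))%C by ring.
rewrite Cmod_mult.
replace (eps * Cmod (w - z)) with (Cmod (Cexp z) * (eps / Cmod (Cexp z) * Cmod (w - z))) by (field; lra).
apply Rmult_le_compat_l; lra.
Qed.

Lemma vcont_Cexp {T : UniformSpace} (f : T -> C) (x : T) : vcont (V := CS) f x ->
  vcont (V := CS) (fun t => Cexp (f t)) x.
Proof. intros H; apply (vcont_compC (V := CS) f Cexp); [exact H | apply vcont_Cexp0]. Qed.

(** * The principal logarithm and real powers *)

Lemma slit_Cmod (z : C) : slit_plane z -> 0 < Cmod z /\ 0 < Cmod z + Re z.
Proof.
intros H.
assert (H1 := re_le_Cmod z).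
assert (H2 := Cmod2_alt z).
assert (H0 := Cmod_ge_0 z).
assert (H3 : 0 < Cmod z).
{ apply Cmod_gt_0; intros ->; apply H; simpl; split; lra. }
split; [exact H3 |].
assert (K : - Re z <= Rabs (Re z)) by (rewrite <- Rabs_Ropp; apply Rle_abs).
destruct (Rlt_le_dec 0 (Cmod z + Re z)) as [| H4]; [assumption | exfalso; apply H].
assert (E : Cmod z = - Re z) by lra.
split; [| lra].
rewrite E in H2; nra.
Qed.

(** Here [t] is the tangent of half the argument, and [|z|^2 = (Re z)^2 + (Im z)^2] gives
    [1 + t^2 = 2 |z| / (|z| + Re z)]; the double-angle formulas then return the two coordinates. *)
Lemma Cexp_Clog (z : C) : slit_plane z -> Cexp (Clog z) = z.
Proof.
intros H; destruct (slit_Cmod z H) as [H1 H2]; assert (H3 := Cmod2_alt z).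
unfold Cexp, Clog, Carg; simpl.
rewrite exp_ln by exact H1.
set (m := Cmod z) in *; set (t := Im z / (m + Re z)).
rewrite cos_2a, sin_2a, cos_atan, sin_atan.
assert (E : 1 + t² = 2 * m / (m + Re z)).
{ assert (K : (m + Re z) * (m + Re z) + Im z * Im z = 2 * m * (m + Re z)).
  { transitivity (m ^ 2 + 2 * m * Re z + (Re z ^ 2 + Im z ^ 2)); [ring |]; rewrite <- H3; ring. }
  transitivity (((m + Re z) * (m + Re z) + Im z * Im z) / ((m + Re z) * (m + Re z))).
  - unfold t, Rsqr; field; lra.
  - rewrite K; field; lra. }
assert (P : 0 < 1 + t²) by (rewrite E; apply Rdiv_lt_0_compat; lra).
assert (S := sqrt_sqrt (1 + t²) (Rlt_le _ _ P)).
assert (SP := sqrt_lt_R0 _ P).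
set (s := sqrt (1 + t²)) in *.
apply injective_projections; simpl.
- change (fst z) with (Re z).
  replace (m * (1 / s * (1 / s) - t / s * (t / s))) with (m * (1 - t²) / (s * s)) by (unfold Rsqr; field; lra).
  rewrite S; replace (1 - t²) with (2 - 2 * m / (m + Re z)) by lra; rewrite E; field; lra.
- change (snd z) with (Im z).
  replace (m * (2 * (t / s) * (1 / s))) with (m * 2 * t / (s * s)) by (field; lra).
  rewrite S, E; unfold t; field; lra.
Qed.

Lemma slit_open (z : C) : slit_plane z -> exists d, 0 < d /\ forall w, Cmod (w - z) < d -> slit_plane w.
Proof.
intros H; destruct (slit_Cmod z H) as [H1 H2].
destruct (Req_dec (Im z) 0) as [E | N].
- assert (0 < Re z) by (apply Rnot_le_lt; intros K; apply H; split; assumption).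
  exists (Re z); split; [assumption |]; intros w Hw [_ K].
  assert (L := re_le_Cmod (w - z)); simpl in L.
  change (Rabs (Re w - Re z) <= Cmod (w - z)) in L; unfold Rabs in L; destruct Rcase_abs in L; lra.
- exists (Rabs (Im z)); split; [apply Rabs_pos_lt, N |]; intros w Hw [K _].
  assert (L := Rmax_Cmod (w - z)%C).
  assert (L2 := Rle_trans _ _ _ (Rmax_r _ _) L); change (Rabs (Im w - Im z) <= Cmod (w - z)) in L2.
  rewrite K, Rminus_0_l, Rabs_Ropp in L2; lra.
Qed.

Lemma vcont_Clog0 (z : C) : slit_plane z -> vcont (T := C_UniformSpace) (V := CS) Clog z.
Proof.
intros H; destruct (slit_Cmod z H) as [H1 H2].
assert (CM := continuous_Cmod z).
apply vcont_pair.
- apply (continuous_comp (U := C_UniformSpace) Cmod ln); [exact CM |].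
  apply (ex_derive_continuous (K := R_AbsRing) (V := R_NormedModule)); auto_derive; exact H1.
- unfold Carg; apply (continuous_scal_r (U := C_UniformSpace) (K := R_AbsRing) (V := R_NormedModule) 2).
  apply (continuous_comp (U := C_UniformSpace) (fun z => Im z / (Cmod z + Re z)) atan).
  + apply (continuous_mult (K := R_AbsRing)); [apply continuous_Im |].
    apply (continuous_comp (U := C_UniformSpace) (fun z => Cmod z + Re z) Rinv).
    * apply (continuous_plus (V := R_NormedModule)); [exact CM | apply continuous_Re].
    * apply (ex_derive_continuous (K := R_AbsRing) (V := R_NormedModule)); auto_derive; lra.
  + apply (ex_derive_continuous (K := R_AbsRing) (V := R_NormedModule)); auto_derive; exact I.
Qed.

(** An inverse function argument: with [h = Clog w - Clog z] one has [w = z exp h], so the error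
    [h - (w - z) / z] equals [-(exp h - 1 - h)], small relative to [h]. *)
Lemma cder_Clog (z : C) : slit_plane z -> cder (V := CS) Clog z (/ z)%C.
Proof.
intros H eps He; destruct (slit_Cmod z H) as [Hz _].
assert (Nz : z <> 0%C) by (apply Cmod_gt_0; exact Hz).
(* The bound [1/2] yields [|h| <= 2 |w - z| / |z|]; the other bound is what this estimate then needs
   for [eps]. *)
pose (e := Rmin (/ 2) (eps * Cmod z / 2)).
assert (E0 : 0 < e).
{ unfold e; apply Rmin_glb_lt; [lra |]; apply Rdiv_lt_0_compat; [apply Rmult_lt_0_compat; assumption | lra]. }
destruct (Cexp_taylor e E0) as [d1 [D1 H1]].
destruct (proj1 (locally_Cmod _ _) (vcont_Clog0 z H d1 D1)) as [d2 [D2 H2]].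
destruct (slit_open z H) as [d3 [D3 H3]].
exists (Rmin d2 d3); split; [apply Rmin_glb_lt; assumption |]; intros w Hw.
assert (W1 := Rlt_le_trans _ _ _ Hw (Rmin_l _ _)).
assert (W2 := Rlt_le_trans _ _ _ Hw (Rmin_r _ _)).
specialize (H2 w W1); specialize (H3 w W2).
change (Cmod (Clog w - Clog z) < d1) in H2.
set (h := (Clog w - Clog z)%C) in *; specialize (H1 h H2).
assert (E : w = (z * Cexp h)%C).
{ rewrite <- (Cexp_Clog z H) at 1; rewrite <- Cexp_plus, <- (Cexp_Clog w H3) at 1; f_equal; unfold h; ring. }
change (Cmod (h - (w - z) * / z) <= eps * Cmod (w - z)).
assert (E2 : (h - (w - z) * / z = - (Cexp h - 1 - h))%C) by (rewrite E; field; exact Nz).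
rewrite E2, Cmod_opp.
assert (L : Cmod h <= 2 * (Cmod (w - z) / Cmod z)).
{ assert (K : Cmod h <= Cmod ((w - z) * / z) + Cmod (Cexp h - 1 - h)).
  { replace h with ((w - z) * / z + - (Cexp h - 1 - h))%C at 1 by (rewrite <- E2; ring).
    rewrite <- (Cmod_opp (Cexp h - 1 - h)); apply Cmod_triangle. }
  rewrite Cmod_mult, Cmod_inv in K by exact Nz.
  assert (e <= / 2) by apply Rmin_l.
  assert (e * Cmod h <= / 2 * Cmod h) by (apply Rmult_le_compat_r; [apply Cmod_ge_0 | assumption]).
  unfold Rdiv; lra. }
apply Rle_trans with (1 := H1).
apply Rle_trans with (eps * Cmod z / 2 * (2 * (Cmod (w - z) / Cmod z))).
- apply Rmult_le_compat; [lra | apply Cmod_ge_0 | apply Rmin_r | exact L].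
- right; field; lra.
Qed.

Lemma Clog_1 : Clog 1 = 0%C.
Proof.
unfold Clog, Carg; simpl; rewrite Cmod_1, ln_1.
replace (0 / (1 + 1)) with 0 by field; rewrite atan_0, Rmult_0_r; reflexivity.
Qed.

Lemma Crpow_1_l (s : R) : Crpow 1 s = 1%C.
Proof. unfold Crpow; rewrite Clog_1, Cmult_0_r; apply Cexp_0. Qed.

Lemma Crpow_plus (z : C) (s t : R) : Crpow z (s + t) = (Crpow z s * Crpow z t)%C.
Proof. unfold Crpow; rewrite <- Cexp_plus, RtoC_plus; f_equal; ring. Qed.

Lemma Crpow_1_r (z : C) : slit_plane z -> Crpow z 1 = z.
Proof. intros H; unfold Crpow; rewrite Cmult_1_l; apply Cexp_Clog, H. Qed.

Lemma Crpow_pred (z : C) (s : R) : slit_plane z -> (z * Crpow z (s - 1))%C = Crpow z s.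
Proof.
intros H; replace s with (1 + (s - 1)) at 2 by ring.
rewrite Crpow_plus, Crpow_1_r by exact H; reflexivity.
Qed.

Lemma cder_Crpow (z : C) (s : R) : slit_plane z ->
  cder (V := CS) (fun z => Crpow z s) z (s * Crpow z (s - 1))%C.
Proof.
intros H; destruct (slit_Cmod z H) as [Hz _].
assert (Nz : z <> 0%C) by (apply Cmod_gt_0; exact Hz).
eapply der_eq.
- apply (cder_chain (V := CS) (fun w => w) (fun z => s * Clog z)%C Cexp z); [| apply cder_Cexp].
  exact (der_lin _ (sc_linmap (V := CS) s) _ _ _ (cder_Clog z H)).
- change ((s * / z * Cexp (s * Clog z))%C = (s * Crpow z (s - 1))%C).
  change (Cexp (s * Clog z)) with (Crpow z s).
  rewrite <- (Crpow_pred z s H); field; exact Nz.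
Qed.

Lemma vcont_Crpow {T : UniformSpace} (f : T -> C) (x : T) (s : R) : slit_plane (f x) ->
  vcont (V := CS) f x -> vcont (V := CS) (fun t => Crpow (f t) s) x.
Proof.
intros H Hf; apply (vcont_compC (V := CS) f (fun z => Crpow z s)); [exact Hf |].
exact (cder_vcont _ _ _ (cder_Crpow _ s H)).
Qed.

(** * Contour integrals *)

(** Two real structures on the complex numbers occur: that of Coquelicot, in the definitions of
    [loop] and [hyp2F1], and [realify CS] elsewhere. This identity transfers derivatives and Riemann
    sums between them. *)
Lemma C_R_scal (r : R) (z : C) : scal (V := C_R_ModuleSpace) r z = (r * z)%C.
Proof. apply injective_projections; simpl; unfold scal; simpl; unfold mult; simpl; ring. Qed.

Lemma rder_C_R (f : R -> C) t l :
  is_derive (K := R_AbsRing) (V := C_R_NormedModule) f t l <-> rder (V := CS) f t l.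
Proof.
split.
- intros [_ H] eps He; specialize (H t (fun P H => H) (mkposreal _ He)).
  destruct H as [d H]; exists d; split; [apply cond_pos |]; intros s Hs.
  rewrite <- RtoC_minus, Cmod_R in Hs; specialize (H s Hs).
  rewrite <- Cmod_norm in H.
  change (Cmod (f s - f t - (s - t) * l)%C <= eps * Cmod (s - t)%C).
  rewrite <- !RtoC_minus, Cmod_R; rewrite <- C_R_scal; exact H.
- intros H; split; [apply (is_linear_scal_l (K := R_AbsRing) (V := C_R_NormedModule)) |].
  intros x Hx; rewrite <- (is_filter_lim_locally_unique _ _ Hx); clear x Hx.
  intros eps; destruct (H eps (cond_pos eps)) as [d [D H1]].
  exists (mkposreal d D); intros s Hs.
  assert (Hs' : Cmod (s - t)%C < d) by (rewrite <- RtoC_minus, Cmod_R; exact Hs).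
  specialize (H1 s Hs').
  change (Cmod (f s - f t - (s - t) * l)%C <= eps * Cmod (s - t)%C) in H1.
  rewrite <- !RtoC_minus, Cmod_R in H1; rewrite <- C_R_scal in H1.
  rewrite <- Cmod_norm; exact H1.
Qed.

Lemma is_RInt_C_R (f : R -> C) a b l :
  is_RInt (V := C_R_NormedModule) f a b l <-> is_vint (V := CS) f a b l.
Proof.
assert (E : forall ptd, Riemann_sum (V := C_R_NormedModule) f ptd = Riemann_sum (V := realify CS) f ptd).
{ intros ptd; apply SF_cons_ind with (s := ptd); clear ptd.
  - intros x0; reflexivity.
  - intros h s IH; rewrite !Riemann_sum_cons, <- IH.
    apply (f_equal2 Cplus); [exact (C_R_scal _ _) | reflexivity]. }
split; intros H; (eapply filterlim_ext; [| exact H]); intros ptd; simpl.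
- rewrite <- E; exact (C_R_scal _ _).
- rewrite <- E; symmetry; exact (C_R_scal _ _).
Qed.

Lemma path_rder (g : loop) t : 0 <= t <= 1 -> rder (V := CS) (path g) t (velocity g t).
Proof. intros H; apply rder_C_R, path_derive, H. Qed.

Lemma path_vcont (g : loop) t : 0 <= t <= 1 -> vcont (V := CS) (path g) t.
Proof. intros H; exact (rder_vcont _ _ _ (path_rder g t H)). Qed.

Lemma velocity_vcont (g : loop) t : 0 <= t <= 1 -> vcont (V := CS) (velocity g) t.
Proof. intros H; apply vcont_continuous, (velocity_continuous g t H). Qed.

Fixpoint csum {V : CNM} (G : contour) (f : C -> V) (t : R) : V :=
  match G with
  | nil => vzero
  | g :: G => velocity g t [*] f (path g t) [+] csum G f t
  end.

Lemma contour_int_iff {V : CNM} (G : contour) (f : C -> V) I :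
  is_contour_int G f I <-> is_vint (csum G f) 0 1 I.
Proof.
assert (E : forall t, fold_right plus zero
       (map (fun g => scal (velocity g t : C_AbsRing) (f (path g t))) G) = csum G f t).
{ intros t; induction G as [| g G IH]; simpl; [reflexivity |].
  exact (f_equal (fun y => vadd (velocity g t [*] f (path g t)) y) IH). }
unfold is_contour_int; split; apply (is_RInt_ext (V := realify V)); intros t _; [| symmetry]; apply E.
Qed.

Definition oint {V : CNM} (G : contour) (f : C -> V) : V := vint (csum G f) 0 1.
Definition conG {V : CNM} (G : contour) (f : C -> V) : Prop :=
  contour_in G (fun z => vcont (T := C_UniformSpace) f z).

Lemma contour_in_cons g G D : contour_in (g :: G) D <->
  (forall t, 0 <= t <= 1 -> D (path g t)) /\ contour_in G D.
Proof.
split.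
- intros H; split; [apply H; left; reflexivity |]; intros h Hh; apply H; right; exact Hh.
- intros [H1 H2] h [<- | Hh]; [exact H1 | apply H2, Hh].
Qed.

Lemma contour_in_imp G (D D' : C -> Prop) : (forall z, D z -> D' z) ->
  contour_in G D -> contour_in G D'.
Proof. intros H K g Hg t Ht; apply H, (K g Hg t Ht). Qed.

Section Oint.
Context {V : CNM}.
Implicit Types f : C -> V.

Lemma csum_conton G f : conG G f -> conton (csum G f) 0 1.
Proof.
intros H t Ht; induction G as [| g G IH]; simpl; [apply vcont_const |].
apply contour_in_cons in H; destruct H as [H1 H2].
apply vcont_add; [apply vcont_sc | apply IH, H2].
- apply velocity_vcont, Ht.
- apply (vcont_compC (T := R_UniformSpace) (path g) f); [apply path_vcont, Ht | apply H1, Ht].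
Qed.

Lemma oint_correct G f : conG G f -> is_contour_int G f (oint G f).
Proof. intros H; apply contour_int_iff, vint_correct; [lra | apply csum_conton, H]. Qed.

Lemma oint_unique G f I : is_contour_int G f I -> oint G f = I.
Proof. intros H; exact (vint_unique _ _ _ _ (proj1 (contour_int_iff G f I) H)). Qed.

Lemma csum_ext G f f' t : 0 <= t <= 1 -> contour_in G (fun z => f z = f' z) ->
  csum G f t = csum G f' t.
Proof.
intros Ht; induction G as [| g G IH]; simpl; intros H; [reflexivity |].
apply contour_in_cons in H; destruct H as [H1 H2]; rewrite IH, H1 by assumption; reflexivity.
Qed.

Lemma oint_ext G f f' : contour_in G (fun z => f z = f' z) -> oint G f = oint G f'.
Proof. intros H; apply vint_ext; [lra |]; intros t Ht; apply csum_ext; assumption. Qed.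

Lemma csum_lin {W : CNM} {b : V -> W} (Hb : linmap b) G f t :
  csum G (fun z => b (f z)) t = b (csum G f t).
Proof.
induction G as [| g G IH]; simpl; [symmetry; apply (lin_0 Hb) |].
rewrite IH, (lin_add _ Hb), (lin_sc _ Hb); reflexivity.
Qed.

Lemma oint_lin {W : CNM} {b : V -> W} (Hb : linmap b) G f : conG G f ->
  oint G (fun z => b (f z)) = b (oint G f).
Proof.
intros H; unfold oint; rewrite <- (vint_lin Hb _ 0 1 Rle_0_1 (csum_conton G f H)).
apply vint_ext; [lra |]; intros t _; apply csum_lin, Hb.
Qed.

Lemma csum_add G f f' t : csum G (fun z => f z [+] f' z) t = csum G f t [+] csum G f' t.
Proof. induction G as [| g G IH]; simpl; [vmod | rewrite IH; vmod]. Qed.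

Lemma oint_add G f f' : conG G f -> conG G f' ->
  oint G (fun z => f z [+] f' z) = oint G f [+] oint G f'.
Proof.
intros H H'; unfold oint; rewrite <- vint_add; try (apply csum_conton; assumption); [| lra].
apply vint_ext; [lra |]; intros t _; apply csum_add.
Qed.

Lemma csum_sub G f f' t : csum G (fun z => f z [-] f' z) t = csum G f t [-] csum G f' t.
Proof. induction G as [| g G IH]; simpl; [vmod | rewrite IH; vmod]. Qed.

Lemma oint_sub G f f' : conG G f -> conG G f' ->
  oint G (fun z => f z [-] f' z) = oint G f [-] oint G f'.
Proof.
intros H H'; unfold oint; rewrite <- vint_sub; try (apply csum_conton; assumption); [| lra].
apply vint_ext; [lra |]; intros t _; apply csum_sub.
Qed.

Lemma oint_primitive G (F f : C -> V) : contour_in G (fun z => cder F z (f z)) -> conG G f ->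
  oint G f = vzero.
Proof.
intros HF Hf; unfold oint.
assert (H : is_vint (csum G f) 0 1 vzero); [| exact (vint_unique _ _ _ _ H)].
induction G as [| g G IH]; simpl.
- apply is_vint_0, Rle_0_1.
- apply contour_in_cons in HF; destruct HF as [HF1 HF2].
  apply contour_in_cons in Hf; destruct Hf as [Hf1 Hf2].
  replace (vzero : V) with ((F (path g 1) [-] F (path g 0)) [+] vzero).
  + apply is_vint_add; [| apply IH; assumption].
    apply (is_vint_ftc (fun t => F (path g t))); [lra | |].
    * intros t Ht; apply cder_chain; [apply path_rder, Ht | apply HF1, Ht].
    * intros t Ht; apply vcont_sc; [apply velocity_vcont, Ht |].
      apply (vcont_compC (T := R_UniformSpace) (path g) f); [apply path_vcont, Ht | apply Hf1, Ht].
  + rewrite (path_closed g); vmod.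
Qed.

Fixpoint cspeed (G : contour) (t : R) : R :=
  match G with nil => 0 | g :: G => Cmod (velocity g t) + cspeed G t end.

Lemma cspeed_bounded G : exists L, 0 <= L /\ forall t, 0 <= t <= 1 -> cspeed G t <= L.
Proof.
induction G as [| g G [L [HL IH]]]; simpl; [exists 0; split; intros; lra |].
destruct (bounded_continuity (K := C_AbsRing) (V := C_NormedModule) (velocity g) 0 1) as [M HM].
{ intros t Ht; exact (proj1 (vcont_continuous (V := CS) _ _) (velocity_vcont g t Ht)). }
exists (Rmax M 0 + L); split; [generalize (Rmax_r M 0); lra |]; intros t Ht.
apply Rplus_le_compat; [| apply IH, Ht].
apply Rle_trans with M; [left; exact (HM t Ht) | apply Rmax_l].
Qed.

Lemma csum_bound G f t M : 0 <= t <= 1 -> contour_in G (fun z => nrm (f z) <= M) ->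
  nrm (csum G f t) <= cspeed G t * M.
Proof.
intros Ht; induction G as [| g G IH]; simpl; intros H; [rewrite nrm_0; lra |].
apply contour_in_cons in H; destruct H as [H1 H2].
apply Rle_trans with (1 := nrm_add _ _); rewrite Rmult_plus_distr_r.
apply Rplus_le_compat; [| apply IH, H2].
apply Rle_trans with (1 := nrm_sc_le _ _).
apply Rmult_le_compat_l; [apply Cmod_ge_0 | apply H1, Ht].
Qed.

Lemma oint_bound G : exists L, 0 <= L /\ forall f M, 0 <= M -> conG G f ->
  contour_in G (fun z => nrm (f z) <= M) -> nrm (oint G f) <= L * M.
Proof.
destruct (cspeed_bounded G) as [L [HL H]]; exists L; split; [exact HL |].
intros f M HM Hc Hb.
replace (L * M) with ((1 - 0) * (L * M)) by ring.
apply vint_bound; [lra | apply csum_conton, Hc |]; intros t Ht.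
apply Rle_trans with (1 := csum_bound G f t M Ht Hb).
apply Rmult_le_compat_r; [exact HM | apply H, Ht].
Qed.

Lemma conG_bounded G f : conG G f -> exists M, 0 <= M /\ contour_in G (fun z => nrm (f z) <= M).
Proof.
induction G as [| g G IH]; intros H; [exists 0; split; [lra | intros g []] |].
apply contour_in_cons in H; destruct H as [H1 H2]; destruct (IH H2) as [M [HM HG]].
destruct (bounded_continuity (K := C_AbsRing) (V := V) (fun t => f (path g t)) 0 1) as [M' HM'].
{ intros t Ht; apply (proj1 (vcont_continuous (V := V) (fun t => f (path g t)) t)).
  apply (vcont_compC (T := R_UniformSpace) (path g) f); [apply path_vcont, Ht | apply H1, Ht]. }
exists (Rmax M M'); split; [apply Rle_trans with M; [exact HM | apply Rmax_l] |].
apply contour_in_cons; split.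
- intros t Ht; apply Rle_trans with M'; [left; exact (HM' t Ht) | apply Rmax_r].
- apply contour_in_imp with (2 := HG); intros z Hz; apply Rle_trans with M; [exact Hz | apply Rmax_l].
Qed.

End Oint.

(** * Contour integrals depending on a parameter *)

Section OintParam.
Context {P : UniformSpace} {V : CNM}.

Definition jcontC (f : C -> P -> V) (z : C) (p : P) : Prop :=
  vcont (T := prod_UniformSpace C_UniformSpace P) (fun zp => f (fst zp) (snd zp)) (z, p).

Lemma csum_jcont G (f : C -> P -> V) t p : 0 <= t <= 1 ->
  contour_in G (fun z => jcontC f z p) -> jcont (fun t p => csum G (fun z => f z p) t) t p.
Proof.
intros Ht; induction G as [| g G IH]; simpl; intros H;
  [exact (jcont_fst (P := P) (fun _ => vzero) t p (vcont_const vzero t)) |].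
apply contour_in_cons in H; destruct H as [H1 H2].
apply (vcont_add (T := prod_UniformSpace R_UniformSpace P)); [apply (vcont_sc (T := prod_UniformSpace R_UniformSpace P)) | exact (IH H2)].
- exact (jcont_fst (P := P) (V := CS) (velocity g) t p (velocity_vcont g t Ht)).
- apply (vcont_comp (T := prod_UniformSpace R_UniformSpace P)
    (S := prod_UniformSpace C_UniformSpace P) (fun tp => (path g (fst tp), snd tp))
    (fun zp => f (fst zp) (snd zp)) (t, p)); [| apply H1, Ht].
  assert (K := jcont_fst (P := P) (V := CS) (path g) t p (path_vcont g t Ht)).
  apply vcont_continuous in K.
  intros Q [e He].
  destruct (proj1 (filterlim_locally _ _) K e) as [e1 K1].
  assert (Hm : 0 < Rmin e e1) by (apply Rmin_glb_lt; apply cond_pos).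
  exists (mkposreal _ Hm); intros y Y; apply He; split.
  + apply K1; destruct Y as [Y1 Y2]; split.
    * eapply ball_le; [| exact Y1]; apply Rmin_r.
    * eapply ball_le; [| exact Y2]; apply Rmin_r.
  + destruct Y as [Y1 Y2]; eapply ball_le; [| exact Y2]; apply Rmin_l.
Qed.

Lemma vcont_oint G (f : C -> P -> V) p0 :
  contour_in G (fun z => jcontC f z p0) ->
  locally p0 (fun p => conG G (fun z => f z p)) ->
  vcont (fun p => oint G (fun z => f z p)) p0.
Proof.
intros H1 H2; apply (vcont_vint (fun t p => csum G (fun z => f z p) t)); [lra | |].
- intros t Ht; apply csum_jcont; assumption.
- generalize H2; apply filter_imp; intros p Hp; apply csum_conton, Hp.
Qed.

End OintParam.

Lemma jcontC_fst {P : UniformSpace} {V : CNM} (f : C -> V) z (p : P) :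
  vcont (T := C_UniformSpace) f z -> jcontC (fun z _ => f z) z p.
Proof.
intros H; apply (vcont_comp (T := prod_UniformSpace C_UniformSpace P) (S := C_UniformSpace)
  (fun tp => fst tp) f (z, p)); [apply continuous_fst | exact H].
Qed.

Lemma jcontC_snd {P : UniformSpace} {V : CNM} (f : P -> V) (z : C) (p : P) :
  vcont f p -> jcontC (fun _ p => f p) z p.
Proof.
intros H; apply (vcont_comp (T := prod_UniformSpace C_UniformSpace P) (S := P)
  (fun tp => snd tp) f (z, p)); [apply continuous_snd | exact H].
Qed.

Lemma rder_oint {V : CNM} G (f f' : C -> R -> V) (p : R) :
  locally p (fun q => conG G (fun z => f z q) /\
    contour_in G (fun z => rder (f z) q (f' z q) /\ vcont (f' z) q)) ->
  contour_in G (fun z => jcontC (P := R_UniformSpace) f' z p) ->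
  rder (fun q => oint G (fun z => f z q)) p (oint G (fun z => f' z p)).
Proof.
intros H1 H2; apply (rder_vint_param (fun t q => csum G (fun z => f z q) t)
  (fun t q => csum G (fun z => f' z q) t)); [lra | |].
- generalize H1; apply filter_imp; intros q [K1 K2]; split; [apply csum_conton, K1 |].
  intros t Ht; clear - K2 Ht; induction G as [| g G IH]; simpl.
  + split; [apply der_const | apply vcont_const].
  + apply contour_in_cons in K2; destruct K2 as [K2 K3].
    destruct (K2 t Ht) as [K4 K5]; destruct (IH K3) as [K6 K7]; split.
    * apply der_add; [| exact K6]; exact (der_lin _ (sc_linmap (velocity g t)) _ _ _ K4).
    * apply vcont_add; [| exact K7]; exact (vcont_lin (sc_linmap (velocity g t)) _ _ K5).
- intros t Ht; apply csum_jcont; assumption.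
Qed.

Lemma cder_oint {V : CNM} G (f f' : C -> C -> V) (p : C) :
  locally (T := C_UniformSpace) p (fun q => conG G (fun z => f z q) /\
    contour_in G (fun z => cder (f z) q (f' z q) /\ vcont (T := C_UniformSpace) (f' z) q)) ->
  contour_in G (fun z => jcontC (P := C_UniformSpace) f' z p) ->
  cder (fun q => oint G (fun z => f z q)) p (oint G (fun z => f' z p)).
Proof.
intros H1 H2; apply (cder_vint_param (fun t q => csum G (fun z => f z q) t)
  (fun t q => csum G (fun z => f' z q) t)); [lra | |].
- generalize H1; apply filter_imp; intros q [K1 K2]; split; [apply csum_conton, K1 |].
  intros t Ht; clear - K2 Ht; induction G as [| g G IH]; simpl.
  + split; [apply der_const | apply vcont_const].
  + apply contour_in_cons in K2; destruct K2 as [K2 K3].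
    destruct (K2 t Ht) as [K4 K5]; destruct (IH K3) as [K6 K7]; split.
    * apply der_add; [| exact K6]; exact (der_lin _ (sc_linmap (velocity g t)) _ _ _ K4).
    * apply vcont_add; [| exact K7]; exact (vcont_lin (sc_linmap (velocity g t)) _ _ K5).
- intros t Ht; apply csum_jcont; assumption.
Qed.

Lemma fubini_oint {V : CNM} G (f : C -> R -> V) a b : a <= b ->
  (forall p, a <= p <= b -> contour_in G (fun z => jcontC (P := R_UniformSpace) f z p)) ->
  oint G (fun z => vint (fun p => f z p) a b) = vint (fun p => oint G (fun z => f z p)) a b.
Proof.
intros Hab H.
transitivity (vint (fun t => vint (fun p => csum G (fun z => f z p) t) a b) 0 1).
- apply vint_ext; [lra |]; intros t Ht; clear - Hab H Ht; symmetry; apply vint_unique.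
  induction G as [| g G IH]; simpl.
  + apply is_vint_0, Hab.
  + apply is_vint_add.
    * apply (is_vint_lin (sc_linmap (velocity g t))), vint_correct; [exact Hab |]; intros p Hp.
      assert (K : jcontC (P := R_UniformSpace) f (path g t) p) by (apply (H p Hp g); [left; reflexivity | exact Ht]).
      apply (vcont_comp (T := R_UniformSpace) (S := prod_UniformSpace C_UniformSpace R_UniformSpace)
        (fun q => (path g t, q)) (fun tp => f (fst tp) (snd tp)) p); [| exact K].
      intros Q [e He]; exists e; intros y Hy; apply He; split; [apply ball_center | exact Hy].
    * apply IH; intros p Hp g' Hg'; apply (H p Hp); right; exact Hg'.
- apply (fubini (fun t p => csum G (fun z => f z p) t)); [lra | exact Hab |].
  intros t p Ht Hp; apply csum_jcont; [exact Ht | apply H, Hp].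
Qed.

(** * Straight-line homotopies *)

Section Homotopy.
Context {V : CNM}.

(* The derivative of [H] along the straight-line homotopy is a total derivative in
   the curve parameter, so the two curve integrals differ by boundary terms only. *)
Lemma homotopy (H H1 : C -> V) (D : C -> Prop) (p q p' q' : R -> C) a b : a <= b ->
  (forall z, D z -> cder H z (H1 z) /\ vcont (T := C_UniformSpace) H1 z) ->
  (forall t, a <= t <= b -> rder (V := CS) p t (p' t) /\ vcont (V := CS) p' t /\
                            rder (V := CS) q t (q' t) /\ vcont (V := CS) q' t) ->
  (forall s t, 0 <= s <= 1 -> a <= t <= b -> D (p t + s * (q t - p t))%C) ->
  (forall s, 0 <= s <= 1 -> (q b - p b)%C [*] H (p b + s * (q b - p b))%C =
                            (q a - p a)%C [*] H (p a + s * (q a - p a))%C) ->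
  vint (fun t => q' t [*] H (q t)) a b = vint (fun t => p' t [*] H (p t)) a b.
Proof.
intros Hab HH Hp HD Hb.
pose (Gm := fun (s t : R) => (p t + s * (q t - p t))%C).
(* This is at once the [t]-derivative of [(q - p) H(Gm)] and the [s]-derivative of
   [(p' + s (q' - p')) H(Gm)]. Integrating it in both orders gives the boundary terms on one side
   and the difference of the curve integrals on the other. *)
pose (g := fun s t : R => ((q t - p t) * (p' t + s * (q' t - p' t)))%C [*] H1 (Gm s t) [+]
                    (q' t - p' t)%C [*] H (Gm s t)).
assert (Dl : forall c d s, rder (V := CS) (fun s => c + s * d)%C s d).
{ intros c d s; apply (der_eq RtoC (V := CS)) with (vadd (V := CS) vzero (vsc (V := CS) d (RtoC 1))).
  - apply der_ext with (fun s => vadd (V := CS) c (vsc (V := CS) d (RtoC s))).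
    + intros r; change ((c + d * r)%C = (c + r * d)%C); ring.
    + apply der_add; [apply der_const |].
      exact (der_lin _ (sc_linmap d) _ _ _ (der_io RtoC s)).
  - change ((0 + d * 1)%C = d); ring. }
assert (Cs : forall s t : R, vcont (T := prod_UniformSpace R_UniformSpace R_UniformSpace) (V := CS)
   (fun st => RtoC (fst st)) (s, t)).
{ intros s t; apply (jcont_fst (P := R_UniformSpace) (V := CS) RtoC s t).
  apply vcont_Rfun, continuous_id. }
assert (Ct : forall (f : R -> C) (s t : R), vcont (V := CS) f t ->
   vcont (T := prod_UniformSpace R_UniformSpace R_UniformSpace) (V := CS) (fun st => f (snd st)) (s, t)).
{ intros f s t Hf; exact (jcont_snd (P := R_UniformSpace) (V := CS) f s t Hf). }
assert (J : forall s t, 0 <= s <= 1 -> a <= t <= b -> jcont (P := R_UniformSpace) g s t).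
{ intros s t Hs Ht; destruct (Hp t Ht) as [P1 [P2 [Q1 Q2]]].
  destruct (HH _ (HD s t Hs Ht)) as [D1 D2]; change (cder H (Gm s t) (H1 (Gm s t))) in D1.
  assert (cp := rder_vcont _ _ _ P1); assert (cq := rder_vcont _ _ _ Q1).
  assert (cG : vcont (T := prod_UniformSpace R_UniformSpace R_UniformSpace) (V := CS)
                 (fun st => Gm (fst st) (snd st)) (s, t)).
  { apply vcont_Cplus; [apply (Ct p), cp |]; apply vcont_Cmult; [apply Cs |].
    apply vcont_Cminus; [apply (Ct q), cq | apply (Ct p), cp]. }
  apply vcont_add; apply vcont_sc.
  - apply vcont_Cmult.
    + apply vcont_Cminus; [apply (Ct q), cq | apply (Ct p), cp].
    + apply vcont_Cplus; [apply (Ct p'), P2 |]; apply vcont_Cmult; [apply Cs |].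
      apply vcont_Cminus; [apply (Ct q'), Q2 | apply (Ct p'), P2].
  - apply (vcont_compC _ H1); [exact cG | exact D2].
  - apply vcont_Cminus; [apply (Ct q'), Q2 | apply (Ct p'), P2].
  - apply (vcont_compC _ H); [exact cG | exact (cder_vcont _ _ _ D1)]. }
assert (F := fubini g 0 1 a b Rle_0_1 Hab J).
assert (F1 : vint (fun u => vint (fun v => g u v) a b) 0 1 = vzero).
{ rewrite (vint_ext _ (fun _ => vzero)); [| lra |].
  - apply vint_unique, is_vint_0, Rle_0_1.
  - intros s Hs; apply vint_unique.
    replace (vzero : V) with ((q b - p b)%C [*] H (Gm s b) [-] (q a - p a)%C [*] H (Gm s a)).
    2:{ unfold Gm; rewrite Hb by exact Hs; vmod. }
    apply (is_vint_ftc (fun t => (q t - p t)%C [*] H (Gm s t))); [exact Hab | |].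
    + intros t Ht; destruct (Hp t Ht) as [P1 [P2 [Q1 Q2]]].
      destruct (HH _ (HD s t Hs Ht)) as [D1 D2]; change (cder H (Gm s t) (H1 (Gm s t))) in D1.
      assert (E := der_sub RtoC (V := CS) _ _ _ _ _ Q1 P1).
      assert (EG : rder (V := CS) (fun t => Gm s t) t (p' t + s * (q' t - p' t))%C).
      { apply (der_add RtoC (V := CS)); [exact P1 |].
        exact (der_lin RtoC (sc_linmap (V := CS) s) _ _ _ E). }
      eapply der_eq; [apply der_sc; [exact E |]; apply (cder_chain RtoC (fun t => Gm s t) H t); [exact EG | exact D1] |].
      change (vsub (V := CS) (q' t) (p' t)) with (q' t - p' t)%C.
      unfold g; vmod.
    + intros t Ht; exact (jcont_r (P := R_UniformSpace) _ _ _ (J s t Hs Ht)). }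
assert (F2 : forall t, a <= t <= b -> vint (fun u => g u t) 0 1 = q' t [*] H (q t) [-] p' t [*] H (p t)).
{ intros t Ht; destruct (Hp t Ht) as [P1 [P2 [Q1 Q2]]].
  apply vint_unique.
  replace (q' t [*] H (q t) [-] p' t [*] H (p t)) with
    ((p' t + 1%R * (q' t - p' t))%C [*] H (Gm 1 t) [-] (p' t + 0%R * (q' t - p' t))%C [*] H (Gm 0 t)).
  2:{ unfold Gm; f_equal; (f_equal; [ring | f_equal; ring]). }
  apply (is_vint_ftc (fun s => (p' t + s * (q' t - p' t))%C [*] H (Gm s t))); [lra | |].
  - intros s Hs; destruct (HH _ (HD s t Hs Ht)) as [D1 D2]; change (cder H (Gm s t) (H1 (Gm s t))) in D1.
    eapply der_eq; [apply der_sc; [apply Dl |]; apply (cder_chain RtoC (fun s => Gm s t) H s); [apply Dl | exact D1] |].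
    unfold g; vmod.
  - intros s Hs; exact (jcont_l (P := R_UniformSpace) _ _ _ (J s t Hs Ht)). }
rewrite F1 in F.
assert (CQ : conton (fun t => q' t [*] H (q t)) a b).
{ intros t Ht; destruct (Hp t Ht) as [P1 [P2 [Q1 Q2]]].
  assert (Hd := HD 1 t ltac:(lra) Ht); replace (p t + 1%R * (q t - p t))%C with (q t) in Hd by ring.
  apply vcont_sc; [exact Q2 |]; apply (vcont_compC (T := R_UniformSpace) q H).
  - exact (rder_vcont _ _ _ Q1).
  - exact (cder_vcont _ _ _ (proj1 (HH _ Hd))). }
assert (CP : conton (fun t => p' t [*] H (p t)) a b).
{ intros t Ht; destruct (Hp t Ht) as [P1 [P2 [Q1 Q2]]].
  assert (Hd := HD 0 t ltac:(lra) Ht); replace (p t + 0%R * (q t - p t))%C with (p t) in Hd by ring.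
  apply vcont_sc; [exact P2 |]; apply (vcont_compC (T := R_UniformSpace) p H).
  - exact (rder_vcont _ _ _ P1).
  - exact (cder_vcont _ _ _ (proj1 (HH _ Hd))). }
rewrite (vint_ext _ (fun t => q' t [*] H (q t) [-] p' t [*] H (p t)) a b Hab F2) in F.
rewrite vint_sub in F by assumption.
match goal with |- ?A = ?B => replace A with ((A [-] B) [+] B) by vmod end.
rewrite <- F; vmod.
Qed.

End Homotopy.

(** * Contours surrounding a spectrum *)

Lemma two_pi_i_neq0 : two_pi_i <> 0%C.
Proof.
intros E; assert (H := f_equal snd E); simpl in H; generalize PI_RGT_0; lra.
Qed.

Lemma Cexp_two_pi_i : Cexp two_pi_i = 1%C.
Proof.
unfold Cexp, two_pi_i; simpl.
replace ((2 * PI - 0 * 0) * 0 - (2 * 0 + 0 * PI) * 1) with 0 by ring.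
replace ((2 * PI - 0 * 0) * 1 + (2 * 0 + 0 * PI) * 0) with (2 * PI) by ring.
rewrite exp_0, cos_2PI, sin_2PI; apply injective_projections; simpl; ring.
Qed.

Definition circle_path (c : C) (r t : R) : C := (c + r * Cexp (t * two_pi_i))%C.
Definition circle_velocity (r t : R) : C := (r * (two_pi_i * Cexp (t * two_pi_i)))%C.

Lemma circle_rder c r t : rder (V := CS) (circle_path c r) t (circle_velocity r t).
Proof.
apply (der_eq RtoC (V := CS)) with (vadd (V := CS) vzero (circle_velocity r t)).
- apply (der_add RtoC (V := CS)); [apply der_const |].
  exact (der_lin RtoC (sc_linmap (V := CS) r) _ _ _ (rder_Cexp_line two_pi_i t)).
- apply (vadd_0_l (V := CS)).
Qed.

Lemma circle_velocity_vcont r t : vcont (V := CS) (circle_velocity r) t.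
Proof.
apply vcont_Cmult; [apply vcont_const |]; apply vcont_Cmult; [apply vcont_const |].
exact (rder_vcont _ _ _ (rder_Cexp_line two_pi_i t)).
Qed.

Lemma circle_closed c r : circle_path c r 0 = circle_path c r 1.
Proof.
unfold circle_path; do 2 f_equal.
replace (1%R * two_pi_i)%C with two_pi_i by ring; rewrite Cexp_two_pi_i, <- Cexp_0; f_equal; ring.
Qed.

Definition circle (c : C) (r : R) : loop.
Proof.
apply (Build_loop (circle_path c r) (circle_velocity r)).
- intros t _; apply rder_C_R, circle_rder.
- intros t _; exact (proj1 (vcont_continuous (V := CS) _ _) (circle_velocity_vcont r t)).
- apply circle_closed.
Defined.

Lemma Cmod_unit (t : R) : Cmod (Cexp (t * two_pi_i)) = 1.
Proof.
rewrite Cmod_Cexp; replace (Re (t * two_pi_i)) with 0; [apply exp_0 |].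
unfold two_pi_i, Re; simpl; ring.
Qed.

Lemma circle_dist (c : C) (r t : R) : 0 <= r -> Cmod (circle_path c r t - c) = r.
Proof.
intros Hr; unfold circle_path; replace (c + r * Cexp (t * two_pi_i) - c)%C with (r * Cexp (t * two_pi_i))%C by ring.
rewrite Cmod_mult, Cmod_unit, Cmod_R, Rabs_pos_eq by exact Hr; ring.
Qed.

Lemma right_half_slit (z : C) : 0 < Re z -> slit_plane z.
Proof. intros H [_ K]; lra. Qed.

Lemma conG_inv G w : contour_in G (fun z => z <> w) -> conG (V := CS) G (fun z => / (z - w))%C.
Proof.
apply contour_in_imp; intros z Hz; exact (cder_vcont _ _ _ (cder_inv_sub w z Hz)).
Qed.

Definition index (G : contour) (w : C) : C := oint (V := CS) G (fun z => / (z - w))%C.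

Lemma has_index_iff G w n : contour_in G (fun z => z <> w) ->
  (has_index G w n <-> index G w = (two_pi_i * n)%C).
Proof.
intros H; assert (Hc := conG_inv G w H); unfold has_index.
assert (Hc' : conG (V := CS) G (fun z => / two_pi_i * / (z - w))%C).
{ intros g Hg t Ht; exact (vcont_lin (sc_linmap (V := CS) _) _ _ (Hc g Hg t Ht)). }
assert (E : oint (V := CS) G (fun z => / two_pi_i * / (z - w))%C = (/ two_pi_i * index G w)%C).
{ exact (oint_lin (V := CS) (sc_linmap (V := CS) (/ two_pi_i)%C) G _ Hc). }
split.
- intros K; rewrite (oint_unique G _ n K) in E; rewrite E; field; exact two_pi_i_neq0.
- intros K; rewrite K in E.
  replace n with (oint (V := CS) G (fun z => / two_pi_i * / (z - w))%C).
  + exact (oint_correct (V := CS) G _ Hc').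
  + rewrite E; change (@eq C (/ two_pi_i * (two_pi_i * n))%C n); field; exact two_pi_i_neq0.
Qed.

Lemma far_neq (z w w0 : C) : Cmod (w - w0) < Cmod (z - w0) -> z <> w.
Proof. intros H ->; lra. Qed.

(** Along [G] the quotient [(z - w) / (z - w0) = 1 - (w - w0) / (z - w0)] stays in the right half
    plane, so its logarithm is a primitive of [1 / (z - w) - 1 / (z - w0)]. *)
Lemma index_local G w w0 :
  contour_in G (fun z => Cmod (w - w0) < Cmod (z - w0)) -> index G w = index G w0.
Proof.
intros H.
assert (H1 : contour_in G (fun z => z <> w)) by (eapply contour_in_imp, H; intros z; apply far_neq).
assert (H0 : contour_in G (fun z => z <> w0)).
{ eapply contour_in_imp, H; intros z Hz; apply far_neq with w0.
  replace (w0 - w0)%C with (RtoC 0) by ring; rewrite Cmod_0.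
  apply Rle_lt_trans with (2 := Hz), Cmod_ge_0. }
assert (E : vsub (V := CS) (index G w) (index G w0) = vzero).
{ unfold index; rewrite <- oint_sub by (apply conG_inv; assumption).
  apply (oint_primitive (V := CS) G (fun z => Clog ((z - w) * / (z - w0)))).
  - intros g Hg t Ht; specialize (H g Hg t Ht); specialize (H1 g Hg t Ht); specialize (H0 g Hg t Ht).
    simpl in H, H1, H0; set (z := path g t) in *.
    assert (N1 := Cminus_neq0 _ _ H1); assert (N0 := Cminus_neq0 _ _ H0).
    assert (Hs : slit_plane ((z - w) * / (z - w0))).
    { apply right_half_slit.
      replace ((z - w) * / (z - w0))%C with (1 - (w - w0) * / (z - w0))%C by (field; exact N0).
      assert (K := re_le_Cmod ((w - w0) * / (z - w0))).
      rewrite Cmod_mult, Cmod_inv in K by exact N0.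
      assert (K2 : Cmod (w - w0) * / Cmod (z - w0) < 1).
      { assert (0 < Cmod (z - w0)) by (apply Cmod_gt_0, N0).
        apply Rmult_lt_reg_r with (Cmod (z - w0)); [assumption |].
        rewrite Rmult_assoc, Rinv_l by lra; lra. }
      set (u := ((w - w0) * / (z - w0))%C) in *.
      change (0 < 1 + - Re u); generalize (Rle_abs (Re u)); lra. }
    eapply der_eq.
    + apply (cder_chain (V := CS) (fun z => z) (fun z => (z - w) * / (z - w0))%C Clog z);
        [| exact (cder_Clog _ Hs)].
      apply (der_bilin (fun z => z) (vsc_bilin (V := CS)) (fun z => z - w)%C (fun z => / (z - w0))%C z).
      * apply (der_sub (fun z => z) (V := CS) (fun z => z) (fun _ => w)); [exact (der_io (fun z => z) z) | apply der_const].
      * exact (cder_inv_sub w0 z H0).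
    + change (((((1 - 0) * / (z - w0)) + (z - w) * - (/ (z - w0) * / (z - w0))) * / ((z - w) * / (z - w0)))%C
        = (/ (z - w) - / (z - w0))%C).
      field; split; assumption.
  - intros g Hg t Ht; apply vcont_sub; [apply (conG_inv G w H1 g Hg t Ht) | apply (conG_inv G w0 H0 g Hg t Ht)]. }
replace (index G w) with (index G w - index G w0 + index G w0)%C by ring.
change (index G w - index G w0)%C with (vsub (V := CS) (index G w) (index G w0)); rewrite E.
exact (vadd_0_l (V := CS) _).
Qed.

(** The difference [z - w] remains in the right half plane, where [Clog] provides a primitive. *)
Lemma index_left G w : contour_in G (fun z => Re w < Re z) -> index G w = 0%C.
Proof.
intros H; apply (oint_primitive (V := CS) G (fun z => Clog (z - w))).
- intros g Hg t Ht; specialize (H g Hg t Ht); simpl in H; set (z := path g t) in *.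
  assert (Hs : slit_plane (z - w)).
  { apply right_half_slit; change (0 < Re z + - Re w); lra. }
  eapply der_eq.
  + apply (cder_chain (V := CS) (fun z => z) (fun z => z - w)%C Clog z); [| exact (cder_Clog _ Hs)].
    apply (der_sub (fun z => z) (V := CS) (fun z => z) (fun _ => w)); [exact (der_io (fun z => z) z) | apply der_const].
  + change (((1 - 0) * / (z - w))%C = (/ (z - w))%C); ring.
- apply conG_inv; eapply contour_in_imp, H; intros z Hz E; rewrite E in Hz; lra.
Qed.

Lemma circle_center c r : 0 < r -> index [circle c r] c = two_pi_i.
Proof.
intros Hr; apply vint_unique.
apply (is_vint_ext (V := CS) (fun _ => two_pi_i)); [lra | |].
- intros t _; simpl.
  change (two_pi_i = (circle_velocity r t * / (circle_path c r t - c) + 0)%C).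
  unfold circle_velocity, circle_path.
  assert (N : Cexp (t * two_pi_i) <> 0%C) by apply Cexp_neq0.
  assert (Nr : RtoC r <> 0%C) by (intros E; injection E; lra).
  field; repeat split; try assumption.
  intros E; replace (c + r * Cexp (t * two_pi_i) - c)%C with (r * Cexp (t * two_pi_i))%C in E by ring.
  apply (f_equal Cmod) in E; rewrite Cmod_mult, Cmod_unit, Cmod_R, Rabs_pos_eq, Cmod_0 in E by lra; lra.
- assert (E : two_pi_i = vsub (V := CS) (1%R * two_pi_i)%C (0%R * two_pi_i)%C).
  { change (two_pi_i = (1%R * two_pi_i - 0%R * two_pi_i)%C); ring. }
  assert (H : is_vint (V := CS) (fun _ => two_pi_i) 0 1 (vsub (V := CS) (1%R * two_pi_i)%C (0%R * two_pi_i)%C)).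
  { apply (is_vint_ftc (V := CS) (fun t => t * two_pi_i)%C); [lra | | intros t _; apply vcont_const].
    intros t _; apply (der_eq RtoC (V := CS)) with (vsc (V := CS) (RtoC 1) two_pi_i).
    - exact (der_lin RtoC (scl_linmap (V := CS) two_pi_i) _ _ _ (der_io RtoC t)).
    - exact (vsc_1 (V := CS) _). }
  rewrite <- E in H; exact H.
Qed.

Lemma circle_inside c r w : 0 < r -> Cmod (w - c) < r -> index [circle c r] w = two_pi_i.
Proof.
intros Hr Hw; rewrite <- (circle_center c r Hr); apply index_local.
intros g [<- | []] t _; simpl; rewrite circle_dist by lra; exact Hw.
Qed.

Lemma circle_right (c r t : R) : 0 <= r -> c - r <= Re (circle_path c r t).
Proof.
intros Hr; assert (K := re_le_Cmod (circle_path c r t - c)); rewrite circle_dist in K by exact Hr.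
change (Rabs (Re (circle_path c r t) - c) <= r) in K; unfold Rabs in K; destruct Rcase_abs in K; lra.
Qed.

Lemma C_two : RtoC 2 = (1 + 1)%C.
Proof. rewrite <- RtoC_plus; reflexivity. Qed.

Definition square_loop (g : loop) : loop.
Proof.
apply (Build_loop (fun t => path g t * path g t)%C (fun t => 2 * path g t * velocity g t)%C).
- intros t Ht; apply rder_C_R.
  eapply der_eq.
  + exact (der_bilin RtoC (vsc_bilin (V := CS)) _ _ _ _ _ (path_rder g t Ht) (path_rder g t Ht)).
  + change ((velocity g t * path g t + path g t * velocity g t)%C = (2 * path g t * velocity g t)%C).
    rewrite C_two; ring.
- intros t Ht; apply (proj1 (vcont_continuous (V := CS) _ _)).
  apply vcont_Cmult; [apply vcont_Cmult; [apply vcont_const | apply path_vcont, Ht] | apply velocity_vcont, Ht].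
- rewrite (path_closed g); reflexivity.
Defined.

(** Partial fractions: [2 z / (z^2 - w^2) = 1 / (z - w) + 1 / (z + w)], where the factor [2 z] is
    the velocity of the square. *)
Lemma index_square g w : (forall t, 0 <= t <= 1 -> path g t <> w /\ path g t <> (- w)%C) ->
  index [square_loop g] (w * w) = (index [g] w + index [g] (- w))%C.
Proof.
intros H; unfold index.
change (oint (V := CS) [square_loop g] (fun z => / (z - w * w))%C =
  vadd (V := CS) (oint (V := CS) [g] (fun z => / (z - w))%C) (oint (V := CS) [g] (fun z => / (z - - w))%C)).
rewrite <- oint_add by (apply conG_inv; intros g' [<- | []] t Ht; apply H, Ht).
apply vint_ext; [lra |]; intros t Ht; simpl.
destruct (H t Ht) as [H1 H2]; apply Cminus_neq0 in H1; apply Cminus_neq0 in H2.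
change ((2 * path g t * velocity g t * / (path g t * path g t - w * w) + 0)%C =
  (velocity g t * (/ (path g t - w) + / (path g t - - w)) + 0)%C).
set (z := path g t) in *.
rewrite C_two; field; repeat split; try assumption.
replace (z * z - w * w)%C with ((z - w) * (z - - w))%C by ring; apply Cmult_neq_0; assumption.
Qed.

(** The last clause, which is [|w|^2 + Re(w^2) = 2 (Re w)^2], converts a lower bound on [|z| + Re z]
    into one on [Re w]. *)
Lemma slit_sqrt (z : C) : slit_plane z ->
  exists w, z = (w * w)%C /\ 0 < Re w /\ 2 * (Re w * Re w) = Cmod z + Re z.
Proof.
intros H; exists (Crpow z (1 / 2)).
assert (E : z = (Crpow z (1 / 2) * Crpow z (1 / 2))%C).
{ rewrite <- Crpow_plus; replace (1 / 2 + 1 / 2) with 1 by field; symmetry; apply Crpow_1_r, H. }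
split; [exact E | split].
- unfold Crpow, Cexp, Clog; simpl.
  apply Rmult_lt_0_compat; [apply exp_pos |].
  match goal with |- 0 < cos ?a => replace a with (atan (Im z / (Cmod z + Re z))) by (unfold Carg; field) end.
  destruct (atan_bound (Im z / (Cmod z + Re z))); apply cos_gt_0; lra.
- assert (E2 := f_equal Cmod E); rewrite Cmod_mult in E2.
  assert (E3 := f_equal Re E).
  set (w := Crpow z (1 / 2)) in *.
  change (Re z = Re w * Re w - Im w * Im w) in E3.
  assert (E4 := Cmod2_alt w); rewrite E2, E3.
  replace (Cmod w * Cmod w) with (Cmod w ^ 2) by ring; rewrite E4; ring.
Qed.

Section Surround.
Context {B : BanachAlgebra} (x : B).

Lemma spectrum_bound z : spectrum x z -> Cmod z <= nrm x.
Proof.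
intros H; apply Rnot_lt_le; intros K; apply H; exact (proj1 (regular_large x z K)).
Qed.

(* A large circle in the right half plane is mapped by the square onto a loop that
   surrounds any given compact subset of the slit plane. *)
Lemma surround_exists d : 0 < d ->
  (forall tau z, 0 <= tau -> Cmod (z + tau) < d -> regular x z) ->
  exists G, surrounds G (spectrum x) slit_plane.
Proof.
intros Hd H.
set (M := nrm x); assert (HM : 0 <= M) by apply nrm_ge0.
(* When [Re z < 0], the product [(|z| + Re z) (|z| - Re z) = (Im z)^2] is at least [d^2], and the
   second factor is at most [2 (M + 1)]; otherwise [|z| >= d] suffices. *)
assert (Hspec : forall z, spectrum x z -> slit_plane z /\ exists e, 0 < e /\ e = Rmin d (d * d / (2 * (M + 1))) /\
  e <= Cmod z + Re z).
{ intros z Hz.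
  assert (Hz1 := spectrum_bound z Hz); fold M in Hz1.
  assert (Hn : forall tau, 0 <= tau -> d <= Cmod (z + tau)).
  { intros tau Ht; apply Rnot_lt_le; intros K; exact (Hz (H tau z Ht K)). }
  assert (Hr := re_le_Cmod z).
  assert (Hm := Cmod2_alt z); assert (Hm0 := Cmod_ge_0 z).
  assert (Hs : slit_plane z).
  { intros [K1 K2]; specialize (Hn (- Re z) ltac:(lra)).
    replace (z + (- Re z)%R)%C with (RtoC 0) in Hn.
    - rewrite Cmod_0 in Hn; lra.
    - apply injective_projections; simpl; [| rewrite Rplus_0_r; symmetry; exact K1].
      unfold Re; ring. }
  split; [exact Hs |]; eexists; split; [| split; [reflexivity |]].
  - apply Rmin_glb_lt; [exact Hd |]; apply Rdiv_lt_0_compat; nra.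
  - destruct (Rle_lt_dec 0 (Re z)) as [K | K].
    + specialize (Hn 0 (Rle_refl _)); rewrite Cplus_0_r in Hn.
      apply Rle_trans with d; [apply Rmin_l | lra].
    + specialize (Hn (- Re z) ltac:(lra)).
      replace (z + (- Re z)%R)%C with (0, Im z) in Hn.
      2:{ apply injective_projections; simpl; unfold Re, Im; ring. }
      assert (Hi : Cmod (0, Im z) = Rabs (Im z)).
      { unfold Cmod; simpl; replace (0 * (0 * 1) + Im z * (Im z * 1)) with (Rsqr (Im z)) by (unfold Rsqr; ring).
        apply sqrt_Rsqr_abs. }
      rewrite Hi in Hn.
      assert (Hi2 : d * d <= Im z * Im z).
      { replace (Im z * Im z) with (Rabs (Im z) * Rabs (Im z)) by (rewrite <- Rabs_mult; apply Rabs_pos_eq; nra).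
        apply Rmult_le_compat; lra. }
      apply Rle_trans with (1 := Rmin_r _ _).
      destruct (slit_Cmod z Hs) as [_ Hp].
      apply Rmult_le_reg_r with (2 * (M + 1)); [lra |].
      replace (d * d / (2 * (M + 1)) * (2 * (M + 1))) with (d * d) by (field; lra).
      assert (- Re z <= Cmod z) by (rewrite <- Rabs_left by exact K; exact Hr).
      assert (d * d <= (Cmod z + Re z) * (Cmod z - Re z)) by nra.
      assert ((Cmod z + Re z) * (Cmod z - Re z) <= (Cmod z + Re z) * (2 * (M + 1))).
      { apply Rmult_le_compat_l; lra. }
      lra. }
pose (e := Rmin d (d * d / (2 * (M + 1)))).
assert (He : 0 < e) by (apply Rmin_glb_lt; [exact Hd |]; apply Rdiv_lt_0_compat; nra).
(* By [slit_sqrt], square roots of spectral points taken in the right half plane have real part at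
   least [s]. *)
pose (s := sqrt (e / 2)).
assert (Hs0 : 0 < s) by (apply sqrt_lt_R0; lra).
assert (Hss : s * s = e / 2) by (apply sqrt_sqrt; lra).
(* The circle stays in [Re z >= s / 2]. It encloses each root [w], since
   [|w - c|^2 <= M - 2 c s + c^2], while [r^2 = c^2 - c s + s^2 / 4] and [c s > M]. *)
pose (c := s + M / s + 1).
pose (r := c - s / 2).
assert (Hc : s < c).
{ assert (0 <= M / s) by (apply Rdiv_le_0_compat; lra); unfold c; lra. }
assert (Hr : 0 < r) by (unfold r; lra).
assert (Hpos : forall t, 0 < Re (circle_path c r t)).
{ intros t; assert (K := circle_right c r t ltac:(lra)); unfold r in *; lra. }
assert (Hroot : forall z, spectrum x z -> exists w, z = (w * w)%C /\ 0 < Re w /\ Cmod (w - c) < r).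
{ intros z Hz; destruct (Hspec z Hz) as [Hsl [e' [_ [Ee Hle]]]]; fold e in Ee; subst e'.
  assert (Hz1 := spectrum_bound z Hz); fold M in Hz1.
  destruct (slit_sqrt z Hsl) as [w [E [Hw Hw2]]].
  exists w; split; [exact E | split; [exact Hw |]].
  assert (Hsw : s <= Re w).
  { apply Rsqr_incr_0_var; [unfold Rsqr; lra | lra]. }
  assert (K1 := Cmod2_alt (w - c)); assert (K2 := Cmod2_alt w).
  change (Re (w - c)) with (Re w - c) in K1.
  replace (Im (w - c)) with (Im w) in K1.
  2:{ destruct w as [w1 w2]; simpl; ring. }
  assert (K3 : Cmod w * Cmod w = Cmod z) by (rewrite E, Cmod_mult; reflexivity).
  apply Rsqr_incrst_0; [| apply Cmod_ge_0 | lra].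
  unfold Rsqr; replace (Cmod (w - c) * Cmod (w - c)) with (Cmod (w - c) ^ 2) by ring.
  rewrite K1; unfold r.
  assert (c * s <= c * Re w) by (apply Rmult_le_compat_l; lra).
  assert (M < c * s).
  { unfold c; replace ((s + M / s + 1) * s) with (s * s + M + s) by (field; lra); nra. }
  nra. }
exists [square_loop (circle c r)]; split; [| split].
- intros g [<- | []] t Ht; simpl.
  assert (Hp := Hpos t); set (p := circle_path c r t) in *; split.
  + intros [K1 K2]; change (Im (p * p)) with (Re p * Im p + Im p * Re p) in K1.
    change (Re (p * p)) with (Re p * Re p - Im p * Im p) in K2.
    assert (Im p = 0) by nra; nra.
  + intros Hz; destruct (Hroot _ Hz) as [w [E [Hw Hwc]]].
    assert (K : ((p - w) * (p + w))%C = 0%C) by (replace ((p - w) * (p + w))%C with (p * p - w * w)%C by ring; rewrite E; ring).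
    destruct (Ceq_dec (p - w) 0) as [K1 | K1].
    * assert (Ep : p = w) by (replace p with (p - w + w)%C by ring; rewrite K1; ring).
      assert (Kd := circle_dist c r t ltac:(lra)); fold p in Kd; rewrite Ep in Kd; lra.
    * assert (K2 : (p + w)%C = 0%C).
      { apply Cmod_eq_0; apply (f_equal Cmod) in K; rewrite Cmod_mult, Cmod_0 in K.
        apply Rmult_integral in K; destruct K as [K | K]; [| exact K].
        apply Cmod_eq_0 in K; contradiction. }
      apply (f_equal Re) in K2; change (Re p + Re w = 0) in K2; lra.
- intros z Hz; destruct (Hroot z Hz) as [w [E [Hw Hwc]]].
  assert (HN : forall t, 0 <= t <= 1 -> path (circle c r) t <> w /\ path (circle c r) t <> (- w)%C).
  { intros t Ht; simpl; assert (Hp := Hpos t); split; intros K.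
    - assert (Kd := circle_dist c r t ltac:(lra)); rewrite K in Kd; lra.
    - rewrite K in Hp; change (0 < - Re w) in Hp; lra. }
  apply has_index_iff.
  + intros g [<- | []] t Ht; simpl; intros K; rewrite E in K.
    destruct (HN t Ht) as [N1 N2]; simpl in N1, N2; apply Cminus_neq0 in N1; apply Cminus_neq0 in N2.
    apply (Cmult_neq_0 _ _ N1 N2); replace (circle_path c r t - w)%C with (circle_path c r t - w)%C by ring.
    transitivity (circle_path c r t * circle_path c r t - w * w)%C; [ring | rewrite K; ring].
  + rewrite E, index_square by exact HN.
    rewrite circle_inside by assumption.
    rewrite index_left.
    * ring.
    * intros g [<- | []] t Ht; simpl; change (- Re w < Re (circle_path c r t)); generalize (Hpos t); lra.
- intros z Hz.
  assert (K : Im z = 0 /\ Re z <= 0) by (apply NNPP; exact Hz).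
  destruct K as [K1 K2].
  (* A point of the cut has purely imaginary square roots, and both lie to the left of the
     circle. *)
  pose (w := (0, sqrt (- Re z)) : C).
  assert (E : z = (w * w)%C).
  { destruct z as [z1 z2]; simpl in K1, K2; apply injective_projections; simpl; [| lra].
    rewrite sqrt_sqrt by lra; ring. }
  assert (HN : forall t, 0 <= t <= 1 -> path (circle c r) t <> w /\ path (circle c r) t <> (- w)%C).
  { intros t Ht; simpl; assert (Hp := Hpos t); split; intros K; rewrite K in Hp; simpl in Hp; lra. }
  apply has_index_iff.
  + intros g [<- | []] t Ht; simpl; intros K; rewrite E in K.
    destruct (HN t Ht) as [N1 N2]; simpl in N1, N2; apply Cminus_neq0 in N1; apply Cminus_neq0 in N2.
    apply (Cmult_neq_0 _ _ N1 N2).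
    transitivity (circle_path c r t * circle_path c r t - w * w)%C; [ring | rewrite K; ring].
  + rewrite E, index_square by exact HN.
    rewrite !index_left.
    * ring.
    * intros g [<- | []] t Ht; simpl; rewrite Ropp_0; apply Hpos.
    * intros g [<- | []] t Ht; simpl; apply Hpos.
Qed.

End Surround.

(** * The integral of the resolvent *)

(** The function [1 / (z - w)] is continuous on the contour, hence bounded there by compactness. *)
Lemma contour_away G w : contour_in G (fun z => z <> w) ->
  exists d, 0 < d /\ contour_in G (fun z => d <= Cmod (z - w)).
Proof.
intros H; destruct (conG_bounded G _ (conG_inv G w H)) as [M [HM HG]].
exists (/ (M + 1)); split; [apply Rinv_0_lt_compat; lra |].
intros g Hg t Ht; specialize (HG g Hg t Ht); specialize (H g Hg t Ht); simpl in *.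
apply Cminus_neq0 in H; rewrite nrm_C, Cmod_inv in HG by exact H.
apply Cmod_gt_0 in H.
apply Rmult_le_compat_r with (r := Cmod (path g t - w)) in HG; [| lra].
rewrite Rinv_l in HG by lra.
apply Rmult_le_reg_l with (M + 1); [lra |]; rewrite Rinv_r by lra; lra.
Qed.

Lemma contour_near_away G w : contour_in G (fun z => z <> w) ->
  locally (T := C_UniformSpace) w (fun q => contour_in G (fun z => z <> q)).
Proof.
intros H; destruct (contour_away G w H) as [d [Hd K]].
apply locally_Cmod; exists d; split; [exact Hd |]; intros q Hq.
apply contour_in_imp with (2 := K); intros z Hz ->; lra.
Qed.

Section Cauchy.
Context {B : BanachAlgebra} (x : B) (G : contour).
Hypothesis HG : contour_in G (regular x).

Let cauchy (w : C) : B := oint G (fun z => (/ (z - w))%C [*] res x z).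
Let cauchy' (w : C) : B := oint G (fun z => (/ (z - w) * / (z - w))%C [*] res x z).

Lemma conG_res : conG G (res x).
Proof. apply contour_in_imp with (2 := HG); intros z; apply vcont_res. Qed.

Lemma conG_sc {V : CNM} (c : C -> C) (f : C -> V) :
  conG (V := CS) G c -> conG G f -> conG G (fun z => c z [*] f z).
Proof. intros H1 H2 g Hg t Ht; exact (vcont_sc c f _ (H1 g Hg t Ht) (H2 g Hg t Ht)). Qed.

Lemma conG_inv2 w : contour_in G (fun z => z <> w) -> conG (V := CS) G (fun z => / (z - w) * / (z - w))%C.
Proof.
intros H g Hg t Ht; apply vcont_Cmult; exact (conG_inv G w H g Hg t Ht).
Qed.

(** Write [w - x = (z - x) - (z - w)] under the integral. Where the winding number is 1 and [w] is
    regular, this reads [cauchy w = T res w], with [T] the defect of the normalisation to be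
    proved. *)
Lemma cauchy_mul w : contour_in G (fun z => z <> w) ->
  cauchy w [o] (w [*] aone [-] x) = index G w [*] aone [-] oint G (res x).
Proof.
intros H; assert (Hc := conG_inv G w H).
unfold cauchy.
rewrite <- (oint_lin (mul_r_linmap (w [*] aone [-] x)) G _ (conG_sc _ _ Hc conG_res)).
rewrite (oint_ext G _ (fun z => (/ (z - w))%C [*] aone [-] res x z)).
- rewrite oint_sub; [| | exact conG_res].
  + f_equal; exact (oint_lin (scl_linmap (aone : B)) G _ Hc).
  + apply conG_sc; [exact Hc | intros g Hg t Ht; apply vcont_const].
- intros g Hg t Ht; specialize (HG g Hg t Ht); specialize (H g Hg t Ht); simpl in *.
  apply Cminus_neq0 in H; set (z := path g t) in *.
  repeat (progress aexp); rewrite (res_l x z HG); vmod0; field; exact H.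
Qed.

(** The same splitting leaves [1 / (z - w)^2], which has a primitive and integrates to zero. *)
Lemma cauchy'_mul w : contour_in G (fun z => z <> w) ->
  cauchy' w [o] (w [*] aone [-] x) = vneg (cauchy w).
Proof.
intros H; assert (Hc := conG_inv G w H); assert (Hc2 := conG_inv2 w H).
unfold cauchy'.
rewrite <- (oint_lin (mul_r_linmap (w [*] aone [-] x)) G _ (conG_sc _ _ Hc2 conG_res)).
rewrite (oint_ext G _ (fun z => (/ (z - w) * / (z - w))%C [*] aone [-] (/ (z - w))%C [*] res x z)).
- assert (K1 : conG G (fun z => (/ (z - w) * / (z - w))%C [*] (aone : B))).
  { apply conG_sc; [exact Hc2 | intros g Hg t Ht; apply vcont_const]. }
  rewrite oint_sub; [| exact K1 | exact (conG_sc _ _ Hc conG_res)].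
  rewrite (oint_lin (scl_linmap (aone : B)) G _ Hc2).
  rewrite (oint_primitive (V := CS) G (fun z => - / (z - w))%C); [fold (cauchy w) | | exact Hc2].
  + change (0%C [*] aone [-] cauchy w = vneg (cauchy w)); vmod.
  + intros g Hg t Ht; specialize (H g Hg t Ht); simpl in *.
    eapply der_eq.
    * apply (der_ext (fun z => z) (V := CS) (fun z => - (1) * / (z - w))%C).
      { intros q; change (@eq C (- (1) * / (q - w))%C (- / (q - w))%C); ring. }
      exact (der_lin (fun z => z) (sc_linmap (V := CS) (- (1))%C) _ _ _ (cder_inv_sub w _ H)).
    * change ((- (1) * - (/ (path g t - w) * / (path g t - w)))%C = (/ (path g t - w) * / (path g t - w))%C); ring.
- intros g Hg t Ht; specialize (HG g Hg t Ht); specialize (H g Hg t Ht); simpl in *.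
  apply Cminus_neq0 in H; set (z := path g t) in *.
  repeat (progress aexp); rewrite (res_l x z HG); vmod0; field; exact H.
Qed.

Lemma jcontC_inv (z w : C) : z <> w ->
  jcontC (P := C_UniformSpace) (V := CS) (fun z w => / (z - w))%C z w.
Proof.
intros H; apply (vcont_inv (T := prod_UniformSpace C_UniformSpace C_UniformSpace)).
- exact (Cminus_neq0 _ _ H).
- apply vcont_Cminus.
  + exact (jcontC_fst (P := C_UniformSpace) (V := CS) (fun z => z) z w (vcont_id_C z)).
  + exact (jcontC_snd (P := C_UniformSpace) (V := CS) (fun z => z) z w (vcont_id_C w)).
Qed.

Lemma jcontC_cauchy' (z w : C) : z <> w -> regular x z ->
  jcontC (P := C_UniformSpace) (fun z w => (/ (z - w) * / (z - w))%C [*] res x z) z w.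
Proof.
intros H Hr; apply (vcont_sc (T := prod_UniformSpace C_UniformSpace C_UniformSpace)).
- apply vcont_Cmult; exact (jcontC_inv z w H).
- exact (jcontC_fst (P := C_UniformSpace) (res x) z w (vcont_res x z Hr)).
Qed.

Lemma vcont_cauchy' w : contour_in G (fun z => z <> w) -> vcont (T := C_UniformSpace) cauchy' w.
Proof.
intros H; apply (vcont_oint (P := C_UniformSpace) G (fun z w => (/ (z - w) * / (z - w))%C [*] res x z)).
- intros g Hg t Ht; apply jcontC_cauchy'; [exact (H g Hg t Ht) | exact (HG g Hg t Ht)].
- generalize (contour_near_away G w H); apply filter_imp; intros q Hq.
  apply conG_sc; [apply conG_inv2, Hq | exact conG_res].
Qed.

Lemma cder_inv_sub_r (z w : C) : z <> w ->
  cder (V := CS) (fun w => / (z - w))%C w (/ (z - w) * / (z - w))%C.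
Proof.
intros H; assert (N := Cminus_neq0 _ _ H).
eapply der_eq.
- apply (cder_chain (V := CS) (fun w => w) (fun w => z - w)%C Cinv w); [| exact (cder_inv _ N)].
  apply (der_sub (fun w => w) (V := CS) (fun _ => z) (fun w => w)); [apply der_const | exact (der_io (fun w => w) w)].
- change (((0 - 1) * - (/ (z - w) * / (z - w)))%C = (/ (z - w) * / (z - w))%C); ring.
Qed.

Lemma cder_cauchy w : contour_in G (fun z => z <> w) -> cder cauchy w (cauchy' w).
Proof.
intros H; apply (cder_oint G (fun z w => (/ (z - w))%C [*] res x z)
  (fun z w => (/ (z - w) * / (z - w))%C [*] res x z)).
- generalize (contour_near_away G w H); apply filter_imp; intros q Hq; split.
  + apply conG_sc; [apply conG_inv, Hq | exact conG_res].
  + intros g Hg t Ht; split.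
    * exact (der_lin _ (scl_linmap (res x (path g t))) _ _ _ (cder_inv_sub_r _ _ (Hq g Hg t Ht))).
    * apply (vcont_sc (T := C_UniformSpace)); [| apply vcont_const].
      apply vcont_Cmult; exact (cder_vcont _ _ _ (cder_inv_sub_r _ _ (Hq g Hg t Ht))).
- intros g Hg t Ht; apply jcontC_cauchy'; [exact (H g Hg t Ht) | exact (HG g Hg t Ht)].
Qed.

Hypothesis HI : forall w, ~ regular x w -> index G w = two_pi_i.

Let T : B := two_pi_i [*] aone [-] oint G (res x).

(** Both branches agree at regular points close to the spectrum, where the winding number is locally
    constant. So [cauchy] continues [T res] across the spectrum and the glued function is entire. *)
Let ext (w : C) : B :=
  if excluded_middle_informative (regular x w) then T [o] res x w else cauchy w.
Let ext' (w : C) : B :=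
  if excluded_middle_informative (regular x w) then vneg (T [o] (res x w [o] res x w)) else cauchy' w.

Lemma spectrum_off w : ~ regular x w -> contour_in G (fun z => z <> w).
Proof. intros H g Hg t Ht E; apply H; rewrite <- E; apply (HG g Hg t Ht). Qed.

Lemma ext_near_spectrum w : ~ regular x w ->
  locally (T := C_UniformSpace) w (fun q => cauchy q = ext q /\ cauchy' q = ext' q).
Proof.
intros Hw; assert (Ho := spectrum_off w Hw).
destruct (contour_away G w Ho) as [d [Hd K]].
apply locally_Cmod; exists d; split; [exact Hd |]; intros q Hq.
assert (Hq2 : contour_in G (fun z => z <> q)).
{ apply contour_in_imp with (2 := K); intros z Hz ->; lra. }
assert (Ei : index G q = two_pi_i).
{ rewrite (index_local G q w); [apply HI, Hw |].
  apply contour_in_imp with (2 := K); intros z Hz; lra. }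
unfold ext, ext'; destruct (excluded_middle_informative (regular x q)) as [Hr | Hr]; [| split; reflexivity].
assert (E1 := cauchy_mul q Hq2); rewrite Ei in E1; fold T in E1.
assert (E2 := cauchy'_mul q Hq2).
destruct (res_spec x q Hr) as [S _]; change ((q [*] aone [-] x) [o] res x q = aone) in S.
assert (F1 : cauchy q = T [o] res x q).
{ rewrite <- E1, amulA, S, amul_1_r; reflexivity. }
split; [exact F1 |].
rewrite <- amulA, <- F1, <- amul_neg_l, <- E2, amulA, S, amul_1_r; reflexivity.
Qed.

Lemma ext_near_regular w : regular x w ->
  locally (T := C_UniformSpace) w (fun q => T [o] res x q = ext q /\ vneg (T [o] (res x q [o] res x q)) = ext' q).
Proof.
intros Hw; destruct (regular_open x w Hw) as [d [Hd K]].
apply locally_Cmod; exists d; split; [exact Hd |]; intros q Hq.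
unfold ext, ext'; destruct (excluded_middle_informative (regular x q)) as [Hr | Hr].
- split; reflexivity.
- exfalso; apply Hr, K, Hq.
Qed.

Lemma cder_ext_locally {V : CNM} (f g : C -> V) w l :
  locally (T := C_UniformSpace) w (fun q => f q = g q) -> cder f w l -> cder g w l.
Proof.
intros H; apply der_ext_loc; destruct (proj1 (locally_Cmod _ _) H) as [d [Hd K]].
exists d; split; assumption.
Qed.

Lemma ext_entire w : cder ext w (ext' w) /\ vcont (T := C_UniformSpace) ext' w.
Proof.
destruct (classic (regular x w)) as [Hr | Hr].
- assert (L := ext_near_regular w Hr); split.
  + apply cder_ext_locally with (fun q => T [o] res x q).
    * generalize L; apply filter_imp; intros q Hq; apply Hq.
    * rewrite <- (proj2 (locally_singleton _ _ L)).
      rewrite <- amul_neg_r; exact (der_lin _ (mul_l_linmap T) _ _ _ (cder_res x w Hr)).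
  + apply vcont_ext_loc with (fun q => vneg (T [o] (res x q [o] res x q))).
    * generalize L; apply filter_imp; intros q Hq; apply Hq.
    * apply vcont_neg, (vcont_lin (mul_l_linmap T)), vcont_mul; apply vcont_res, Hr.
- assert (L := ext_near_spectrum w Hr); assert (Ho := spectrum_off w Hr); split.
  + apply cder_ext_locally with cauchy.
    * generalize L; apply filter_imp; intros q Hq; apply Hq.
    * rewrite <- (proj2 (locally_singleton _ _ L)); apply cder_cauchy, Ho.
  + apply vcont_ext_loc with cauchy'.
    * generalize L; apply filter_imp; intros q Hq; apply Hq.
    * apply vcont_cauchy', Ho.
Qed.

Lemma circle_dist0 r t : 0 <= r -> Cmod (circle_path 0 r t) = r.
Proof.
intros Hr; rewrite <- (circle_dist 0 r t Hr) at 2; f_equal; ring.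
Qed.

Lemma circle_conton {V : CNM} (f : C -> V) r : 0 <= r ->
  (forall z, Cmod z = r -> vcont (T := C_UniformSpace) f z) ->
  conton (fun t => circle_velocity r t [*] f (circle_path 0 r t)) 0 1.
Proof.
intros Hr H t Ht; apply vcont_sc; [apply circle_velocity_vcont |].
apply (vcont_compC (T := R_UniformSpace) (circle_path 0 r) f).
- exact (rder_vcont _ _ _ (circle_rder 0 r t)).
- apply H, circle_dist0, Hr.
Qed.

Lemma circle_velocity_bound r t : 0 <= r -> Cmod (circle_velocity r t) = 2 * PI * r.
Proof.
intros Hr; unfold circle_velocity.
rewrite !Cmod_mult, Cmod_unit, Cmod_R, Rabs_pos_eq by exact Hr.
replace (Cmod two_pi_i) with (2 * PI); [ring |].
unfold two_pi_i; rewrite !Cmod_mult, !Cmod_R, Cmod_Ci, !Rabs_pos_eq; [ring | | lra].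
left; exact PI_RGT_0.
Qed.

(* The function [ext] is entire and [O(1/w)] at infinity with leading coefficient [T];
   shrinking a large circle to a point shows that [T] vanishes. *)
Lemma oint_res : oint G (res x) = two_pi_i [*] aone.
Proof.
assert (HT : T = vzero).
2:{ replace (two_pi_i [*] (aone : B)) with (T [+] oint G (res x)) by (unfold T; vmod).
    rewrite HT; symmetry; apply vadd_0_l. }
assert (Key : forall r, 2 * nrm x < r -> 0 < r ->
  nrm (two_pi_i [*] T) <= nrm (T [o] x) * (2 * PI * (2 * nrm (aone : B))) / r).
{ intros r Hr Hr0; assert (H0 := nrm_ge0 x).
  assert (Hz : vint (fun t => circle_velocity r t [*] ext (circle_path 0 r t)) 0 1 = vzero).
  (* The circle is contracted to the constant path at 0, on which the velocity vanishes. *)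
  { rewrite (homotopy ext ext' (fun _ => True) (fun _ => 0%C) (circle_path 0 r) (fun _ => 0%C)
      (circle_velocity r) 0 1 Rle_0_1).
    - transitivity (vint (fun _ : R => (vzero : B)) 0 1).
      + apply vint_ext; [lra |]; intros t _; apply vsc_0.
      + apply vint_unique, is_vint_0, Rle_0_1.
    - intros z _; apply ext_entire.
    - intros t _; repeat split.
      + apply (der_const RtoC (V := CS)).
      + apply (vcont_const (V := CS)).
      + apply circle_rder.
      + apply circle_velocity_vcont.
    - intros; exact I.
    - intros s _; rewrite (circle_closed 0 r); reflexivity. }
  assert (Hm : forall t, Cmod (circle_path 0 r t) = r).
  { intros t; apply circle_dist0; lra. }
  assert (Hreg : forall z, Cmod z = r -> regular x z).
  { intros z Hz2; apply (regular_large x z); lra. }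
  assert (C1 := circle_conton (res x) r ltac:(lra) (fun z Hz => vcont_res x z (Hreg z Hz))).
  assert (C2 : conton (fun t => circle_velocity r t [*] ((/ circle_path 0 r t)%C [*] res x (circle_path 0 r t))) 0 1).
  { apply (circle_conton (fun z => (/ z)%C [*] res x z)); [lra |]; intros z Hz2.
    apply (vcont_sc (T := C_UniformSpace)); [| apply vcont_res, Hreg, Hz2].
    exact (cder_vcont _ _ _ (cder_inv z ltac:(apply Cmod_gt_0; lra))). }
  (* On the circle the velocity is [2 pi i z] and [res z = (1 + x res z) / z], which isolates the
     constant [2 pi i T] from a term of order [1 / r]. *)
  assert (E1 : vint (fun t => circle_velocity r t [*] ext (circle_path 0 r t)) 0 1 =
     two_pi_i [*] T [+] (T [o] x) [o]
      vint (fun t => circle_velocity r t [*] ((/ circle_path 0 r t)%C [*] res x (circle_path 0 r t))) 0 1).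
  { rewrite <- (vint_lin (mul_l_linmap (T [o] x)) _ 0 1 Rle_0_1 C2).
    apply vint_unique.
    apply is_vint_ext with (fun t => two_pi_i [*] T [+] (T [o] x) [o]
      (circle_velocity r t [*] ((/ circle_path 0 r t)%C [*] res x (circle_path 0 r t)))); [lra | |].
    - intros t Ht; unfold ext; destruct excluded_middle_informative as [K | K]; [| exfalso; apply K, Hreg, Hm].
      assert (N : circle_path 0 r t <> 0%C) by (apply Cmod_gt_0; rewrite Hm; exact Hr0).
      assert (Ev : circle_velocity r t = (two_pi_i * circle_path 0 r t)%C).
      { unfold circle_velocity, circle_path; ring. }
      rewrite Ev; set (z := circle_path 0 r t) in *.
      repeat (progress aexp); rewrite (res_r x z K); repeat (progress aexp); vmod0; field; exact N.
    - apply is_vint_add.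
      + apply is_vint_const01.
      + apply vint_correct; [lra |]; intros t Ht; apply (vcont_lin (mul_l_linmap _)), C2, Ht. }
  rewrite Hz in E1.
  assert (E2 : two_pi_i [*] T = vneg ((T [o] x) [o]
      vint (fun t => circle_velocity r t [*] ((/ circle_path 0 r t)%C [*] res x (circle_path 0 r t))) 0 1)).
  { match goal with |- ?a = vneg ?b => replace a with ((a [+] b) [-] b) by vmod end.
    rewrite <- E1; vmod. }
  rewrite E2, nrm_neg; apply Rle_trans with (1 := nrm_mul _ _).
  unfold Rdiv; rewrite Rmult_assoc; apply Rmult_le_compat_l; [apply nrm_ge0 |].
  replace (2 * PI * (2 * nrm (aone : B)) * / r) with ((1 - 0) * (2 * PI * (2 * nrm (aone : B)) * / r)) by ring.
  apply vint_bound; [lra | exact C2 |]; intros t Ht.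
  assert (N : circle_path 0 r t <> 0%C) by (apply Cmod_gt_0; rewrite Hm; exact Hr0).
  apply Rle_trans with (1 := nrm_sc_le _ _); rewrite circle_velocity_bound by lra.
  assert (K1 := nrm_sc_le (/ circle_path 0 r t)%C (res x (circle_path 0 r t))).
  rewrite Cmod_inv, Hm in K1 by exact N.
  assert (K2 : nrm (res x (circle_path 0 r t)) <= 2 * nrm (aone : B) / r).
  { assert (L := proj2 (regular_large x (circle_path 0 r t) ltac:(rewrite Hm; lra))).
    rewrite Hm in L; apply L; lra. }
  assert (HPI := PI_RGT_0).
  apply Rle_trans with (2 * PI * r * (/ r * (2 * nrm (aone : B) / r))).
  - apply Rmult_le_compat_l; [apply Rmult_le_pos; lra |].
    apply Rle_trans with (1 := K1); apply Rmult_le_compat_l; [left; apply Rinv_0_lt_compat; lra | exact K2].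
  - right; field; lra. }
apply nrm_eq0, Rle_antisym; [| apply nrm_ge0].
apply Rnot_lt_le; intros Hp.
set (c := nrm (T [o] x) * (2 * PI * (2 * nrm (aone : B)))) in Key.
assert (Hc : 0 <= c).
{ assert (HPI := PI_RGT_0); assert (N0 := nrm_ge0 (aone : B)).
  unfold c; apply Rmult_le_pos; [apply nrm_ge0 |]; nra. }
assert (Ht : nrm T <= / Cmod two_pi_i * nrm (two_pi_i [*] T)).
{ rewrite <- Cmod_inv by exact two_pi_i_neq0.
  replace (nrm T) with (nrm ((/ two_pi_i)%C [*] (two_pi_i [*] T))); [apply nrm_sc_le |].
  f_equal; vmod0; field; exact two_pi_i_neq0. }
assert (Hq : 0 < Cmod two_pi_i) by (apply Cmod_gt_0, two_pi_i_neq0).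
assert (Hq2 : 0 < nrm (two_pi_i [*] T)).
{ apply Rnot_le_lt; intros K; assert (/ Cmod two_pi_i * nrm (two_pi_i [*] T) <= 0).
  { rewrite <- (Rmult_0_r (/ Cmod two_pi_i)); apply Rmult_le_compat_l; [left; apply Rinv_0_lt_compat, Hq | exact K]. }
  lra. }
set (n := nrm (two_pi_i [*] T)) in *.
assert (N0 := nrm_ge0 x).
assert (D0 : 0 <= c / n) by (apply Rdiv_le_0_compat; assumption).
(* A radius with [n X > c], in contradiction with [Key]. *)
assert (HX : exists X, 2 * nrm x < X /\ 0 < X /\ n * X = n * (2 * nrm x + 1) + c).
{ exists (2 * nrm x + 1 + c / n); repeat split; [lra | lra | field; lra]. }
destruct HX as [X [X1 [X2 X3]]]; specialize (Key X X1 X2).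
apply Rmult_le_compat_r with (r := X) in Key; [| lra].
replace (c / X * X) with c in Key by (field; lra).
rewrite X3 in Key.
assert (0 < n * (2 * nrm x + 1)) by (apply Rmult_lt_0_compat; lra).
lra.
Qed.

End Cauchy.

(** * Powers of [(1 - c) + c x] *)

Definition fc {B : BanachAlgebra} (x : B) (G : contour) (f : C -> C) : B :=
  (/ two_pi_i)%C [*] oint G (fun z => f z [*] res x z).

(** The point with parameter [c] on the segment from 1 to [z]. The slit plane is star-shaped about
    1, so the segment never meets the cut. *)
Definition segp (c : R) (z : C) : C := (1 - c + c * z)%C.

Lemma segp_slit c z : 0 <= c <= 1 -> slit_plane z -> slit_plane (segp c z).
Proof.
intros Hc Hz [H1 H2].
assert (E1 : Im (segp c z) = c * Im z) by (unfold segp, Im; simpl; ring).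
assert (E2 : Re (segp c z) = 1 - c + c * Re z) by (unfold segp, Re; simpl; ring).
rewrite E1 in H1; rewrite E2 in H2.
destruct (Req_dec c 0) as [-> | N]; [lra |].
assert (H3 : Im z = 0) by (apply Rmult_integral in H1; tauto).
apply Hz; split; [exact H3 | nra].
Qed.

Lemma Crpow_0_r z : Crpow z 0 = 1%C.
Proof. unfold Crpow; rewrite Cmult_0_l; apply Cexp_0. Qed.

Lemma cder_segp c z : cder (V := CS) (segp c) z (RtoC c).
Proof.
apply (der_eq (fun z => z) (V := CS)) with (vadd (V := CS) vzero (vsc (V := CS) c (RtoC 1))).
- apply (der_add (fun z => z) (V := CS) (fun _ => (1 - c)%C) (fun z => c * z)%C); [apply der_const |].
  exact (der_lin _ (sc_linmap (V := CS) c) _ _ _ (der_io (fun z => z) z)).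
- change (@eq C (0 + c * 1)%C c); ring.
Qed.

Section Calculus.
Context {B : BanachAlgebra} (x : B) (G : contour).
Hypothesis HG : contour_in G (regular x).

Lemma conG_fc f : conG (V := CS) G f -> conG G (fun z => f z [*] res x z).
Proof. intros H; apply conG_sc; [exact H | apply conG_res, HG]. Qed.

Lemma fc_ext f g : contour_in G (fun z => f z = g z) -> fc x G f = fc x G g.
Proof.
intros H; unfold fc; f_equal; apply oint_ext, (contour_in_imp G (fun z => f z = g z)); [| exact H].
intros z ->; reflexivity.
Qed.

Lemma fc_add f g : conG (V := CS) G f -> conG (V := CS) G g ->
  fc x G (fun z => f z + g z)%C = fc x G f [+] fc x G g.
Proof.
intros Hf Hg; unfold fc; rewrite <- vsc_add_r; f_equal.
rewrite <- oint_add by (apply conG_fc; assumption).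
apply oint_ext; intros g' _ t _; apply vsc_add_l.
Qed.

Lemma fc_scal c f : conG (V := CS) G f -> fc x G (fun z => c * f z)%C = c [*] fc x G f.
Proof.
intros Hf; unfold fc; rewrite vsc_assoc, (Cmult_comm c), <- vsc_assoc; f_equal.
rewrite <- (oint_lin (sc_linmap c) G _ (conG_fc f Hf)).
apply oint_ext; intros g' _ t _; symmetry; apply vsc_assoc.
Qed.

(** As [x res z = z res z - 1], the two sides differ by the integral of [f] alone. The functions of
    interest have explicit primitives, so this integral vanishes. *)
Lemma fc_mul f : conG (V := CS) G f -> oint (V := CS) G f = RtoC 0 ->
  x [o] fc x G f = fc x G (fun z => z * f z)%C.
Proof.
intros Hf H0; unfold fc; rewrite amul_sc_r; f_equal.
rewrite <- (oint_lin (mul_l_linmap x) G _ (conG_fc f Hf)).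
assert (Hz : conG (V := CS) G (fun z => z * f z)%C).
{ intros g Hg t Ht; apply vcont_Cmult; [apply vcont_id_C | exact (Hf g Hg t Ht)]. }
rewrite (oint_ext G _ (fun z => (z * f z)%C [*] res x z [-] f z [*] aone)).
- rewrite oint_sub.
  + rewrite (oint_lin (scl_linmap (aone : B)) G f Hf), H0; vmod.
  + apply conG_fc, Hz.
  + intros g Hg t Ht; apply (vcont_sc f); [exact (Hf g Hg t Ht) | apply vcont_const].
- intros g Hg t Ht; rewrite amul_sc_r, (res_r x _ (HG g Hg t Ht)); vmod.
Qed.

Lemma fc_comm a f : conG (V := CS) G f -> a [o] x = x [o] a -> a [o] fc x G f = fc x G f [o] a.
Proof.
intros Hf Ha; unfold fc; rewrite amul_sc_r, amul_sc_l; f_equal.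
rewrite <- (oint_lin (mul_l_linmap a) G _ (conG_fc f Hf)).
rewrite <- (oint_lin (mul_r_linmap a) G _ (conG_fc f Hf)).
apply oint_ext; intros g Hg t Ht; rewrite amul_sc_r, amul_sc_l; f_equal.
apply res_comm; [exact (HG g Hg t Ht) | exact Ha].
Qed.

Lemma fc_bound : exists L, 0 <= L /\ forall f M, 0 <= M -> conG (V := CS) G f ->
  contour_in G (fun z => Cmod (f z) <= M) -> nrm (fc x G f) <= L * M.
Proof.
destruct (oint_bound (V := B) G) as [L [HL H]].
destruct (conG_bounded G _ (conG_res x G HG)) as [K [HK HKG]].
assert (Hp : 0 <= Cmod (/ two_pi_i)) by apply Cmod_ge_0.
exists (Cmod (/ two_pi_i) * (L * K)); split; [apply Rmult_le_pos; [| apply Rmult_le_pos]; assumption |].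
intros f M HM Hf Hb; apply Rle_trans with (1 := nrm_sc_le _ _).
rewrite Rmult_assoc; apply Rmult_le_compat_l; [exact Hp |].
replace (L * K * M) with (L * (M * K)) by ring.
apply H; [apply Rmult_le_pos; assumption | apply conG_fc, Hf |].
intros g Hg t Ht; apply Rle_trans with (1 := nrm_sc_le _ _).
apply Rmult_le_compat; [apply Cmod_ge_0 | apply nrm_ge0 | exact (Hb g Hg t Ht) | exact (HKG g Hg t Ht)].
Qed.

Lemma jcontC_fc {P : UniformSpace} (f : C -> P -> C) z p : regular x z -> jcontC (V := CS) f z p ->
  jcontC (fun z p => f z p [*] res x z) z p.
Proof.
intros Hr H; apply (vcont_sc (T := prod_UniformSpace C_UniformSpace P)); [exact H |].
exact (jcontC_fst (P := P) (res x) z p (vcont_res x z Hr)).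
Qed.

Lemma vcont_fc {P : UniformSpace} (f : C -> P -> C) (p : P) :
  contour_in G (fun z => jcontC (V := CS) f z p) ->
  locally p (fun q => conG (V := CS) G (fun z => f z q)) ->
  vcont (fun q => fc x G (fun z => f z q)) p.
Proof.
intros H1 H2; apply (vcont_lin (sc_linmap _)).
apply (vcont_oint (P := P) G (fun z p => f z p [*] res x z)).
- intros g Hg t Ht; apply jcontC_fc; [exact (HG g Hg t Ht) | exact (H1 g Hg t Ht)].
- generalize H2; apply filter_imp; intros q Hq; apply conG_fc, Hq.
Qed.

Lemma rder_fc (f f' : C -> R -> C) (p : R) :
  locally p (fun q => conG (V := CS) G (fun z => f z q) /\
    contour_in G (fun z => rder (V := CS) (f z) q (f' z q) /\ vcont (V := CS) (f' z) q)) ->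
  contour_in G (fun z => jcontC (P := R_UniformSpace) (V := CS) f' z p) ->
  rder (fun q => fc x G (fun z => f z q)) p (fc x G (fun z => f' z p)).
Proof.
intros H1 H2; apply (der_lin RtoC (sc_linmap (/ two_pi_i)%C)).
apply (rder_oint G (fun z q => f z q [*] res x z) (fun z q => f' z q [*] res x z)).
- generalize H1; apply filter_imp; intros q [K1 K2]; split; [apply conG_fc, K1 |].
  intros g Hg t Ht; destruct (K2 g Hg t Ht) as [K3 K4]; split.
  + exact (der_lin _ (scl_linmap (res x (path g t))) _ _ _ K3).
  + exact (vcont_lin (scl_linmap (res x (path g t))) _ _ K4).
- intros g Hg t Ht; apply jcontC_fc; [exact (HG g Hg t Ht) | exact (H2 g Hg t Ht)].
Qed.

Lemma fubini_fc (f : C -> R -> C) a b : a <= b ->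
  (forall p, a <= p <= b -> contour_in G (fun z => jcontC (P := R_UniformSpace) (V := CS) f z p)) ->
  fc x G (fun z => vint (V := CS) (fun p => f z p) a b) = vint (fun p => fc x G (fun z => f z p)) a b.
Proof.
intros Hab H; unfold fc.
assert (Hc : forall p, a <= p <= b -> contour_in G (fun z => jcontC (P := R_UniformSpace) (fun z p => f z p [*] res x z) z p)).
{ intros p Hp g Hg t Ht; apply jcontC_fc; [exact (HG g Hg t Ht) | exact (H p Hp g Hg t Ht)]. }
(* Clamping gives continuity of the inner integral at the end points of [[a, b]], near which other
   parameters escape the hypothesis on [f]. *)
rewrite (vint_ext _ (fun p => (/ two_pi_i)%C [*] vint (fun t => csum G (fun z => f z (clamp a b p) [*] res x z) t) 0 1)).
2: exact Hab.
2:{ intros p Hp; rewrite clamp_id by exact Hp; reflexivity. }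
rewrite (vint_lin (sc_linmap (/ two_pi_i)%C)); [| exact Hab |].
- f_equal.
  rewrite (oint_ext G _ (fun z => vint (fun p => f z p [*] res x z) a b)).
  + rewrite (fubini_oint G (fun z p => f z p [*] res x z) a b Hab Hc).
    apply vint_ext; [exact Hab |]; intros p Hp; rewrite clamp_id by exact Hp; reflexivity.
  + intros g Hg t Ht; symmetry; apply (vint_lin (scl_linmap (res x (path g t)))); [exact Hab |].
    intros p Hp.
    apply (vcont_comp (T := R_UniformSpace) (S := prod_UniformSpace C_UniformSpace R_UniformSpace)
        (V := CS) (fun q => (path g t, q)) (fun tp => f (fst tp) (snd tp)) p); [| exact (H p Hp g Hg t Ht)].
    intros Q [e He]; exists e; intros y Hy; apply He; split; [apply ball_center | exact Hy].
- apply (conton_vint (fun t p => csum G (fun z => f z p [*] res x z) t)); [lra | | exact Hab].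
  intros t p Ht Hp; apply (csum_jcont (P := R_UniformSpace) G (fun z p => f z p [*] res x z) t p Ht), Hc, Hp.
Qed.

Hypothesis H1 : oint G (res x) = two_pi_i [*] aone.

Lemma fc_one : fc x G (fun _ => 1%C) = aone.
Proof.
unfold fc; rewrite (oint_ext G _ (res x)).
- rewrite H1; vmod0; field; exact two_pi_i_neq0.
- intros g _ t _; apply vsc_1.
Qed.

Hypothesis HS : contour_in G slit_plane.

(** The power [((1 - c) + c x)^s] computed along [G]. The parameter joins 1 to [x^s] and makes
    differential equations in [c] available. *)
Definition xp (s c : R) : B := fc x G (fun z => Crpow (segp c z) s).

Lemma cder_Crpow_segp s c z : 0 <= c <= 1 -> slit_plane z ->
  cder (V := CS) (fun z => Crpow (segp c z) s) z (c * (s * Crpow (segp c z) (s - 1)))%C.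
Proof.
intros Hc Hz; apply (cder_chain (V := CS) (fun z => z) (segp c) (fun w => Crpow w s) z); [apply cder_segp |].
apply cder_Crpow, segp_slit; assumption.
Qed.

Lemma conG_Crpow s c : 0 <= c <= 1 -> conG (V := CS) G (fun z => Crpow (segp c z) s).
Proof.
intros Hc g Hg t Ht; exact (cder_vcont _ _ _ (cder_Crpow_segp s c _ Hc (HS g Hg t Ht))).
Qed.

(** There is a primitive on the slit plane: [z] when [c = 0], a logarithm when [s = -1], and a
    multiple of the power [s + 1] in the other cases. *)
Lemma oint_Crpow s c : 0 <= c <= 1 -> oint (V := CS) G (fun z => Crpow (segp c z) s) = RtoC 0.
Proof.
intros Hc.
destruct (Req_dec c 0) as [-> | Nc].
{ apply (oint_primitive (V := CS) G (fun z => z)); [| apply conG_Crpow; lra].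
  intros g Hg t Ht; apply (der_eq (fun z => z) (V := CS)) with (RtoC 1); [exact (der_io (fun z => z) _) |].
  unfold segp; replace (1 - 0 + 0 * path g t)%C with (RtoC 1) by ring; symmetry; apply Crpow_1_l. }
assert (Nc' : RtoC c <> 0%C) by (intros E; injection E; exact Nc).
destruct (Req_dec s (-1)) as [-> | Ns].
- apply (oint_primitive (V := CS) G (fun z => / c * Clog (segp c z))%C); [| apply conG_Crpow; lra].
  intros g Hg t Ht; specialize (HS g Hg t Ht); simpl in *; set (z := path g t) in *.
  assert (Hs := segp_slit c z Hc HS).
  eapply der_eq.
  + exact (der_lin _ (sc_linmap (V := CS) (/ c)%C) _ _ _
      (cder_chain (V := CS) (fun z => z) (segp c) Clog z _ _ (cder_segp c z) (cder_Clog _ Hs))).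
  + change (@eq C (/ c * (c * / segp c z))%C (Crpow (segp c z) (-1))).
    assert (N : segp c z <> 0%C) by (apply Cmod_gt_0, (slit_Cmod _ Hs)).
    assert (K := Crpow_pred (segp c z) 0 Hs); rewrite Crpow_0_r in K.
    replace (0 - 1) with (-1) in K by ring.
    transitivity (/ segp c z * 1)%C; [field; split; assumption |]; rewrite <- K; field; exact N.
- assert (Ns' : RtoC (s + 1) <> 0%C) by (intros E; injection E; lra).
  apply (oint_primitive (V := CS) G (fun z => (/ (c * (s + 1)%R)) * Crpow (segp c z) (s + 1))%C);
    [| apply conG_Crpow; lra].
  intros g Hg t Ht; specialize (HS g Hg t Ht); simpl in *; set (z := path g t) in *.
  eapply der_eq.
  + exact (der_lin _ (sc_linmap (V := CS) (/ (c * (s + 1)%R))%C) _ _ _ (cder_Crpow_segp (s + 1) c z Hc HS)).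
  + change (@eq C (/ (c * (s + 1)%R) * (c * ((s + 1)%R * Crpow (segp c z) (s + 1 - 1))))%C (Crpow (segp c z) s)).
    replace (s + 1 - 1) with s by ring; field; split; assumption.
Qed.

Lemma xp_mul_x s c : 0 <= c <= 1 -> x [o] xp s c = fc x G (fun z => z * Crpow (segp c z) s)%C.
Proof. intros Hc; apply fc_mul; [apply conG_Crpow, Hc | apply oint_Crpow, Hc]. Qed.

Lemma conG_zCrpow s c : 0 <= c <= 1 -> conG (V := CS) G (fun z => z * Crpow (segp c z) s)%C.
Proof.
intros Hc g Hg t Ht; apply vcont_Cmult; [apply vcont_id_C | exact (conG_Crpow s c Hc g Hg t Ht)].
Qed.

Lemma xp_succ s c : 0 <= c <= 1 ->
  ((1 - c)%C [*] aone [+] c [*] x) [o] xp (s - 1) c = xp s c.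
Proof.
intros Hc; rewrite amul_add_l, !amul_sc_l, amul_1_l, xp_mul_x by exact Hc.
assert (K1 := conG_Crpow (s - 1) c Hc); assert (K2 := conG_zCrpow (s - 1) c Hc).
unfold xp; rewrite <- !fc_scal by assumption; rewrite <- fc_add.
- apply fc_ext; intros g Hg t Ht.
  rewrite <- (Crpow_pred _ s (segp_slit c _ Hc (HS g Hg t Ht))); unfold segp; ring.
- intros g Hg t Ht; exact (vcont_lin (sc_linmap (V := CS) _) _ _ (K1 g Hg t Ht)).
- intros g Hg t Ht; exact (vcont_lin (sc_linmap (V := CS) _) _ _ (K2 g Hg t Ht)).
Qed.

Lemma xp_comm a s c : 0 <= c <= 1 -> a [o] x = x [o] a -> a [o] xp s c = xp s c [o] a.
Proof. intros Hc; apply fc_comm, conG_Crpow, Hc. Qed.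

Lemma xp_0_r s : xp s 0 = aone.
Proof.
rewrite <- fc_one; apply fc_ext; intros g _ t _.
unfold segp; replace (1 - 0 + 0 * path g t)%C with (RtoC 1) by ring; apply Crpow_1_l.
Qed.

Lemma xp_0_l c : xp 0 c = aone.
Proof. rewrite <- fc_one; apply fc_ext; intros g _ t _; apply Crpow_0_r. Qed.

Lemma xp_m1_inverse c : 0 <= c <= 1 ->
  inverse_of ((1 - c)%C [*] aone [+] c [*] x) (xp (-1) c).
Proof.
intros Hc; assert (E := xp_succ 0 c Hc); rewrite xp_0_l in E.
replace (0 - 1) with (-1) in E by ring.
split; [exact E |].
change (xp (-1) c [o] ((1 - c)%C [*] aone [+] c [*] x) = aone).
rewrite <- xp_comm, E; [reflexivity | exact Hc |].
repeat (progress aexp); reflexivity.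
Qed.

Lemma xp_pred s c : 0 <= c <= 1 -> xp (s - 1) c = xp (-1) c [o] xp s c.
Proof.
intros Hc; rewrite <- (xp_succ s c Hc), <- amulA.
destruct (xp_m1_inverse c Hc) as [_ E].
change (xp (-1) c [o] ((1 - c)%C [*] aone [+] c [*] x) = aone) in E.
rewrite E, amul_1_l; reflexivity.
Qed.

Lemma jcontC_Crpow {P : UniformSpace} (c : P -> R) s z p : (forall q, 0 <= c q <= 1) ->
  continuous c p -> slit_plane z ->
  jcontC (P := P) (V := CS) (fun z q => Crpow (segp (c q) z) s) z p.
Proof.
intros Hc Hp Hz; apply vcont_Crpow; [apply segp_slit; [apply Hc | exact Hz] |].
assert (K1 : vcont (T := prod_UniformSpace C_UniformSpace P) (V := CS) (fun zp => RtoC (c (snd zp))) (z, p)).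
{ exact (jcontC_snd (P := P) (V := CS) (fun q => RtoC (c q)) z p (vcont_Rfun _ _ Hp)). }
apply vcont_Cplus; [apply vcont_Cminus; [apply vcont_const | exact K1] |].
apply vcont_Cmult; [exact K1 |].
exact (jcontC_fst (P := P) (V := CS) (fun z => z) z p (vcont_id_C z)).
Qed.

Lemma vcont_xp {P : UniformSpace} (c : P -> R) s p : (forall q, 0 <= c q <= 1) -> continuous c p ->
  vcont (fun q => xp s (c q)) p.
Proof.
intros Hc Hp; apply (vcont_fc (fun z q => Crpow (segp (c q) z) s)).
- intros g Hg t Ht; apply jcontC_Crpow; [exact Hc | exact Hp | exact (HS g Hg t Ht)].
- apply filter_forall; intros q; apply conG_Crpow, Hc.
Qed.

Lemma xp_bounded s : exists M, 0 <= M /\ forall c, 0 <= c <= 1 -> nrm (xp s c) <= M.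
Proof.
destruct (bounded_continuity (K := C_AbsRing) (V := B) (fun c => xp s (clamp 0 1 c)) 0 1) as [M HM].
{ intros c _; apply (proj1 (vcont_continuous (V := B) (fun c => xp s (clamp 0 1 c)) c)).
  apply vcont_xp; [intros; apply clamp_in, Rle_0_1 | apply continuous_clamp]. }
exists (Rmax M 0); split; [apply Rmax_r |]; intros c Hc.
apply Rle_trans with M; [| apply Rmax_l]; left.
specialize (HM c Hc); rewrite clamp_id in HM by exact Hc; exact HM.
Qed.

(** The parameter is a function from the whole line to [[0, 1]] because [der] is two-sided, whereas
    [segp] avoids the cut only for [0 <= c <= 1]. *)
Lemma rder_xp (c c' : R -> R) s p : (forall q, 0 <= c q <= 1) ->
  (forall q, is_derive c q (c' q)) -> (forall q, continuous c' q) ->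
  rder (fun q => xp s (c q)) p ((c' p * s)%R [*] ((x [-] aone) [o] xp (s - 1) (c p))).
Proof.
intros Hc Hd Hd'.
assert (Cc : forall q, continuous c q).
{ intros q; apply (ex_derive_continuous (K := R_AbsRing) (V := R_NormedModule)); exists (c' q); apply Hd. }
pose (f' := fun z q => ((c' q * (z - 1)) * (s * Crpow (segp (c q) z) (s - 1)))%C).
assert (JC : forall z q, slit_plane z -> jcontC (P := R_UniformSpace) (V := CS) f' z q).
{ intros z q Hz; apply vcont_Cmult; apply vcont_Cmult.
  - exact (jcontC_snd (P := R_UniformSpace) (V := CS) (fun q => RtoC (c' q)) z q (vcont_Rfun _ _ (Hd' q))).
  - apply vcont_Cminus; [| apply vcont_const].
    exact (jcontC_fst (P := R_UniformSpace) (V := CS) (fun z => z) z q (vcont_id_C z)).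
  - apply vcont_const.
  - exact (jcontC_Crpow (P := R_UniformSpace) c (s - 1) z q Hc (Cc q) Hz). }
eapply der_eq.
- apply (rder_fc (fun z q => Crpow (segp (c q) z) s) f').
  + apply filter_forall; intros q; split; [apply conG_Crpow, Hc |].
    intros g Hg t Ht; specialize (HS g Hg t Ht); simpl in *; set (z := path g t) in *; split.
    * apply (cder_chain (V := CS) RtoC (fun q => segp (c q) z) (fun w => Crpow w s) q).
      -- apply (der_ext RtoC (V := CS) (fun q => 1 + c q * (z - 1))%C).
         { intros r; unfold segp; change (@eq C (1 + c r * (z - 1))%C (1 - c r + c r * z)%C); ring. }
         apply (der_eq RtoC (V := CS)) with (vadd (V := CS) vzero (vsc (V := CS) (c' q) (z - 1)%C)).
         ++ apply (der_add RtoC (V := CS)); [apply der_const |].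
            exact (der_lin _ (scl_linmap (V := CS) (z - 1)%C) _ _ _ (rder_R _ _ _ (Hd q))).
         ++ exact (vadd_0_l (V := CS) _).
      -- apply cder_Crpow, segp_slit; [apply Hc | exact HS].
    * apply (vcont_comp (T := R_UniformSpace) (S := prod_UniformSpace C_UniformSpace R_UniformSpace)
        (V := CS) (fun q => (z, q)) (fun tp => f' (fst tp) (snd tp)) q); [| exact (JC z q HS)].
      intros Q [e He]; exists e; intros y Hy; apply He; split; [apply ball_center | exact Hy].
  + intros g Hg t Ht; apply JC, (HS g Hg t Ht).
- assert (K1 := conG_Crpow (s - 1) (c p) (Hc p)); assert (K2 := conG_zCrpow (s - 1) (c p) (Hc p)).
  rewrite amul_sub_l, amul_1_l, xp_mul_x by apply Hc.
  replace (fc x G (fun z => z * Crpow (segp (c p) z) (s - 1))%C [-] xp (s - 1) (c p)) with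
    (fc x G (fun z => z * Crpow (segp (c p) z) (s - 1))%C [+] (-(1))%C [*] xp (s - 1) (c p)) by vmod.
  assert (K3 : conG (V := CS) G (fun z => (-(1)) * Crpow (segp (c p) z) (s - 1))%C).
  { intros g Hg t Ht; exact (vcont_lin (sc_linmap (V := CS) _) _ _ (K1 g Hg t Ht)). }
  unfold xp; rewrite <- fc_scal, <- fc_add, <- fc_scal; try assumption.
  + apply fc_ext; intros g _ t _; unfold f'; rewrite RtoC_mult; ring.
  + intros g Hg t Ht; exact (vcont_add (V := CS) _ _ _ (K2 g Hg t Ht) (K3 g Hg t Ht)).
Qed.

End Calculus.

(* [ramp c] maps the whole line into [[0, c]], so that functions defined on the unit
   interval can be differentiated at its end points. *)
Definition ramp (c t : R) : R := c * ((1 - cos (PI * t)) / 2).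
Definition ramp' (c t : R) : R := c * (PI * sin (PI * t) / 2).

Lemma ramp_in c t : 0 <= c <= 1 -> 0 <= ramp c t <= 1.
Proof. intros H; unfold ramp; generalize (COS_bound (PI * t)); nra. Qed.
Lemma ramp_0 c : ramp c 0 = 0.
Proof. unfold ramp; rewrite Rmult_0_r, cos_0; field. Qed.
Lemma ramp_1 c : ramp c 1 = c.
Proof. unfold ramp; rewrite Rmult_1_r, cos_PI; field. Qed.
Lemma ramp_derive c t : is_derive (ramp c) t (ramp' c t).
Proof. unfold ramp, ramp'; auto_derive; [exact I | field]. Qed.
Lemma ramp'_continuous c t : continuous (ramp' c) t.
Proof.
apply (ex_derive_continuous (K := R_AbsRing) (V := R_NormedModule)); unfold ramp'; auto_derive; exact I.
Qed.
Lemma ramp_continuous c t : continuous (ramp c) t.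
Proof.
apply (ex_derive_continuous (K := R_AbsRing) (V := R_NormedModule)); exists (ramp' c t); apply ramp_derive.
Qed.

(** * Independence of the contour *)

Section TwoContours.
Context {B : BanachAlgebra} (x : B).

(** What the calculus retains of [surrounds]. In this form the notion also applies to the explicit
    circle that defines the exponential. *)
Definition good (G : contour) : Prop :=
  contour_in G (regular x) /\ contour_in G slit_plane /\ oint G (res x) = two_pi_i [*] aone.

Lemma surrounds_good G : surrounds G (spectrum x) slit_plane -> good G.
Proof.
intros [H1 [H2 H3]].
assert (K1 : contour_in G (regular x)).
{ apply contour_in_imp with (2 := H1); intros z [_ Hz]; apply regular_spectrum, Hz. }
split; [exact K1 | split].
- apply contour_in_imp with (2 := H1); intros z [Hz _]; exact Hz.
- apply oint_res; [exact K1 |]; intros w Hw.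
  assert (Hoff : contour_in G (fun z => z <> w)) by (apply (spectrum_off x G K1), Hw).
  apply (has_index_iff G w 1%C Hoff) in H2; [rewrite H2; ring | exact Hw].
Qed.

(** The product is 1 at [c = 0] and its derivative in [c] vanishes. The two factors may use
    different contours. *)
Lemma xp_inverse G G' s c : good G -> good G' -> 0 <= c <= 1 -> xp x G s c [o] xp x G' (- s) c = aone.
Proof.
intros [A1 [A2 A3]] [B1 [B2 B3]] Hc.
assert (Hr := fun t => ramp_in c t Hc).
assert (K : is_vint (fun _ => vzero : B) 0 1
  (xp x G s (ramp c 1) [o] xp x G' (- s) (ramp c 1) [-] xp x G s (ramp c 0) [o] xp x G' (- s) (ramp c 0))).
{ apply (is_vint_ftc (fun t => xp x G s (ramp c t) [o] xp x G' (- s) (ramp c t))); [lra | | intros t _; apply vcont_const].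
  intros t _; eapply der_eq.
  - apply der_mul.
    + apply (rder_xp x G A1 A2 (ramp c) (ramp' c)); [exact Hr | apply ramp_derive | apply ramp'_continuous].
    + apply (rder_xp x G' B1 B2 (ramp c) (ramp' c)); [exact Hr | apply ramp_derive | apply ramp'_continuous].
  - rewrite (xp_pred x G A1 A3 A2 s), (xp_pred x G' B1 B3 B2 (- s)) by apply Hr.
    (* Along either contour the exponent [-1] gives the inverse of [(1 - c) + c x]. The two terms of
       the product rule then carry the same factor with opposite signs. *)
    assert (ED : xp x G' (-1) (ramp c t) = xp x G (-1) (ramp c t)).
    { apply inverse_unique with ((1 - ramp c t)%C [*] aone [+] ramp c t [*] x); apply xp_m1_inverse; auto. }
    rewrite ED.
    set (D := xp x G (-1) (ramp c t)); set (X := xp x G s (ramp c t)); set (Y := xp x G' (- s) (ramp c t)).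
    assert (CX : X [o] x = x [o] X) by (symmetry; apply xp_comm; auto).
    assert (CD : X [o] D = D [o] X) by (apply xp_comm; auto).
    rewrite !amul_sc_l, !amul_sc_r, !amul_sub_l, !amul_1_l, !amul_sub_r, !amulA.
    rewrite <- (amulA X x), CX, amulA, <- (amulA X D), CD, !amulA.
    rewrite (Ropp_mult_distr_r_reverse (ramp' c t) s), RtoC_opp; vmod. }
rewrite !ramp_0, !ramp_1, !xp_0_r, amul_1_l in K by assumption.
assert (E := is_RInt_unique (V := realify B) _ _ _ _ (is_vint_0 (V := B) 0 1 Rle_0_1)).
assert (E2 := vint_unique _ _ _ _ K); unfold vint in E2; rewrite E in E2.
match type of E2 with _ = ?a [-] ?b => replace a with ((a [-] b) [+] b) by vmod end.
rewrite <- E2; apply vadd_0_l.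
Qed.

(** Both powers are inverse to the power [- s] taken along [G']. *)
Lemma xp_indep G G' s c : good G -> good G' -> 0 <= c <= 1 -> xp x G s c = xp x G' s c.
Proof.
intros H H' Hc.
assert (E1 := xp_inverse G G' s c H H' Hc).
assert (E2 := xp_inverse G' G' (- s) c H' H' Hc); rewrite Ropp_involutive in E2.
rewrite <- (amul_1_r (xp x G s c)), <- E2, <- amulA, E1; apply amul_1_l.
Qed.

End TwoContours.

(** * Semigroups and radial integrals *)

Ltac rtoc := repeat first [rewrite RtoC_mult | rewrite RtoC_opp | rewrite RtoC_minus | rewrite RtoC_plus].

(** The properties of [exp(-u p)] used later: its equation, its commutation with the commutant of
    [p], and its decay. They hold alike for [k], its multiples, multiplication operators and the
    scalar 1. *)
Definition semigroup {B : BanachAlgebra} (p : B) (P : R -> B) : Prop :=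
  P 0 = aone /\ (forall u, rder P u (vneg (p [o] P u))) /\
  (forall a, a [o] p = p [o] a -> forall u, a [o] P u = P u [o] a) /\
  exists C eps, 0 < C /\ 0 < eps /\ forall u, 0 <= u -> nrm (P u) <= C * exp (- (eps * u)).

Section Semigroup.
Context {B : BanachAlgebra} (k : B) (delta : R).
Hypothesis Hdelta : 0 < delta.
Hypothesis Hspec : forall z, ~ regular k z -> Im z = 0 /\ delta <= Re z.

Let c := nrm k + delta.
Let r := c - delta / 2.

(** The spectrum lies in [[delta, |k|]]. The centre [|k| + delta] and the radius put the leftmost
    point at [delta / 2] and the whole spectrum inside. *)
Definition right_circle : contour := [circle c r].

Lemma right_circle_radius : 0 < r.
Proof. unfold r, c; generalize (nrm_ge0 k); lra. Qed.

Lemma right_circle_Re : contour_in right_circle (fun z => delta / 2 <= Re z).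
Proof.
intros g [<- | []] t _; change (delta / 2 <= Re (circle_path c r t)); assert (H := right_circle_radius).
assert (K := circle_right c r t ltac:(lra)).
assert (E : c - r = delta / 2) by (unfold r; lra); lra.
Qed.

Lemma right_circle_spectrum z : ~ regular k z -> Cmod (z - c) < r.
Proof.
intros Hz; destruct (Hspec z Hz) as [H1 H2].
assert (H3 : Cmod z <= nrm k).
{ apply (spectrum_bound k z); intros K; exact (Hz K). }
assert (H4 := Rle_trans _ _ _ (Rle_abs _) (re_le_Cmod z)).
replace (z - c)%C with (RtoC (Re z - c)).
- rewrite Cmod_R, Rabs_left by (unfold c; lra); unfold r; lra.
- destruct z as [z1 z2]; simpl in H1; apply injective_projections; simpl; lra.
Qed.

Lemma right_circle_good : good k right_circle.
Proof.
assert (Hr := right_circle_radius).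
assert (K1 : contour_in right_circle (regular k)).
{ intros g [<- | []] t _; simpl; apply NNPP; intros K.
  assert (L := right_circle_spectrum _ K); rewrite circle_dist in L by lra; lra. }
split; [exact K1 | split].
- apply contour_in_imp with (2 := right_circle_Re); intros z Hz; apply right_half_slit; lra.
- apply oint_res; [exact K1 |]; intros w Hw.
  apply circle_inside; [exact Hr | apply right_circle_spectrum, Hw].
Qed.

Lemma cder_Cexp_mul (a z : C) : cder (V := CS) (fun z => Cexp (a * z)) z (a * Cexp (a * z))%C.
Proof.
apply (cder_chain (V := CS) (fun z => z) (fun z => a * z)%C Cexp z); [| apply cder_Cexp].
apply (der_eq (fun z => z) (V := CS)) with (vsc (V := CS) a (RtoC 1)).
- exact (der_lin _ (sc_linmap (V := CS) a) _ _ _ (der_io (fun z => z) z)).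
- change (@eq C (a * 1)%C a); ring.
Qed.

Definition expo (u : R) : B := fc k right_circle (fun z => Cexp (- u * z)).

Lemma conG_Cexp G (a : C) : conG (V := CS) G (fun z => Cexp (a * z)).
Proof. intros g _ t _; exact (cder_vcont _ _ _ (cder_Cexp_mul a _)). Qed.

Lemma Cexp_primitive (a : C) : exists F : C -> C, forall z, cder (V := CS) F z (Cexp (a * z)).
Proof.
destruct (Ceq_dec a 0) as [-> | N].
- exists (fun z => z); intros z.
  apply (der_eq (fun z => z) (V := CS)) with (RtoC 1); [exact (der_io (fun z => z) _) |].
  rewrite Cmult_0_l; symmetry; exact Cexp_0.
- exists (fun z => / a * Cexp (a * z))%C; intros z; eapply der_eq.
  + exact (der_lin _ (sc_linmap (V := CS) (/ a)%C) _ _ _ (cder_Cexp_mul a _)).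
  + change (@eq C (/ a * (a * Cexp (a * z)))%C (Cexp (a * z))); field; exact N.
Qed.

Lemma oint_Cexp G (a : C) : oint (V := CS) G (fun z => Cexp (a * z)) = RtoC 0.
Proof.
destruct (Cexp_primitive a) as [F HF].
apply (oint_primitive (V := CS) G F); [intros g _ t _; apply HF | apply conG_Cexp].
Qed.

Lemma jcontC_Cexp (z : C) (u : R) : jcontC (P := R_UniformSpace) (V := CS) (fun z u => Cexp (- u * z)) z u.
Proof.
apply vcont_Cexp, vcont_Cmult.
- apply vcont_Copp; exact (jcontC_snd (P := R_UniformSpace) (V := CS) RtoC z u (vcont_Rfun _ _ (continuous_id u))).
- exact (jcontC_fst (P := R_UniformSpace) (V := CS) (fun z => z) z u (vcont_id_C z)).
Qed.

Lemma rder_Cexp_mul (z : C) u : rder (V := CS) (fun u => Cexp (- u * z)) u (- z * Cexp (- u * z))%C.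
Proof.
apply (der_ext RtoC (V := CS) (fun u => Cexp (u * (- z)))%C).
- intros v; f_equal; ring.
- replace (- u * z)%C with (u * (- z))%C by ring; apply rder_Cexp_line.
Qed.

(** Differentiation under the integral produces the factor [- z], which [fc_mul] turns into [- k].
    The decay rate is the lower bound [delta / 2] of [Re z] on the circle. *)
Lemma expo_semigroup : semigroup k expo.
Proof.
destruct right_circle_good as [G1 [G2 G3]].
split; [| split; [| split]].
- transitivity (fc k right_circle (fun _ => 1%C)); [| exact (fc_one k right_circle G3)].
  unfold expo; apply (fc_ext k right_circle); intros g _ t _.
  replace (- 0 * path g t)%C with (RtoC 0) by ring; exact Cexp_0.
- intros u; eapply der_eq.
  + apply (rder_fc k right_circle G1 (fun z u => Cexp (- u * z)) (fun z u => - z * Cexp (- u * z))%C).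
    * apply filter_forall; intros v; split; [apply conG_Cexp |].
      intros g _ t _; split; [apply rder_Cexp_mul |].
      exact (vcont_lin (sc_linmap (V := CS) _) _ _ (rder_vcont _ _ _ (rder_Cexp_mul _ v))).
    * intros g _ t _; apply vcont_Cmult; [| apply jcontC_Cexp].
      apply vcont_Copp.
      exact (jcontC_fst (P := R_UniformSpace) (V := CS) (fun z => z) _ u (vcont_id_C _)).
  + unfold expo; rewrite (fc_mul k right_circle G1); [| apply conG_Cexp | apply oint_Cexp].
    rewrite vneg_sc, <- fc_scal; [| exact G1 |].
    * apply fc_ext; intros g _ t _; ring.
    * intros g _ t _; apply vcont_Cmult; [apply vcont_id_C | exact (cder_vcont _ _ _ (cder_Cexp_mul _ _))].
- intros a Ha u; exact (fc_comm k right_circle G1 a _ (conG_Cexp right_circle (- u)%C) Ha).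
- destruct (fc_bound k right_circle G1) as [L [HL H]].
  exists (L + 1), (delta / 2); split; [lra | split; [lra |]]; intros u Hu.
  apply Rle_trans with (L * exp (- (delta / 2 * u))).
  + unfold expo; apply H; [left; apply exp_pos | apply conG_Cexp |].
    apply contour_in_imp with (2 := right_circle_Re); intros z Hz.
    rewrite Cmod_Cexp; replace (Re (- u * z)) with (- (u * Re z)) by (unfold Re; simpl; ring).
    assert (K : - (u * Re z) <= - (delta / 2 * u)) by nra.
    destruct K as [K | K]; [left; apply exp_increasing, K | right; rewrite K; reflexivity].
  + apply Rmult_le_compat_r; [left; apply exp_pos | lra].
Qed.

End Semigroup.

Lemma semigroup_vcont {B : BanachAlgebra} (p : B) P : semigroup p P -> forall u, vcont P u.
Proof. intros [_ [H _]] u; exact (rder_vcont _ _ _ (H u)). Qed.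

Lemma rder_comp_R {V : CNM} (g : R -> R) (f : R -> V) t g' f' :
  is_derive g t g' -> rder f (g t) f' -> rder (fun s => f (g s)) t (g' [*] f').
Proof.
intros Hg Hf; apply rder_is_derive.
exact (is_derive_comp (K := R_AbsRing) (V := realify V) f g t f' g'
  (proj1 (rder_is_derive f (g t) f') Hf) Hg).
Qed.

(** * Truncated radial integrals along the path of powers *)

Section Radial.
Context {B : BanachAlgebra} (y : B) (G : contour).
Hypothesis HG : good y G.
Context (p q : B) (P Q : R -> B).
Hypothesis HP : semigroup p P.
Hypothesis HQ : semigroup q Q.
Hypothesis Hpy : p [o] y = q.
Hypothesis Hyp : y [o] p = q.
Hypothesis Hqp : q [o] p = p [o] q.
Variable N : nat.

(** In this section [rho] is the radius of truncation. For commuting [p] and [q] the integrand is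
    [r^n exp(-r^2 ((1 - c) p + c q))]. *)
Definition radial (n : nat) (rho c : R) : B :=
  vint (fun r => RtoC (r ^ n) [*] (P ((1 - c) * r ^ 2) [o] Q (c * r ^ 2))) 0 rho.

Let s := (INR N + 1) / 2.

Lemma radial_vcont n c t :
  vcont (fun r => RtoC (r ^ n) [*] (P ((1 - c) * r ^ 2) [o] Q (c * r ^ 2))) t.
Proof.
apply vcont_sc.
- apply vcont_Rfun, (ex_derive_continuous (K := R_AbsRing) (V := R_NormedModule)); auto_derive; exact I.
- apply vcont_mul.
  + apply (vcont_comp (S := R_UniformSpace) (fun r => (1 - c) * r ^ 2) P); [| apply (semigroup_vcont p P HP)].
    apply (ex_derive_continuous (K := R_AbsRing) (V := R_NormedModule)); auto_derive; exact I.
  + apply (vcont_comp (S := R_UniformSpace) (fun r => c * r ^ 2) Q); [| apply (semigroup_vcont q Q HQ)].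
    apply (ex_derive_continuous (K := R_AbsRing) (V := R_NormedModule)); auto_derive; exact I.
Qed.

Lemma radial_linmap (a : B) n rho c : 0 <= rho ->
  is_vint (fun r => a [o] (RtoC (r ^ n) [*] (P ((1 - c) * r ^ 2) [o] Q (c * r ^ 2)))) 0 rho
    (a [o] radial n rho c).
Proof.
intros Hrho; apply (is_vint_lin (mul_l_linmap a)), vint_correct; [exact Hrho |].
intros t _; apply radial_vcont.
Qed.

Definition radial_end (rho c : R) : B :=
  RtoC (rho ^ S N) [*] (P ((1 - c) * rho ^ 2) [o] Q (c * rho ^ 2)).

(** Integrate the [r]-derivative of [r^(N+1) P Q]: it equals [(N + 1) r^N P Q - 2 r^(N+2) ((1 - c) p
    + c q) P Q], and [2 s = N + 1]. *)
Lemma radial_parts (rho c : R) : 0 <= rho ->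
  ((1 - c)%C [*] p [+] c [*] q) [o] radial (S (S N)) rho c =
  s [*] radial N rho c [-] (/ 2)%R [*] radial_end rho c.
Proof.
intros Hrho.
assert (Pq : forall u, P u [o] q = q [o] P u).
{ intros u; symmetry; apply HP; exact Hqp. }
assert (H : is_vint (fun r => (2 * s)%R [*] (RtoC (r ^ N) [*] (P ((1 - c) * r ^ 2) [o] Q (c * r ^ 2))) [-]
    2%R [*] (((1 - c)%C [*] p [+] c [*] q) [o] (RtoC (r ^ S (S N)) [*] (P ((1 - c) * r ^ 2) [o] Q (c * r ^ 2)))))
  0 rho (radial_end rho c [-] radial_end 0 c)).
{ apply (is_vint_ftc (fun r => radial_end r c)); [exact Hrho | |].
  - intros t _; unfold radial_end; eapply der_eq.
    + apply der_sc.
      * apply rder_R; auto_derive; [exact I | reflexivity].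
      * apply der_mul.
        -- apply (rder_comp_R (fun r => (1 - c) * r ^ 2) P); [auto_derive; [exact I | reflexivity] | apply HP].
        -- apply (rder_comp_R (fun r => c * r ^ 2) Q); [auto_derive; [exact I | reflexivity] | apply HQ].
    + cbv beta; set (U := P ((1 - c) * t ^ 2)); set (W := Q (c * t ^ 2)).
      assert (PqU : U [o] (q [o] W) = q [o] (U [o] W)) by (rewrite <- amulA; unfold U; rewrite Pq, amulA; reflexivity).
      repeat (progress aexp); rewrite PqU; unfold s.
      change (match N with | O => 1 | S _ => INR N + 1 end) with (INR (S N)).
      rewrite S_INR; simpl pow.
      replace (2 * ((INR N + 1) / 2)) with (INR N + 1) by field.
      rewrite !RtoC_mult, !RtoC_minus, !RtoC_plus; vmod.
  - intros t _; apply vcont_sub; [exact (vcont_lin (sc_linmap _) _ _ (radial_vcont N c t)) |].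
    apply (vcont_lin (sc_linmap 2%R)), (vcont_lin (mul_l_linmap _)), radial_vcont. }
assert (H2 := is_vint_sub _ _ _ _ _ _
  (is_vint_lin (sc_linmap (2 * s)%R) _ _ _ _ (vint_correct _ _ _ Hrho (fun t _ => radial_vcont N c t)))
  (is_vint_lin (sc_linmap 2%R) _ _ _ _ (radial_linmap ((1 - c)%C [*] p [+] c [*] q) (S (S N)) rho c Hrho))).
apply vint_unique in H; apply vint_unique in H2; rewrite H in H2.
change (vint _ 0 rho) with (radial N rho c) in H2.
assert (E0 : radial_end 0 c = vzero).
{ unfold radial_end; rewrite pow_i by lia; apply vsc_0. }
rewrite E0 in H2.
set (A := ((1 - c)%C [*] p [+] c [*] q) [o] radial (S (S N)) rho c) in *.
replace A with ((/ 2)%R [*] ((2 * s)%R [*] radial N rho c [-] (radial_end rho c [-] vzero))).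
- assert (E2 : RtoC (/ 2) = (/ 2)%C) by (apply RtoC_inv; lra).
  vmod0; rewrite RtoC_mult, E2; field.
  all: intros E; injection E; lra.
- rewrite H2.
  assert (E2 : RtoC (/ 2) = (/ 2)%C) by (apply RtoC_inv; lra).
  vmod0; rewrite RtoC_mult, E2; field.
  all: intros E; injection E; lra.
Qed.

(** Differentiating in the parameter brings down [-(q - p) r^2]; the power of [r] raised here by two
    is lowered again by [radial_parts]. *)
Lemma radial_rder (n : nat) (rho c t : R) : 0 <= rho ->
  rder (fun t => radial n rho (ramp c t)) t
    (ramp' c t [*] vneg ((q [-] p) [o] radial (S (S n)) rho (ramp c t))).
Proof.
intros Hrho.
assert (Pq : forall u, P u [o] q = q [o] P u).
{ intros u; symmetry; apply HP; exact Hqp. }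
pose (g' := fun r t => ramp' c t [*] (vneg (q [-] p) [o]
   (RtoC (r ^ S (S n)) [*] (P ((1 - ramp c t) * r ^ 2) [o] Q (ramp c t * r ^ 2))))).
assert (JC : forall r t, jcont (P := R_UniformSpace) g' r t).
{ intros r u.
  assert (Kr : continuous (U := R_UniformSpace) (fun tp : prod_UniformSpace R_UniformSpace R_UniformSpace => ramp c (snd tp)) (r, u)).
  { apply (continuous_comp (V := R_UniformSpace) snd (ramp c)); [apply continuous_snd | apply ramp_continuous]. }
  assert (K2 : continuous (U := R_UniformSpace) (fun tp : prod_UniformSpace R_UniformSpace R_UniformSpace => fst tp ^ 2) (r, u)).
  { apply (continuous_comp (V := R_UniformSpace) fst (fun r => r ^ 2)); [apply continuous_fst |].
    apply (ex_derive_continuous (K := R_AbsRing) (V := R_NormedModule)); auto_derive; exact I. }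
  apply (vcont_sc (T := prod_UniformSpace R_UniformSpace R_UniformSpace)).
  { exact (jcont_snd (P := R_UniformSpace) (V := CS) (fun t => RtoC (ramp' c t)) r u (vcont_Rfun _ _ (ramp'_continuous c u))). }
  apply (vcont_lin (mul_l_linmap _)).
  apply (vcont_sc (T := prod_UniformSpace R_UniformSpace R_UniformSpace)).
  { apply (jcont_fst (P := R_UniformSpace) (V := CS) (fun r => RtoC (r ^ S (S n))) r u), vcont_Rfun.
    apply (ex_derive_continuous (K := R_AbsRing) (V := R_NormedModule)); auto_derive; exact I. }
  apply vcont_mul.
  - apply (vcont_comp (T := prod_UniformSpace R_UniformSpace R_UniformSpace) (S := R_UniformSpace)
      (fun tp => (1 - ramp c (snd tp)) * fst tp ^ 2) P (r, u)); [| apply (semigroup_vcont p P HP)].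
    apply (continuous_mult (K := R_AbsRing)); [| exact K2].
    apply (continuous_minus (V := R_NormedModule)); [apply continuous_const | exact Kr].
  - apply (vcont_comp (T := prod_UniformSpace R_UniformSpace R_UniformSpace) (S := R_UniformSpace)
      (fun tp => ramp c (snd tp) * fst tp ^ 2) Q (r, u)); [| apply (semigroup_vcont q Q HQ)].
    apply (continuous_mult (K := R_AbsRing)); [exact Kr | exact K2]. }
eapply der_eq.
- apply (rder_vint_param (fun r t => RtoC (r ^ n) [*] (P ((1 - ramp c t) * r ^ 2) [o] Q (ramp c t * r ^ 2))) g').
  + exact Hrho.
  + apply filter_forall; intros u; split; [intros r _; apply radial_vcont |].
    intros r _; split; [| exact (jcont_r (P := R_UniformSpace) _ _ _ (JC r u))].
    eapply der_eq.
    * apply (der_lin RtoC (sc_linmap (RtoC (r ^ n)))), der_mul.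
      -- apply (rder_comp_R (fun u => (1 - ramp c u) * r ^ 2) P); [| apply HP].
         unfold ramp; auto_derive; [exact I | reflexivity].
      -- apply (rder_comp_R (fun u => ramp c u * r ^ 2) Q); [| apply HQ].
         unfold ramp; auto_derive; [exact I | reflexivity].
    * unfold g'; cbv beta; set (U := P ((1 - ramp c u) * r ^ 2)); set (W := Q (ramp c u * r ^ 2)).
      assert (PqU : U [o] (q [o] W) = q [o] (U [o] W)) by (rewrite <- amulA; unfold U; rewrite Pq, amulA; reflexivity).
      repeat (progress aexp); rewrite PqU; unfold ramp'.
      assert (E2 : RtoC (/ 2) = (/ 2)%C) by (apply RtoC_inv; lra).
      simpl pow; unfold Rdiv; rtoc; rewrite ?E2; vmod.
  + intros r _; apply JC.
- unfold g'; apply vint_unique.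
  replace (vneg ((q [-] p) [o] radial (S (S n)) rho (ramp c t))) with
    (vneg (q [-] p) [o] radial (S (S n)) rho (ramp c t)) by (rewrite amul_neg_l; reflexivity).
  apply (is_vint_lin (sc_linmap (ramp' c t))), radial_linmap, Hrho.
Qed.

(* With [y_c = (1 - c) + c y], an integration by parts in [r] shows that the derivative of
   [y_c^s radial N rho c] in [c] is [(1/2) (y - 1) y_c^(s-1) radial_end rho c]. *)
Lemma radial_estimate : exists K eps, 0 <= K /\ 0 < eps /\
  forall rho c, 0 <= rho -> 0 <= c <= 1 ->
    nrm (radial N rho c [-] xp y G (- s) c [o] radial N rho 0) <= K * (rho ^ S N * exp (- (eps * rho ^ 2))).
Proof.
destruct HG as [G1 [G2 G3]].
destruct HP as [_ [_ [_ [CP [eP [HCP [HeP BP]]]]]]].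
destruct HQ as [_ [_ [_ [CQ [eQ [HCQ [HeQ BQ]]]]]]].
destruct (xp_bounded y G G1 G2 s) as [M1 [HM1 B1]].
destruct (xp_bounded y G G1 G2 (-1)) as [M2 [HM2 B2]].
destruct (xp_bounded y G G1 G2 (- s)) as [M3 [HM3 B3]].
pose (e := Rmin eP eQ).
assert (He : 0 < e) by (apply Rmin_glb_lt; assumption).
pose (Y := nrm (y [-] aone)); assert (HY : 0 <= Y) by apply nrm_ge0.
assert (HPI := PI_RGT_0).
(* The factors bound, in order, [ramp' / 2], [y - 1], [y_c^(-1)], [y_c^s] and the two semigroups in
   the boundary term. *)
pose (K0 := PI * (Y * (M2 * (M1 * (CP * CQ))))).
assert (HCC : 0 < CP * CQ) by (apply Rmult_lt_0_compat; assumption).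
assert (HK0 : 0 <= K0).
{ unfold K0; repeat (apply Rmult_le_pos; [lra |]); lra. }
exists (M3 * K0), e; split; [apply Rmult_le_pos; assumption | split; [exact He |]].
intros rho c Hrho Hc.
assert (Hr := fun t => ramp_in c t Hc).
assert (Hend : forall d, 0 <= d <= 1 -> nrm (radial_end rho d) <= CP * CQ * (rho ^ S N * exp (- (e * rho ^ 2)))).
{ intros d Hd; assert (R0 : 0 <= rho ^ 2) by apply pow2_ge_0.
  assert (RN : 0 <= rho ^ S N) by (apply pow_le; exact Hrho).
  apply Rle_trans with (1 := nrm_sc_le _ _); rewrite Cmod_R, Rabs_pos_eq by exact RN.
  replace (CP * CQ * (rho ^ S N * exp (- (e * rho ^ 2)))) with
    (rho ^ S N * (CP * CQ * exp (- (e * rho ^ 2)))) by ring.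
  apply Rmult_le_compat_l; [exact RN |].
  apply Rle_trans with (1 := nrm_mul _ _).
  assert (L1 := BP ((1 - d) * rho ^ 2) ltac:(apply Rmult_le_pos; lra)).
  assert (L2 := BQ (d * rho ^ 2) ltac:(apply Rmult_le_pos; lra)).
  apply Rle_trans with ((CP * exp (- (eP * ((1 - d) * rho ^ 2)))) * (CQ * exp (- (eQ * (d * rho ^ 2))))).
  - apply Rmult_le_compat; try apply nrm_ge0; assumption.
  - replace ((CP * exp (- (eP * ((1 - d) * rho ^ 2)))) * (CQ * exp (- (eQ * (d * rho ^ 2))))) with
      (CP * CQ * exp (- (eP * ((1 - d) * rho ^ 2)) + - (eQ * (d * rho ^ 2)))) by (rewrite exp_plus; ring).
    apply Rmult_le_compat_l; [lra |].
    assert (E : - (eP * ((1 - d) * rho ^ 2)) + - (eQ * (d * rho ^ 2)) <= - (e * rho ^ 2)).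
    { assert (e <= eP) by apply Rmin_l; assert (e <= eQ) by apply Rmin_r.
      assert (0 <= (1 - d) * rho ^ 2) by (apply Rmult_le_pos; lra).
      assert (0 <= d * rho ^ 2) by (apply Rmult_le_pos; lra).
      assert (e * ((1 - d) * rho ^ 2) <= eP * ((1 - d) * rho ^ 2)) by (apply Rmult_le_compat_r; assumption).
      assert (e * (d * rho ^ 2) <= eQ * (d * rho ^ 2)) by (apply Rmult_le_compat_r; assumption).
      lra. }
    destruct E as [E | E]; [left; apply exp_increasing, E | right; rewrite E; reflexivity]. }
pose (Z := fun t => xp y G s (ramp c t)).
pose (D := fun t => xp y G (-1) (ramp c t)).
pose (F' := fun t => (ramp' c t * / 2)%R [*] ((y [-] aone) [o] (D t [o] (Z t [o] radial_end rho (ramp c t))))).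
assert (HF : nrm (Z 1 [o] radial N rho (ramp c 1) [-] Z 0 [o] radial N rho (ramp c 0) [-] vzero)
   <= K0 * (rho ^ S N * exp (- (e * rho ^ 2)))).
{ apply (mvt01 (fun t => Z t [o] radial N rho (ramp c t)) F').
  - intros t _; eapply der_eq.
    + apply der_mul.
      * exact (rder_xp y G G1 G2 (ramp c) (ramp' c) s t Hr (ramp_derive c) (ramp'_continuous c)).
      * exact (radial_rder N rho c t Hrho).
    + rewrite (xp_pred y G G1 G3 G2 s) by apply Hr; unfold F'; fold (Z t); fold (D t).
      assert (CZ : Z t [o] y = y [o] Z t) by
        exact (eq_sym (xp_comm y G G1 G2 y s (ramp c t) (Hr t) eq_refl)).
      assert (CD : Z t [o] D t = D t [o] Z t) by exact (xp_comm y G G1 G2 (Z t) (-1) (ramp c t) (Hr t) CZ).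
      set (E0 := s [*] radial N rho (ramp c t) [-] (/ 2)%R [*] radial_end rho (ramp c t)).
      (* Since [q = y p], one has [q - p = (y - 1) y_c^(-1) (y_c p)], and [y_c p = (1 - c) p + c q]
         is the factor in [radial_parts]. *)
      assert (EV : (q [-] p) [o] radial (S (S N)) rho (ramp c t) = (y [-] aone) [o] (D t [o] E0)).
      { unfold E0; rewrite <- radial_parts by exact Hrho.
        destruct (xp_m1_inverse y G G1 G3 G2 (ramp c t) (Hr t)) as [_ ED].
        change (D t [o] ((1 - ramp c t)%C [*] aone [+] ramp c t [*] y) = aone) in ED.
        replace ((1 - ramp c t)%C [*] p [+] ramp c t [*] q) with
          (((1 - ramp c t)%C [*] aone [+] ramp c t [*] y) [o] p).
        2:{ rewrite amul_add_l, !amul_sc_l, amul_1_l, Hyp; reflexivity. }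
        rewrite (amulA _ p), <- (amulA (D t)), ED, amul_1_l, <- amulA, (amul_sub_l y), amul_1_l, Hyp; reflexivity. }
      rewrite EV; unfold E0.
      set (W := radial N rho (ramp c t)); set (R0 := radial_end rho (ramp c t)).
      assert (E1 : forall a, Z t [o] ((y [-] aone) [o] (D t [o] a)) = (y [-] aone) [o] (D t [o] (Z t [o] a))).
      { intros a; rewrite <- (amulA (Z t)), amul_sub_r, CZ, amul_1_r.
        rewrite <- (amul_1_l (Z t)) at 2; rewrite <- amul_sub_l, amulA, <- (amulA (Z t)), CD, amulA; reflexivity. }
      rewrite amul_sc_r, amul_neg_r, E1.
      rewrite !amul_sc_l, !amul_sub_r, !amul_sc_r, !amulA, !RtoC_mult; vmod.
  - intros t _; apply (vcont_sc (T := R_UniformSpace)).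
    + apply vcont_Rfun, (continuous_mult (K := R_AbsRing)); [apply ramp'_continuous | apply continuous_const].
    + apply (vcont_lin (mul_l_linmap _)), vcont_mul; [| apply vcont_mul].
      * exact (vcont_xp (P := R_UniformSpace) y G G1 G2 (ramp c) (-1) t Hr (ramp_continuous c t)).
      * exact (vcont_xp (P := R_UniformSpace) y G G1 G2 (ramp c) s t Hr (ramp_continuous c t)).
      * apply (vcont_lin (sc_linmap _)), vcont_mul.
        -- apply (vcont_comp (S := R_UniformSpace) (fun t => (1 - ramp c t) * rho ^ 2) P);
             [| apply (semigroup_vcont p P HP)].
           apply (continuous_mult (K := R_AbsRing)); [| apply continuous_const].
           apply (continuous_minus (V := R_NormedModule)); [apply continuous_const | apply ramp_continuous].
        -- apply (vcont_comp (S := R_UniformSpace) (fun t => ramp c t * rho ^ 2) Q);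
             [| apply (semigroup_vcont q Q HQ)].
           apply (continuous_mult (K := R_AbsRing)); [apply ramp_continuous | apply continuous_const].
  - intros t _; replace (F' t [-] vzero) with (F' t) by vmod; unfold F'.
    apply Rle_trans with (1 := nrm_sc_le _ _); rewrite Cmod_R.
    assert (Hr' : Rabs (ramp' c t * / 2) <= PI).
    { unfold ramp'; generalize (SIN_bound (PI * t)); intros [S1 S2].
      apply Rabs_le; set (v := sin (PI * t)) in *.
      assert (- 1 <= c * v <= 1) by nra; split; nra. }
    unfold K0; rewrite Rmult_assoc; apply Rmult_le_compat; [apply Rabs_pos | apply nrm_ge0 | exact Hr' |].
    apply Rle_trans with (1 := nrm_mul _ _); fold Y; rewrite Rmult_assoc; apply Rmult_le_compat_l; [exact HY |].
    apply Rle_trans with (1 := nrm_mul _ _); rewrite Rmult_assoc.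
    apply Rmult_le_compat; [apply nrm_ge0 | apply nrm_ge0 | apply B2, Hr |].
    apply Rle_trans with (1 := nrm_mul _ _); rewrite Rmult_assoc.
    apply Rmult_le_compat; [apply nrm_ge0 | apply nrm_ge0 | apply B1, Hr |].
    apply Hend, Hr. }
unfold Z in HF; rewrite ramp_0, ramp_1, (xp_0_r y G G3), amul_1_l in HF.
(* Multiplication by [y_c^(-s)], bounded by [M3], undoes the power [y_c^s] in front of the
   integral. *)
assert (E : radial N rho c [-] xp y G (- s) c [o] radial N rho 0 =
  xp y G (- s) c [o] (xp y G s c [o] radial N rho c [-] radial N rho 0 [-] vzero)).
{ assert (Ei := xp_inverse y G G (- s) c HG HG Hc); rewrite Ropp_involutive in Ei.
  rewrite !amul_sub_r, <- amulA, Ei, amul_1_l, amul_0_r; vmod. }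
rewrite E; apply Rle_trans with (1 := nrm_mul _ _); rewrite Rmult_assoc.
apply Rmult_le_compat; [apply nrm_ge0 | apply nrm_ge0 | apply B3, Hc | exact HF].
Qed.

End Radial.

(** * Improper integrals and the Gamma function *)

Section Improper.
Context {W : CompleteNormedModule R_AbsRing}.

Lemma ex_RInt_cont (g : R -> W) a b : (forall r, continuous g r) -> ex_RInt g a b.
Proof. intros H; apply ex_RInt_continuous; intros; apply H. Qed.

(** The integrands of interest are prescribed only for positive arguments, with [Rpower] for powers.
    The function [g] extends them continuously across 0, so the lower limit contributes nothing. *)
Lemma is_RInt_gen_from_0 (f g : R -> W) (Fb : (R -> Prop) -> Prop) (L : W) (m : R) :
  Filter Fb -> 0 < m -> (forall r, continuous g r) ->
  Fb (fun b => m < b /\ forall r, 0 < r < b -> f r = g r) ->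
  filterlim (fun b => RInt g 0 b) Fb (locally L) ->
  is_RInt_gen f (at_right 0) Fb L.
Proof.
intros FF Hm Hg Hfg HL.
assert (H0 : filterlim (fun a => RInt g 0 a) (at_right 0) (locally (zero : W))).
{ assert (K : continuous (fun a => RInt g 0 a) 0).
  { apply (ex_derive_continuous (K := R_AbsRing) (V := W)); exists (g 0).
    apply (is_derive_RInt (V := W) g _ 0 0); [| apply Hg].
    apply filter_forall; intros b; apply RInt_correct, ex_RInt_cont, Hg. }
  unfold continuous in K; rewrite RInt_point in K.
  eapply filterlim_filter_le_1; [| exact K]; intros P HP; unfold at_right, within.
  generalize HP; apply filter_imp; tauto. }
assert (Hlim : filterlim (fun ab => plus (RInt g 0 (snd ab)) (opp (RInt g 0 (fst ab))))
   (filter_prod (at_right 0) Fb) (locally (plus L (opp zero)))).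
{ apply (filterlim_comp_2 (G := locally L) (H := locally (T := W) (opp (zero : W))) (I := locally (T := W) (plus L (opp (zero : W))))).
  - eapply filterlim_comp; [apply filterlim_snd | exact HL].
  - eapply filterlim_comp; [| apply (filterlim_opp (V := W))].
    eapply filterlim_comp; [apply filterlim_fst | exact H0].
  - apply (filterlim_plus (V := W)). }
rewrite (opp_zero (G := W)), (plus_zero_r (G := W)) in Hlim.
intros P HP; specialize (Hlim P HP); unfold filtermap in Hlim.
assert (Hev : filter_prod (at_right 0) Fb (fun ab => 0 < fst ab < m /\ m < snd ab /\
   forall r, 0 < r < snd ab -> f r = g r)).
{ apply Filter_prod with (fun a => 0 < a < m) (fun b => m < b /\ forall r, 0 < r < b -> f r = g r).
  - exists (mkposreal m Hm); intros y Hy Hy0; split; [exact Hy0 |].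
    apply Rabs_def2 in Hy; simpl in Hy; unfold minus, plus, opp in Hy; simpl in Hy; lra.
  - exact Hfg.
  - intros a b Ha [Hb1 Hb2]; simpl; split; [exact Ha | split; assumption]. }
unfold filtermapi; generalize (filter_and _ _ Hlim Hev); apply filter_imp; intros [a b] [HPab [Ha [Hb Hfb]]]; simpl in *.
exists (plus (RInt g 0 b) (opp (RInt g 0 a))); split; [| exact HPab].
apply is_RInt_ext with g.
- intros r; rewrite Rmin_left, Rmax_right by lra; intros Hr; symmetry; apply Hfb; lra.
- rewrite plus_comm; apply (is_RInt_Chasles (V := W)) with 0.
  + apply (is_RInt_swap (V := W)), RInt_correct, ex_RInt_cont, Hg.
  + apply RInt_correct, ex_RInt_cont, Hg.
Qed.

Lemma RInt_inv_sqr C a b : 0 < a -> a <= b -> is_RInt (fun s => C / s ^ 2) a b (C / a - C / b).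
Proof.
intros Ha Hab.
replace (C / a - C / b) with (minus ((fun s => - (C / s)) b) ((fun s => - (C / s)) a)).
2:{ unfold minus, plus, opp; simpl; ring. }
apply (is_RInt_derive (V := R_CompleteNormedModule) (fun s => - (C / s)) (fun s => C / s ^ 2)).
- intros s; rewrite Rmin_left, Rmax_right by exact Hab; intros Hs.
  auto_derive; [lra | field; lra].
- intros s; rewrite Rmin_left, Rmax_right by exact Hab; intros Hs.
  apply (ex_derive_continuous (K := R_AbsRing) (V := R_NormedModule)); auto_derive.
  apply Rgt_not_eq; nra.
Qed.

(** Cauchy's criterion: the integral over [[u, v]] is at most [C / u - C / v]. *)
Lemma improper_converges (f : R -> W) C M0 : 0 <= C -> 1 <= M0 -> (forall r, continuous f r) ->
  (forall s, M0 <= s -> norm (f s) <= C / s ^ 2) ->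
  exists L, filterlim (fun b => RInt f 0 b) (Rbar_locally p_infty) (locally L).
Proof.
intros HC HM0 Hf Hb.
apply (proj1 (filterlim_locally_cauchy (U := W) (F := Rbar_locally p_infty) (fun b => RInt f 0 b))).
intros eps.
pose (M := Rmax M0 (C / eps + 1)).
assert (HM1 : M0 <= M) by apply Rmax_l.
assert (HM2 : C / eps + 1 <= M) by apply Rmax_r.
assert (Heps := cond_pos eps).
assert (Hd : forall u v, M < u -> u <= v -> norm (minus (RInt f 0 v) (RInt f 0 u)) < eps).
{ intros u v Hu Huv.
  assert (E : minus (RInt f 0 v) (RInt f 0 u) = RInt f u v).
  { rewrite <- (RInt_Chasles f 0 u v) by (apply ex_RInt_cont, Hf).
    unfold minus; rewrite (plus_comm (RInt f 0 u)), <- plus_assoc.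
    etransitivity; [apply f_equal; exact (plus_opp_r (G := W) _) | exact (plus_zero_r (G := W) _)]. }
  rewrite E; apply Rle_lt_trans with (C / u - C / v).
  - apply (norm_RInt_le f (fun s => C / s ^ 2) u v); [exact Huv | intros s Hs; apply Hb; lra | |].
    + apply RInt_correct, ex_RInt_cont, Hf.
    + apply RInt_inv_sqr; lra.
  - assert (0 <= C / v) by (apply Rdiv_le_0_compat; lra).
    apply Rle_lt_trans with (C / u); [lra |].
    apply Rmult_lt_reg_r with u; [lra |].
    replace (C / u * u) with C by (field; lra).
    replace C with (eps * (C / eps)) by (field; lra).
    apply Rmult_lt_compat_l; lra. }
exists (fun u => M < u); split; [exists M; intros; assumption |].
intros u v Hu Hv.
destruct (Rle_lt_dec u v) as [H | H].
- apply (norm_compat1 (V := W)), Hd; assumption.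
- apply ball_sym, (norm_compat1 (V := W)), Hd; lra.
Qed.

(** Quadratic decay makes the two halves converge separately. The limit over symmetric windows,
    which closing the contour provides, therefore determines the limit with independent ends. *)
Lemma is_RInt_gen_symmetric (f : R -> W) C M0 (L : W) : 0 <= C -> 1 <= M0 -> (forall r, continuous f r) ->
  (forall s, M0 <= Rabs s -> norm (f s) <= C / s ^ 2) ->
  filterlim (fun b => RInt f (- b) b) (Rbar_locally p_infty) (locally L) ->
  is_RInt_gen f (Rbar_locally m_infty) (Rbar_locally p_infty) L.
Proof.
intros HC HM0 Hf Hb HL.
destruct (improper_converges f C M0 HC HM0 Hf) as [L1 H1].
{ intros s Hs; apply Hb; rewrite Rabs_pos_eq; lra. }
assert (Hf' : forall r, continuous (fun s => f (- s)) r).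
{ intros r; apply (continuous_comp (U := R_UniformSpace) (V := R_UniformSpace) Ropp f); [| apply Hf].
  apply (continuous_opp (V := R_NormedModule)), continuous_id. }
destruct (improper_converges (fun s => f (- s)) C M0 HC HM0 Hf') as [L2 H2].
{ intros s Hs; replace (s ^ 2) with ((- s) ^ 2) by ring; apply Hb; rewrite Rabs_Ropp, Rabs_pos_eq; lra. }
assert (E : forall b, RInt (fun s => f (- s)) 0 b = RInt f (- b) 0).
{ intros b; apply is_RInt_unique.
  apply is_RInt_ext with (fun s => opp (opp (f (- s)))).
  { intros s _; apply (opp_opp (G := W)). }
  replace (RInt f (- b) 0) with (opp (RInt f 0 (- b))).
  2:{ apply (opp_RInt_swap (V := W)), ex_RInt_cont, Hf. }
  apply (is_RInt_opp (V := W) (fun s => opp (f (- s)))), (is_RInt_comp_opp (V := W)).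
  rewrite Ropp_0; apply RInt_correct, ex_RInt_cont, Hf. }
assert (EL : plus L2 L1 = L).
{ apply (filterlim_locally_unique (V := W) (F := Rbar_locally p_infty) (fun b => RInt f (- b) b)); [| exact HL].
  apply filterlim_ext with (fun b => plus (RInt (fun s => f (- s)) 0 b) (RInt f 0 b)).
  { intros b; rewrite E; apply (RInt_Chasles (V := W)); apply ex_RInt_cont, Hf. }
  apply (filterlim_comp_2 (G := locally L2) (H := locally L1)); [exact H2 | exact H1 |].
  apply (filterlim_plus (V := W)). }
rewrite <- EL; intros P HP.
assert (K2 : filterlim (fun a => RInt f a 0) (Rbar_locally m_infty) (locally L2)).
{ intros Q HQ; destruct (H2 Q HQ) as [M HM]; exists (- M); intros a Ha.
  rewrite <- (Ropp_involutive a), <- E; apply HM; lra. }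
assert (Hlim : filterlim (fun ab => plus (RInt f (fst ab) 0) (RInt f 0 (snd ab)))
  (filter_prod (Rbar_locally m_infty) (Rbar_locally p_infty)) (locally (plus L2 L1))).
{ apply (filterlim_comp_2 (G := locally L2) (H := locally L1)).
  - exact (filterlim_comp _ _ _ fst (fun a => RInt f a 0) _ _ _ filterlim_fst K2).
  - exact (filterlim_comp _ _ _ snd (fun b => RInt f 0 b) _ _ _ filterlim_snd H1).
  - apply (filterlim_plus (V := W)). }
specialize (Hlim P HP); unfold filtermap in Hlim; unfold filtermapi; generalize Hlim.
apply filter_imp; intros [a b] Hab; simpl in *.
exists (plus (RInt f a 0) (RInt f 0 b)); split; [| exact Hab].
apply (is_RInt_Chasles (V := W)) with 0; apply RInt_correct, ex_RInt_cont, Hf.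
Qed.

End Improper.

(** Raise [u / n <= exp(u / n)] to the power [n]. *)
Lemma pow_exp_bound n u : 0 <= u -> u ^ n * exp (- u) <= INR n ^ n.
Proof.
intros Hu; destruct n as [| n].
{ simpl; rewrite Rmult_1_l, <- exp_0.
  destruct (Req_dec u 0) as [-> | N]; [rewrite Ropp_0; lra | left; apply exp_increasing; lra]. }
set (m := INR (S n)); assert (Hm : 0 < m) by (apply lt_0_INR; lia).
assert (E : exp u = exp (u / m) ^ S n).
{ rewrite <- Rpower_pow by apply exp_pos; unfold Rpower; rewrite ln_exp; fold m; f_equal; field; lra. }
assert (H1 : (u / m) ^ S n <= exp u).
{ rewrite E; apply pow_incr; split; [apply Rdiv_le_0_compat; lra |].
  apply Rle_trans with (1 + u / m); [lra |].
  destruct (Req_dec (u / m) 0) as [K | K]; [rewrite K, exp_0; lra | left; apply exp_ineq1, K]. }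
rewrite exp_Ropp; apply Rmult_le_reg_r with (exp u); [apply exp_pos |].
rewrite Rmult_assoc, Rinv_l, Rmult_1_r by (generalize (exp_pos u); lra).
replace (u ^ S n) with (m ^ S n * (u / m) ^ S n).
- apply Rmult_le_compat_l; [apply pow_le; lra | exact H1].
- rewrite <- Rpow_mult_distr; f_equal; field; lra.
Qed.

(** From [r^n <= 1 + (r^2)^n] and the previous bound at [u = eps r^2]. *)
Lemma gauss_bound n eps : 0 < eps -> exists C, 0 <= C /\ forall r, 0 <= r ->
  r ^ n * exp (- (eps * r ^ 2)) <= C.
Proof.
intros He.
assert (Hn : 0 <= INR n ^ n) by (apply pow_le, pos_INR).
assert (Hi : 0 <= / eps ^ n) by (left; apply Rinv_0_lt_compat, pow_lt, He).
exists (1 + / eps ^ n * INR n ^ n); split.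
{ generalize (Rmult_le_pos _ _ Hi Hn); lra. }
intros r Hr.
assert (H0 : 0 <= r ^ 2) by apply pow2_ge_0.
assert (Hx : 0 < exp (- (eps * r ^ 2)) <= 1).
{ split; [apply exp_pos |].
  assert (0 <= eps * r ^ 2) by (apply Rmult_le_pos; lra).
  rewrite <- exp_0; destruct (Req_dec (eps * r ^ 2) 0) as [K | K];
    [rewrite K, Ropp_0; lra | left; apply exp_increasing; lra]. }
assert (H1 := pow_exp_bound n (eps * r ^ 2) ltac:(apply Rmult_le_pos; lra)).
rewrite Rpow_mult_distr in H1.
assert (H2 : (r ^ 2) ^ n * exp (- (eps * r ^ 2)) <= / eps ^ n * INR n ^ n).
{ apply Rmult_le_reg_l with (eps ^ n); [apply pow_lt, He |].
  rewrite <- !Rmult_assoc, Rinv_r, Rmult_1_l by (apply Rgt_not_eq, pow_lt, He); exact H1. }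
assert (H3 : r ^ n <= 1 + (r ^ 2) ^ n).
{ destruct (Rle_lt_dec r 1) as [K | K].
  - assert (r ^ n <= 1) by (rewrite <- (pow1 n); apply pow_incr; lra).
    generalize (pow_le (r ^ 2) n H0); lra.
  - assert (r ^ n <= (r ^ 2) ^ n) by (apply pow_incr; split; [lra |]; simpl; nra); lra. }
apply Rle_trans with ((1 + (r ^ 2) ^ n) * exp (- (eps * r ^ 2))).
- apply Rmult_le_compat_r; lra.
- rewrite Rmult_plus_distr_r; lra.
Qed.

(** * Gaussian moments and values of Gamma *)

Definition gauss (n : nat) (r : R) : R := r ^ n * exp (- r ^ 2).

Lemma gauss_continuous n r : continuous (gauss n) r.
Proof.
apply (ex_derive_continuous (K := R_AbsRing) (V := R_NormedModule)); unfold gauss; auto_derive; exact I.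
Qed.

Lemma gauss_converges n :
  exists L : R, filterlim (fun b => RInt (gauss n) 0 b) (Rbar_locally p_infty) (locally L).
Proof.
destruct (gauss_bound (S (S n)) 1 Rlt_0_1) as [C [HC H]].
apply (improper_converges (W := R_CompleteNormedModule) (gauss n) C 1 HC (Rle_refl 1)); [apply gauss_continuous |].
intros s Hs; change (Rabs (gauss n s) <= C / s ^ 2).
assert (Hp : 0 < s ^ 2) by (apply pow_lt; lra).
rewrite Rabs_pos_eq.
- apply Rmult_le_reg_r with (s ^ 2); [exact Hp |].
  unfold Rdiv; rewrite Rmult_assoc, Rinv_l, Rmult_1_r by lra.
  specialize (H s ltac:(lra)); rewrite Rmult_1_l in H; unfold gauss.
  replace (s ^ n * exp (- s ^ 2) * s ^ 2) with (s ^ S (S n) * exp (- s ^ 2)) by (simpl; ring); exact H.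
- apply Rmult_le_pos; [apply pow_le; lra | left; apply exp_pos].
Qed.

Lemma gauss_end n : filterlim (fun b => b ^ S n * exp (- b ^ 2)) (Rbar_locally p_infty) (locally 0).
Proof.
destruct (gauss_bound (S (S n)) 1 Rlt_0_1) as [C [HC H]].
apply filterlim_locally; intros eps; assert (He := cond_pos eps).
exists (Rmax 1 (C / eps + 1)); intros b Hb.
assert (B1 := Rle_lt_trans _ _ _ (Rmax_l _ _) Hb); assert (B2 := Rle_lt_trans _ _ _ (Rmax_r _ _) Hb).
change (Rabs (b ^ S n * exp (- b ^ 2) - 0) < eps); rewrite Rminus_0_r, Rabs_pos_eq.
2:{ apply Rmult_le_pos; [apply pow_le; lra | left; apply exp_pos]. }
specialize (H b ltac:(lra)); rewrite Rmult_1_l in H.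
apply Rmult_lt_reg_l with b; [lra |].
replace (b * (b ^ S n * exp (- b ^ 2))) with (b ^ S (S n) * exp (- b ^ 2)) by (simpl; ring).
apply Rle_lt_trans with (1 := H).
replace C with (C / eps * eps) by (field; lra); apply Rmult_lt_compat_r; lra.
Qed.

Lemma RInt_gauss_step n b :
  RInt (gauss (S (S n))) 0 b = (INR (S n) / 2) * RInt (gauss n) 0 b - / 2 * (b ^ S n * exp (- b ^ 2)).
Proof.
assert (H : is_RInt (fun r => minus (scal (INR (S n)) (gauss n r)) (scal 2 (gauss (S (S n)) r))) 0 b
  (minus (b ^ S n * exp (- b ^ 2)) (0 ^ S n * exp (- 0 ^ 2)))).
{ apply (is_RInt_derive (V := R_CompleteNormedModule) (fun r => r ^ S n * exp (- r ^ 2))).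
  - intros r _; unfold gauss; auto_derive; [exact I |].
    change (match n with | O => 1 | S _ => INR n + 1 end) with (INR (S n)).
    unfold minus, plus, opp, scal; simpl; unfold mult; simpl; ring.
  - intros r _; apply (continuous_minus (V := R_NormedModule));
      apply (continuous_scal_r (V := R_NormedModule)), gauss_continuous. }
assert (H2 : is_RInt (fun r => minus (scal (INR (S n)) (gauss n r)) (scal 2 (gauss (S (S n)) r))) 0 b
  (minus (scal (INR (S n)) (RInt (gauss n) 0 b)) (scal 2 (RInt (gauss (S (S n))) 0 b)))).
{ apply (is_RInt_minus (V := R_NormedModule)); apply (is_RInt_scal (V := R_NormedModule));
    apply (RInt_correct (V := R_CompleteNormedModule)), (ex_RInt_cont (W := R_CompleteNormedModule)), gauss_continuous. }
apply (is_RInt_unique (V := R_CompleteNormedModule)) in H.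
apply (is_RInt_unique (V := R_CompleteNormedModule)) in H2.
rewrite H in H2; unfold minus, plus, opp, scal in H2; simpl in H2; unfold mult in H2; simpl in H2.
rewrite !Rmult_0_l in H2.
change (match n with | O => 1 | S _ => INR n + 1 end) with (INR (S n)) in *; simpl pow; lra.
Qed.

(** The antiderivative is explicit for the first moment. Each integration by parts raises the order
    by two and multiplies the limit by [n + 1], as the boundary term dies out. *)
Lemma gauss_odd_limit n :
  filterlim (fun b => RInt (gauss (2 * n + 1)) 0 b) (Rbar_locally p_infty) (locally (INR (fact n) / 2)).
Proof.
induction n as [| n IH].
- assert (E : forall b, / 2 - / 2 * exp (- b ^ 2) = RInt (gauss (2 * 0 + 1)) 0 b).
  { intros b; symmetry; apply (is_RInt_unique (V := R_CompleteNormedModule)).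
    replace (/ 2 - / 2 * exp (- b ^ 2)) with
      (minus ((fun r => - / 2 * exp (- r ^ 2)) b) ((fun r => - / 2 * exp (- r ^ 2)) 0)).
    - apply (is_RInt_derive (V := R_CompleteNormedModule) (fun r => - / 2 * exp (- r ^ 2)) (gauss (2 * 0 + 1))).
      + intros r _; unfold gauss; auto_derive; [exact I | simpl; field].
      + intros r _; apply gauss_continuous.
    - unfold minus, plus, opp; simpl; rewrite Rmult_0_l, Ropp_0, exp_0; field. }
  apply (filterlim_ext _ _ E); simpl fact; simpl INR.
  replace (locally (1 / 2)) with (locally (/ 2 - / 2 * 0)) by (f_equal; field).
  assert (K : filterlim (fun b => exp (- b ^ 2)) (Rbar_locally p_infty) (locally 0)).
  { apply filterlim_locally; intros eps; destruct (proj1 (filterlim_locally _ _) (gauss_end 0) eps) as [M HM].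
    exists (Rmax M 1); intros b Hb.
    assert (B1 := Rle_lt_trans _ _ _ (Rmax_l _ _) Hb); assert (B2 := Rle_lt_trans _ _ _ (Rmax_r _ _) Hb).
    specialize (HM b B1); change (Rabs (exp (- b ^ 2) - 0) < eps).
    change (Rabs (b ^ 1 * exp (- b ^ 2) - 0) < eps) in HM.
    assert (P := exp_pos (- b ^ 2)).
    rewrite Rminus_0_r, Rabs_pos_eq in * by nra; nra. }
  apply filterlim_locally; intros eps; destruct (proj1 (filterlim_locally _ _) K eps) as [M HM].
  exists M; intros b Hb; specialize (HM b Hb).
  change (Rabs (/ 2 - / 2 * exp (- b ^ 2) - (/ 2 - / 2 * 0)) < eps).
  change (Rabs (exp (- b ^ 2) - 0) < eps) in HM.
  assert (P := exp_pos (- b ^ 2)); rewrite Rminus_0_r, Rabs_pos_eq in HM by lra.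
  rewrite Rabs_left; lra.
- apply filterlim_ext with (fun b => plus (scal (INR (S (2 * n + 1)) / 2) (RInt (gauss (2 * n + 1)) 0 b))
     (opp (scal (/ 2) (b ^ S (2 * n + 1) * exp (- b ^ 2))))).
  { intros b; replace (2 * S n + 1)%nat with (S (S (2 * n + 1))) by lia.
    rewrite RInt_gauss_step; reflexivity. }
  replace (INR (fact (S n)) / 2) with (plus (scal (INR (S (2 * n + 1)) / 2) (INR (fact n) / 2)) (opp (scal (/ 2) 0))).
  2:{ change (INR (S (2 * n + 1)) / 2 * (INR (fact n) / 2) + - (/ 2 * 0) = INR (fact (S n)) / 2).
      replace (INR (S (2 * n + 1))) with (INR 2 * INR (S n)) by (rewrite <- mult_INR; f_equal; lia).
      change (fact (S n)) with (S n * fact n)%nat; rewrite mult_INR; change (INR 2) with 2; field. }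
  apply (filterlim_comp_2 (G := locally (scal (INR (S (2 * n + 1)) / 2) (INR (fact n) / 2)))
      (H := locally (opp (scal (/ 2) 0)))).
  + refine (filterlim_comp _ _ _ _ (fun y : R => scal (INR (S (2 * n + 1)) / 2) y) _ _ _ IH _).
    apply (ex_derive_continuous (K := R_AbsRing) (V := R_NormedModule)
      (fun y => INR (S (2 * n + 1)) / 2 * y)); auto_derive; exact I.
  + refine (filterlim_comp _ _ _ _ (fun y : R => opp (scal (/ 2) y)) _ _ _ (gauss_end (2 * n + 1)) _).
    apply (ex_derive_continuous (K := R_AbsRing) (V := R_NormedModule)
      (fun y => - (/ 2 * y))); auto_derive; exact I.
  + apply (filterlim_plus (V := R_NormedModule)).
Qed.

Lemma Rpower_INR_sqr n r : 0 < r -> 2 * r * Rpower (r ^ 2) ((INR n + 1) / 2 - 1) = 2 * r ^ n.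
Proof.
intros Hr.
replace (r ^ 2) with (Rpower r (INR 2)) by (rewrite Rpower_pow; [reflexivity | exact Hr]).
rewrite Rpower_mult.
replace (2 * r) with (2 * Rpower r 1) by (rewrite Rpower_1 by exact Hr; reflexivity).
rewrite Rmult_assoc, <- Rpower_plus.
replace (1 + INR 2 * ((INR n + 1) / 2 - 1)) with (INR n) by (simpl; field).
rewrite Rpower_pow by exact Hr; reflexivity.
Qed.

(* The substitution [t = r^2] in Euler's integral. *)
Lemma Gamma_gauss n (L : R) :
  filterlim (fun b => RInt (gauss n) 0 b) (Rbar_locally p_infty) (locally L) ->
  Gamma ((INR n + 1) / 2) = 2 * L.
Proof.
intros HL; unfold Gamma.
set (f := fun t => Rpower t ((INR n + 1) / 2 - 1) * exp (- t)).
apply (is_RInt_gen_unique (V := R_CompleteNormedModule) (Fa := at_right 0) (Fb := Rbar_locally p_infty) f (2 * L)).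
assert (Hfc : forall t, 0 < t -> continuous f t).
{ intros t Ht; apply (ex_derive_continuous (K := R_AbsRing) (V := R_NormedModule)).
  unfold f, Rpower; auto_derive; exact Ht. }
assert (Hsub : forall a b, 0 < a -> 0 < b ->
  is_RInt f a b (2 * (RInt (gauss n) 0 (sqrt b) - RInt (gauss n) 0 (sqrt a)))).
{ intros a b Ha Hb.
  assert (Sa := sqrt_lt_R0 a Ha); assert (Sb := sqrt_lt_R0 b Hb).
  assert (Hm : 0 < Rmin (sqrt a) (sqrt b)) by (apply Rmin_glb_lt; assumption).
  assert (H := is_RInt_comp (V := R_CompleteNormedModule) f (fun r => r ^ 2) (fun r => 2 * r) (sqrt a) (sqrt b)
    ltac:(intros r Hr; apply Hfc, pow_lt; lra)
    ltac:(intros r Hr; split; [auto_derive; [exact I | ring] |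
      apply (ex_derive_continuous (K := R_AbsRing) (V := R_NormedModule)); auto_derive; exact I])).
  cbv beta in H; rewrite !pow2_sqrt in H by lra.
  assert (H2 : is_RInt (fun y => scal (2 * y) (f (y ^ 2))) (sqrt a) (sqrt b)
     (scal 2 (minus (RInt (gauss n) 0 (sqrt b)) (RInt (gauss n) 0 (sqrt a))))).
  { apply is_RInt_ext with (fun r => scal 2 (gauss n r)).
    - intros r Hr.
      change (2 * (r ^ n * exp (- r ^ 2)) = 2 * r * (Rpower (r ^ 2) ((INR n + 1) / 2 - 1) * exp (- r ^ 2))).
      rewrite <- (Rmult_assoc (2 * r)), Rpower_INR_sqr by lra; ring.
    - apply (is_RInt_scal (V := R_NormedModule)); unfold minus; rewrite plus_comm.
      apply (is_RInt_Chasles (V := R_NormedModule)) with 0.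
      + apply (is_RInt_swap (V := R_NormedModule)), (RInt_correct (V := R_CompleteNormedModule)),
          (ex_RInt_cont (W := R_CompleteNormedModule)), gauss_continuous.
      + apply (RInt_correct (V := R_CompleteNormedModule)),
          (ex_RInt_cont (W := R_CompleteNormedModule)), gauss_continuous. }
  apply (is_RInt_unique (V := R_CompleteNormedModule)) in H.
  apply (is_RInt_unique (V := R_CompleteNormedModule)) in H2.
  replace (2 * (RInt (gauss n) 0 (sqrt b) - RInt (gauss n) 0 (sqrt a))) with (RInt f a b)
    by exact (eq_trans (eq_sym H) H2).
  apply (RInt_correct (V := R_CompleteNormedModule)), (ex_RInt_continuous (V := R_CompleteNormedModule)).
  intros z Hz; apply Hfc; generalize (Rmin_glb_lt _ _ _ Ha Hb); lra. }
assert (H0 : filterlim (fun a => RInt (gauss n) 0 (sqrt a)) (at_right 0) (locally 0)).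
{ assert (K : continuous (fun a => RInt (gauss n) 0 a) 0).
  { apply (ex_derive_continuous (K := R_AbsRing) (V := R_NormedModule)); exists (gauss n 0).
    apply (is_derive_RInt (V := R_NormedModule) (gauss n) _ 0 0); [| apply gauss_continuous].
    apply filter_forall; intros b; apply (RInt_correct (V := R_CompleteNormedModule)),
      (ex_RInt_cont (W := R_CompleteNormedModule)), gauss_continuous. }
  unfold continuous in K; rewrite (RInt_point (V := R_CompleteNormedModule)) in K.
  eapply filterlim_comp; [| exact K].
  intros P HP; rewrite <- sqrt_0 in HP.
  assert (C := continuous_sqrt 0 P HP); unfold filtermap, at_right, within in *.
  generalize C; apply filter_imp; tauto. }
assert (H1 : filterlim (fun b => RInt (gauss n) 0 (sqrt b)) (Rbar_locally p_infty) (locally L)).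
{ eapply filterlim_comp; [exact filterlim_sqrt_p | exact HL]. }
assert (Hlim : filterlim (fun ab => scal 2 (plus (RInt (gauss n) 0 (sqrt (snd ab))) (opp (RInt (gauss n) 0 (sqrt (fst ab))))))
   (filter_prod (at_right 0) (Rbar_locally p_infty)) (locally (scal 2 (plus L (opp 0))))).
{ refine (filterlim_comp _ _ _ _ (fun y : R => scal 2 y) _ (locally (plus L (opp 0))) _ _ _).
  2: apply (ex_derive_continuous (K := R_AbsRing) (V := R_NormedModule) (fun y => 2 * y)); auto_derive; exact I.
  apply (filterlim_comp_2 (G := locally L) (H := locally (opp 0)) (I := locally (plus L (opp 0)))).
  - exact (filterlim_comp _ _ _ snd (fun b => RInt (gauss n) 0 (sqrt b)) _ _ _ filterlim_snd H1).
  - refine (filterlim_comp _ _ _ _ (fun y : R => opp y) _ (locally 0) _ _ _).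
    + exact (filterlim_comp _ _ _ fst (fun a => RInt (gauss n) 0 (sqrt a)) _ _ _ filterlim_fst H0).
    + apply (ex_derive_continuous (K := R_AbsRing) (V := R_NormedModule) (fun y => - y)); auto_derive; exact I.
  - apply (filterlim_plus (V := R_NormedModule)). }
intros P HP.
replace (2 * L) with (scal 2 (plus L (opp 0))) in HP.
2:{ unfold scal, plus, opp; simpl; unfold mult; simpl; ring. }
specialize (Hlim P HP); unfold filtermap in Hlim.
assert (Hev : filter_prod (at_right 0) (Rbar_locally p_infty) (fun ab => 0 < fst ab /\ 0 < snd ab)).
{ apply Filter_prod with (fun a => 0 < a) (fun b => 0 < b).
  - exists (mkposreal 1 Rlt_0_1); intros y _ Hy; exact Hy.
  - exists 0; intros; assumption.
  - intros a b Ha Hb; split; assumption. }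
unfold filtermapi; generalize (filter_and _ _ Hlim Hev); apply filter_imp; intros [a b] [HPab [Ha Hb]]; simpl in Ha, Hb.
eexists; split; [apply Hsub; assumption | exact HPab].
Qed.

(** Since [n + 1 = ((2 n + 1) + 1) / 2], this value is twice an odd Gaussian moment. *)
Lemma Gamma_fact n : Gamma (INR (S n)) = INR (fact n).
Proof.
replace (INR (S n)) with ((INR (2 * n + 1) + 1) / 2).
- rewrite (Gamma_gauss _ _ (gauss_odd_limit n)); field.
- rewrite plus_INR, mult_INR, (S_INR n); change (INR 2) with 2; change (INR 1) with 1; field.
Qed.

(** * The half-disc contour *)

Definition half_turn : C := (- (Ci * PI))%C.
(** Clockwise: from [-i S] through [-S] to [i S] at [t = 1], then through [S] back to the start at
    [t = 2]. The clockwise sign is compensated by integrating [(x - l)^(-1)], the opposite of the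
    resolvent. *)
Definition arc (S t : R) : C := (- Ci * S * Cexp (t * half_turn))%C.
Definition arc' (S t : R) : C := (half_turn * arc S t)%C.
Definition seg (S t : R) : C := (Ci * (S * (2 * t - 1))%R)%C.
Definition seg' (S : R) : C := (Ci * (2 * S)%R)%C.

Lemma rder_arc S t : rder (V := CS) (arc S) t (arc' S t).
Proof.
eapply der_eq.
- exact (der_lin RtoC (sc_linmap (V := CS) (- Ci * S)%C) _ _ _ (rder_Cexp_line half_turn t)).
- change (@eq C (- Ci * S * (half_turn * Cexp (t * half_turn)))%C (half_turn * (- Ci * S * Cexp (t * half_turn)))%C); ring.
Qed.

Lemma vcont_arc' S t : vcont (V := CS) (arc' S) t.
Proof. exact (vcont_lin (sc_linmap (V := CS) half_turn) _ _ (rder_vcont _ _ _ (rder_arc S t))). Qed.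

Lemma rder_seg S t : rder (V := CS) (seg S) t (seg' S).
Proof.
eapply der_eq.
- apply (der_lin RtoC (sc_linmap (V := CS) Ci)); apply rder_R.
  auto_derive; [exact I | reflexivity].
- change (@eq C (Ci * (S * (2 * 1))%R)%C (Ci * (2 * S)%R)%C); f_equal; f_equal; ring.
Qed.

Lemma Cexp_half (t : R) : Cexp (t * half_turn) = (cos (PI * t), - sin (PI * t)).
Proof.
unfold Cexp, half_turn.
replace (Re (t * - (Ci * PI))) with 0 by (unfold Re; simpl; ring).
replace (Im (t * - (Ci * PI))) with (- (PI * t)) by (unfold Im; simpl; ring).
rewrite exp_0, cos_neg, sin_neg; f_equal; ring.
Qed.

Lemma arc_eq (S t : R) : arc S t = (- (S * sin (PI * t)), - (S * cos (PI * t))).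
Proof. unfold arc; rewrite Cexp_half; apply injective_projections; simpl; ring. Qed.

Lemma arc_dist S t : 0 <= S -> Cmod (arc S t) = S.
Proof.
intros HS; unfold arc; rewrite !Cmod_mult, Cmod_opp, Cmod_Ci, Cmod_R, Rabs_pos_eq, Cmod_Cexp by exact HS.
replace (Re (t * half_turn)) with 0 by (unfold half_turn, Re; simpl; ring); rewrite exp_0; ring.
Qed.

Lemma arc'_dist S t : 0 <= S -> Cmod (arc' S t) = PI * S.
Proof.
intros HS; unfold arc'; rewrite Cmod_mult, arc_dist by exact HS.
unfold half_turn; rewrite Cmod_opp, Cmod_mult, Cmod_Ci, Cmod_R, Rabs_pos_eq; [ring | left; exact PI_RGT_0].
Qed.

Lemma arc_left S t : 0 <= S -> 0 <= t <= 1 -> Re (arc S t) <= 0.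
Proof.
intros HS Ht; rewrite arc_eq; simpl; assert (P := PI_RGT_0).
assert (0 <= sin (PI * t)) by (apply sin_ge_0; nra); nra.
Qed.

Lemma arc_right S t : 0 <= S -> 1 <= t <= 2 -> 0 <= Re (arc S t).
Proof.
intros HS Ht; rewrite arc_eq; simpl; assert (P := PI_RGT_0).
assert (sin (PI * t) <= 0) by (apply sin_le_0; nra); nra.
Qed.

Lemma arc_0 S : arc S 0 = seg S 0.
Proof. rewrite arc_eq, Rmult_0_r, sin_0, cos_0; apply injective_projections; simpl; ring. Qed.
Lemma arc_1 S : arc S 1 = seg S 1.
Proof. rewrite arc_eq, Rmult_1_r, sin_PI, cos_PI; apply injective_projections; simpl; ring. Qed.
Lemma arc_2 S : arc S 2 = arc S 0.
Proof.
rewrite !arc_eq, Rmult_0_r, (Rmult_comm PI 2), sin_2PI, cos_2PI, sin_0, cos_0; reflexivity.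
Qed.

Lemma seg_Re S t : Re (seg S t) = 0.
Proof. unfold seg, Re; simpl; ring. Qed.

(* [arc] traverses the left half circle for [0 <= t <= 1] and the right one for
   [1 <= t <= 2]; only the latter closes the segment. *)
Definition dint {V : CNM} (S : R) (f : C -> V) : V :=
  vint (fun t => seg' S [*] f (seg S t)) 0 1 [+] vint (fun t => arc' S t [*] f (arc S t)) 1 2.

Definition onD {V : CNM} (S : R) (f : C -> V) : Prop :=
  (forall t, 0 <= t <= 1 -> vcont (T := C_UniformSpace) f (seg S t)) /\
  (forall t, 1 <= t <= 2 -> vcont (T := C_UniformSpace) f (arc S t)).

Section HalfDisc.
Context {V : CNM} (S : R).
Implicit Types f g : C -> V.

Lemma onD_seg f : onD S f -> conton (fun t => seg' S [*] f (seg S t)) 0 1.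
Proof.
intros [H _] t Ht; apply (vcont_lin (sc_linmap (seg' S))).
apply (vcont_compC (T := R_UniformSpace) (seg S) f); [exact (rder_vcont _ _ _ (rder_seg S t)) | apply H, Ht].
Qed.

Lemma onD_arc f : onD S f -> conton (fun t => arc' S t [*] f (arc S t)) 1 2.
Proof.
intros [_ H] t Ht; apply vcont_sc; [apply vcont_arc' |].
apply (vcont_compC (T := R_UniformSpace) (arc S) f); [exact (rder_vcont _ _ _ (rder_arc S t)) | apply H, Ht].
Qed.

Lemma dint_lin {W : CNM} {b : V -> W} (Hb : linmap b) f : onD S f -> dint S (fun l => b (f l)) = b (dint S f).
Proof.
intros H; unfold dint; rewrite (lin_add _ Hb).
rewrite <- (vint_lin Hb _ 0 1 ltac:(lra) (onD_seg f H)), <- (vint_lin Hb _ 1 2 ltac:(lra) (onD_arc f H)).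
f_equal; (apply vint_ext; [lra |]; intros t _; symmetry; apply (lin_sc _ Hb)).
Qed.

Lemma dint_sub f g : onD S f -> onD S g -> dint S (fun l => f l [-] g l) = dint S f [-] dint S g.
Proof.
intros Hf Hg; unfold dint.
rewrite (vint_ext _ (fun t => seg' S [*] f (seg S t) [-] seg' S [*] g (seg S t)) 0 1) by (try lra; intros; vmod).
rewrite (vint_ext (fun t => arc' S t [*] (f (arc S t) [-] g (arc S t)))
   (fun t => arc' S t [*] f (arc S t) [-] arc' S t [*] g (arc S t)) 1 2) by (try lra; intros; vmod).
rewrite !vint_sub; try lra; try (apply onD_seg; assumption); try (apply onD_arc; assumption); vmod.
Qed.

Lemma dint_ext f g : (forall t, 0 <= t <= 1 -> f (seg S t) = g (seg S t)) ->
  (forall t, 1 <= t <= 2 -> f (arc S t) = g (arc S t)) -> dint S f = dint S g.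
Proof.
intros H1 H2; unfold dint; f_equal; (apply vint_ext; [lra |]); intros t Ht;
  [rewrite H1 | rewrite H2]; auto.
Qed.

Lemma dint_primitive (F f : C -> V) :
  (forall t, 0 <= t <= 1 -> cder F (seg S t) (f (seg S t))) ->
  (forall t, 1 <= t <= 2 -> cder F (arc S t) (f (arc S t))) -> onD S f -> dint S f = vzero.
Proof.
intros H1 H2 H; unfold dint.
rewrite (vint_unique _ 0 1 (F (seg S 1) [-] F (seg S 0))).
- rewrite (vint_unique _ 1 2 (F (arc S 2) [-] F (arc S 1))).
  + rewrite arc_2, arc_0, arc_1; vmod.
  + apply (is_vint_ftc (fun t => F (arc S t))); [lra | | apply onD_arc, H].
    intros t Ht; apply (cder_chain RtoC (arc S) F t); [apply rder_arc | apply H2, Ht].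
- apply (is_vint_ftc (fun t => F (seg S t))); [lra | | apply onD_seg, H].
  intros t Ht; apply (cder_chain RtoC (seg S) F t); [apply rder_seg | apply H1, Ht].
Qed.

Lemma dint_rder (f : C -> V) v : onD S f ->
  rder (fun v => dint S (fun l => Cexp (- v * l) [*] f l)) v
    (dint S (fun l => (- l * Cexp (- v * l))%C [*] f l)).
Proof.
intros [H1 H2].
assert (K : forall (g g' : R -> C) a b, a <= b -> (forall t, rder (V := CS) g t (g' t)) ->
   (forall t, vcont (V := CS) g' t) ->
   (forall t, a <= t <= b -> vcont (T := C_UniformSpace) f (g t)) ->
   rder (fun v => vint (fun t => g' t [*] (Cexp (- v * g t) [*] f (g t))) a b) v
        (vint (fun t => g' t [*] ((- g t * Cexp (- v * g t))%C [*] f (g t))) a b)).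
{ intros g g' a b Hab Hg Hg' Hf.
  assert (Cg : forall t, vcont (V := CS) g t) by (intros t; exact (rder_vcont _ _ _ (Hg t))).
  assert (Cf : forall t, a <= t <= b -> vcont (fun t => f (g t)) t).
  { intros t Ht; apply (vcont_compC (T := R_UniformSpace) g f); [apply Cg | apply Hf, Ht]. }
  assert (JE : forall t w, jcont (P := R_UniformSpace) (V := CS) (fun t v => Cexp (- v * g t)) t w).
  { intros t w; apply vcont_Cexp, vcont_Cmult.
    - apply vcont_Copp; exact (jcont_snd (P := R_UniformSpace) (V := CS) RtoC t w (vcont_Rfun _ _ (continuous_id w))).
    - exact (jcont_fst (P := R_UniformSpace) (V := CS) g t w (Cg t)). }
  assert (JC : forall t w, a <= t <= b -> jcont (P := R_UniformSpace)
     (fun t v => g' t [*] ((- g t * Cexp (- v * g t))%C [*] f (g t))) t w).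
  { intros t w Ht; apply (vcont_sc (T := prod_UniformSpace R_UniformSpace R_UniformSpace)).
    - exact (jcont_fst (P := R_UniformSpace) (V := CS) g' t w (Hg' t)).
    - apply (vcont_sc (T := prod_UniformSpace R_UniformSpace R_UniformSpace)).
      + apply vcont_Cmult; [| apply JE].
        apply vcont_Copp; exact (jcont_fst (P := R_UniformSpace) (V := CS) g t w (Cg t)).
      + exact (jcont_fst (P := R_UniformSpace) (fun t => f (g t)) t w (Cf t Ht)). }
  apply (rder_vint_param (fun t v => g' t [*] (Cexp (- v * g t) [*] f (g t)))
     (fun t v => g' t [*] ((- g t * Cexp (- v * g t))%C [*] f (g t)))).
  - exact Hab.
  - apply filter_forall; intros w; split.
    + intros t Ht; apply (vcont_sc (T := R_UniformSpace)); [apply Hg' |].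
      apply (vcont_sc (T := R_UniformSpace)); [| apply Cf, Ht].
      exact (jcont_l (P := R_UniformSpace) (V := CS) _ _ _ (JE t w)).
    + intros t Ht; split; [| exact (jcont_r (P := R_UniformSpace) _ _ _ (JC t w Ht))].
      apply (der_lin RtoC (sc_linmap (g' t))).
      exact (der_lin RtoC (scl_linmap (f (g t))) _ _ _ (rder_Cexp_mul (g t) w)).
  - intros t Ht; apply JC, Ht. }
apply der_add.
- apply (K (seg S) (fun _ => seg' S) 0 1); [lra | apply rder_seg | intros; apply vcont_const | exact H1].
- apply (K (arc S) (arc' S) 1 2); [lra | apply rder_arc | apply vcont_arc' | exact H2].
Qed.

End HalfDisc.

(** * Integrals over large circles *)

Section Circle.
Context {V : CNM} (H H1 : C -> V) (S0 : R).
Hypothesis HS0 : 0 <= S0.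
Hypothesis HH : forall l, S0 < Cmod l -> cder H l (H1 l) /\ vcont (T := C_UniformSpace) H1 l.

Lemma circle_indep S S' : S0 < S -> S <= S' ->
  vint (fun t => arc' S' t [*] H (arc S' t)) 0 2 = vint (fun t => arc' S t [*] H (arc S t)) 0 2.
Proof.
intros HS HS'.
apply (homotopy H H1 (fun l => S0 < Cmod l)); [lra | exact HH | | |].
- intros t _; repeat split; try apply rder_arc; apply vcont_arc'.
- intros s t Hs _.
  replace (arc S t + s * (arc S' t - arc S t))%C with (arc (S + s * (S' - S)) t).
  + rewrite arc_dist; nra.
  + unfold arc; rewrite RtoC_plus, RtoC_mult, RtoC_minus; ring.
- intros s _; rewrite !arc_2; reflexivity.
Qed.

(** The integral does not depend on the radius and is at most [2 pi C / S'] over the circle of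
    radius [S'], which can be made arbitrarily small. *)
Lemma circle_decay C : 0 <= C -> (forall l, S0 < Cmod l -> nrm (H l) <= C / Cmod l ^ 2) ->
  forall S, S0 < S -> vint (fun t => arc' S t [*] H (arc S t)) 0 2 = vzero.
Proof.
intros HC Hb S HS; apply nrm_eq0, Rle_antisym; [| apply nrm_ge0].
assert (P := PI_RGT_0).
assert (K : forall S', S <= S' -> nrm (vint (fun t => arc' S t [*] H (arc S t)) 0 2) <= 2 * PI * C / S').
{ intros S' HS'; rewrite <- (circle_indep S S' HS HS').
  replace (2 * PI * C / S') with ((2 - 0) * (PI * S' * (C / S' ^ 2))) by (field; lra).
  assert (Hm : forall t, Cmod (arc S' t) = S') by (intros t; apply arc_dist; lra).
  apply vint_bound; [lra | |].
  - intros t _; apply vcont_sc; [apply vcont_arc' |].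
    apply (vcont_compC (T := R_UniformSpace) (arc S') H); [exact (rder_vcont _ _ _ (rder_arc S' t)) |].
    apply (cder_vcont H _ (H1 (arc S' t))), HH; rewrite Hm; lra.
  - intros t _; apply Rle_trans with (1 := nrm_sc_le _ _); rewrite arc'_dist by lra.
    apply Rmult_le_compat_l; [nra |].
    rewrite <- (Hm t) at 2; apply Hb; rewrite Hm; lra. }
apply Rnot_lt_le; intros Hn.
set (n := nrm _) in *.
assert (D : 0 <= 2 * PI * C / n) by (apply Rdiv_le_0_compat; nra).
specialize (K (S + 2 * PI * C / n) ltac:(lra)).
assert (HX : exists X, 0 < X /\ n * X = n * S + 2 * PI * C /\ X = S + 2 * PI * C / n).
{ exists (S + 2 * PI * C / n); split; [lra | split; [field; lra | reflexivity]]. }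
destruct HX as [X [X1 [X2 X3]]]; rewrite <- X3 in K.
apply Rmult_le_compat_r with (r := X) in K; [| lra].
replace (2 * PI * C / X * X) with (2 * PI * C) in K by (field; lra).
assert (0 < n * S) by (apply Rmult_lt_0_compat; lra); lra.
Qed.

Hypothesis Hleft : forall l, Re l <= 0 -> cder H l (H1 l) /\ vcont (T := C_UniformSpace) H1 l.

(** The vertical segment is deformed to the left half circle with the same end points, inside the
    left half plane where [H] is holomorphic. *)
Lemma dint_circle S : S0 < S -> dint S H = vint (fun t => arc' S t [*] H (arc S t)) 0 2.
Proof.
intros HS.
assert (Hc : forall t, vcont (fun t => arc' S t [*] H (arc S t)) t).
{ intros t; apply vcont_sc; [apply vcont_arc' |].
  apply (vcont_compC (T := R_UniformSpace) (arc S) H); [exact (rder_vcont _ _ _ (rder_arc S t)) |].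
  apply (cder_vcont H _ (H1 (arc S t))), HH; rewrite arc_dist; lra. }
rewrite <- (vint_chasles _ 0 1 2) by (try lra; intros t _; apply Hc).
unfold dint; f_equal; symmetry.
apply (homotopy H H1 (fun l => Re l <= 0) (seg S) (arc S) (fun _ => seg' S) (arc' S)); [lra | exact Hleft | | |].
- intros t _; repeat split; [apply rder_seg | apply vcont_const | apply rder_arc | apply vcont_arc'].
- intros s t Hs Ht.
  assert (K := arc_left S t ltac:(lra) Ht); assert (E := seg_Re S t).
  set (p := seg S t) in *; set (q := arc S t) in *.
  replace (Re (p + s * (q - p))) with (Re p + s * (Re q - Re p)) by (unfold Re; simpl; ring).
  rewrite E; nra.
- intros s _; rewrite arc_0, arc_1.
  replace (seg S 1 - seg S 1)%C with (RtoC 0) by ring.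
  replace (seg S 0 - seg S 0)%C with (RtoC 0) by ring; rewrite !vsc_0; reflexivity.
Qed.

End Circle.

(** * The vertical integral *)

Section Vertical.
Context {B : BanachAlgebra} (x rho : B) (P : R -> B).
Hypothesis HP : semigroup x P.
Hypothesis Hleft : forall l, Re l <= 0 -> regular x l.

(** This is [(x - l)^(-1)], the factor in the vertical integral of the theorem; below, [bundle m b]
    is the product with [rho] between its powers. *)
Let sres (l : C) : B := vneg (res x l).
Let bundle (m b : nat) (l : C) : B := apow (sres l) m [o] (rho [o] apow (sres l) b).
Let S0 : R := 2 * nrm x + 1.

Lemma S0_ge1 : 1 <= S0.
Proof. unfold S0; generalize (nrm_ge0 x); lra. Qed.

Lemma far_regular l : S0 < Cmod l -> regular x l /\ nrm (sres l) <= 2 * nrm (aone : B) / Cmod l.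
Proof.
intros H; assert (N := nrm_ge0 x); unfold S0 in H; destruct (regular_large x l ltac:(lra)) as [H1 H2].
split; [exact H1 |]; unfold sres; rewrite nrm_neg; apply H2; lra.
Qed.

Lemma sres_mul l : regular x l -> x [o] sres l = aone [+] l [*] sres l.
Proof. intros H; unfold sres; rewrite amul_neg_r, (res_r x l H); vmod. Qed.

Lemma cder_sres l : regular x l -> cder sres l (sres l [o] sres l).
Proof.
intros H; unfold sres; eapply der_eq.
- apply der_ext with (fun l => (-(1))%C [*] res x l); [intros q; symmetry; apply vneg_sc |].
  exact (der_lin _ (sc_linmap (-(1))%C) _ _ _ (cder_res x l H)).
- rewrite amul_neg_l, amul_neg_r; vmod.
Qed.

Lemma cder_apow_sres n l : regular x l ->
  cder (fun l => apow (sres l) n) l (INR n [*] apow (sres l) (S n)).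
Proof.
intros H; induction n as [| n IH].
- simpl; apply der_eq with vzero; [apply der_const | vmod].
- eapply der_eq.
  + exact (der_mul (fun l => l) sres (fun l => apow (sres l) n) l _ _ (cder_sres l H) IH).
  + change (apow (sres l) (S (S n))) with (sres l [o] (sres l [o] apow (sres l) n)).
    change (apow (sres l) (S n)) with (sres l [o] apow (sres l) n).
    rewrite S_INR, RtoC_plus; alg.
Qed.

Lemma vcont_apow_sres n l : regular x l -> vcont (T := C_UniformSpace) (fun l => apow (sres l) n) l.
Proof. intros H; exact (cder_vcont _ _ _ (cder_apow_sres n l H)). Qed.

Lemma vcont_bundle m b l : regular x l -> vcont (T := C_UniformSpace) (bundle m b) l.
Proof.
intros H; apply vcont_mul; [apply vcont_apow_sres, H |].
apply (vcont_lin (mul_l_linmap rho)), vcont_apow_sres, H.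
Qed.

Lemma cder_bundle m b l : regular x l -> cder (bundle m b) l
  (INR m [*] bundle (S m) b l [+] INR b [*] bundle m (S b) l).
Proof.
intros H; eapply der_eq.
- apply (der_mul (fun l => l) (fun l => apow (sres l) m) (fun l => rho [o] apow (sres l) b) l).
  + apply cder_apow_sres, H.
  + exact (der_lin _ (mul_l_linmap rho) _ _ _ (cder_apow_sres b l H)).
- unfold bundle; rewrite amul_sc_l, !amul_sc_r; reflexivity.
Qed.

(** Each resolvent contributes [1 / |l|]; as [S0 >= 1], the factors beyond the second can be bounded
    by 1. *)
Lemma bundle_decay m b : (2 <= m + b)%nat -> exists C, 0 <= C /\
  forall l, S0 < Cmod l -> nrm (bundle m b l) <= C / Cmod l ^ 2.
Proof.
intros Hmb; pose (N := nrm (aone : B)); pose (c := 2 * N).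
assert (HN : 0 <= N) by apply nrm_ge0.
assert (Hr : 0 <= nrm rho) by apply nrm_ge0.
assert (Hc : 0 <= c ^ (m + b)) by (apply pow_le; unfold c; lra).
exists (c ^ (m + b) * (N * (nrm rho * N))); split.
{ apply Rmult_le_pos; [exact Hc | apply Rmult_le_pos; [| apply Rmult_le_pos]; assumption]. }
intros l Hl; destruct (far_regular l Hl) as [_ Hb]; fold N in Hb; fold c in Hb.
assert (H1 := S0_ge1).
assert (Hp : forall n, nrm (apow (sres l) n) <= (c / Cmod l) ^ n * N).
{ intros n; apply Rle_trans with (1 := nrm_apow _ _); apply Rmult_le_compat_r; [exact HN |].
  apply pow_incr; split; [apply nrm_ge0 | exact Hb]. }
apply Rle_trans with (1 := nrm_mul _ _).
apply Rle_trans with (((c / Cmod l) ^ m * N) * (nrm rho * ((c / Cmod l) ^ b * N))).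
- apply Rmult_le_compat; try apply nrm_ge0; [apply Hp |].
  apply Rle_trans with (1 := nrm_mul _ _); apply Rmult_le_compat_l; [exact Hr | apply Hp].
- replace (((c / Cmod l) ^ m * N) * (nrm rho * ((c / Cmod l) ^ b * N))) with
    ((c / Cmod l) ^ (m + b) * (N * (nrm rho * N))) by (rewrite pow_add; ring).
  unfold Rdiv at 1; rewrite Rpow_mult_distr.
  replace (c ^ (m + b) * (N * (nrm rho * N)) / Cmod l ^ 2) with
    (c ^ (m + b) * (/ Cmod l) ^ 2 * (N * (nrm rho * N))) by (rewrite pow_inv; unfold Rdiv; ring).
  apply Rmult_le_compat_r; [apply Rmult_le_pos; [| apply Rmult_le_pos]; assumption |].
  apply Rmult_le_compat_l; [exact Hc |].
  replace (m + b)%nat with (2 + (m + b - 2))%nat by lia; rewrite pow_add.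
  rewrite <- (Rmult_1_r ((/ Cmod l) ^ 2)) at 2.
  apply Rmult_le_compat_l; [apply pow_le; left; apply Rinv_0_lt_compat; lra |].
  rewrite <- (pow1 (m + b - 2)); apply pow_incr; split; [left; apply Rinv_0_lt_compat; lra |].
  rewrite <- Rinv_1; apply Rinv_le_contravar; lra.
Qed.

Let kern (n : nat) (u : R) : B := (u ^ n / INR (fact n))%R [*] P u.

(** A convolution at time 1. Indices are shifted: [kern n], that is [u^n / n! exp(-u x)], is the
    transform of the resolvent power [n + 1]. *)
Definition laplace_pair (a b : nat) : B := vint (fun u => kern a (1 - u) [o] (rho [o] kern b u)) 0 1.

Let vline (a b : nat) (s : R) : B :=
  (/ two_pi_i * Cexp (- (Ci * s)) * Ci)%C [*] bundle (S a) (S b) (Ci * s)%C.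

Lemma vline_continuous a b s : vcont (vline a b) s.
Proof.
assert (Cs : vcont (V := CS) (fun s : R => Ci * s)%C s).
{ apply (vcont_lin (sc_linmap (V := CS) Ci)).
  apply (vcont_Rfun (fun s => s)); apply continuous_id. }
apply vcont_sc.
- apply vcont_Cmult; [| apply vcont_const].
  apply vcont_Cmult; [apply vcont_const |].
  apply vcont_Cexp, vcont_Copp, Cs.
- apply (vcont_compC (T := R_UniformSpace) (fun s : R => (Ci * s)%C)); [exact Cs |].
  apply vcont_bundle, Hleft; unfold Re; simpl; lra.
Qed.

(** * Transforms of resolvent powers over the closed half disc *)

Section Contour.
Variable S : R.
Hypothesis HS : S0 < S.

Lemma seg_regular t : regular x (seg S t).
Proof. apply Hleft; rewrite seg_Re; lra. Qed.
Lemma arc_regular t : regular x (arc S t).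
Proof. apply far_regular; rewrite arc_dist; [exact HS | generalize S0_ge1; lra]. Qed.

Lemma onD_regular {V : CNM} (f : C -> V) : (forall l, regular x l -> vcont (T := C_UniformSpace) f l) -> onD S f.
Proof. intros H; split; intros t _; apply H; [apply seg_regular | apply arc_regular]. Qed.

Lemma dint_ext_regular {V : CNM} (f g : C -> V) : (forall l, regular x l -> f l = g l) -> dint S f = dint S g.
Proof. intros H; apply dint_ext; intros t _; apply H; [apply seg_regular | apply arc_regular]. Qed.

Lemma dint_bundle_0 m b : (2 <= m + b)%nat -> dint S (bundle m b) = vzero.
Proof.
intros Hmb; destruct (bundle_decay m b Hmb) as [C [HC Hb]].
pose (H1 := fun l => INR m [*] bundle (Datatypes.S m) b l [+] INR b [*] bundle m (Datatypes.S b) l).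
assert (K : forall l, regular x l -> cder (bundle m b) l (H1 l) /\ vcont (T := C_UniformSpace) H1 l).
{ intros l Hl; split; [apply cder_bundle, Hl |].
  apply vcont_add; apply (vcont_lin (sc_linmap _)), vcont_bundle, Hl. }
rewrite (dint_circle (bundle m b) H1 S0) ; [| | | | exact HS].
- apply (circle_decay (bundle m b) H1 S0) with C; [| | exact HC | exact Hb | exact HS].
  + generalize S0_ge1; lra.
  + intros l Hl; apply K, far_regular, Hl.
- generalize S0_ge1; lra.
- intros l Hl; apply K, far_regular, Hl.
- intros l Hl; apply K, Hleft, Hl.
Qed.

(** Split [sres l = -1 / l + (1 / l) x sres l]. The second term decays quadratically and integrates
    to zero; the first, over a clockwise circle, gives [-2 half_turn = 2 pi i]. *)
Lemma dint_sres : dint S sres = two_pi_i [*] aone.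
Proof.
assert (HS0 := S0_ge1).
pose (H1 := fun l => sres l [o] sres l).
assert (K : forall l, regular x l -> cder sres l (H1 l) /\ vcont (T := C_UniformSpace) H1 l).
{ intros l Hl; split; [apply cder_sres, Hl |].
  apply vcont_mul; exact (cder_vcont _ _ _ (cder_sres l Hl)). }
rewrite (dint_circle sres H1 S0); [| lra | | | exact HS].
2:{ intros l Hl; apply K, far_regular, Hl. }
2:{ intros l Hl; apply K, Hleft, Hl. }
pose (D := fun l => (/ l)%C [*] (x [o] sres l)).
pose (D1 := fun l => (- (/ l * / l))%C [*] (x [o] sres l) [+] (/ l)%C [*] (x [o] H1 l)).
assert (KD : forall l, S0 < Cmod l -> cder D l (D1 l) /\ vcont (T := C_UniformSpace) D1 l).
{ intros l Hl; destruct (far_regular l Hl) as [Hr _].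
  assert (N : l <> 0%C) by (apply Cmod_gt_0; lra).
  destruct (K l Hr) as [K1 K2]; split.
  - apply (der_sc (fun l => l) Cinv (fun l => x [o] sres l)); [exact (cder_inv l N) |].
    exact (der_lin _ (mul_l_linmap x) _ _ _ K1).
  - assert (Ci := cder_vcont _ _ _ (cder_inv l N)).
    apply vcont_add; apply (vcont_sc (T := C_UniformSpace)).
    + apply vcont_Copp, vcont_Cmult; exact Ci.
    + apply (vcont_lin (mul_l_linmap x)); exact (cder_vcont _ _ _ K1).
    + exact Ci.
    + apply (vcont_lin (mul_l_linmap x)); exact K2. }
assert (HD : vint (fun t => arc' S t [*] D (arc S t)) 0 2 = vzero).
{ assert (Nx := nrm_ge0 x); assert (Na := nrm_ge0 (aone : B)).
  apply (circle_decay D D1 S0) with (nrm x * (2 * nrm (aone : B))); [lra | exact KD | nra | | exact HS].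
  intros l Hl; destruct (far_regular l Hl) as [_ Hb].
  assert (N : l <> 0%C) by (apply Cmod_gt_0; lra).
  apply Rle_trans with (1 := nrm_sc_le _ _); rewrite Cmod_inv by exact N.
  replace (nrm x * (2 * nrm (aone : B)) / Cmod l ^ 2) with (/ Cmod l * (nrm x * (2 * nrm (aone : B) / Cmod l))) by (field; lra).
  apply Rmult_le_compat_l; [left; apply Rinv_0_lt_compat; lra |].
  apply Rle_trans with (1 := nrm_mul _ _); apply Rmult_le_compat_l; [exact Nx | exact Hb]. }
apply vint_unique.
apply is_vint_ext with (fun t => (- half_turn)%C [*] aone [+] arc' S t [*] D (arc S t)); [lra | |].
- intros t _; assert (Hr := arc_regular t).
  assert (N : arc S t <> 0%C) by (apply Cmod_gt_0; rewrite arc_dist; lra).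
  unfold D; rewrite (sres_mul _ Hr); unfold arc'; set (l := arc S t) in *.
  vmod0; field; exact N.
- replace (two_pi_i [*] (aone : B)) with
    ((2%R * - half_turn)%C [*] aone [-] (0%R * - half_turn)%C [*] aone [+]
      vint (fun t => arc' S t [*] D (arc S t)) 0 2).
  2:{ rewrite HD; unfold two_pi_i, half_turn; vmod. }
  apply is_vint_add.
  + apply (is_vint_ftc (fun t => (t * - half_turn)%C [*] aone)); [lra | | intros t _; apply vcont_const].
    intros t _; apply (der_lin RtoC (scl_linmap (aone : B)) (fun t => t * - half_turn)%C).
    apply (der_eq RtoC (V := CS)) with (vsc (V := CS) (RtoC 1) (- half_turn)%C).
    * exact (der_lin RtoC (scl_linmap (V := CS) (- half_turn)%C) _ _ _ (der_io RtoC t)).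
    * exact (vsc_1 (V := CS) _).
  + apply vint_correct; [lra |]; intros t _; apply vcont_sc; [apply vcont_arc' |].
    apply (vcont_compC (T := R_UniformSpace) (arc S) D); [exact (rder_vcont _ _ _ (rder_arc S t)) |].
    apply (cder_vcont D _ (D1 (arc S t))), KD; rewrite arc_dist; lra.
Qed.

(** An inverse Laplace transform at time [v], up to [2 pi i]. Taken over a bounded closed curve, it
    is a proper integral and differentiable in [v] everywhere. *)
Let trans {V : CNM} (f : C -> V) (v : R) : V := dint S (fun l => Cexp (- v * l) [*] f l).

Lemma trans_Cexp v : dint S (fun l => Cexp (- v * l) [*] (aone : B)) = vzero.
Proof.
destruct (Cexp_primitive (- v)%C) as [F HF].
apply (dint_primitive S (fun l => F l [*] (aone : B))).
- intros t _; exact (der_lin _ (scl_linmap (aone : B)) _ _ _ (HF (seg S t))).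
- intros t _; exact (der_lin _ (scl_linmap (aone : B)) _ _ _ (HF (arc S t))).
- apply onD_regular; intros l _; apply (vcont_lin (scl_linmap (aone : B))).
  exact (cder_vcont _ _ _ (cder_Cexp_mul (- v)%C l)).
Qed.

Lemma vcont_trans_integrand {V : CNM} (f : C -> V) v l : vcont (T := C_UniformSpace) f l ->
  vcont (T := C_UniformSpace) (fun l => Cexp (- v * l) [*] f l) l.
Proof.
intros Hf; apply (vcont_sc (T := C_UniformSpace)); [| exact Hf].
exact (cder_vcont _ _ _ (cder_Cexp_mul (- v)%C l)).
Qed.

Lemma trans_lin {V W : CNM} {b : V -> W} (Hb : linmap b) (f : C -> V) v :
  (forall l, regular x l -> vcont (T := C_UniformSpace) f l) ->
  trans (fun l => b (f l)) v = b (trans f v).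
Proof.
intros H; unfold trans; rewrite <- (dint_lin S Hb).
- apply dint_ext_regular; intros l _; symmetry; apply (lin_sc _ Hb).
- apply onD_regular; intros l Hl; apply vcont_trans_integrand, H, Hl.
Qed.

Lemma rder_trans {V : CNM} (f : C -> V) v : (forall l, regular x l -> vcont (T := C_UniformSpace) f l) ->
  rder (trans f) v (trans (fun l => (- l)%C [*] f l) v).
Proof.
intros H; eapply der_eq; [apply dint_rder, onD_regular, H |].
apply dint_ext_regular; intros l _; rewrite vsc_assoc; f_equal; ring.
Qed.

Lemma trans_0 {V : CNM} (f : C -> V) : trans f 0 = dint S f.
Proof.
apply dint_ext_regular; intros l _; replace (- 0 * l)%C with (RtoC 0) by ring.
rewrite Cexp_0; apply vsc_1.
Qed.

Lemma rder_P_rev v u : rder (fun u => P (v - u)) u (x [o] P (v - u)).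
Proof.
eapply der_eq.
- apply (rder_comp_R (fun u => v - u) P); [auto_derive; [exact I | reflexivity] | apply HP].
- replace (0 + - (1)) with (-1) by ring; vmod0; rewrite RtoC_opp; ring.
Qed.

(** Because [x sres = 1 + l sres] and the exponential alone integrates to zero, [trans sres] solves
    the equation of the semigroup. Hence [P (v - u)] times its value at [u] is constant in [u], and
    [dint_sres] gives the initial value. *)
Lemma trans_sres v : 0 <= v -> trans sres v = two_pi_i [*] P v.
Proof.
intros Hv.
assert (Cs : forall l, regular x l -> vcont (T := C_UniformSpace) sres l).
{ intros l Hl; exact (cder_vcont _ _ _ (cder_sres l Hl)). }
assert (Hd : forall u, rder (trans sres) u (vneg (x [o] trans sres u))).
{ intros u; eapply der_eq; [apply rder_trans, Cs |].
  rewrite <- (trans_lin (mul_l_linmap x)) by exact Cs.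
  replace (trans (fun l => (- l)%C [*] sres l) u) with
    (trans (fun l => aone [-] x [o] sres l) u).
  - unfold trans.
    rewrite (dint_ext_regular _ (fun l => Cexp (- u * l) [*] aone [-] Cexp (- u * l) [*] (x [o] sres l))) by (intros; vmod).
    rewrite dint_sub.
    + rewrite trans_Cexp; vmod.
    + apply onD_regular; intros l _; apply vcont_trans_integrand, vcont_const.
    + apply onD_regular; intros l Hl; apply vcont_trans_integrand, (vcont_lin (mul_l_linmap x)), Cs, Hl.
  - apply dint_ext_regular; intros l Hl; rewrite (sres_mul l Hl); vmod. }
assert (HI : is_vint (fun _ => vzero : B) 0 v (P (v - v) [o] trans sres v [-] P (v - 0) [o] trans sres 0)).
{ apply (is_vint_ftc (fun u => P (v - u) [o] trans sres u)); [exact Hv | | intros t _; apply vcont_const].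
  intros u _; eapply der_eq; [apply der_mul; [apply rder_P_rev | apply Hd] |].
  assert (Cm : x [o] P (v - u) = P (v - u) [o] x) by (apply HP; reflexivity).
  rewrite amul_neg_r, <- (amulA (P (v - u))), Cm; vmod. }
apply vint_unique in HI; rewrite (vint_unique _ _ _ _ (is_vint_0 0 v Hv)) in HI.
replace (v - v) with 0 in HI by ring; replace (v - 0) with v in HI by ring.
destruct HP as [P0 _]; rewrite P0, amul_1_l, trans_0, dint_sres, amul_sc_r, amul_1_r in HI.
match type of HI with _ = ?a [-] ?b => replace a with ((a [-] b) [+] b) by vmod end.
rewrite <- HI; apply vadd_0_l.
Qed.

(** The derivative of [exp(-v l) sres^b] integrates to zero over the closed curve, so [b] times the
    transform of [sres^(b+1)] is [v] times that of [sres^b]. *)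
Lemma trans_apow n v : 0 <= v ->
  trans (fun l => apow (sres l) (Datatypes.S n)) v = two_pi_i [*] kern n v.
Proof.
intros Hv; induction n as [| n IH].
- transitivity (trans sres v).
  + apply dint_ext_regular; intros l _; f_equal; apply (amul_1_r (sres l)).
  + rewrite (trans_sres v Hv); unfold kern; simpl pow; simpl fact; simpl INR.
    replace (1 / 1) with 1 by field; vmod.
- pose (b := Datatypes.S n).
  assert (Hb : INR b <> 0) by (apply not_0_INR; unfold b; lia).
  assert (Dg : forall l, regular x l -> cder (fun l => Cexp (- v * l) [*] apow (sres l) b) l
    (Cexp (- v * l) [*] ((- v)%C [*] apow (sres l) b) [-]
     (-(1))%C [*] (Cexp (- v * l) [*] (INR b [*] apow (sres l) (Datatypes.S b))))).
  { intros l Hl.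
    apply (der_eq _ (fun l => Cexp (- v * l) [*] apow (sres l) b) l _ _
      (der_sc (fun l => l) (fun l => Cexp (- v * l)) (fun l => apow (sres l) b) l _ _
        (cder_Cexp_mul (- v)%C l) (cder_apow_sres b l Hl))).
    cbv beta; generalize (apow (sres l) (Datatypes.S b)) (apow (sres l) b); intros p q; vmod. }
  assert (E : (- v)%C [*] trans (fun l => apow (sres l) b) v [+]
     INR b [*] trans (fun l => apow (sres l) (Datatypes.S b)) v = vzero).
  { rewrite <- (trans_lin (sc_linmap (- v)%C)), <- (trans_lin (sc_linmap (INR b))) by (intros; apply vcont_apow_sres; assumption).
    unfold trans.
    replace (dint S (fun l => Cexp (- v * l) [*] (INR b [*] apow (sres l) (Datatypes.S b)))) with
      (vneg (dint S (fun l => (-(1))%C [*] (Cexp (- v * l) [*] (INR b [*] apow (sres l) (Datatypes.S b)))))).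
    2:{ rewrite (dint_lin S (sc_linmap (-(1))%C)); [vmod |].
        apply onD_regular; intros l Hl; apply vcont_trans_integrand, (vcont_lin (sc_linmap (INR b))), vcont_apow_sres, Hl. }
    match goal with |- ?a [+] vneg ?c = _ => replace (a [+] vneg c) with (a [-] c) by vmod end.
    rewrite <- dint_sub.
    - apply (dint_primitive S (fun l => Cexp (- v * l) [*] apow (sres l) b)).
      + intros t _; exact (Dg (seg S t) (seg_regular t)).
      + intros t _; exact (Dg (arc S t) (arc_regular t)).
      + apply onD_regular; intros l Hl; apply vcont_sub.
        * apply vcont_trans_integrand, (vcont_lin (sc_linmap (- v)%C)), vcont_apow_sres, Hl.
        * apply (vcont_lin (sc_linmap _)), vcont_trans_integrand, (vcont_lin (sc_linmap (INR b))), vcont_apow_sres, Hl.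
    - apply onD_regular; intros l Hl; apply vcont_trans_integrand, (vcont_lin (sc_linmap (- v)%C)), vcont_apow_sres, Hl.
    - apply onD_regular; intros l Hl.
      apply (vcont_lin (sc_linmap _)), vcont_trans_integrand, (vcont_lin (sc_linmap (INR b))), vcont_apow_sres, Hl. }
  fold b in IH; rewrite IH in E.
  assert (Hb' : RtoC (INR b) <> 0%C) by (intros K; injection K; exact Hb).
  transitivity ((/ INR b)%C [*] (INR b [*] trans (fun l => apow (sres l) (Datatypes.S b)) v)).
  { rewrite vsc_assoc, Cinv_l by exact Hb'; symmetry; apply vsc_1. }
  replace (INR b [*] trans (fun l => apow (sres l) (Datatypes.S b)) v) with
    (((- v)%C [*] (two_pi_i [*] kern n v) [+] INR b [*] trans (fun l => apow (sres l) (Datatypes.S b)) v)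
      [-] (- v)%C [*] (two_pi_i [*] kern n v)) by vmod.
  rewrite E; unfold kern.
  change (fact (Datatypes.S n)) with (b * fact n)%nat; rewrite mult_INR.
  assert (Hf : INR (fact n) <> 0) by (apply not_0_INR, fact_neq_0).
  assert (Hf' : RtoC (INR (fact n)) <> 0%C) by (intros K; injection K; exact Hf).
  unfold Rdiv; rewrite Rinv_mult, !RtoC_mult, !RtoC_inv by assumption; simpl pow; rewrite RtoC_mult.
  vmod0; field; split; assumption.
Qed.

Lemma rder_kern_S n u : rder (kern (Datatypes.S n)) u (kern n u [-] x [o] kern (Datatypes.S n) u).
Proof.
assert (Hf : INR (fact n) <> 0) by (apply not_0_INR, fact_neq_0).
assert (Hn : INR (Datatypes.S n) <> 0) by (apply not_0_INR; lia).
assert (H : is_derive (fun u => u ^ Datatypes.S n / INR (fact (Datatypes.S n))) u (u ^ n / INR (fact n))).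
{ replace (u ^ n / INR (fact n)) with
    (INR (Datatypes.S n) * 1 * u ^ pred (Datatypes.S n) * / INR (fact (Datatypes.S n))).
  - unfold Rdiv; apply (is_derive_scal_l (V := R_NormedModule)).
    apply (is_derive_pow (fun u => u)); exact (is_derive_id (K := R_AbsRing) u).
  - change (fact (Datatypes.S n)) with (Datatypes.S n * fact n)%nat; rewrite mult_INR.
    change (pred (Datatypes.S n)) with n; field; split; assumption. }
apply (der_eq RtoC (kern (Datatypes.S n)) u _ _
  (der_sc RtoC (fun u => RtoC (u ^ Datatypes.S n / INR (fact (Datatypes.S n)))) P u _ _ (rder_R _ _ _ H) (proj1 (proj2 HP) u))).
unfold kern; rewrite amul_sc_r; vmod.
Qed.

Lemma rder_kern_0 u : rder (kern 0) u (vneg (x [o] kern 0 u)).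
Proof.
unfold kern; eapply der_eq.
- apply (der_lin RtoC (sc_linmap (RtoC (u ^ 0 / INR (fact 0))))), HP.
- rewrite amul_sc_r; vmod.
Qed.

Lemma rder_rev {V : CNM} (f : R -> V) f' v u : rder f (v - u) f' -> rder (fun u => f (v - u)) u (vneg f').
Proof.
intros H; eapply der_eq.
- apply (rder_comp_R (fun u => v - u) f); [auto_derive; [exact I | reflexivity] | exact H].
- replace (0 + - (1)) with (-1) by ring; vmod0; rewrite RtoC_opp; ring.
Qed.

Lemma kern_comm n u : x [o] kern n u = kern n u [o] x.
Proof.
unfold kern; rewrite amul_sc_r, amul_sc_l; f_equal; apply HP; reflexivity.
Qed.

Lemma vcont_kern n u : vcont (kern n) u.
Proof.
destruct n as [| n]; [exact (rder_vcont _ _ _ (rder_kern_0 u)) | exact (rder_vcont _ _ _ (rder_kern_S n u))].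
Qed.

Lemma vcont_kern_rev n v u : vcont (fun u => kern n (v - u)) u.
Proof.
destruct n as [| n].
- exact (rder_vcont _ _ _ (rder_rev _ _ v u (rder_kern_0 (v - u)))).
- exact (rder_vcont _ _ _ (rder_rev _ _ v u (rder_kern_S n (v - u)))).
Qed.

Lemma rder_trans_bundle m b u :
  rder (trans (bundle (Datatypes.S m) b)) u (trans (bundle m b) u [-] x [o] trans (bundle (Datatypes.S m) b) u).
Proof.
assert (Cb : forall m l, regular x l -> vcont (T := C_UniformSpace) (bundle m b) l) by (intros; apply vcont_bundle; assumption).
eapply der_eq; [apply rder_trans, Cb |].
rewrite <- (trans_lin (mul_l_linmap x)) by apply Cb.
unfold trans; rewrite <- dint_sub.
- apply dint_ext_regular; intros l Hl; unfold bundle.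
  change (apow (sres l) (Datatypes.S m)) with (sres l [o] apow (sres l) m).
  rewrite <- !amulA, (sres_mul l Hl), !amul_add_l, !amul_sc_l, amul_1_l, !amulA; vmod.
- apply onD_regular; intros l Hl; apply vcont_trans_integrand, Cb, Hl.
- apply onD_regular; intros l Hl; apply vcont_trans_integrand, (vcont_lin (mul_l_linmap x)), Cb, Hl.
Qed.

Lemma vcont_trans_bundle m b u : vcont (trans (bundle m b)) u.
Proof.
apply (rder_vcont _ _ (trans (fun l => (- l)%C [*] bundle m b l) u)), rder_trans.
intros; apply vcont_bundle; assumption.
Qed.

(* Iterated Duhamel formula: each integration by parts trades one power of the kernel
   for one left factor of the resolvent. *)
Lemma duhamel i : forall m b v, (0 < b)%nat -> 0 <= v ->
  vint (fun u => kern i (v - u) [o] trans (bundle m b) u) 0 v = trans (bundle (m + i + 1) b) v.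
Proof.
assert (Cint : forall i m b v t, vcont (fun u => kern i (v - u) [o] trans (bundle m b) u) t).
{ intros; apply vcont_mul; [apply vcont_kern_rev | apply vcont_trans_bundle]. }
assert (Z : forall m b, (0 < b)%nat -> trans (bundle (Datatypes.S m) b) 0 = vzero).
{ intros m b Hb; rewrite trans_0; apply dint_bundle_0; lia. }
induction i as [| i IH]; intros m b v Hb Hv.
- assert (H : is_vint (fun u => kern 0 (v - u) [o] trans (bundle m b) u) 0 v
    (kern 0 (v - v) [o] trans (bundle (Datatypes.S m) b) v [-] kern 0 (v - 0) [o] trans (bundle (Datatypes.S m) b) 0)).
  { apply (is_vint_ftc (fun u => kern 0 (v - u) [o] trans (bundle (Datatypes.S m) b) u)); [exact Hv | | intros t _; apply Cint].
    intros u _; eapply der_eq.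
    - apply der_mul; [apply rder_rev, rder_kern_0 | apply rder_trans_bundle].
    - rewrite kern_comm, amul_neg_l, amul_neg_l, amulA, amul_sub_r; vmod. }
  rewrite (vint_unique _ _ _ _ H), Z by exact Hb; rewrite amul_0_r.
  replace (v - v) with 0 by ring.
  unfold kern; destruct HP as [P0 _]; rewrite P0; simpl pow; simpl fact; simpl INR.
  replace (1 / 1) with 1 by field; rewrite amul_sc_l, amul_1_l.
  replace (m + 0 + 1)%nat with (Datatypes.S m) by lia; vmod.
- assert (H : is_vint (fun u => kern (Datatypes.S i) (v - u) [o] trans (bundle m b) u [-]
       kern i (v - u) [o] trans (bundle (Datatypes.S m) b) u) 0 v
    (kern (Datatypes.S i) (v - v) [o] trans (bundle (Datatypes.S m) b) v [-]
     kern (Datatypes.S i) (v - 0) [o] trans (bundle (Datatypes.S m) b) 0)).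
  { apply (is_vint_ftc (fun u => kern (Datatypes.S i) (v - u) [o] trans (bundle (Datatypes.S m) b) u)); [exact Hv | |].
    - intros u _; eapply der_eq.
      + apply der_mul; [apply rder_rev, rder_kern_S | apply rder_trans_bundle].
      + rewrite kern_comm, amul_neg_l, amul_sub_l, amulA, amul_sub_r; vmod.
    - intros t _; apply vcont_sub; apply Cint. }
  assert (E : kern (Datatypes.S i) (v - v) = vzero).
  { unfold kern; replace (v - v) with 0 by ring; rewrite pow_i by lia.
    replace (0 / INR (fact (Datatypes.S i))) with 0 by (unfold Rdiv; ring); apply vsc_0. }
  rewrite E, amul_0_l, Z, amul_0_r in H by exact Hb.
  apply vint_unique in H; rewrite vint_sub in H; try (intros t _; apply Cint); [| exact Hv].
  rewrite (IH (Datatypes.S m) b v Hb Hv) in H.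
  match type of H with ?a [-] ?c = _ => replace a with ((a [-] c) [+] c) by vmod end.
  rewrite H; replace (m + Datatypes.S i + 1)%nat with (Datatypes.S m + i + 1)%nat by lia; vmod.
Qed.

(** Start [duhamel] at [m = 0], where the bundle is [rho] times a resolvent power whose transform is
    known. *)
Lemma trans_bundle_1 a b :
  trans (bundle (Datatypes.S a) (Datatypes.S b)) 1 = two_pi_i [*] laplace_pair a b.
Proof.
replace (Datatypes.S a) with (0 + a + 1)%nat by lia.
rewrite <- duhamel by (lia || lra).
unfold laplace_pair; rewrite <- (vint_lin (sc_linmap two_pi_i)).
- apply vint_ext; [lra |]; intros u Hu.
  rewrite <- amul_sc_r; f_equal; rewrite <- amul_sc_r.
  rewrite <- (trans_apow b u) by lra.
  rewrite <- (trans_lin (mul_l_linmap rho)) by (intros; apply vcont_apow_sres; assumption).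
  apply dint_ext_regular; intros l _; f_equal; apply amul_1_l.
- lra.
- intros t _; apply vcont_mul; [apply vcont_kern_rev | apply (vcont_lin (mul_l_linmap rho)), vcont_kern].
Qed.

(** The integral over the window is the segment part of the transform at time 1, up to [2 pi i];
    what separates it from the full transform is the right half circle. *)
Lemma vline_window a b : vint (vline a b) (- S) S [-] laplace_pair a b =
  vneg ((/ two_pi_i)%C [*] vint (fun t => arc' S t [*] (Cexp (- (1) * arc S t) [*]
    bundle (Datatypes.S a) (Datatypes.S b) (arc S t))) 1 2).
Proof.
assert (H0 := S0_ge1).
assert (E : vint (vline a b) (- S) S =
  (/ two_pi_i)%C [*] vint (fun t => seg' S [*] (Cexp (- (1) * seg S t) [*]
    bundle (Datatypes.S a) (Datatypes.S b) (seg S t))) 0 1).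
{ rewrite <- (vint_lin (sc_linmap (/ two_pi_i)%C)).
  - symmetry; apply vint_unique.
    assert (H := vint_correct (vline a b) (- S) S ltac:(lra) ltac:(intros t _; apply vline_continuous)).
    unfold is_vint in H.
    replace (- S) with (2 * S * 0 + - S) in H at 1 by ring.
    replace S with (2 * S * 1 + - S) in H at 3 by ring.
    apply (is_RInt_comp_lin (V := realify B)) in H; revert H.
    apply is_vint_ext; [lra |]; intros t _.
    change (RtoC (2 * S) [*] vline a b (2 * S * t + - S) =
      (/ two_pi_i)%C [*] (seg' S [*] (Cexp (- (1) * seg S t) [*] bundle (Datatypes.S a) (Datatypes.S b) (seg S t)))).
    unfold vline; replace (Ci * (2 * S * t + - S)%R)%C with (seg S t) by (unfold seg; f_equal; f_equal; ring).
    replace (- (1) * seg S t)%C with (- seg S t)%C by ring.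
    unfold seg'; generalize (/ two_pi_i)%C (Cexp (- seg S t)) (bundle (Datatypes.S a) (Datatypes.S b) (seg S t)).
    intros p q w; vmod.
  - lra.
  - intros t Ht; apply (onD_seg S (fun l => Cexp (- (1) * l) [*] bundle (Datatypes.S a) (Datatypes.S b) l)); [| exact Ht].
    apply onD_regular; intros l Hl; apply (vcont_trans_integrand _ 1), vcont_bundle, Hl. }
assert (T := trans_bundle_1 a b); unfold trans, dint in T.
rewrite E.
transitivity ((/ two_pi_i)%C [*] (vint (fun t => seg' S [*] (Cexp (- (1) * seg S t) [*]
    bundle (Datatypes.S a) (Datatypes.S b) (seg S t))) 0 1 [-] two_pi_i [*] laplace_pair a b)).
- replace (laplace_pair a b) with ((/ two_pi_i)%C [*] (two_pi_i [*] laplace_pair a b)) at 1.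
  + vmod.
  + rewrite vsc_assoc, Cinv_l by exact two_pi_i_neq0; apply vsc_1.
- rewrite <- T; vmod.
Qed.

(** On the right half circle [|exp(-l)| <= 1], so an arc of length [pi S] contributes at most
    [C / (2 S)] after division by [2 pi]. *)
Lemma vline_window_bound a b C : 0 <= C ->
  (forall l, S0 < Cmod l -> nrm (bundle (Datatypes.S a) (Datatypes.S b) l) <= C / Cmod l ^ 2) ->
  nrm (vint (vline a b) (- S) S [-] laplace_pair a b) <= C / S.
Proof.
intros HC H; assert (H0 := S0_ge1); assert (HPI := PI_RGT_0).
rewrite vline_window, nrm_neg.
apply Rle_trans with (1 := nrm_sc_le _ _); rewrite Cmod_inv by exact two_pi_i_neq0.
replace (Cmod two_pi_i) with (2 * PI).
2:{ unfold two_pi_i; rewrite !Cmod_mult, Cmod_Ci, !Cmod_R, !Rabs_pos_eq by lra; ring. }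
apply Rle_trans with (/ (2 * PI) * ((2 - 1) * (PI * S * (1 * (C / S ^ 2))))).
- apply Rmult_le_compat_l; [left; apply Rinv_0_lt_compat; lra |].
  apply vint_bound; [lra | |].
  + apply (onD_arc S (fun l => Cexp (- (1) * l) [*] bundle (Datatypes.S a) (Datatypes.S b) l)).
    apply onD_regular; intros l Hl; apply (vcont_trans_integrand _ 1), vcont_bundle, Hl.
  + intros t Ht; assert (Hd : Cmod (arc S t) = S) by (apply arc_dist; lra).
    apply Rle_trans with (1 := nrm_sc_le _ _); rewrite arc'_dist by lra.
    apply Rmult_le_compat_l; [nra |].
    apply Rle_trans with (1 := nrm_sc_le _ _); apply Rmult_le_compat; [apply Cmod_ge_0 | apply nrm_ge0 | |].
    * rewrite Cmod_Cexp, <- exp_0; apply Rnot_lt_le; intros K0; apply exp_lt_inv in K0; revert K0; apply Rle_not_lt.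
      assert (K := arc_right S t ltac:(lra) Ht).
      assert (E : Re (- (1) * arc S t)%C = - Re (arc S t)) by (unfold Re; simpl; ring).
      rewrite exp_0, E; lra.
    * rewrite <- Hd at 2; apply H; lra.
- replace (/ (2 * PI) * ((2 - 1) * (PI * S * (1 * (C / S ^ 2))))) with (/ 2 * (C / S)) by (field; lra).
  assert (0 <= C / S) by (apply Rmult_le_pos; [exact HC | left; apply Rinv_0_lt_compat; lra]); lra.
Qed.

End Contour.

Lemma vertical_integral (a b : nat) :
  is_RInt_gen (V := realify B)
    (fun s : R => (/ two_pi_i * Cexp (- (Ci * s)) * Ci)%C [*]
       (apow (vneg (res x (Ci * s))) (S a) [o] (rho [o] apow (vneg (res x (Ci * s))) (S b))))
    (Rbar_locally m_infty) (Rbar_locally p_infty) (laplace_pair a b).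
Proof.
destruct (bundle_decay (S a) (S b) ltac:(lia)) as [C [HC Hb]]; assert (H0 := S0_ge1).
assert (Cv : forall s, vcont (fun s : R => (/ two_pi_i * Cexp (- (Ci * s)) * Ci)%C [*] bundle (S a) (S b) (Ci * s)%C) s)
  by (intros s; apply vline_continuous).
assert (Ht : 0 < Cmod two_pi_i) by (apply Cmod_gt_0, two_pi_i_neq0).
apply (is_RInt_gen_symmetric (W := realify B)
  (fun s : R => (/ two_pi_i * Cexp (- (Ci * s)) * Ci)%C [*] bundle (S a) (S b) (Ci * s)%C)
  (/ Cmod two_pi_i * C) (S0 + 1)).
- apply Rmult_le_pos; [left; apply Rinv_0_lt_compat, Ht | exact HC].
- lra.
- intros s; apply vcont_continuous, Cv.
- intros s Hs; assert (Hd : Cmod (Ci * s) = Rabs s) by (rewrite Cmod_mult, Cmod_Ci, Cmod_R; ring).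
  change (nrm ((/ two_pi_i * Cexp (- (Ci * s)) * Ci)%C [*] bundle (S a) (S b) (Ci * s)%C) <= / Cmod two_pi_i * C / s ^ 2).
  apply Rle_trans with (1 := nrm_sc_le _ _).
  rewrite !Cmod_mult, Cmod_Ci, Cmod_Cexp, Cmod_inv by exact two_pi_i_neq0.
  replace (Re (- (Ci * s))) with 0 by (unfold Re; simpl; ring); rewrite exp_0.
  replace (/ Cmod two_pi_i * C / s ^ 2) with (/ Cmod two_pi_i * 1 * 1 * (C / s ^ 2)) by (unfold Rdiv; ring).
  apply Rmult_le_compat_l; [rewrite !Rmult_1_r; left; apply Rinv_0_lt_compat, Ht |].
  rewrite <- (pow2_abs s), <- Hd; apply Hb; lra.
- apply (filterlim_locally (F := Rbar_locally p_infty) (U := realify B)); intros eps.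
  exists (Rmax (S0 + 1) (C / (eps / 2))); intros M HM.
  assert (HM1 := Rmax_l (S0 + 1) (C / (eps / 2))); assert (HM2 := Rmax_r (S0 + 1) (C / (eps / 2))).
  assert (He := cond_pos eps).
  apply (norm_compat1 (V := realify B)).
  apply Rle_lt_trans with (C / M).
  + exact (vline_window_bound M ltac:(lra) a b C HC Hb).
  + apply Rle_lt_trans with (eps / 2); [| lra].
    assert (C / (eps / 2) * (eps / 2) = C) by (field; lra).
    apply Rmult_le_reg_r with M; [lra |]; unfold Rdiv at 1; rewrite Rmult_assoc, Rinv_l by lra; nra.
Qed.

End Vertical.

(** * Positive invertible elements *)

Section HolomorphicCalculus.
Context {B : BanachAlgebra} (x : B) (d : R).
Hypothesis Hd : 0 < d.
Hypothesis Hx : forall tau z, 0 <= tau -> Cmod (z + tau) < d -> regular x z.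

Lemma off_ray_slit z : ~ regular x z -> slit_plane z.
Proof.
intros H [H1 H2]; apply H, (Hx (- Re z)); [lra |].
replace (z + (- Re z)%R)%C with (RtoC 0); [rewrite Cmod_0; exact Hd |].
apply injective_projections; simpl; [unfold Re; ring | unfold Im in H1; rewrite H1; ring].
Qed.

(** The hypothesis [Hx] keeps a tube about the closed negative ray free of spectrum, which yields
    both the inclusion in the slit plane and a surrounding contour. What remains is agreement of
    [fc] over good contours. *)
Lemma holo_calc_slit (f : C -> C) (v : B) :
  (forall z, slit_plane z -> exists l, cder (V := CS) f z l) ->
  (forall G, good x G -> fc x G f = v) -> holo_calc slit_plane f x v.
Proof.
intros Hf Hv; split; [| split; [| split; [| split]]].
- intros z Hz; exact (proj2 (locally_Cmod z slit_plane) (slit_open z Hz)).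
- intros z Hz; destruct (Hf z Hz) as [l Hl]; exists l; exact (proj1 (cder_is_derive (V := CS) f z l) Hl).
- intros z Hz; apply off_ray_slit; intros K; exact (proj1 (regular_spectrum x z) K Hz).
- exact (surround_exists x d Hd Hx).
- intros G HG; assert (Hg := surrounds_good x G HG).
  rewrite <- (Hv G Hg); destruct Hg as [G1 [G2 G3]].
  assert (Cf : conG (V := CS) G f).
  { intros g Hin t Ht; destruct (Hf _ (G2 g Hin t Ht)) as [l Hl]; exact (cder_vcont _ _ _ Hl). }
  assert (E : fc x G f = oint G (fun z => (/ two_pi_i * f z)%C [*] res x z)).
  { unfold fc; rewrite <- (oint_lin (sc_linmap (/ two_pi_i)%C) G _ (conG_fc x G G1 f Cf)).
    apply oint_ext; intros g _ t _; apply vsc_assoc. }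
  rewrite E; apply oint_correct.
  apply conG_sc; [| apply conG_res, G1].
  intros g Hin t Ht; apply vcont_Cmult; [apply vcont_const | exact (Cf g Hin t Ht)].
Qed.

End HolomorphicCalculus.

Lemma expo_scaled {B : BanachAlgebra} (p : B) (P : R -> B) (c : R) : 0 < c ->
  semigroup p P -> semigroup (RtoC c [*] p) (fun u => P (c * u)).
Proof.
intros Hc [H1 [H2 [H3 [K [eps [HK [He H4]]]]]]]; split; [| split; [| split]].
- rewrite Rmult_0_r; exact H1.
- intros u; apply (der_eq RtoC (fun u => P (c * u)) u _ _
    (rder_comp_R (fun u => c * u) P u c _ ltac:(auto_derive; [exact I | ring]) (H2 (c * u)))).
  rewrite amul_sc_l; vmod.
- intros a Ha u; apply H3.
  assert (Nc : RtoC c <> 0%C) by (intros N; injection N; lra).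
  rewrite <- (vsc_1 (a [o] p)), <- (vsc_1 (p [o] a)), <- (Cinv_l _ Nc), <- !vsc_assoc.
  f_equal; rewrite <- amul_sc_r, <- amul_sc_l; exact Ha.
- exists K, (eps * c); split; [exact HK | split; [nra |]]; intros u Hu.
  replace (eps * c * u) with (eps * (c * u)) by ring; apply H4; nra.
Qed.

Section Positive.
Context {A : CStarAlgebra} (k : A).
Hypothesis Hpos : cs_positive k.
Hypothesis Hinv : invertible k.

(** Invertibility makes 0 regular, and regularity is an open condition; the rest of the spectrum is
    real and nonnegative by positivity. *)
Lemma positive_gap : exists delta, 0 < delta /\ forall z, ~ regular k z -> Im z = 0 /\ delta <= Re z.
Proof.
assert (R0 : regular k 0).
{ destruct Hinv as [y [H1 H2]]; exists (vneg y).
  change (k [o] y = aone) in H1; change (y [o] k = aone) in H2; split.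
  - change ((0%C [*] aone [-] k) [o] vneg y = aone); rewrite <- H1; alg.
  - change (vneg y [o] (0%C [*] aone [-] k) = aone); rewrite <- H2; alg. }
destruct (regular_open k 0 R0) as [delta [Hd H]].
exists delta; split; [exact Hd |]; intros z Hz.
destruct (proj2 Hpos z) as [H1 H2].
{ intros K; exact (Hz K). }
split; [exact H1 |]; apply Rnot_lt_le; intros L; apply Hz, H.
replace (z - 0)%C with (RtoC (Re z)).
- rewrite Cmod_R, Rabs_pos_eq; lra.
- apply injective_projections; simpl; [unfold Re; ring | unfold Im in H1; rewrite H1; ring].
Qed.

Context (delta : R).
Hypothesis Hdelta : 0 < delta.
Hypothesis Hgap : forall z, ~ regular k z -> Im z = 0 /\ delta <= Re z.

Lemma gap_ray tau z : 0 <= tau -> Cmod (z + tau) < delta -> regular k z.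
Proof.
intros Ht Hz; apply NNPP; intros K; destruct (Hgap z K) as [H1 H2].
assert (L := Rle_trans _ _ _ (Rle_abs _) (re_le_Cmod (z + tau))).
replace (Re (z + tau)) with (Re z + tau) in L by (unfold Re; simpl; ring); lra.
Qed.

Lemma holo_Crpow s G : good k G -> holo_calc slit_plane (fun z => Crpow z s) k (xp k G s 1).
Proof.
intros HG; apply (holo_calc_slit k delta Hdelta gap_ray).
- intros z Hz; eexists; apply (cder_Crpow z s Hz).
- intros G' HG'; rewrite (xp_indep k G G' s 1 HG HG' ltac:(lra)).
  apply fc_ext; intros g _ t _; f_equal; unfold segp; ring.
Qed.

Let E := expo k delta.

Lemma scaled_left (c : R) l : 0 < c -> Re l <= 0 -> regular (RtoC c [*] k) l.
Proof.
intros Hc Hl; assert (Np : RtoC c <> 0%C) by (intros N; injection N; lra).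
pose (w := (/ c * l)%C); assert (El : (c * w)%C = l) by (unfold w; field; exact Np).
assert (Hk : regular k w).
{ apply NNPP; intros K; destruct (Hgap _ K) as [_ H]; rewrite <- El in Hl.
  replace (Re (c * w)) with (c * Re w) in Hl by (unfold Re; simpl; ring); nra. }
destruct Hk as [y [H1 H2]].
change ((w [*] aone [-] k) [o] y = aone) in H1.
change (y [o] (w [*] aone [-] k) = aone) in H2.
assert (F : l [*] aone [-] c [*] k = c [*] (w [*] aone [-] k)) by (rewrite <- El; vmod).
exists ((/ c)%C [*] y); split.
- change ((l [*] aone [-] c [*] k) [o] ((/ c)%C [*] y) = aone).
  rewrite F, amul_sc_l, amul_sc_r, H1, vsc_assoc, Cinv_r by exact Np; apply vsc_1.
- change (((/ c)%C [*] y) [o] (l [*] aone [-] c [*] k) = aone).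
  rewrite F, amul_sc_l, amul_sc_r, H2, vsc_assoc, Cinv_l by exact Np; apply vsc_1.
Qed.

Lemma vertical_int_laplace (rho : A) a b r : 0 < r ->
  is_vertical_int k rho (S a) (S b) r (laplace_pair rho (fun u => E (r ^ 2 * u)) a b).
Proof.
intros Hr; assert (Hp : 0 < r ^ 2) by (apply pow_lt, Hr).
assert (H := vertical_integral (RtoC (r ^ 2) [*] k) rho (fun u => E (r ^ 2 * u))
  (expo_scaled k E (r ^ 2) Hp (expo_semigroup k delta Hdelta Hgap)) (fun l => scaled_left (r ^ 2) l Hp) a b).
unfold is_vertical_int; revert H; apply is_RInt_gen_ext.
apply filter_forall; intros [u v] s _; cbv zeta.
(* The vertical integral inverts [r^2 k - l], whereas [res] inverts [l - r^2 k]. *)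
assert (N : ainv (minus (scal (RtoC (r ^ 2)) k) (scal (Ci * s : C)%C (aone : A))) =
  vneg (res (RtoC (r ^ 2) [*] k) (Ci * s)%C)).
{ apply ainv_eq; assert (Hl : regular (RtoC (r ^ 2) [*] k) (Ci * s)) by (apply scaled_left; [exact Hp | unfold Re; simpl; lra]).
  destruct (res_spec _ _ Hl) as [H1 H2].
  change (((Ci * s)%C [*] aone [-] (r ^ 2)%R [*] k) [o] res (RtoC (r ^ 2) [*] k) (Ci * s)%C = aone) in H1.
  change (res (RtoC (r ^ 2) [*] k) (Ci * s)%C [o] ((Ci * s)%C [*] aone [-] (r ^ 2)%R [*] k) = aone) in H2.
  split.
  - change (((r ^ 2)%R [*] k [-] (Ci * s)%C [*] aone) [o] vneg (res (RtoC (r ^ 2) [*] k) (Ci * s)%C) = aone).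
    rewrite <- H1 at 2; alg.
  - change (vneg (res (RtoC (r ^ 2) [*] k) (Ci * s)%C) [o] ((r ^ 2)%R [*] k [-] (Ci * s)%C [*] aone) = aone).
    rewrite <- H2 at 2; alg. }
rewrite N; reflexivity.
Qed.

End Positive.

(** * Spectra of quotients of generators *)

Section Quotient.
Context {B : BanachAlgebra} (p q y : B) (P Q : R -> B).
Hypothesis HP : semigroup p P.
Hypothesis HQ : semigroup q Q.
Hypothesis Hp : invertible p.
Hypothesis Hpy : p [o] y = q.
Hypothesis Hqp : q [o] p = p [o] q.

Lemma small_exp C e : 0 < C -> 0 < e -> exists U, 0 < U /\ C * exp (- (e * U)) <= / 2.
Proof.
intros HC He; exists (2 * C / e); split; [apply Rdiv_lt_0_compat; lra |].
replace (e * (2 * C / e)) with (2 * C) by (field; lra).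
rewrite exp_Ropp; assert (H := exp_ineq1 (2 * C) ltac:(lra)).
apply Rmult_le_reg_r with (exp (2 * C)); [apply exp_pos |].
rewrite Rmult_assoc, Rinv_l by (generalize (exp_pos (2 * C)); lra); lra.
Qed.

(** As [p] and [q] commute, this is [exp(-u (tau p + q))]. *)
Let PQ (tau u : R) : B := P (tau * u) [o] Q u.

Lemma rder_PQ tau u : rder (PQ tau) u (vneg ((tau [*] p [+] q) [o] PQ tau u)).
Proof.
assert (Pq : q [o] P (tau * u) = P (tau * u) [o] q) by (apply HP, Hqp).
eapply der_eq.
- apply (der_mul RtoC (fun u => P (tau * u)) Q u).
  + apply (rder_comp_R (fun u => tau * u) P u tau); [auto_derive; [exact I | ring] | apply HP].
  + apply HQ.
- unfold PQ; cbv beta; rewrite amul_add_l, amul_sc_l, <- (amulA q), Pq.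
  rewrite amul_sc_l, amul_neg_l, amul_neg_r, !amulA; vmod.
Qed.

Lemma vcont_PQ tau u : vcont (PQ tau) u.
Proof. exact (rder_vcont _ _ _ (rder_PQ tau u)). Qed.

Lemma PQ_parts (tau U : R) : 0 <= U ->
  (tau [*] p [+] q) [o] vint (PQ tau) 0 U = aone [-] PQ tau U /\
  vint (PQ tau) 0 U [o] (tau [*] p [+] q) = aone [-] PQ tau U.
Proof.
intros HU; set (w := tau [*] p [+] q).
assert (HI : is_vint (fun u => vneg (w [o] PQ tau u)) 0 U (PQ tau U [-] PQ tau 0)).
{ apply (is_vint_ftc (PQ tau)); [exact HU | intros u _; apply rder_PQ |].
  intros u _; apply vcont_neg, (vcont_lin (mul_l_linmap w)), vcont_PQ. }
assert (E0 : PQ tau 0 = aone).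
{ unfold PQ; rewrite Rmult_0_r, (proj1 HP), (proj1 HQ); apply amul_1_l. }
rewrite E0 in HI.
assert (E : w [o] vint (PQ tau) 0 U = aone [-] PQ tau U).
{ rewrite <- (vint_lin (mul_l_linmap w)); [| exact HU | intros u _; apply vcont_PQ].
  assert (K := vint_correct (fun u => w [o] PQ tau u) 0 U HU
    (fun u _ => vcont_lin (mul_l_linmap w) _ u (vcont_PQ tau u))).
  apply (is_vint_lin (sc_linmap (- (1))%C)) in K.
  assert (K' : is_vint (fun u => vneg (w [o] PQ tau u)) 0 U ((- (1))%C [*] vint (fun u => w [o] PQ tau u) 0 U)).
  { revert K; apply is_vint_ext; [exact HU |]; intros u _; symmetry; apply vneg_sc. }
  apply vint_unique in K'; rewrite (vint_unique _ _ _ _ HI) in K'.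
  transitivity (vneg ((- (1))%C [*] vint (fun u => w [o] PQ tau u) 0 U)); [vmod |].
  rewrite <- K'; vmod. }
split; [exact E |]; rewrite <- E.
rewrite <- (vint_lin (mul_l_linmap w)), <- (vint_lin (mul_r_linmap w)); try exact HU; try (intros u _; apply vcont_PQ).
apply vint_ext; [exact HU |]; intros u _; unfold PQ.
assert (Pp : p [o] P (tau * u) = P (tau * u) [o] p) by (apply HP; reflexivity).
assert (Pq : q [o] P (tau * u) = P (tau * u) [o] q) by (apply HP, Hqp).
assert (Qp : p [o] Q u = Q u [o] p) by (apply HQ; symmetry; exact Hqp).
assert (Qq : q [o] Q u = Q u [o] q) by (apply HQ; reflexivity).
unfold w; rewrite amul_add_l, amul_add_r, amul_sc_l, amul_sc_r, <- (amulA p), <- (amulA q), Pp, Pq.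
rewrite !amulA, Qp, Qq; reflexivity.
Qed.

(** Integrating [PQ tau] up to [U] inverts [tau p + q] up to the factor [1 - PQ tau U], which the
    Neumann series handles. The decay of [Q] alone fixes [U], so the bounds do not involve [tau],
    and the resolvent of [y] at [-tau] is uniformly bounded. *)
Lemma quotient_ray : exists d, 0 < d /\ forall (tau : R) z, 0 <= tau -> Cmod (z + tau) < d -> regular y z.
Proof.
destruct (proj2 (proj2 (proj2 HP))) as [CP [eP [HCP [HeP BP]]]].
destruct (proj2 (proj2 (proj2 HQ))) as [CQ [eQ [HCQ [HeQ BQ]]]].
destruct (small_exp (CP * CQ) eQ ltac:(nra) HeQ) as [U [HU HUs]].
destruct Hp as [p' [Hp1 Hp2]]; change (p [o] p' = aone) in Hp1; change (p' [o] p = aone) in Hp2.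
assert (BPQ : forall tau u, 0 <= tau -> 0 <= u -> nrm (PQ tau u) <= CP * CQ * exp (- (eQ * u))).
{ intros tau u Ht Hu; apply Rle_trans with (1 := nrm_mul _ _); rewrite Rmult_assoc.
  apply Rmult_le_compat; try apply nrm_ge0; [| apply BQ, Hu].
  apply Rle_trans with (1 := BP _ (Rmult_le_pos _ _ Ht Hu)).
  rewrite <- (Rmult_1_r CP) at 2; apply Rmult_le_compat_l; [lra |].
  rewrite <- exp_0; apply Rnot_lt_le; intros K; apply exp_lt_inv in K; revert K.
  apply Rle_not_lt; generalize (Rmult_le_pos _ _ Ht Hu); nra. }
assert (N1 := nrm_ge0 (aone : B)).
(* The Neumann inverse has norm at most [2 |1|] because [|PQ tau U| <= 1/2], and the integral has
   norm at most [U CP CQ]. *)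
pose (M := 2 * nrm (aone : B) * (U * (CP * CQ))).
assert (Hinv : forall tau : R, 0 <= tau -> exists W, inverse_of (tau [*] p [+] q) W /\ nrm W <= M).
{ intros tau Ht; destruct (PQ_parts tau U ltac:(lra)) as [E1 E2].
  assert (Hs : nrm (PQ tau U) <= / 2) by (apply Rle_trans with (2 := HUs), BPQ; lra).
  destruct (neumann (PQ tau U) ltac:(lra)) as [N [N1' N2']].
  change ((aone [-] PQ tau U) [o] N = aone) in N1'; change (N [o] (aone [-] PQ tau U) = aone) in N2'.
  assert (F1 : (tau [*] p [+] q) [o] (vint (PQ tau) 0 U [o] N) = aone) by (rewrite <- amulA, E1; exact N1').
  assert (F2 : (N [o] vint (PQ tau) 0 U) [o] (tau [*] p [+] q) = aone) by (rewrite amulA, E2; exact N2').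
  destruct (inverse_left_right _ _ _ F2 F1) as [_ F3].
  exists (vint (PQ tau) 0 U [o] N); split; [exact F3 |].
  assert (BV : nrm (vint (PQ tau) 0 U) <= (U - 0) * (CP * CQ)).
  { apply vint_bound; [lra | intros u _; apply vcont_PQ |]; intros u Hu.
    apply Rle_trans with (1 := BPQ tau u Ht ltac:(lra)).
    rewrite <- (Rmult_1_r (CP * CQ)) at 2; apply Rmult_le_compat_l; [nra |].
    rewrite <- exp_0; apply Rnot_lt_le; intros K; apply exp_lt_inv in K; revert K.
    apply Rle_not_lt; nra. }
  assert (BN : nrm N <= 2 * nrm (aone : B)).
  { assert (EN : N = aone [+] PQ tau U [o] N).
    { rewrite <- N1'; rewrite amul_sub_l, amul_1_l; vmod. }
    assert (K : nrm N <= nrm (aone : B) + / 2 * nrm N); [| lra].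
    rewrite EN at 1; apply Rle_trans with (1 := nrm_add _ _); apply Rplus_le_compat_l.
    apply Rle_trans with (1 := nrm_mul _ _); apply Rmult_le_compat_r; [apply nrm_ge0 | exact Hs]. }
  apply Rle_trans with (1 := nrm_mul _ _); unfold M; rewrite (Rmult_comm (2 * _)).
  apply Rmult_le_compat; try apply nrm_ge0; [lra | exact BN]. }
assert (HM : 0 <= M).
{ destruct (Hinv 0 ltac:(lra)) as [W [_ HW]]; apply Rle_trans with (2 := HW), nrm_ge0. }
pose (K := M * nrm p); assert (HK : 0 <= K) by (apply Rmult_le_pos; [exact HM | apply nrm_ge0]).
exists (/ (2 * (K + 1))); split; [apply Rinv_0_lt_compat; lra |].
intros tau z Ht Hz; destruct (Hinv tau Ht) as [W [[W1 W2] HW]].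
change ((tau [*] p [+] q) [o] W = aone) in W1; change (W [o] (tau [*] p [+] q) = aone) in W2.
(* From [tau + y = p^(-1) (tau p + q)]. *)
assert (Hr : inverse_of ((- tau)%C [*] aone [-] y) (vneg (W [o] p))).
{ split.
  - change (((- tau)%C [*] aone [-] y) [o] vneg (W [o] p) = aone).
    transitivity (p' [o] (((tau [*] p [+] q) [o] W) [o] p)).
    + rewrite <- Hpy; transitivity ((p' [o] p) [o] ((tau [*] aone [+] y) [o] (W [o] p))).
      * rewrite Hp2, amul_1_l, amul_neg_r, amul_sub_l, amul_add_l, !amul_sc_l; vmod.
      * rewrite !amulA; f_equal; rewrite <- !amulA; f_equal; f_equal.
        rewrite amul_add_r, amul_sc_r, amul_1_r; reflexivity.
    + rewrite W1, amul_1_l; exact Hp2.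
  - change (vneg (W [o] p) [o] ((- tau)%C [*] aone [-] y) = aone).
    rewrite <- W2 at 2; rewrite <- Hpy.
    rewrite amul_neg_l, amul_sub_r, amul_sc_r, amul_1_r, amul_add_r, amul_sc_r, !amulA; vmod. }
assert (Rr : regular y (- tau)) by (exists (vneg (W [o] p)); exact Hr).
apply (regular_near y (- tau)%C Rr z).
replace (z - - tau)%C with (z + tau)%C by ring.
assert (Er : res y (- tau)%C = vneg (W [o] p)) by (apply ainv_eq, Hr).
rewrite Er, nrm_neg.
apply Rle_trans with (/ (2 * (K + 1)) * K).
- apply Rmult_le_compat; [apply Cmod_ge_0 | apply nrm_ge0 | lra |].
  apply Rle_trans with (1 := nrm_mul _ _); apply Rmult_le_compat_r; [apply nrm_ge0 | exact HW].
- apply Rmult_le_reg_l with (2 * (K + 1)); [lra |].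
  rewrite <- Rmult_assoc, Rinv_r by lra; lra.
Qed.

End Quotient.

(** The product [P (v - u) Q u] has zero derivative in [u]; compare its values at [u = 0] and
    [u = v]. *)
Lemma semigroup_unique {B : BanachAlgebra} (p : B) (P Q : R -> B) : semigroup p P -> Q 0 = aone ->
  (forall u, rder Q u (vneg (p [o] Q u))) -> forall v, 0 <= v -> Q v = P v.
Proof.
intros HP Q0 HQ v Hv.
assert (HI : is_vint (fun _ => vzero : B) 0 v (P (v - v) [o] Q v [-] P (v - 0) [o] Q 0)).
{ apply (is_vint_ftc (fun u => P (v - u) [o] Q u)); [exact Hv | | intros t _; apply vcont_const].
  intros u _; eapply der_eq; [apply der_mul; [| apply HQ] |].
  - apply (rder_comp_R (fun u => v - u) P u (-1)); [auto_derive; [exact I | ring] | apply HP].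
  - assert (Cm : p [o] P (v - u) = P (v - u) [o] p) by (apply HP; reflexivity).
    rewrite amul_sc_l, amul_neg_l, amul_neg_r, <- (amulA (P (v - u))), <- Cm, !amulA; vmod. }
apply vint_unique in HI; rewrite (vint_unique _ _ _ _ (is_vint_0 0 v Hv)) in HI.
replace (v - v) with 0 in HI by ring; replace (v - 0) with v in HI by ring.
rewrite (proj1 HP), Q0, amul_1_l, amul_1_r in HI.
transitivity ((Q v [-] P v) [+] P v); [vmod |]; rewrite <- HI; apply vadd_0_l.
Qed.

(** * The modular operator *)

Lemma is_vint_RtoC (f : R -> R) a b : a <= b -> (forall r, continuous f r) ->
  is_vint (V := CS) (fun r => RtoC (f r)) a b (RtoC (RInt f a b)).
Proof.
intros Hab Hf.
replace (RtoC (RInt f a b)) with (vsub (V := CS) (RtoC (RInt f a b)) (RtoC (RInt f a a))).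
- apply (is_vint_ftc (V := CS) (fun t => RtoC (RInt f a t)) (fun r => RtoC (f r)) a b Hab).
  + intros t _; apply rder_R, (is_derive_RInt f (fun t => RInt f a t) a t); [| apply Hf].
    apply filter_forall; intros u; apply (RInt_correct (V := R_CompleteNormedModule)), ex_RInt_cont, Hf.
  + intros t _; apply vcont_Rfun, Hf.
- rewrite RInt_point; change (@eq C (RtoC (RInt f a b) - RtoC 0)%C (RtoC (RInt f a b))); ring.
Qed.

Section Operators.
Context {A : BanachAlgebra}.

Lemma linmap_is_linear (f : A -> A) : linmap f -> is_linear f.
Proof.
intros [H1 H2 [M [_ H3]]]; exact (Defs.mk_linear A f M H1 H2 H3).
Qed.

Definition Lop (a : A) : Bop_BanachAlgebra A :=
  exist _ (fun x => a [o] x) (linmap_is_linear _ (mul_l_linmap a)).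
Definition Rop (a : A) : Bop_BanachAlgebra A :=
  exist _ (fun x => x [o] a) (linmap_is_linear _ (mul_r_linmap a)).

Lemma bop_eval_linmap (x : A) :
  linmap (U := Bop_BanachAlgebra A) (V := A) (fun f => bop_fun f x).
Proof.
split; [reflexivity | reflexivity |].
exists (nrm x + 1); assert (H := nrm_ge0 x); split; [lra |]; intros f.
apply Rle_trans with (1 := opnorm_bound A f x).
change (opnorm A (bop_fun (f : Bop A)) * nrm x <= (nrm x + 1) * opnorm A (bop_fun (f : Bop A))).
assert (K := opnorm_ge_0 A (f : Bop A)); nra.
Qed.

Lemma bop_eval_bound (f : Bop_BanachAlgebra A) (x : A) : nrm (bop_fun f x) <= nrm f * nrm x.
Proof. exact (opnorm_bound A f x). Qed.

Lemma Lop_linmap : linmap (U := A) (V := Bop_BanachAlgebra A) Lop.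
Proof.
split.
- intros x y; apply Bop_ext; intros z; exact (amul_add_l x y z).
- intros c x; apply Bop_ext; intros z; exact (amul_sc_l c x z).
- exists 1; split; [lra |]; intros x.
  apply (opnorm_le A (Lop x)); [generalize (nrm_ge0 x); lra |].
  intros z; rewrite Rmult_1_l; exact (nrm_mul x z).
Qed.

Lemma Rop_linmap : linmap (U := A) (V := Bop_BanachAlgebra A) Rop.
Proof.
split.
- intros x y; apply Bop_ext; intros z; exact (amul_add_r z x y).
- intros c x; apply Bop_ext; intros z; exact (amul_sc_r c z x).
- exists 1; split; [lra |]; intros x.
  apply (opnorm_le A (Rop x)); [generalize (nrm_ge0 x); lra |].
  intros z; rewrite Rmult_1_l, Rmult_comm; exact (nrm_mul z x).
Qed.

Lemma Lop_mul a b : Lop (a [o] b) = Lop a [o] Lop b.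
Proof. apply Bop_ext; intros z; exact (amulA a b z). Qed.
Lemma Rop_mul a b : Rop (a [o] b) = Rop b [o] Rop a.
Proof. apply Bop_ext; intros z; symmetry; exact (amulA z a b). Qed.
Lemma Lop_one : Lop aone = aone.
Proof. apply Bop_ext; intros z; exact (amul_1_l z). Qed.
Lemma Rop_one : Rop aone = aone.
Proof. apply Bop_ext; intros z; exact (amul_1_r z). Qed.
Lemma Lop_Rop a b : Rop b [o] Lop a = Lop a [o] Rop b.
Proof. apply Bop_ext; intros z; exact (amulA a z b). Qed.

Lemma Lop_regular k z : regular k z -> regular (Lop k) z.
Proof.
intros [w [H1 H2]]; exists (Lop w).
change ((z [*] aone [-] k) [o] w = aone) in H1; change (w [o] (z [*] aone [-] k) = aone) in H2.
assert (E : Lop (z [*] aone [-] k) = z [*] aone [-] Lop k).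
{ rewrite (lin_sub Lop_linmap), (lin_sc _ Lop_linmap), Lop_one; reflexivity. }
split.
- change ((z [*] aone [-] Lop k) [o] Lop w = aone); rewrite <- E, <- Lop_mul, H1; apply Lop_one.
- change (Lop w [o] (z [*] aone [-] Lop k) = aone); rewrite <- E, <- Lop_mul, H2; apply Lop_one.
Qed.

Lemma Rop_regular k z : regular k z -> regular (Rop k) z.
Proof.
intros [w [H1 H2]]; exists (Rop w).
change ((z [*] aone [-] k) [o] w = aone) in H1; change (w [o] (z [*] aone [-] k) = aone) in H2.
assert (E : Rop (z [*] aone [-] k) = z [*] aone [-] Rop k).
{ rewrite (lin_sub Rop_linmap), (lin_sc _ Rop_linmap), Rop_one; reflexivity. }
split.
- change ((z [*] aone [-] Rop k) [o] Rop w = aone); rewrite <- E, <- Rop_mul, H2; apply Rop_one.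
- change (Rop w [o] (z [*] aone [-] Rop k) = aone); rewrite <- E, <- Rop_mul, H1; apply Rop_one.
Qed.

Context (k : A) (delta : R).
Hypothesis Hinv : invertible k.
Hypothesis Hdelta : 0 < delta.
Hypothesis Hgap : forall z, ~ regular k z -> Im z = 0 /\ delta <= Re z.

Let E := expo k delta.
Let PL := expo (Lop k) delta.
Let PR := expo (Rop k) delta.

Lemma semigroup_Lop : semigroup (Lop k) PL.
Proof. apply (expo_semigroup (Lop k) delta Hdelta); intros z Hz; apply Hgap; intros K; exact (Hz (Lop_regular k z K)). Qed.
Lemma semigroup_Rop : semigroup (Rop k) PR.
Proof. apply (expo_semigroup (Rop k) delta Hdelta); intros z Hz; apply Hgap; intros K; exact (Hz (Rop_regular k z K)). Qed.
Lemma semigroup_E : semigroup k E.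
Proof. exact (expo_semigroup k delta Hdelta Hgap). Qed.

(** [PL] is a contour integral of operators; multiplication by [E u] solves the same equation, so
    uniqueness identifies the two. *)
Lemma Lop_E u : 0 <= u -> PL u = Lop (E u).
Proof.
intros Hu; symmetry; apply (semigroup_unique (Lop k) PL (fun u => Lop (E u)) semigroup_Lop); [| | exact Hu].
- rewrite (proj1 semigroup_E); apply Lop_one.
- intros v; apply (der_eq RtoC (fun u => Lop (E u)) v _ _ (der_lin RtoC Lop_linmap E v _ (proj1 (proj2 semigroup_E) v))).
  rewrite (lin_neg Lop_linmap), Lop_mul; reflexivity.
Qed.

Lemma Rop_E u : 0 <= u -> PR u = Rop (E u).
Proof.
intros Hu; symmetry; apply (semigroup_unique (Rop k) PR (fun u => Rop (E u)) semigroup_Rop); [| | exact Hu].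
- rewrite (proj1 semigroup_E); apply Rop_one.
- intros v; apply (der_eq RtoC (fun u => Rop (E u)) v _ _ (der_lin RtoC Rop_linmap E v _ (proj1 (proj2 semigroup_E) v))).
  rewrite (lin_neg Rop_linmap); f_equal; rewrite <- Rop_mul; f_equal.
  apply semigroup_E; reflexivity.
Qed.

Lemma Lop_modular : Lop k [o] modular k = Rop k.
Proof.
apply Bop_ext; intros z; change (k [o] (ainv k [o] (z [o] k)) = z [o] k).
destruct (ainv_spec k Hinv) as [H _]; change (k [o] ainv k = aone) in H.
rewrite <- amulA, H; apply amul_1_l.
Qed.

Lemma modular_Lop a : a [o] k = k [o] a -> modular k [o] Lop a = Lop a [o] modular k.
Proof.
intros Ha; apply Bop_ext; intros z; change (ainv k [o] ((a [o] z) [o] k) = a [o] (ainv k [o] (z [o] k))).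
rewrite (amulA a z k), <- (amulA (ainv k) a), <- (amulA a (ainv k)); f_equal.
symmetry; exact (inverse_comm k _ a (ainv_spec k Hinv) Ha).
Qed.

Lemma modular_ray : exists d, 0 < d /\ forall (tau : R) z, 0 <= tau -> Cmod (z + tau) < d -> regular (modular k) z.
Proof.
apply (quotient_ray (Lop k) (Rop k) (modular k) PL PR semigroup_Lop semigroup_Rop).
- destruct Hinv as [w [H1 H2]]; exists (Lop w); split.
  + change (Lop k [o] Lop w = aone); rewrite <- Lop_mul; change (k [o] w = aone) in H1; rewrite H1; apply Lop_one.
  + change (Lop w [o] Lop k = aone); rewrite <- Lop_mul; change (w [o] k = aone) in H2; rewrite H2; apply Lop_one.
- exact Lop_modular.
- apply Lop_Rop.
Qed.

Context (N : nat).
Let s := (INR N + 1) / 2.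

Definition radial_pair (rho : A) (M c : R) : A :=
  vint (fun r => RtoC (r ^ N) [*] (E ((1 - c) * r ^ 2) [o] (rho [o] E (c * r ^ 2)))) 0 M.
(** The value at [c = 0], where the radial integral of operators is left multiplication by this
    element. *)
Definition radial_mass (M : R) : A := vint (fun r => RtoC (r ^ N) [*] E (r ^ 2)) 0 M.

Lemma radial_pair_eq rho M c : 0 <= M -> 0 <= c <= 1 ->
  bop_fun (radial PL PR N M c) rho = radial_pair rho M c.
Proof.
intros HM Hc; unfold radial, radial_pair.
rewrite <- (vint_lin (bop_eval_linmap rho)); [| exact HM |].
- apply vint_ext; [exact HM |]; intros r Hr.
  rewrite (Lop_E ((1 - c) * r ^ 2)), (Rop_E (c * r ^ 2)) by (apply Rmult_le_pos; [lra | apply pow2_ge_0]).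
  reflexivity.
- intros r _; apply (radial_vcont (Lop k) (Rop k) PL PR semigroup_Lop semigroup_Rop).
Qed.

Lemma radial_zero M : 0 <= M -> radial PL PR N M 0 = Lop (radial_mass M).
Proof.
intros HM; unfold radial_mass; rewrite <- (vint_lin Lop_linmap); [| exact HM |].
- apply vint_ext; [exact HM |]; intros r Hr.
  rewrite Rmult_0_l, (proj1 semigroup_Rop), amul_1_r.
  replace ((1 - 0) * r ^ 2) with (r ^ 2) by ring.
  rewrite (Lop_E (r ^ 2)) by apply pow2_ge_0; symmetry; apply (lin_sc _ Lop_linmap).
- intros r _; apply vcont_sc.
  + apply vcont_Rfun, (ex_derive_continuous (K := R_AbsRing) (V := R_NormedModule)); auto_derive; exact I.
  + apply (vcont_comp (S := R_UniformSpace) (fun r => r ^ 2) E); [| apply (semigroup_vcont k E semigroup_E)].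
    apply (ex_derive_continuous (K := R_AbsRing) (V := R_NormedModule)); auto_derive; exact I.
Qed.

(** [radial_estimate] for left and right multiplication by [k], with [y] the modular operator,
    evaluated at [rho]. *)
Lemma radial_pair_estimate (G : contour) : good (modular k) G ->
  exists K eps, 0 <= K /\ 0 < eps /\ forall rho M c, 0 <= M -> 0 <= c <= 1 ->
    nrm (radial_pair rho M c [-] bop_fun (xp (modular k) G (- s) c) (radial_mass M [o] rho)) <=
    K * (M ^ S N * exp (- (eps * M ^ 2))) * nrm rho.
Proof.
intros HG.
destruct (radial_estimate (modular k) G HG (Lop k) (Rop k) PL PR semigroup_Lop semigroup_Rop
  (eq_trans (modular_Lop k eq_refl) Lop_modular) (Lop_Rop k k) N) as [K [eps [HK [He H]]]].
exists K, eps; split; [exact HK | split; [exact He |]]; intros rho M c HM Hc.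
rewrite <- (radial_pair_eq rho M c HM Hc).
specialize (H M c HM Hc); fold s in H; rewrite (radial_zero M HM) in H.
assert (L := lin_sub (bop_eval_linmap rho) (radial PL PR N M c) (xp (modular k) G (- s) c [o] Lop (radial_mass M))).
apply Rle_trans with (2 := Rmult_le_compat_r _ _ _ (nrm_ge0 rho) H).
apply Rle_trans with (2 := bop_eval_bound _ rho).
right; symmetry; exact (f_equal nrm L).
Qed.

Lemma semigroup_scalar : semigroup (aone : A) (fun u => RtoC (exp (- u)) [*] aone).
Proof.
split; [| split; [| split]].
- rewrite Ropp_0, exp_0; apply vsc_1.
- intros u; apply (der_eq RtoC (fun u => RtoC (exp (- u)) [*] (aone : A)) u _ _
    (der_lin RtoC (scl_linmap (aone : A)) (fun u => RtoC (exp (- u))) u _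
      (rder_R (fun u => exp (- u)) u (- exp (- u)) ltac:(auto_derive; [exact I | ring])))).
  rewrite amul_1_l, RtoC_opp; vmod.
- intros a _ u; rewrite amul_sc_l, amul_sc_r, amul_1_l, amul_1_r; reflexivity.
- exists (nrm (aone : A) + 1), 1; assert (H := nrm_ge0 (aone : A)); split; [lra | split; [lra |]]; intros u _.
  apply Rle_trans with (1 := nrm_sc_le _ _); rewrite Cmod_R, Rabs_pos_eq by (left; apply exp_pos).
  rewrite Rmult_1_l; generalize (exp_pos (- u)); nra.
Qed.

(** [radial_estimate] again, now with [p = 1] and [q = y = k], at [c = 1]: the end [c = 0] is a
    scalar Gaussian integral, and the end [c = 1] is [radial_mass]. *)
Lemma radial_mass_estimate (G : contour) : good k G ->
  exists K eps, 0 <= K /\ 0 < eps /\ forall M, 0 <= M ->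
    nrm (radial_mass M [-] RtoC (RInt (gauss N) 0 M) [*] xp k G (- s) 1) <= K * (M ^ S N * exp (- (eps * M ^ 2))).
Proof.
intros HG.
destruct (radial_estimate k G HG aone k (fun u => RtoC (exp (- u)) [*] aone) E semigroup_scalar semigroup_E
  (amul_1_r k) (eq_trans (amul_1_r k) (eq_sym (amul_1_l k))) N) as [K [eps [HK [He H]]]].
exists K, eps; split; [exact HK | split; [exact He |]]; intros M HM.
specialize (H M 1 HM ltac:(lra)); fold s in H.
assert (E1 : radial (fun u => RtoC (exp (- u)) [*] aone) E N M 1 = radial_mass M).
{ apply vint_ext; [exact HM |]; intros r _.
  replace ((1 - 1) * r ^ 2) with 0 by ring; rewrite Ropp_0, exp_0, Rmult_1_l, vsc_1, amul_1_l; reflexivity. }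
assert (E0 : radial (fun u => RtoC (exp (- u)) [*] aone) E N M 0 = RtoC (RInt (gauss N) 0 M) [*] aone).
{ apply vint_unique.
  apply is_vint_ext with (fun r => RtoC (gauss N r) [*] aone); [exact HM | |].
  - intros r _; rewrite Rmult_0_l, (proj1 semigroup_E), amul_1_r, vsc_assoc, <- RtoC_mult.
    unfold gauss; f_equal; f_equal; f_equal; f_equal; ring.
  - apply (is_vint_lin (scl_linmap (aone : A)) (fun r => RtoC (gauss N r))).
    apply is_vint_RtoC; [exact HM | apply gauss_continuous]. }
rewrite E1, E0, amul_sc_r, amul_1_r in H; exact H.
Qed.

End Operators.

(** * The hypergeometric function *)

Section EulerIntegral.
Variables (a b : nat) (s : R).

Definition beta_weight (t : R) : R := (1 - t) ^ a * t ^ b.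
(** The Gamma quotient in front of Euler's integral when the exponents of the theorem are [a + 1]
    and [b + 1]. *)
Definition beta_const : R := INR (fact (a + b + 1)) / (INR (fact b) * INR (fact a)).

(* Clamping [t] to the unit interval keeps [segp] off the branch cut, so that the integrand
   is continuous on the whole line. *)
Let core (z : C) (t : R) : C := (RtoC (beta_weight t) * Crpow (segp (clamp 0 1 t) z) (- s))%C.

Lemma beta_weight_continuous t : continuous beta_weight t.
Proof.
apply (ex_derive_continuous (K := R_AbsRing) (V := R_NormedModule)); unfold beta_weight; auto_derive; exact I.
Qed.

Lemma clamp01 t : 0 <= clamp 0 1 t <= 1.
Proof. apply clamp_in, Rle_0_1. Qed.

Lemma jcontC_core z t : slit_plane z -> jcontC (P := R_UniformSpace) (V := CS) core z t.
Proof.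
intros Hz; apply vcont_Cmult.
- exact (jcontC_snd (P := R_UniformSpace) (V := CS) (fun t => RtoC (beta_weight t)) z t
    (vcont_Rfun _ _ (beta_weight_continuous t))).
- exact (jcontC_Crpow (P := R_UniformSpace) (clamp 0 1) (- s) z t clamp01 (continuous_clamp 0 1 t) Hz).
Qed.

Lemma vcont_core z t : slit_plane z -> vcont (V := CS) (core z) t.
Proof.
intros Hz; apply vcont_Cmult; [apply vcont_Rfun, beta_weight_continuous |].
apply vcont_Crpow; [apply segp_slit; [apply clamp01 | exact Hz] |].
assert (K : vcont (V := CS) (fun t => RtoC (clamp 0 1 t)) t) by apply vcont_Rfun, continuous_clamp.
apply vcont_Cplus; [apply vcont_Cminus; [apply vcont_const | exact K] |].
apply vcont_Cmult; [exact K | apply vcont_const].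
Qed.

(** At the argument [1 - z] the base [1 - (1 - z) t] is [segp t z]. The exponents are natural
    numbers, so the integrand extends continuously to [[0, 1]] and the improper integral is a proper
    one. *)
Lemma hyp2F1_euler z : slit_plane z ->
  hyp2F1 s (INR (S b)) (INR (S a) + INR (S b)) (1 - z) = (beta_const * vint (V := CS) (core z) 0 1)%C.
Proof.
intros Hz; unfold hyp2F1.
replace (INR (S a) + INR (S b) - INR (S b)) with (INR (S a)) by ring.
replace (INR (S a) + INR (S b)) with (INR (S (a + b + 1))) by (rewrite <- plus_INR; f_equal; lia).
rewrite !Gamma_fact.
f_equal.
- unfold beta_const; rewrite RtoC_div, RtoC_mult; [reflexivity |].
  apply Rmult_integral_contrapositive_currified; apply not_0_INR, fact_neq_0.
- apply (is_RInt_gen_unique (V := C_R_CompleteNormedModule)).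
  assert (Cc : forall t, continuous (U := C_R_CompleteNormedModule) (core z) t).
  { intros t; apply (vcont_continuous (V := CS) (core z) t), vcont_core, Hz. }
  assert (EI : RInt (V := C_R_CompleteNormedModule) (core z) 0 1 = vint (V := CS) (core z) 0 1).
  { apply (is_RInt_unique (V := C_R_CompleteNormedModule)), is_RInt_C_R, vint_correct; [lra |].
    intros t _; apply vcont_core, Hz. }
  apply (is_RInt_gen_from_0 (W := C_R_CompleteNormedModule) _ (core z) (at_left 1) _ (/ 2)).
  + apply at_left_proper_filter.
  + lra.
  + exact Cc.
  + exists (mkposreal (/ 2) ltac:(lra)); intros c Hc Hc1; split.
    { apply Rabs_def2 in Hc; simpl in Hc; unfold minus, plus, opp in Hc; simpl in Hc; lra. }
    intros t Ht; unfold core, beta_weight; rewrite clamp_id by lra.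
    replace (INR (S a) - 1) with (INR a) by (rewrite S_INR; ring).
    replace (INR (S b) - 1) with (INR b) by (rewrite S_INR; ring).
    rewrite !Rpower_pow, RtoC_mult by lra; f_equal; f_equal; unfold segp; ring.
  + rewrite <- EI.
    assert (K : continuous (U := C_R_CompleteNormedModule) (fun c => RInt (V := C_R_CompleteNormedModule) (core z) 0 c) 1).
    { apply (ex_derive_continuous (K := R_AbsRing) (V := C_R_CompleteNormedModule)); exists (core z 1).
      apply (is_derive_RInt (V := C_R_CompleteNormedModule) (core z) _ 0 1); [| apply Cc].
      apply filter_forall; intros c; apply (RInt_correct (V := C_R_CompleteNormedModule)), ex_RInt_cont, Cc. }
    eapply filterlim_filter_le_1; [| exact K]; intros P HP; unfold at_left, within.
    generalize HP; apply filter_imp; tauto.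
Qed.

Lemma cder_core_vint z : slit_plane z ->
  exists l, cder (V := CS) (fun z => vint (V := CS) (core z) 0 1) z l.
Proof.
intros Hz.
pose (core' := fun t z => (RtoC (beta_weight t) * (clamp 0 1 t * ((- s)%R * Crpow (segp (clamp 0 1 t) z) (- s - 1))))%C).
exists (vint (V := CS) (fun t => core' t z) 0 1).
destruct (slit_open z Hz) as [d [Hd Hs]].
assert (J : forall t w, slit_plane w -> jcont (P := C_UniformSpace) (V := CS) core' t w).
{ intros t w Hw.
  assert (K1 : jcont (P := C_UniformSpace) (V := CS) (fun t _ => RtoC (clamp 0 1 t)) t w)
    by (exact (jcont_fst (P := C_UniformSpace) (V := CS) _ t w (vcont_Rfun _ _ (continuous_clamp 0 1 t)))).
  apply vcont_Cmult; [| apply vcont_Cmult; [exact K1 | apply vcont_Cmult; [apply vcont_const |]]].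
  - exact (jcont_fst (P := C_UniformSpace) (V := CS) _ t w (vcont_Rfun _ _ (beta_weight_continuous t))).
  - apply vcont_Crpow; [apply segp_slit; [apply clamp01 | exact Hw] |].
    apply vcont_Cplus; [apply vcont_Cminus; [apply vcont_const | exact K1] |].
    apply vcont_Cmult; [exact K1 |].
    exact (jcont_snd (P := C_UniformSpace) (V := CS) (fun z => z) t w (vcont_id_C w)). }
apply (cder_vint_param (V := CS) (fun t z => core z t) core' 0 1 z Rle_0_1).
- apply (proj2 (locally_Cmod z _)); exists d; split; [exact Hd |]; intros w Hw; split.
  + intros t _; apply vcont_core, Hs, Hw.
  + intros t _; split; [| exact (jcont_r (P := C_UniformSpace) (V := CS) core' t w (J t w (Hs w Hw)))].
    exact (der_lin _ (sc_linmap (V := CS) (RtoC (beta_weight t))) _ _ _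
      (cder_Crpow_segp (- s) (clamp 0 1 t) w (clamp01 t) (Hs w Hw))).
- intros t _; apply J, Hz.
Qed.

Lemma cder_euler z : slit_plane z ->
  exists l, cder (V := CS) (fun z => hyp2F1 s (INR (S b)) (INR (S a) + INR (S b)) (1 - z)) z l.
Proof.
intros Hz; destruct (cder_core_vint z Hz) as [l Hl]; exists (beta_const * l)%C.
destruct (slit_open z Hz) as [d [Hd Hs]].
apply (der_ext_loc (fun z => z) (V := CS) (fun z => (beta_const * vint (V := CS) (core z) 0 1)%C)).
- exists d; split; [exact Hd |]; intros w Hw; symmetry; apply hyp2F1_euler, Hs, Hw.
- exact (der_lin _ (sc_linmap (V := CS) (RtoC beta_const)) _ _ _ Hl).
Qed.

(** Exchanging the contour with Euler's integral leaves, for each [t], the power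
    [((1 - t) + t y)^(-s)]. *)
Lemma fc_euler {B : BanachAlgebra} (y : B) G : good y G ->
  fc y G (fun z => hyp2F1 s (INR (S b)) (INR (S a) + INR (S b)) (1 - z)) =
  RtoC beta_const [*] vint (fun t => RtoC (beta_weight t) [*] xp y G (- s) t) 0 1.
Proof.
intros [G1 [G2 _]].
assert (Cf : conG (V := CS) G (fun z => vint (V := CS) (core z) 0 1)).
{ intros g Hg t Ht; destruct (cder_core_vint _ (G2 g Hg t Ht)) as [l Hl]; exact (cder_vcont _ _ _ Hl). }
rewrite (fc_ext y G _ (fun z => beta_const * vint (V := CS) (core z) 0 1)%C).
2:{ intros g Hg t Ht; apply hyp2F1_euler, (G2 g Hg t Ht). }
rewrite (fc_scal y G G1 (RtoC beta_const) _ Cf); f_equal.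
transitivity (vint (fun t => fc y G (fun z => core z t)) 0 1).
{ apply (fubini_fc y G G1 (fun z t => core z t) 0 1 Rle_0_1).
  intros t _ g Hg u Hu; apply jcontC_core, (G2 g Hg u Hu). }
apply vint_ext; [lra |]; intros t Ht; unfold core; rewrite clamp_id by exact Ht.
apply (fc_scal y G G1 (RtoC (beta_weight t)) (fun z => Crpow (segp t z) (- s))).
exact (conG_Crpow G G2 (- s) t Ht).
Qed.

End EulerIntegral.

(** * The radial integral *)

Section Assembly.
Context {A : BanachAlgebra} (k : A) (delta : R).
Hypothesis Hinv : invertible k.
Hypothesis Hdelta : 0 < delta.
Hypothesis Hgap : forall z, ~ regular k z -> Im z = 0 /\ delta <= Re z.
Variables (a b N : nat).
Variables (Gk Gy : contour).
Hypothesis HGk : good k Gk.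
Hypothesis HGy : good (modular k) Gy.
Variable rho : A.

Let E := expo k delta.
Let s := (INR N + 1) / 2.
Let kpow := xp k Gk (- s) 1.
Let w := beta_weight a b.
Let fct : R := INR (fact a) * INR (fact b).

(** The clamp makes it continuous on the whole line without changing it on [[0, 1]]. *)
Definition euler_integrand (t : R) : Bop_BanachAlgebra A :=
  RtoC (w t) [*] xp (modular k) Gy (- s) (clamp 0 1 t).
Definition euler_op : Bop_BanachAlgebra A := vint euler_integrand 0 1.

Lemma vcont_E {T : UniformSpace} (g : T -> R) p : continuous g p -> vcont (fun p => E (g p)) p.
Proof.
intros H; apply (vcont_comp (S := R_UniformSpace) g E p H).
apply (semigroup_vcont k E (semigroup_E k delta Hdelta Hgap)).
Qed.

Lemma vcont_euler_integrand t : vcont euler_integrand t.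
Proof.
unfold euler_integrand; apply vcont_sc; [apply vcont_Rfun, beta_weight_continuous |].
exact (vcont_xp (P := R_UniformSpace) (modular k) Gy (proj1 HGy) (proj1 (proj2 HGy)) (clamp 0 1) (- s) t clamp01 (continuous_clamp 0 1 t)).
Qed.

Lemma euler_op_apply x : is_vint (fun t => bop_fun (euler_integrand t) x) 0 1 (bop_fun euler_op x).
Proof.
exact (is_vint_lin (bop_eval_linmap x) euler_integrand 0 1 euler_op
  (vint_correct euler_integrand 0 1 Rle_0_1 (fun t _ => vcont_euler_integrand t))).
Qed.

Lemma kpow_comm : k [o] kpow = kpow [o] k.
Proof. exact (xp_comm k Gk (proj1 HGk) (proj1 (proj2 HGk)) k (- s) 1 ltac:(lra) eq_refl). Qed.

(** As [kpow] commutes with [k], left multiplication by it commutes with the modular operator and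
    with its powers. The estimates leave the power of [k] inside the operator, and the theorem has
    it outside. *)
Lemma euler_op_kpow x : bop_fun euler_op (kpow [o] x) = kpow [o] bop_fun euler_op x.
Proof.
assert (H1 := euler_op_apply (kpow [o] x)).
assert (H2 := is_vint_lin (mul_l_linmap kpow) _ 0 1 _ (euler_op_apply x)).
rewrite <- (vint_unique _ _ _ _ H2); symmetry; apply vint_unique.
apply (is_vint_ext _ _ 0 1 _ Rle_0_1) with (2 := H1); intros t _.
assert (Ec : Lop kpow [o] xp (modular k) Gy (- s) (clamp 0 1 t) = xp (modular k) Gy (- s) (clamp 0 1 t) [o] Lop kpow).
{ apply (xp_comm (modular k) Gy (proj1 HGy) (proj1 (proj2 HGy)) (Lop kpow) (- s) (clamp 0 1 t) (clamp01 t)).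
  symmetry; exact (modular_Lop k Hinv kpow (eq_sym kpow_comm)). }
assert (Ex := f_equal (fun f : Bop_BanachAlgebra A => bop_fun f x) Ec).
change (kpow [o] bop_fun (xp (modular k) Gy (- s) (clamp 0 1 t)) x =
  bop_fun (xp (modular k) Gy (- s) (clamp 0 1 t)) (kpow [o] x)) in Ex.
change (RtoC (w t) [*] bop_fun (xp (modular k) Gy (- s) (clamp 0 1 t)) (kpow [o] x) =
  kpow [o] (RtoC (w t) [*] bop_fun (xp (modular k) Gy (- s) (clamp 0 1 t)) x)).
rewrite amul_sc_r, Ex; reflexivity.
Qed.

Definition pair_integrand (r t : R) : A :=
  RtoC (r ^ N) [*] (RtoC (w t) [*] (E ((1 - t) * r ^ 2) [o] (rho [o] E (t * r ^ 2)))).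

Lemma pair_integrand_jcont r t : jcont (P := R_UniformSpace) pair_integrand r t.
Proof.
assert (K1 : continuous (T := prod_UniformSpace R_UniformSpace R_UniformSpace) (U := R_UniformSpace) (fun p => fst p ^ 2) (r, t)).
{ apply (continuous_comp (U := prod_UniformSpace R_UniformSpace R_UniformSpace) (V := R_UniformSpace) (W := R_UniformSpace) fst (fun r => r ^ 2)).
  - apply continuous_fst.
  - apply (ex_derive_continuous (K := R_AbsRing) (V := R_NormedModule)); auto_derive; exact I. }
assert (K2 : continuous (T := prod_UniformSpace R_UniformSpace R_UniformSpace) (U := R_UniformSpace) (fun p => 1 - snd p) (r, t)).
{ apply (continuous_comp (U := prod_UniformSpace R_UniformSpace R_UniformSpace) (V := R_UniformSpace) (W := R_UniformSpace) snd (fun t => 1 - t)).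
  - apply continuous_snd.
  - apply (ex_derive_continuous (K := R_AbsRing) (V := R_NormedModule)); auto_derive; exact I. }
apply vcont_sc; [| apply vcont_sc].
- apply (jcont_fst (P := R_UniformSpace) (V := CS) (fun r => RtoC (r ^ N)) r t), vcont_Rfun.
  apply (ex_derive_continuous (K := R_AbsRing) (V := R_NormedModule)); auto_derive; exact I.
- exact (jcont_snd (P := R_UniformSpace) (V := CS) (fun t => RtoC (w t)) r t (vcont_Rfun _ _ (beta_weight_continuous a b t))).
- apply vcont_mul; [| apply (vcont_lin (mul_l_linmap rho))].
  + apply vcont_E; exact (continuous_mult (K := R_AbsRing) _ _ _ K2 K1).
  + apply vcont_E; refine (continuous_mult (K := R_AbsRing) _ _ _ _ K1); apply continuous_snd.
Qed.

(** The value of the vertical integral at radius [r > 0]; [E (r^2 u)] is the exponential of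
    [- u r^2 k]. *)
Definition pairing (r : R) : A := laplace_pair rho (fun u => E (r ^ 2 * u)) a b.

Lemma fct_neq0 : fct <> 0.
Proof. apply Rmult_integral_contrapositive_currified; apply not_0_INR, fact_neq_0. Qed.

Lemma pairing_eq r : RtoC (r ^ N) [*] pairing r = RtoC (/ fct) [*] vint (pair_integrand r) 0 1.
Proof.
assert (C1 : conton (pair_integrand r) 0 1).
{ intros t _; exact (jcont_r (P := R_UniformSpace) pair_integrand r t (pair_integrand_jcont r t)). }
assert (Hf := fct_neq0).
assert (C2 : conton (fun u => (((1 - u) ^ a / INR (fact a))%R [*] E (r ^ 2 * (1 - u))) [o]
   (rho [o] ((u ^ b / INR (fact b))%R [*] E (r ^ 2 * u)))) 0 1).
{ intros u _; apply vcont_mul; [| apply (vcont_lin (mul_l_linmap rho))].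
  - apply vcont_sc; [apply vcont_Rfun | apply vcont_E];
      (apply (ex_derive_continuous (K := R_AbsRing) (V := R_NormedModule)); auto_derive; auto using INR_fact_neq_0).
  - apply vcont_sc; [apply vcont_Rfun | apply vcont_E];
      (apply (ex_derive_continuous (K := R_AbsRing) (V := R_NormedModule)); auto_derive; auto using INR_fact_neq_0). }
unfold pairing, laplace_pair.
rewrite <- (vint_lin (sc_linmap (RtoC (/ fct))) _ 0 1 Rle_0_1 C1), <- (vint_lin (sc_linmap (RtoC (r ^ N))) _ 0 1 Rle_0_1 C2).
apply vint_ext; [lra |]; intros u _; unfold pair_integrand.
rewrite amul_sc_l, !amul_sc_r.
replace (r ^ 2 * (1 - u)) with ((1 - u) * r ^ 2) by ring; replace (r ^ 2 * u) with (u * r ^ 2) by ring.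
rewrite !vsc_assoc, <- !RtoC_mult; f_equal; f_equal; unfold w, beta_weight, fct.
field; split; apply INR_fact_neq_0.
Qed.

Lemma vcont_pairing r : vcont (fun r => RtoC (r ^ N) [*] pairing r) r.
Proof.
apply vcont_ext with (fun r => RtoC (/ fct) [*] vint (pair_integrand r) 0 1); [intros q; symmetry; apply pairing_eq |].
apply (vcont_lin (sc_linmap _)).
apply (vcont_vint (P := R_UniformSpace) (fun t r => pair_integrand r t) 0 1 r Rle_0_1).
- intros t _; apply jcont_swap, pair_integrand_jcont.
- apply filter_forall; intros q t _; exact (jcont_r (P := R_UniformSpace) pair_integrand q t (pair_integrand_jcont q t)).
Qed.

Lemma weighted_pair M t : 0 <= M ->
  vint (fun r => pair_integrand r t) 0 M = RtoC (w t) [*] radial_pair k delta N rho M t.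
Proof.
intros HM; unfold radial_pair, pair_integrand.
rewrite <- (vint_lin (sc_linmap (RtoC (w t)))); [| exact HM |].
- apply vint_ext; [exact HM |]; intros r _; unfold E; rewrite !vsc_assoc, Cmult_comm; reflexivity.
- intros r _; apply vcont_sc; [apply vcont_Rfun | apply vcont_mul; [| apply (vcont_lin (mul_l_linmap rho))]; apply vcont_E];
    (apply (ex_derive_continuous (K := R_AbsRing) (V := R_NormedModule)); auto_derive; exact I).
Qed.

Lemma truncated_pairing M : 0 <= M ->
  vint (fun r => RtoC (r ^ N) [*] pairing r) 0 M =
  RtoC (/ fct) [*] vint (fun t => vint (fun r => pair_integrand r t) 0 M) 0 1.
Proof.
intros HM.
assert (C1 : conton (fun r => vint (pair_integrand r) 0 1) 0 M).
{ intros r _; apply (vcont_vint (P := R_UniformSpace) (fun t r => pair_integrand r t) 0 1 r Rle_0_1).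
  - intros t _; apply jcont_swap, pair_integrand_jcont.
  - apply filter_forall; intros q t _; exact (jcont_r (P := R_UniformSpace) pair_integrand q t (pair_integrand_jcont q t)). }
transitivity (vint (fun r => RtoC (/ fct) [*] vint (pair_integrand r) 0 1) 0 M).
{ apply vint_ext; [exact HM |]; intros r _; apply pairing_eq. }
rewrite (vint_lin (sc_linmap (RtoC (/ fct))) _ 0 M HM C1); f_equal.
apply (fubini pair_integrand 0 M 0 1 HM Rle_0_1); intros r t _ _; apply pair_integrand_jcont.
Qed.

Lemma beta_weight_le t : 0 <= t <= 1 -> 0 <= w t <= 1.
Proof.
intros Ht; unfold w, beta_weight.
assert (0 <= (1 - t) ^ a <= 1) by (split; [apply pow_le; lra | apply Rle_trans with (1 ^ a); [apply pow_incr | rewrite pow1]; lra]).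
assert (0 <= t ^ b <= 1) by (split; [apply pow_le; lra | apply Rle_trans with (1 ^ b); [apply pow_incr | rewrite pow1]; lra]).
nra.
Qed.

Lemma gauss_decay K eps : 0 <= K -> 0 < eps ->
  exists D, 0 <= D /\ forall M, 1 <= M -> K * (M ^ S N * exp (- (eps * M ^ 2))) <= D / M.
Proof.
intros HK He; destruct (gauss_bound (S (S N)) eps He) as [D [HD H]].
exists (K * D); split; [apply Rmult_le_pos; assumption |]; intros M HM.
unfold Rdiv; rewrite Rmult_assoc; apply Rmult_le_compat_l; [exact HK |].
apply Rmult_le_reg_l with M; [lra |].
replace (M * (D * / M)) with D by (field; lra).
rewrite <- Rmult_assoc; apply H; lra.
Qed.

(** Two comparisons with errors of order [1 / M]: under the [t]-integral, [radial_pair_estimate]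
    gives [euler_op] applied to [m rho]; then [radial_mass_estimate] replaces [m] by the Gaussian
    integral times [kpow]. *)
Lemma truncated_estimate : exists D, 0 <= D /\ forall M, 1 <= M ->
  nrm (vint (fun r => RtoC (r ^ N) [*] pairing r) 0 M [-]
    RtoC (RInt (gauss N) 0 M) [*] (RtoC (/ fct) [*] bop_fun euler_op (kpow [o] rho))) <= D / M.
Proof.
destruct (radial_pair_estimate k delta Hinv Hdelta Hgap N Gy HGy) as [K1 [e1 [HK1 [He1 H1]]]].
destruct (radial_mass_estimate k delta Hdelta Hgap N Gk HGk) as [K2 [e2 [HK2 [He2 H2]]]].
destruct (gauss_decay K1 e1 HK1 He1) as [D1 [HD1 B1]].
destruct (gauss_decay K2 e2 HK2 He2) as [D2 [HD2 B2]].
assert (Hr := nrm_ge0 rho); assert (Ho := nrm_ge0 euler_op).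
assert (Hf : 0 < fct) by (apply Rmult_lt_0_compat; apply INR_fact_lt_0).
assert (Hf' : 0 < / fct) by (apply Rinv_0_lt_compat, Hf).
exists (/ fct * (D1 * nrm rho + nrm euler_op * (D2 * nrm rho))); split.
{ apply Rmult_le_pos; [lra | apply Rplus_le_le_0_compat; [| apply Rmult_le_pos; [exact Ho |]]; apply Rmult_le_pos; assumption]. }
intros M HM; rewrite (truncated_pairing M ltac:(lra)).
set (V := vint (fun t => vint (fun r => pair_integrand r t) 0 M) 0 1).
set (m := radial_mass k delta N M) in *; set (g := RInt (gauss N) 0 M).
assert (X1 : nrm (V [-] bop_fun euler_op (m [o] rho)) <= D1 / M * nrm rho).
{ assert (CV : is_vint (fun t => vint (fun r => pair_integrand r t) 0 M) 0 1 V).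
  { apply vint_correct; [lra |]; intros t _.
    apply (vcont_vint (P := R_UniformSpace) pair_integrand 0 M t ltac:(lra)).
    - intros r _; apply pair_integrand_jcont.
    - apply filter_forall; intros q r _; exact (jcont_l (P := R_UniformSpace) pair_integrand r q (pair_integrand_jcont r q)). }
  replace (D1 / M * nrm rho) with ((1 - 0) * (D1 / M * nrm rho)) by ring.
  apply (is_vint_bound _ 0 1 _ _ Rle_0_1) with (2 := is_vint_sub _ _ 0 1 _ _ CV (euler_op_apply (m [o] rho))).
  intros t Ht; rewrite (weighted_pair M t ltac:(lra)).
  destruct (beta_weight_le t Ht) as [W1 W2].
  change (bop_fun (euler_integrand t) (m [o] rho)) with
    (RtoC (w t) [*] bop_fun (xp (modular k) Gy (- s) (clamp 0 1 t)) (m [o] rho)).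
  rewrite (clamp_id 0 1 t Ht).
  apply Rle_trans with (nrm (RtoC (w t) [*] (radial_pair k delta N rho M t [-] bop_fun (xp (modular k) Gy (- s) t) (m [o] rho)))).
  { right; f_equal; vmod. }
  apply Rle_trans with (1 := nrm_sc_le _ _); rewrite Cmod_R, Rabs_pos_eq by exact W1.
  assert (X := H1 rho M t ltac:(lra) Ht); assert (Y := B1 M HM).
  assert (Z : K1 * (M ^ S N * exp (- (e1 * M ^ 2))) * nrm rho <= D1 / M * nrm rho) by (apply Rmult_le_compat_r; assumption).
  rewrite <- (Rmult_1_l (D1 / M * nrm rho)); apply Rmult_le_compat; [exact W1 | apply nrm_ge0 | exact W2 |].
  exact (Rle_trans _ _ _ X Z). }
assert (X2 : nrm (bop_fun euler_op (m [o] rho) [-] RtoC g [*] bop_fun euler_op (kpow [o] rho)) <= nrm euler_op * (D2 / M * nrm rho)).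
{ assert (L : bop_fun euler_op (m [o] rho) [-] RtoC g [*] bop_fun euler_op (kpow [o] rho) =
    bop_fun euler_op ((m [-] RtoC g [*] kpow) [o] rho)).
  { assert (Lo : linmap (fun x : A => bop_fun euler_op x)).
    { destruct (proj2_sig (euler_op : Bop A)) as [L1 L2 L3]; split; [exact L1 | exact L2 | exact L3]. }
    rewrite amul_sub_l, amul_sc_l, (lin_sub Lo), (lin_sc _ Lo); reflexivity. }
  rewrite L; apply Rle_trans with (1 := bop_eval_bound _ _); apply Rmult_le_compat_l; [exact Ho |].
  apply Rle_trans with (1 := nrm_mul _ _); apply Rmult_le_compat_r; [exact Hr |].
  exact (Rle_trans _ _ _ (H2 M ltac:(lra)) (B2 M HM)). }
replace (RtoC (/ fct) [*] V [-] RtoC g [*] (RtoC (/ fct) [*] bop_fun euler_op (kpow [o] rho))) with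
  (RtoC (/ fct) [*] ((V [-] bop_fun euler_op (m [o] rho)) [+]
    (bop_fun euler_op (m [o] rho) [-] RtoC g [*] bop_fun euler_op (kpow [o] rho)))) by vmod.
apply Rle_trans with (1 := nrm_sc_le _ _); rewrite Cmod_R, Rabs_pos_eq by lra.
unfold Rdiv at 1; rewrite Rmult_assoc; apply Rmult_le_compat_l; [lra |].
apply Rle_trans with (1 := nrm_add _ _).
replace ((D1 * nrm rho + nrm euler_op * (D2 * nrm rho)) * / M) with
  (D1 / M * nrm rho + nrm euler_op * (D2 / M * nrm rho)) by (unfold Rdiv; ring).
apply Rplus_le_compat; assumption.
Qed.

(** The Gaussian factor converges to half of [Gamma s], and the error of [truncated_estimate]
    vanishes in the limit. *)
Lemma truncated_limit : filterlim (fun M => vint (fun r => RtoC (r ^ N) [*] pairing r) 0 M)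
  (Rbar_locally p_infty)
  (locally (T := realify A) (RtoC (Gamma s / 2 / fct) [*] bop_fun euler_op (kpow [o] rho))).
Proof.
destruct truncated_estimate as [D [HD HE]].
destruct (gauss_converges N) as [L HL].
assert (EG : Gamma s = 2 * L) by (apply Gamma_gauss, HL).
set (X := RtoC (/ fct) [*] bop_fun euler_op (kpow [o] rho)) in *.
assert (EX : RtoC (Gamma s / 2 / fct) [*] bop_fun euler_op (kpow [o] rho) = RtoC L [*] X).
{ unfold X; rewrite vsc_assoc, <- RtoC_mult, EG; f_equal; f_equal; field; exact fct_neq0. }
rewrite EX; apply (filterlim_locally (F := Rbar_locally p_infty) (U := realify A)); intros eps.
assert (He := cond_pos eps); assert (HX := nrm_ge0 X).
assert (Hd : 0 < eps / 2 / (nrm X + 1)) by (apply Rdiv_lt_0_compat; lra).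
assert (HL' := proj1 (filterlim_locally _ _) HL (mkposreal _ Hd)).
assert (Hev : Rbar_locally p_infty (fun M => Rmax 1 (2 * D / eps) < M)) by (exists (Rmax 1 (2 * D / eps)); intros; assumption).
generalize (filter_and _ _ HL' Hev); apply filter_imp; intros M [H1 H2].
assert (M1 := Rmax_l 1 (2 * D / eps)); assert (M2 := Rmax_r 1 (2 * D / eps)).
apply (norm_compat1 (V := realify A)).
change (nrm (vint (fun r => RtoC (r ^ N) [*] pairing r) 0 M [-] RtoC L [*] X) < eps).
change (Rabs (RInt (gauss N) 0 M - L) < eps / 2 / (nrm X + 1)) in H1.
assert (H3 := HE M ltac:(lra)); fold X in H3.
assert (H4 : D / M < eps / 2).
{ apply Rmult_lt_reg_r with M; [lra |]; unfold Rdiv at 1; rewrite Rmult_assoc, Rinv_l, Rmult_1_r by lra.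
  assert (2 * D / eps * eps = 2 * D) by (field; lra); nra. }
set (Q := vint (fun r => RtoC (r ^ N) [*] pairing r) 0 M) in *.
replace (Q [-] RtoC L [*] X) with ((Q [-] RtoC (RInt (gauss N) 0 M) [*] X) [+] RtoC (RInt (gauss N) 0 M - L) [*] X)
  by (rewrite RtoC_minus; vmod).
apply Rle_lt_trans with (1 := nrm_add _ _).
assert (H5 : nrm (RtoC (RInt (gauss N) 0 M - L) [*] X) <= eps / 2).
{ apply Rle_trans with (1 := nrm_sc_le _ _); rewrite Cmod_R.
  apply Rle_trans with (eps / 2 / (nrm X + 1) * (nrm X + 1)); [| right; field; lra].
  apply Rmult_le_compat; [apply Rabs_pos | exact HX | lra | lra]. }
lra.
Qed.

Lemma radial_integral (f : R -> A) :
  (forall r, 0 < r -> f r = RtoC (r ^ N) [*] pairing r) ->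
  is_RInt_gen (V := realify A) f (at_right 0) (Rbar_locally p_infty)
    (RtoC (Gamma s / 2 / fct) [*] (kpow [o] bop_fun euler_op rho)).
Proof.
intros Hf; rewrite <- euler_op_kpow.
apply (is_RInt_gen_from_0 (W := realify A) f (fun r => RtoC (r ^ N) [*] pairing r) (Rbar_locally p_infty) _ 1).
- apply Rbar_locally_filter.
- lra.
- intros r; exact (proj1 (vcont_continuous (V := A) (fun r => RtoC (r ^ N) [*] pairing r) r) (vcont_pairing r)).
- exists 1; intros M HM; split; [exact HM |]; intros r Hr; apply Hf; lra.
- exact truncated_limit.
Qed.

End Assembly.

Theorem proposition2p2 (A : CStarAlgebra) (k rho : A) (a b m : nat)
    (hk_pos : cs_positive k) (hk_inv : invertible k)
    (ha : (0 < a)%nat) (hb : (0 < b)%nat) (hm : (0 < m)%nat) :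
  let d := d_m a b m in
  exists (J : R -> A) (kpow : A) (T : Bop_BanachAlgebra A),
    (forall r : R, 0 < r -> is_vertical_int k rho a b r (J r)) /\
    holo_calc slit_plane (fun z => Crpow z (- (d + 1))) k kpow /\
    holo_calc slit_plane
      (fun y => hyp2F1 (d + 1) (INR b) (INR a + INR b) (1 - y)%C)
      (modular k) T /\
    is_RInt_gen (V := realify A)
      (fun r => scal (RtoC (Rpower r (2 * d + 1)) : C_AbsRing) (J r))
      (at_right 0) (Rbar_locally p_infty)
      (amult kpow
         (scal (RtoC (Gamma (d + 1) / (2 * Gamma (INR a + INR b))) : C_AbsRing)
            (bop_fun T rho))).
Proof.
intros d.
destruct a as [| a]; [lia |]; destruct b as [| b]; [lia |]; destruct m as [| m]; [lia |].
(* With [a], [b], [m] now standing for the predecessors, [d = a + b + (m - 1) / 2], so that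
   [2 d + 1 = N]. *)
pose (N := (2 * (a + b) + m)%nat); pose (s := (INR N + 1) / 2).
assert (Hs : d + 1 = s).
{ unfold d, d_m, s, N; rewrite !S_INR, plus_INR, mult_INR, plus_INR; simpl (INR 2); field. }
assert (H2d : 2 * d + 1 = INR N) by (replace d with (s - 1) by lra; unfold s; field).
destruct (positive_gap k hk_pos hk_inv) as [delta [Hdelta Hgap]].
destruct (surround_exists k delta Hdelta (gap_ray k delta Hgap)) as [Gk HGk].
destruct (modular_ray k delta hk_inv Hdelta Hgap) as [dy [Hdy Hray]].
destruct (surround_exists (modular k) dy Hdy Hray) as [Gy HGy].
apply surrounds_good in HGk; apply surrounds_good in HGy.
exists (pairing k delta a b rho), (xp k Gk (- s) 1), (RtoC (beta_const a b) [*] euler_op k a b N Gy).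
rewrite Hs, H2d; split; [| split; [| split]].
- intros r Hr; exact (vertical_int_laplace k delta Hdelta Hgap rho a b r Hr).
- exact (holo_Crpow k delta Hdelta Hgap (- s) Gk HGk).
- apply (holo_calc_slit (modular k) dy Hdy Hray); [exact (cder_euler a b s) |].
  (* The operator was built along [Gy]; any other good contour gives the same power for each [t],
     hence the same Euler integral. *)
  intros G HG; refine (eq_trans (fc_euler a b s (modular k) G HG) (f_equal (vsc _) _)).
  apply vint_ext; [lra |]; intros t Ht.
  unfold euler_integrand; rewrite (clamp_id 0 1 t Ht).
  exact (f_equal (vsc _) (xp_indep (modular k) G Gy (- s) t HG HGy Ht)).
- assert (H := radial_integral k delta hk_inv Hdelta Hgap a b N Gk Gy HGk HGy rho
    (fun r => RtoC (Rpower r (INR N)) [*] pairing k delta a b rho r)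
    (fun r Hr => f_equal (fun c : R => RtoC c [*] pairing k delta a b rho r) (Rpower_pow N r Hr))).
  fold s in H.
  match type of H with is_RInt_gen _ _ _ ?x => match goal with |- is_RInt_gen _ _ _ ?y =>
    replace y with x; [exact H |] end end.
  change (RtoC (Gamma s / 2 / (INR (fact a) * INR (fact b))) [*]
      (xp k Gk (- s) 1 [o] bop_fun (euler_op k a b N Gy) rho) =
    xp k Gk (- s) 1 [o] (RtoC (Gamma s / (2 * Gamma (INR (S a) + INR (S b)))) [*]
      (RtoC (beta_const a b) [*] bop_fun (euler_op k a b N Gy) rho))).
  (* What remains is scalar: [beta_const] times [1 / Gamma(a + b + 2)] is [1 / (a! b!)]. *)
  rewrite !amul_sc_r, vsc_assoc, <- RtoC_mult; f_equal; f_equal.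
  replace (INR (S a) + INR (S b)) with (INR (S (a + b + 1))) by (rewrite <- plus_INR; f_equal; lia).
  rewrite Gamma_fact; unfold beta_const; field.
  repeat split; apply INR_fact_neq_0.
Qed.
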